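(* There exists $j_0\in\mathbb N^*$ such that for every $j\ge j_0$, the function $\lambda_j$ admits a unique critical point $\alpha_{j,c}$, and this critical point is a non-degenerate minimum. Moreover, $$\lambda_j''(\alpha_{j,c})\to -3F'(E_c)G(E_c)>0\quad\text{as } j\to+\infty,$$ where $F'(E_c)<0$ and, with $V(x)=\left(\frac{x^2}{2}-1\right)^2$ and $x_+(E)=\sqrt{2+2\sqrt E}$, $$G(E)=\Big(\int_0^{x_+(E)}(E-V(x))^{1/2}dx\Big)\Big(\int_0^{x_+(E)}(E-V(x))^{-1/2}dx\Big)^{-2}.$$
   Context: For $\alpha\in\mathbb R$, let $\mathfrak h_{\mathcal M}(\alpha)=-\frac{d^2}{dt^2}+\left(\frac12 t^2-\alpha\right)^2$ be the self-adjoint operator on $L^2(\mathbb R)$ with domain $\{u\in L^2(\mathbb R): -u''+(\frac12 t^2-\alpha)^2u\in L^2(\mathbb R)\}$, with simple positive eigenvalues $0<\lambda_1(\alpha)<\lambda_2(\alpha)<\cdots\to+\infty$, each $\alpha\mapsto\lambda_j(\alpha)$ being $C^\infty$. The function $F:(1,+\infty)\to\mathbb R$ is $F(E)=\int_0^{\sqrt{2+2\sqrt E}}\frac{2-x^2}{\sqrt{E-(x^2/2-1)^2}}dx$; it is $C^1$ and has a unique zero $E_c\in(1,+\infty)$. *)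

(* Defs.v *)
From Stdlib Require Import Reals Lra List ClassicalEpsilon.
From Coquelicot Require Import Coquelicot.
Open Scope R_scope.

(** Potential of the de Gennes-Montgomery operator h_M(alpha):
    q_alpha(t) = (t^2/2 - alpha)^2. *)
Definition qM (alpha t : R) : R := (t ^ 2 / 2 - alpha) ^ 2.

Definition is_eigenvalue (alpha lam : R) : Prop :=
  exists u u' : R -> R,
    (exists t, u t <> 0) /\
    (forall t, is_derive u t (u' t)) /\
    (forall t, is_derive u' t ((qM alpha t - lam) * u t)) /\
    ex_RInt_gen (fun t => (u t) ^ 2) (Rbar_locally m_infty) (Rbar_locally p_infty).

Definition is_jth_eigenvalue (j : nat) (alpha lam : R) : Prop :=
  is_eigenvalue alpha lam /\
  exists l : list R, NoDup l /\ length l = (j - 1)%nat /\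
    (forall mu, In mu l <-> (is_eigenvalue alpha mu /\ mu < lam)).

Definition lambda (j : nat) (alpha : R) : R :=
  epsilon (inhabits 0) (fun lam => is_jth_eigenvalue j alpha lam).

Definition Vw (x : R) : R := (x ^ 2 / 2 - 1) ^ 2.
Definition xplus (E : R) : R := sqrt (2 + 2 * sqrt E).

Definition F (E : R) : R :=
  RInt_gen (fun x => (2 - x ^ 2) / sqrt (E - Vw x)) (at_point 0) (at_left (xplus E)).

Definition G (E : R) : R :=
  RInt (fun x => sqrt (E - Vw x)) 0 (xplus E) /
  (RInt_gen (fun x => / sqrt (E - Vw x)) (at_point 0) (at_left (xplus E))) ^ 2.

(* Main.v *)
(** Let u be the j-th eigenfunction restricted to [0, oo); it is counted by the Prüfer angle at 0, and its
    Cauchy data at 0 depend only on the parity of j. Feynman-Hellmann gives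
    lambda_j'(alpha) = - 2 <t^2/2 - alpha>, the mean being taken with respect to u^2.

    After the scaling t = lambda^(1/4) x one gets hh u'' = ((x^2/2 - b)^2 - 1) u with hh = lambda^(-3/2) and
    b = alpha / sqrt lambda. Put be = 1 / sqrt Ec, y = x^2/2 - be. The condition F Ec = 0 says exactly that
    (1 - y^2) g' = y (1 + x g), g 0 = 0, has a solution regular at the turning point y = 1. Multiplying the
    equation by 2 g u' + g' u gives <x^2/2 - b> = (be - b) <K> + O(hh) with K > 0, so at a critical point
    b = be + O(hh). Comparing the eigenfunctions at a critical point alpha_c and at a nearby alpha, which have the
    same Cauchy data at 0, the same identity yields lambda_j'(alpha) / (alpha - alpha_c) = 2 r0 + o(1) as
    j -> oo, where r0 = 1 / (2 (1 - be^2)) is the limit of <K>. Hence every critical point is a strict local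
    minimum and so there is at most one; there is one because lambda_j' < 0 for alpha <= 0, while lambda_j' > 0
    when the wells are deep compared with lambda_j.

    Finally the elliptic integrals satisfy F'(Ec) = - T / (2 (Ec - 1)) and int p = (2/3) Ec T, where
    p = (Ec - V)^(1/2) and T = int 1/p, so that - 3 F'(Ec) G(Ec) = Ec / (Ec - 1) = 2 r0. *)
Require Import Defs.
From Stdlib Require Import Reals Lra Lia List Permutation ZArith ClassicalEpsilon.
From Coquelicot Require Import Coquelicot.
Open Scope R_scope.

(** * Rapidly decaying functions on the half-line *)

(** The turning point y = 1, where an eigenfunction passes from oscillation to decay, is never
    resolved by asymptotics. Only identities integrated against multipliers are used, and each
    multiplier is the solution of a singular first order equation that stays smooth at y = 1. That
    solution is unique, so its value at 0 cannot be prescribed; it is F Ec = 0 that makes it vanish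
    there, which kills the boundary terms at 0 for both parities at once. Normalizing eigenfunctions
    by their Cauchy data at 0 replaces spectral projections: the difference of two of them solves an
    inhomogeneous equation with zero data, and Gronwall bounds it in L^2. In the scaled variables
    this bound loses a factor hh^(-1/2). The loss is affordable because it only enters multiplied by
    |be - b| + hh, which is O(hh) when one of the two parameters is critical. The step in alpha may
    be taken small compared with powers of hh, since only the limit of the quotient at each fixed j
    is wanted; the errors must however be uniformly small relative to the step. *)

Lemma is_derive_cont (f : R -> R) x l : is_derive f x l -> continuous f x.
Proof. intros H; apply (ex_derive_continuous f x); now exists l. Qed.

Lemma is_derive_cpt (f : R -> R) x l : is_derive f x l -> continuity_pt f x.
Proof. intros H; apply continuity_pt_filterlim; exact (is_derive_cont f x l H). Qed.

Lemma incr_of_derive (f df : R -> R) a b : a <= b ->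
  (forall x, a <= x <= b -> is_derive f x (df x)) ->
  (forall x, a <= x <= b -> 0 <= df x) -> f a <= f b.
Proof.
intros ab Hd Hp.
destruct (MVT_gen f a b df) as [c [Hc E]].
- intros x Hx; apply Hd; rewrite Rmin_left, Rmax_right in Hx; lra.
- intros x Hx; apply (is_derive_cpt f x (df x)), Hd;
  rewrite Rmin_left, Rmax_right in Hx; lra.
- rewrite Rmin_left, Rmax_right in Hc by lra.
  assert (0 <= df c * (b - a)) by (apply Rmult_le_pos; [now apply Hp|lra]); lra.
Qed.

Lemma incr_of_derive_open (f df : R -> R) a b : a <= b ->
  (forall x, a <= x <= b -> continuous f x) ->
  (forall x, a < x < b -> is_derive f x (df x)) ->
  (forall x, a < x < b -> 0 <= df x) -> f a <= f b.
Proof.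
intros ab Hc Hd Hp.
(* [MVT_gen] may return an endpoint, where the sign of [df] is unknown; truncation at 0 makes the
   returned value nonnegative in all cases. *)
destruct (MVT_gen f a b (fun x => Rmax 0 (df x))) as [c [Hi E]].
- intros x Hx; rewrite Rmin_left, Rmax_right in Hx by lra.
  rewrite Rmax_right by (now apply Hp); now apply Hd.
- intros x Hx; rewrite Rmin_left, Rmax_right in Hx by lra.
  apply continuity_pt_filterlim, Hc, Hx.
- assert (0 <= Rmax 0 (df c) * (b - a)) by (apply Rmult_le_pos; [apply Rmax_l|lra]); lra.
Qed.

Lemma exp_mono x y : x <= y -> exp x <= exp y.
Proof. intros [H| ->]; [left; now apply exp_increasing|lra]. Qed.

Definition cont0 (f : R -> R) := forall t, 0 <= t -> continuous f t.
(** Decay faster than every exponential. A product of a [fast] and a [slow] function is [fast], so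
    the integrability of any weighted moment of an eigenfunction becomes a syntactic question, which
    the tactic [sf] settles. *)
Definition fast (f : R -> R) := cont0 f /\
  forall k, exists C, forall t, 0 <= t -> Rabs (f t) <= C * exp (- (k * t)).
Definition slow (f : R -> R) := cont0 f /\
  exists k C, forall t, 0 <= t -> Rabs (f t) <= C * exp (k * t).

Lemma fast_ext f g : (forall t, f t = g t) -> fast f -> fast g.
Proof.
intros E [Hc Hb]; split.
- intros t Ht; apply (continuous_ext f); auto.
- intros k; destruct (Hb k) as [C HC]; exists C; intros t Ht; rewrite <- E; auto.
Qed.

Lemma fast_plus f g : fast f -> fast g -> fast (fun t => f t + g t).
Proof.
intros [Fc Fb] [Gc Gb]; split.
- intros t Ht; apply (continuous_plus f g); auto.
- intros k; destruct (Fb k) as [C HC]; destruct (Gb k) as [D HD]; exists (C + D).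
  intros t Ht; specialize (HC t Ht); specialize (HD t Ht).
  pose proof (Rabs_triang (f t) (g t)); lra.
Qed.

Lemma fast_opp f : fast f -> fast (fun t => - f t).
Proof.
intros [Fc Fb]; split.
- intros t Ht; apply (continuous_opp f); auto.
- intros k; destruct (Fb k) as [C HC]; exists C; intros t Ht; rewrite Rabs_Ropp; auto.
Qed.

Lemma fast_minus f g : fast f -> fast g -> fast (fun t => f t - g t).
Proof. intros; apply fast_plus; [|apply fast_opp]; auto. Qed.

Lemma fast_slow f g : fast f -> slow g -> fast (fun t => f t * g t).
Proof.
intros [Fc Fb] [Gc [k0 [C0 G0]]]; split.
- intros t Ht; apply (continuous_mult f g); auto.
- intros k; destruct (Fb (k + k0)) as [C HC]; exists (C * C0); intros t Ht.
  specialize (HC t Ht); specialize (G0 t Ht); rewrite Rabs_mult.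
  replace (- (k * t)) with (- ((k + k0) * t) + k0 * t) by ring; rewrite exp_plus.
  replace (C * C0 * (exp (- ((k + k0) * t)) * exp (k0 * t)))
    with (C * exp (- ((k + k0) * t)) * (C0 * exp (k0 * t))) by ring.
  apply Rmult_le_compat; auto using Rabs_pos.
Qed.

Lemma slow_fast f g : slow f -> fast g -> fast (fun t => f t * g t).
Proof.
intros Hf Hg; apply (fast_ext (fun t => g t * f t)); [intros; ring|].
now apply fast_slow.
Qed.

Lemma fast_is_slow f : fast f -> slow f.
Proof. intros [Fc Fb]; split; auto. destruct (Fb 0) as [C HC]; exists (-0), C.
intros t Ht; specialize (HC t Ht); now replace (-0 * t) with (- (0 * t)) by ring. Qed.

Lemma fast_mult f g : fast f -> fast g -> fast (fun t => f t * g t).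
Proof. intros; apply fast_slow; auto using fast_is_slow. Qed.

Lemma slow_const c : slow (fun _ => c).
Proof.
split; [intros t _; apply continuous_const|].
exists 0, (Rabs c); intros t _; rewrite Rmult_0_l, exp_0; lra.
Qed.

Lemma slow_id : slow (fun t => t).
Proof.
split; [intros t _; apply continuous_id|].
exists 1, 1; intros t Ht; rewrite Rabs_right by lra.
pose proof (exp_ineq1_le (1 * t)); lra.
Qed.

Lemma slow_plus f g : slow f -> slow g -> slow (fun t => f t + g t).
Proof.
intros [Fc [k [C HC]]] [Gc [l [D HD]]]; split.
- intros t Ht; apply (continuous_plus f g); auto.
- exists (Rmax k l), (Rabs C + Rabs D); intros t Ht.
  specialize (HC t Ht); specialize (HD t Ht).
  assert (E1 : exp (k * t) <= exp (Rmax k l * t)).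
  { apply exp_mono, Rmult_le_compat_r; auto; apply Rmax_l. }
  assert (E2 : exp (l * t) <= exp (Rmax k l * t)).
  { apply exp_mono, Rmult_le_compat_r; auto; apply Rmax_r. }
  pose proof (Rabs_triang (f t) (g t)).
  pose proof (Rle_abs C); pose proof (Rle_abs D).
  pose proof (Rabs_pos C); pose proof (Rabs_pos D).
  pose proof (exp_pos (k * t)); pose proof (exp_pos (l * t)).
  nra.
Qed.

Lemma slow_opp f : slow f -> slow (fun t => - f t).
Proof.
intros [Fc [k [C HC]]]; split.
- intros t Ht; apply (continuous_opp f); auto.
- exists k, C; intros t Ht; rewrite Rabs_Ropp; auto.
Qed.

Lemma slow_minus f g : slow f -> slow g -> slow (fun t => f t - g t).
Proof. intros; apply slow_plus; [|apply slow_opp]; auto. Qed.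

Lemma slow_mult f g : slow f -> slow g -> slow (fun t => f t * g t).
Proof.
intros [Fc [k [C HC]]] [Gc [l [D HD]]]; split.
- intros t Ht; apply (continuous_mult f g); auto.
- exists (k + l), (C * D); intros t Ht; rewrite Rabs_mult.
  rewrite Rmult_plus_distr_r, exp_plus.
  replace (C * D * (exp (k * t) * exp (l * t)))
    with (C * exp (k * t) * (D * exp (l * t))) by ring.
  apply Rmult_le_compat; auto using Rabs_pos.
Qed.

Lemma slow_pow f n : slow f -> slow (fun t => f t ^ n).
Proof.
intros Hf; induction n; simpl; [apply slow_const|].
now apply (slow_mult f (fun t => f t ^ n)).
Qed.

Lemma fast_pow2 f : fast f -> fast (fun t => f t ^ 2).
Proof. intros H; apply (fast_ext (fun t => f t * f t)); [intros; ring|]; now apply fast_mult. Qed.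

Lemma slow_bounded f C : cont0 f -> (forall t, 0 <= t -> Rabs (f t) <= C) -> slow f.
Proof.
intros Hc Hb; split; auto; exists 0, C; intros t Ht.
rewrite Rmult_0_l, exp_0, Rmult_1_r; auto.
Qed.

Ltac sf :=
  match goal with
  | H : fast ?f |- fast ?f => exact H
  | H : slow ?f |- slow ?f => exact H
  | H : fast ?f |- slow ?f => exact (fast_is_slow f H)
  | H : fast ?f |- fast (fun t => ?f t) => exact H
  | H : slow ?f |- slow (fun t => ?f t) => exact H
  | H : fast ?f |- slow (fun t => ?f t) => exact (fast_is_slow f H)
  | |- slow (fun _ => ?c) => exact (slow_const c)
  | |- slow (fun t => t) => exact slow_id
  | |- slow (fun t => @?f t + @?g t) => apply (slow_plus f g); sf
  | |- slow (fun t => @?f t - @?g t) => apply (slow_minus f g); sf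
  | |- slow (fun t => - @?f t) => apply (slow_opp f); sf
  | |- slow (fun t => @?f t * @?g t) => apply (slow_mult f g); sf
  | |- slow (fun t => @?f t / ?c) => apply (slow_mult f (fun _ => / c)); sf
  | |- slow (fun t => @?f t ^ ?n) => apply (slow_pow f n); sf
  | |- fast (fun t => @?f t + @?g t) => apply (fast_plus f g); sf
  | |- fast (fun t => @?f t - @?g t) => apply (fast_minus f g); sf
  | |- fast (fun t => - @?f t) => apply (fast_opp f); sf
  | |- fast (fun t => @?f t * @?g t) =>
      first [ apply (fast_slow f g); [solve [sf] | solve [sf]]
            | apply (slow_fast f g); [solve [sf] | solve [sf]] ]
  | |- fast (fun t => @?f t / ?c) => apply (fast_slow f (fun _ => / c)); sf
  | |- fast (fun t => @?f t ^ 2) => apply (fast_pow2 f); sf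
  end.

Lemma fast_ex_RInt f a b : fast f -> 0 <= a -> 0 <= b -> ex_RInt f a b.
Proof.
intros [Hc _] Ha Hb; apply (ex_RInt_continuous (V := R_CompleteNormedModule)); intros z Hz; apply Hc.
assert (0 <= Rmin a b) by (apply Rmin_glb; auto); lra.
Qed.

Lemma RInt_exp_bound C a b : 0 <= a <= b ->
  is_RInt (fun t => C * exp (- (1 * t))) a b (C * (exp (- a) - exp (- b))).
Proof.
intros ab.
replace (C * (exp (- a) - exp (- b))) with (minus (- C * exp (- b)) (- C * exp (- a)))
  by (unfold minus, plus, opp; simpl; ring).
apply (is_RInt_derive (fun t => - C * exp (- t))).
- intros x _; auto_derive; auto. rewrite Rmult_1_l; ring.
- intros x _; apply (ex_derive_continuous (fun t => C * exp (- (1 * t)))); auto_derive; auto.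
Qed.

Lemma fast_RInt_small f : fast f -> exists C, 0 <= C /\
  forall a b, 0 <= a <= b -> Rabs (RInt f a b) <= C * exp (- a).
Proof.
intros Hf; destruct (proj2 Hf 1) as [C HC]; exists (Rabs C); split; [apply Rabs_pos|].
intros a b ab.
assert (Hex : ex_RInt f a b) by (apply fast_ex_RInt; auto; lra).
assert (E := RInt_exp_bound (Rabs C) a b ab).
assert (Hb : forall t, 0 <= t -> Rabs (f t) <= Rabs C * exp (- (1 * t))).
{ intros t Ht; specialize (HC t Ht); pose proof (Rle_abs C); pose proof (exp_pos (- (1 * t))); nra. }
assert (Rabs C * (exp (- a) - exp (- b)) <= Rabs C * exp (- a)).
{ apply Rmult_le_compat_l; [apply Rabs_pos|]; pose proof (exp_pos (- b)); lra. }
apply Rle_trans with (Rabs C * (exp (- a) - exp (- b))); auto.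
rewrite <- (is_RInt_unique _ _ _ _ E).
apply Rle_trans with (RInt (fun t => Rabs (f t)) a b).
- apply abs_RInt_le; auto; lra.
- apply RInt_le; try lra.
  + apply (ex_RInt_norm f); auto.
  + eexists; apply E.
  + intros x Hx; apply Hb; lra.
Qed.

Lemma exp_INR_small C eps : 0 < eps -> exists N, forall n, (N <= n)%nat -> C * exp (- INR n) < eps.
Proof.
intros He.
destruct (INR_unbounded (Rabs C / eps)) as [N HN]; exists N; intros n Hn.
apply le_INR in Hn.
pose proof (exp_ineq1_le (INR n)).
assert (P := exp_pos (- INR n)).
assert (E : exp (- INR n) * exp (INR n) = 1) by (rewrite <- exp_plus, Rplus_opp_l; apply exp_0).
assert (Rabs C < eps * INR N).
{ apply Rmult_lt_compat_r with (r := eps) in HN; auto.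
  unfold Rdiv in HN; rewrite Rmult_assoc, Rinv_l in HN; lra. }
assert (Rabs C < eps * exp (INR n)) by nra.
pose proof (Rle_abs C). nra.
Qed.

Lemma fast_lim0 (F : R -> R) C a : (forall t, a <= t -> Rabs (F t) <= C * exp (- t)) ->
  is_lim_seq (fun n => F (INR n)) 0.
Proof.
intros H; apply is_lim_seq_spec; intros eps.
destruct (exp_INR_small C eps (cond_pos eps)) as [N HN].
destruct (INR_unbounded a) as [M HM].
exists (max N M); intros n Hn.
rewrite Rminus_0_r.
assert (a <= INR n) by (assert (INR M <= INR n) by (apply le_INR; lia); lra).
assert (C * exp (- INR n) < eps) by (apply HN; lia).
specialize (H _ H0); lra.
Qed.

(** Half-line integral, taken along integer endpoints so that it is a total function; for [fast]
    integrands it is the improper integral. *)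
Definition II (f : R -> R) : R := real (Lim_seq (fun n => RInt f 0 (INR n))).
Definition IIfrom (a : R) (f : R -> R) : R := II f - RInt f 0 a.

Lemma RInt_minus_Chasles f a b : fast f -> 0 <= a -> 0 <= b ->
  RInt f 0 b - RInt f 0 a = RInt f a b.
Proof.
intros Hf Ha Hb.
assert (E := RInt_Chasles f 0 a b (fast_ex_RInt f 0 a Hf (Rle_refl 0) Ha) (fast_ex_RInt f a b Hf Ha Hb)).
unfold plus in E; simpl in E; lra.
Qed.

Lemma II_lim f : fast f -> is_lim_seq (fun n => RInt f 0 (INR n)) (II f).
Proof.
intros Hf; unfold II; apply Lim_seq_correct'.
apply ex_lim_seq_cauchy_corr; intros eps.
destruct (fast_RInt_small f Hf) as [C [HC Hs]].
destruct (exp_INR_small C eps (cond_pos eps)) as [N HN]; exists N.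
assert (K : forall n m, (N <= n)%nat -> (n <= m)%nat ->
   Rabs (RInt f 0 (INR m) - RInt f 0 (INR n)) < eps).
{ intros n m Hn Hm; rewrite RInt_minus_Chasles; auto using pos_INR.
  apply Rle_lt_trans with (C * exp (- INR n)); auto.
  apply Hs; split; [apply pos_INR|now apply le_INR]. }
intros n m Hn Hm; destruct (Nat.le_ge_cases n m).
- rewrite Rabs_minus_sym; auto.
- auto.
Qed.

Lemma IIfrom_lim a f : fast f -> 0 <= a -> is_lim_seq (fun n => RInt f a (INR n)) (IIfrom a f).
Proof.
intros Hf Ha; unfold IIfrom.
apply is_lim_seq_ext with (fun n => RInt f 0 (INR n) - RInt f 0 a).
- intros n; apply RInt_minus_Chasles; auto using pos_INR.
- apply is_lim_seq_minus'; [now apply II_lim | apply is_lim_seq_const].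
Qed.

Lemma IIfrom_0 f : IIfrom 0 f = II f.
Proof. unfold IIfrom; rewrite RInt_point; unfold zero; simpl; ring. Qed.

Lemma II_split a f : II f = RInt f 0 a + IIfrom a f.
Proof. unfold IIfrom; ring. Qed.

(** [F1] is only known as a pointwise derivative, perhaps not integrable. Hence the proof shows that
    [F] minus a primitive of [A - B] is nondecreasing, instead of integrating [F1]. *)
Lemma RInt_le_deriv (A B F F1 : R -> R) a b : a <= b ->
  (forall t, a <= t <= b -> continuous A t) ->
  (forall t, a <= t <= b -> continuous B t) ->
  (forall t, a <= t <= b -> is_derive F t (F1 t)) ->
  (forall t, a <= t <= b -> A t <= B t + F1 t) ->
  RInt A a b <= RInt B a b + F b - F a.
Proof.
intros ab HA HB HF H.
assert (EA : forall x, a <= x <= b -> ex_RInt A a x).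
{ intros x Hx; apply (ex_RInt_continuous (V := R_CompleteNormedModule)); intros z; rewrite Rmin_left, Rmax_right by lra;
  intros; apply HA; lra. }
assert (EB : forall x, a <= x <= b -> ex_RInt B a x).
{ intros x Hx; apply (ex_RInt_continuous (V := R_CompleteNormedModule)); intros z; rewrite Rmin_left, Rmax_right by lra;
  intros; apply HB; lra. }
destruct (Req_dec a b) as [->|ne].
{ rewrite !RInt_point; unfold zero; simpl; lra. }
assert (E : RInt A a b - RInt B a b = RInt (fun t => A t - B t) a b).
{ symmetry; apply (RInt_minus A B a b); [apply EA|apply EB]; lra. }
cut (RInt (fun t => A t - B t) a b <= F b - F a); [lra|].
set (g := fun t => A t - B t) in *.
assert (Hg : forall t, a <= t <= b -> continuous g t).
{ intros t Ht; apply (continuous_minus A B); auto. }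
(* extend the integrand continuously to make the primitive differentiable at the ends *)
set (e := fun t => g (Rmax a (Rmin b t))).
assert (He : forall t, continuous e t).
{ intros t; unfold e.
  apply (continuous_comp (fun t => Rmax a (Rmin b t)) g).
  - apply continuity_pt_filterlim.
    assert (Hid : continuity_pt (fun t => t) t) by apply continuity_pt_id.
    assert (Hm : forall c h, continuity_pt h t -> continuity_pt (fun t => Rmin c (h t)) t).
    { intros c h Hh; apply continuity_pt_ext with (fun t => (c + h t - Rabs (c - h t)) / 2).
      - intros s; unfold Rmin; destruct (Rle_dec c (h s)); [rewrite Rabs_left1|rewrite Rabs_right]; lra.
      - apply continuity_pt_filterlim, (continuous_mult (fun t => c + h t - Rabs (c - h t)) (fun _ => /2));
        [|apply continuous_const].
        apply (continuous_minus (fun t => c + h t) (fun t => Rabs (c - h t))).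
        + apply (continuous_plus (fun _ => c) h); [apply continuous_const|now apply continuity_pt_filterlim].
        + apply (continuous_comp (fun t => c - h t) Rabs).
          * apply (continuous_minus (fun _ => c) h); [apply continuous_const|now apply continuity_pt_filterlim].
          * apply continuous_Rabs. }
    apply continuity_pt_ext with (fun t => - Rmin (- a) (- Rmin b t)).
    { intros s; unfold Rmin, Rmax; repeat destruct Rle_dec; lra. }
    apply continuity_pt_opp, Hm, continuity_pt_opp, Hm, Hid.
  - apply Hg; split; [apply Rmax_l|]; apply Rmax_lub; [lra|apply Rmin_l]. }
assert (Hee : forall t, a <= t <= b -> e t = g t).
{ intros t Ht; unfold e; rewrite Rmin_right, Rmax_right; lra. }
rewrite <- (RInt_ext e).
2:{ intros x Hx; rewrite Rmin_left, Rmax_right in Hx by lra; apply Hee; lra. }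
assert (K := incr_of_derive (fun t => F t - RInt e a t) (fun t => F1 t - e t) a b ab).
assert (F a - RInt e a a <= F b - RInt e a b).
{ apply K.
  - intros x Hx; apply (is_derive_minus F (RInt e a)); [now apply HF|].
    apply (is_derive_RInt e (RInt e a) a x); auto.
    exists (mkposreal 1 Rlt_0_1); intros y _; apply (RInt_correct (V := R_CompleteNormedModule)).
    apply (ex_RInt_continuous (V := R_CompleteNormedModule)); auto.
  - intros x Hx; rewrite Hee by auto; specialize (H x Hx); unfold g; lra. }
rewrite RInt_point in H0; unfold zero in H0; simpl in H0; lra.
Qed.

(** The form taken by every energy and virial estimate below: a pointwise inequality modulo the
    derivative of a decaying [F] leaves only the boundary term at [a]. *)
Lemma IIfrom_le_deriv (A B F F1 : R -> R) C a : 0 <= a -> fast A -> fast B ->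
  (forall t, a <= t -> is_derive F t (F1 t)) ->
  (forall t, a <= t -> Rabs (F t) <= C * exp (- t)) ->
  (forall t, a <= t -> A t <= B t + F1 t) ->
  IIfrom a A <= IIfrom a B - F a.
Proof.
intros Ha HA HB HF HC H.
apply (is_lim_seq_le_loc (fun n => RInt A a (INR n)) (fun n => RInt B a (INR n) + F (INR n) - F a)
        (IIfrom a A) (IIfrom a B - F a)).
- destruct (INR_unbounded a) as [N HN]; exists N; intros n Hn; apply le_INR in Hn.
  apply RInt_le_deriv with F1; try lra.
  + intros t Ht; apply HA; lra.
  + intros t Ht; apply HB; lra.
  + intros t Ht; apply HF; lra.
  + intros t Ht; apply H; lra.
- now apply IIfrom_lim.
- replace (Finite (IIfrom a B - F a)) with (Finite (IIfrom a B + 0 - F a)) by (f_equal; ring).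
  apply is_lim_seq_minus'; [|apply is_lim_seq_const].
  apply is_lim_seq_plus'; [now apply IIfrom_lim|]. now apply fast_lim0 with C a.
Qed.

Lemma fast_exp1 F : fast F -> exists C, forall t, 0 <= t -> Rabs (F t) <= C * exp (- t).
Proof.
intros [_ H]; destruct (H 1) as [C HC]; exists C; intros t Ht.
specialize (HC t Ht); rewrite Rmult_1_l in HC; auto.
Qed.

Lemma II_le_deriv (A B F F1 : R -> R) : fast A -> fast B -> fast F ->
  (forall t, 0 <= t -> is_derive F t (F1 t)) ->
  (forall t, 0 <= t -> A t <= B t + F1 t) ->
  II A <= II B - F 0.
Proof.
intros HA HB HF Hd H; destruct (fast_exp1 F HF) as [C HC].
rewrite <- !IIfrom_0; apply IIfrom_le_deriv with F1 C; auto; lra.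
Qed.

Lemma II_eq_deriv (A B F F1 : R -> R) : fast A -> fast B -> fast F ->
  (forall t, 0 <= t -> is_derive F t (F1 t)) ->
  (forall t, 0 <= t -> A t = B t + F1 t) ->
  II A = II B - F 0.
Proof.
intros HA HB HF Hd H; apply Rle_antisym.
- apply II_le_deriv with F1; auto; intros t Ht; rewrite H; auto; lra.
- assert (II B <= II A - (- F 0)); [|lra].
  apply (II_le_deriv B A (fun t => - F t) (fun t => - F1 t)); auto.
  + now apply fast_opp.
  + intros t Ht; apply (is_derive_opp F); auto.
  + intros t Ht; rewrite H; auto; lra.
Qed.

Lemma fast_0 : fast (fun _ => 0).
Proof.
split; [intros t _; apply continuous_const|].
intros k; exists 0; intros t _; rewrite Rabs_R0; lra.
Qed.

Lemma IIfrom_le a A B : 0 <= a -> fast A -> fast B -> (forall t, a <= t -> A t <= B t) -> IIfrom a A <= IIfrom a B.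
Proof.
intros Ha HA HB H.
replace (IIfrom a B) with (IIfrom a B - 0) by ring.
apply (IIfrom_le_deriv A B (fun _ => 0) (fun _ => 0) 0); auto.
- intros; apply (is_derive_const 0).
- intros; rewrite Rabs_R0; lra.
- intros t Ht; specialize (H t Ht); lra.
Qed.

Lemma II_le A B : fast A -> fast B -> (forall t, 0 <= t -> A t <= B t) -> II A <= II B.
Proof. intros; rewrite <- !IIfrom_0; apply IIfrom_le; auto; lra. Qed.

Lemma II_ext A B : fast A -> fast B -> (forall t, 0 <= t -> A t = B t) -> II A = II B.
Proof. intros HA HB H; apply Rle_antisym; apply II_le; auto; intros; rewrite H; auto; lra. Qed.

Lemma II_0 : II (fun _ => 0) = 0.
Proof.
unfold II; rewrite (Lim_seq_ext _ (fun _ => 0)).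
- rewrite Lim_seq_const; auto.
- intros n; rewrite RInt_const; unfold scal; simpl; unfold mult; simpl; ring.
Qed.

Lemma II_plus f g : fast f -> fast g -> II (fun t => f t + g t) = II f + II g.
Proof.
intros Hf Hg.
assert (L := II_lim _ (fast_plus _ _ Hf Hg)).
assert (M : is_lim_seq (fun n => RInt f 0 (INR n) + RInt g 0 (INR n)) (II f + II g))
  by (apply is_lim_seq_plus'; now apply II_lim).
apply is_lim_seq_unique in L; apply is_lim_seq_unique in M.
assert (E : Finite (II (fun t => f t + g t)) = Finite (II f + II g)); [|now inversion E].
rewrite <- L, <- M; apply Lim_seq_ext; intros n.
apply (RInt_plus f g); apply fast_ex_RInt; auto using pos_INR; lra.
Qed.

Lemma II_scal c f : fast f -> II (fun t => c * f t) = c * II f.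
Proof.
intros Hf.
assert (Hcf : fast (fun t => c * f t)) by sf.
assert (L := II_lim _ Hcf).
assert (M : is_lim_seq (fun n => c * RInt f 0 (INR n)) (c * II f))
  by (apply is_lim_seq_mult'; [apply is_lim_seq_const|now apply II_lim]).
apply is_lim_seq_unique in L; apply is_lim_seq_unique in M.
assert (E : Finite (II (fun t => c * f t)) = Finite (c * II f)); [|now inversion E].
rewrite <- L, <- M; apply Lim_seq_ext; intros n.
apply (RInt_scal f); apply fast_ex_RInt; auto using pos_INR; lra.
Qed.

Lemma II_minus f g : fast f -> fast g -> II (fun t => f t - g t) = II f - II g.
Proof.
intros Hf Hg.
replace (II f - II g) with (II f + (-1) * II g) by ring.
rewrite <- II_scal, <- II_plus; auto; try sf.
apply II_ext; try sf; intros; ring.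
Qed.

Lemma II_ge0 f : fast f -> (forall t, 0 <= t -> 0 <= f t) -> 0 <= II f.
Proof. intros Hf H; rewrite <- II_0; apply II_le; auto using fast_0. Qed.

Lemma II_abs f g : fast f -> fast g -> (forall t, 0 <= t -> Rabs (f t) <= g t) -> Rabs (II f) <= II g.
Proof.
intros Hf Hg H; apply Rabs_le; split.
- replace (- II g) with (II (fun t => (-1) * g t)) by (rewrite II_scal; auto; ring).
  apply II_le; auto; [sf|]; intros t Ht; specialize (H t Ht).
  unfold Rabs in H; destruct (Rcase_abs (f t)); lra.
- apply II_le; auto; intros t Ht; specialize (H t Ht).
  unfold Rabs in H; destruct (Rcase_abs (f t)); lra.
Qed.

Lemma RInt_cont0_pos f a : cont0 f -> (forall t, 0 <= t -> 0 <= f t) -> 0 < a -> 0 < f 0 -> 0 < RInt f 0 a.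
Proof.
intros Hc Hp Ha H0.
destruct (proj1 (filterlim_locally _ _) (Hc 0 (Rle_refl 0)) (mkposreal (f 0 / 2) ltac:(lra))) as [d Hd].
set (r := Rmin a (d / 2)).
assert (Hr : 0 < r) by (apply Rmin_pos; [lra|]; pose proof (cond_pos d); lra).
assert (Hra : r <= a) by apply Rmin_l.
assert (Hrd : r <= d / 2) by apply Rmin_r.
assert (ex : forall x y, 0 <= x -> 0 <= y -> ex_RInt f x y).
{ intros x y Hx Hy; apply (ex_RInt_continuous (V := R_CompleteNormedModule)); intros z Hz; apply Hc.
  assert (0 <= Rmin x y) by (apply Rmin_glb; auto); lra. }
rewrite <- (RInt_Chasles f 0 r a); [|apply ex; lra|apply ex; lra].
unfold plus; simpl.
assert (0 <= RInt f r a) by (apply RInt_ge_0; [lra|apply ex; lra|intros x Hx; apply Hp; lra]).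
assert (r * (f 0 / 2) <= RInt f 0 r).
{ replace (r * (f 0 / 2)) with (RInt (fun _ => f 0 / 2) 0 r)
    by (rewrite RInt_const; unfold scal; simpl; unfold mult; simpl; ring).
  apply RInt_le; [lra|apply ex_RInt_const|apply ex; lra|].
  intros x Hx. assert (B := Hd x). pose proof (cond_pos d).
  assert (ball (f 0) (f 0 / 2) (f x)).
  { apply B; unfold ball; simpl; unfold AbsRing_ball, abs, minus, plus, opp; simpl.
    rewrite Rabs_right; lra. }
  unfold ball in H2; simpl in H2; unfold AbsRing_ball, abs, minus, plus, opp in H2; simpl in H2.
  apply Rabs_def2 in H2; lra. }
nra.
Qed.

Lemma II_pos_point f a : fast f -> (forall t, 0 <= t -> 0 <= f t) -> 0 <= a -> 0 < f a -> 0 < II f.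
Proof.
intros Hf Hp Ha H.
rewrite (II_split (a + 1)).
assert (0 <= IIfrom (a + 1) f).
{ replace 0 with (IIfrom (a + 1) (fun _ => 0)).
  - apply IIfrom_le; auto using fast_0; [lra|]; intros; apply Hp; lra.
  - unfold IIfrom; rewrite II_0, RInt_const; unfold scal; simpl; unfold mult; simpl; ring. }
rewrite <- (RInt_Chasles f 0 a (a + 1)); [|apply fast_ex_RInt; auto; lra|apply fast_ex_RInt; auto; lra].
unfold plus; simpl.
assert (0 <= RInt f 0 a) by (apply RInt_ge_0; [lra|apply fast_ex_RInt; auto; lra|intros x Hx; apply Hp; lra]).
assert (0 < RInt f a (a + 1)); [|lra].
assert (E : RInt f a (a + 1) = RInt (fun s => f (s + a)) 0 1).
{ assert (K := RInt_comp_lin f 1 a 0 1).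
  replace (1 * 0 + a) with a in K by ring; replace (1 * 1 + a) with (a + 1) in K by ring.
  rewrite <- K by (apply fast_ex_RInt; auto; lra).
  apply RInt_ext; intros x _; unfold scal; simpl; unfold mult; simpl.
  rewrite !Rmult_1_l; reflexivity. }
rewrite E; apply RInt_cont0_pos.
- intros t Ht; apply (continuous_comp (fun s => s + a) f).
  + apply (continuous_plus (fun s => s) (fun _ => a)); [apply continuous_id|apply continuous_const].
  + apply Hf; lra.
- intros; apply Hp; lra.
- lra.
- now rewrite Rplus_0_l.
Qed.

(** * Power series solutions of the eigenvalue equation *)

Section PowerSeries.
Variables c0 al nu : R.
Hypothesis nu0 : 0 <= nu.

(** With z = t^2 and u = t^nu phi(z), nu = 0 or 1, the equation u'' = (q - lam) u becomes 4 z phi''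
    + 2 (1 + 2 nu) phi' = (c0 - al z + z^2/4) phi with c0 = al^2 - lam. Its recursion reaches three
    coefficients back, so the state carries the last three. *)
Fixpoint coef_state (k : nat) : R * R * R :=
  match k with
  | O => (1, 0, 0)
  | S k => let '(a, b, c) := coef_state k in
     ((c0 * a - al * b + c / 4) / ((2 * INR k + 2) * (2 * INR k + 1 + 2 * nu)), a, b)
  end.

Definition coef (k : nat) : R := fst (fst (coef_state k)).

Lemma coef_state_eq k :
  coef_state k = (coef k, PS_incr_1 coef k, PS_incr_1 (PS_incr_1 coef) k).
Proof.
induction k as [|k IH]; [reflexivity|].
destruct k as [|k]; [reflexivity|].
rewrite (surjective_pairing (coef_state (S (S k)))).
rewrite (surjective_pairing (fst (coef_state (S (S k))))).
simpl coef_state at 2 3; simpl coef_state in IH.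
unfold coef at 1; simpl.
destruct (coef_state k) as [[a b] c]; simpl.
inversion IH; subst; reflexivity.
Qed.

Lemma coef_rec k : (2 * INR k + 2) * (2 * INR k + 1 + 2 * nu) * coef (S k) =
  c0 * coef k - al * PS_incr_1 coef k + PS_incr_1 (PS_incr_1 coef) k / 4.
Proof.
unfold coef at 1; simpl coef_state; rewrite (coef_state_eq k); cbn [fst snd].
pose proof (pos_INR k); field; split; nra.
Qed.

(** The denominators of the recursion exceed k. Once k is larger than r |c0| + r^2 |al| + r^3, a
    common bound for three consecutive terms of the series at r also holds for the next term. *)
Lemma coef_bound r : 0 <= r -> exists M, forall k, Rabs (coef k * r ^ k) <= M.
Proof.
intros Hr.
(* The last two conditions say that the two previous terms, with powers r^(k-1) and r^(k-2), are at
   most M; they are multiplied by r^2 and r^3 so that no negative exponent occurs. *)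
set (P M k := Rabs (coef k) * r ^ k <= M /\ Rabs (PS_incr_1 coef k) * (r * r ^ k) <= r ^ 2 * M /\
   Rabs (PS_incr_1 (PS_incr_1 coef) k) * (r * r ^ k) <= r ^ 3 * M).
assert (Hp : forall k, 0 <= r ^ k) by (intros; now apply pow_le).
assert (mono : forall M M' k, M <= M' -> P M k -> P M' k).
{ intros M M' k HM [A [B C]]; repeat split; [lra| |].
  - pose proof (Hp 2%nat); nra.
  - pose proof (Hp 3%nat); nra. }
assert (step : forall M k, 0 <= M -> r * Rabs c0 + r ^ 2 * Rabs al + r ^ 3 <= INR k -> P M k -> P M (S k)).
{ intros M k HM Hk [A [B C]].
  assert (D0 : 0 < (2 * INR k + 2) * (2 * INR k + 1 + 2 * nu)) by (pose proof (pos_INR k); nra).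
  assert (D1 : INR k <= (2 * INR k + 2) * (2 * INR k + 1 + 2 * nu)) by (pose proof (pos_INR k); nra).
  unfold P; repeat split.
  - apply Rmult_le_reg_l with (1 := D0).
    assert (E : (2 * INR k + 2) * (2 * INR k + 1 + 2 * nu) * (Rabs (coef (S k)) * r ^ S k) =
       Rabs (c0 * coef k - al * PS_incr_1 coef k + PS_incr_1 (PS_incr_1 coef) k / 4) * (r * r ^ k)).
    { rewrite <- coef_rec, Rabs_mult, (Rabs_right ((2 * INR k + 2) * (2 * INR k + 1 + 2 * nu))) by lra.
      simpl; ring. }
    rewrite E.
    assert (T : Rabs (c0 * coef k - al * PS_incr_1 coef k + PS_incr_1 (PS_incr_1 coef) k / 4) <=
      Rabs c0 * Rabs (coef k) + Rabs al * Rabs (PS_incr_1 coef k) + Rabs (PS_incr_1 (PS_incr_1 coef) k)).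
    { rewrite <- !Rabs_mult.
      eapply Rle_trans; [apply Rabs_triang|]. unfold Rdiv; rewrite (Rabs_mult _ (/4)), (Rabs_right (/4)) by lra.
      eapply Rle_trans; [apply Rplus_le_compat_r, Rabs_triang|]. rewrite Rabs_Ropp.
      pose proof (Rabs_pos (PS_incr_1 (PS_incr_1 coef) k)); lra. }
    assert (U : 0 <= r * r ^ k) by (apply Rmult_le_pos; auto).
    apply Rle_trans with ((r * Rabs c0 + r ^ 2 * Rabs al + r ^ 3) * M).
    + eapply Rle_trans; [apply Rmult_le_compat_r; [exact U|exact T]|].
      pose proof (Rabs_pos c0); pose proof (Rabs_pos al).
      assert (Rabs c0 * (Rabs (coef k) * r ^ k) * r <= Rabs c0 * M * r)
        by (apply Rmult_le_compat_r; auto; apply Rmult_le_compat_l; auto).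
      assert (Rabs al * (Rabs (PS_incr_1 coef k) * (r * r ^ k)) <= Rabs al * (r ^ 2 * M))
        by (apply Rmult_le_compat_l; auto).
      nra.
    + apply Rmult_le_compat_r; auto; lra.
  - replace (PS_incr_1 coef (S k)) with (coef k) by reflexivity.
    simpl; replace (Rabs (coef k) * (r * (r * r ^ k))) with (r * (r * 1) * (Rabs (coef k) * r ^ k)) by ring.
    apply Rmult_le_compat_l; auto; apply (Hp 2%nat).
  - replace (PS_incr_1 (PS_incr_1 coef) (S k)) with (PS_incr_1 coef k) by reflexivity.
    replace (Rabs (PS_incr_1 coef k) * (r * r ^ S k)) with (r * (Rabs (PS_incr_1 coef k) * (r * r ^ k)))
      by (simpl; ring).
    replace (r ^ 3 * M) with (r * (r ^ 2 * M)) by ring.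
    now apply Rmult_le_compat_l. }
assert (init : forall k, r = 0 \/ exists M, 0 <= M /\ P M k).
{ intros k; destruct (Req_dec r 0) as [->|ne]; [now left|right].
  assert (0 < r) by lra. assert (0 < r ^ 2) by (apply pow_lt; auto). assert (0 < r ^ 3) by (apply pow_lt; auto).
  exists (Rabs (coef k) * r ^ k + Rabs (PS_incr_1 coef k) * (r * r ^ k) / r ^ 2
     + Rabs (PS_incr_1 (PS_incr_1 coef) k) * (r * r ^ k) / r ^ 3).
  assert (H2 : 0 <= Rabs (coef k) * r ^ k) by (apply Rmult_le_pos; auto using Rabs_pos).
  assert (H3 : 0 <= Rabs (PS_incr_1 coef k) * (r * r ^ k)) by (repeat apply Rmult_le_pos; auto using Rabs_pos).
  assert (H4 : 0 <= Rabs (PS_incr_1 (PS_incr_1 coef) k) * (r * r ^ k)) by (repeat apply Rmult_le_pos; auto using Rabs_pos).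
  assert (H5 : 0 <= Rabs (PS_incr_1 coef k) * (r * r ^ k) / r ^ 2) by (apply Rdiv_le_0_compat; auto).
  assert (H6 : 0 <= Rabs (PS_incr_1 (PS_incr_1 coef) k) * (r * r ^ k) / r ^ 3) by (apply Rdiv_le_0_compat; auto).
  split; [lra|]; unfold P; repeat split; [lra| |].
  - set (X := Rabs (PS_incr_1 coef k) * (r * r ^ k)) in *.
    replace X with (r ^ 2 * (X / r ^ 2)) at 1 by (field; lra).
    apply Rmult_le_compat_l; lra.
  - set (X := Rabs (PS_incr_1 (PS_incr_1 coef) k) * (r * r ^ k)) in *.
    replace X with (r ^ 3 * (X / r ^ 3)) at 1 by (field; lra).
    apply Rmult_le_compat_l; lra. }
destruct (Req_dec r 0) as [->|ne].
{ exists 1; intros [|k]; simpl.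
  - unfold coef; simpl; rewrite Rmult_1_r, Rabs_R1; lra.
  - rewrite Rmult_0_l, Rmult_0_r, Rabs_R0; lra. }
destruct (INR_unbounded (r * Rabs c0 + r ^ 2 * Rabs al + r ^ 3)) as [N HN].
assert (up : forall n, exists M, 0 <= M /\ forall k, (k <= n)%nat -> P M k).
{ induction n as [|n [M [HM IH]]].
  - destruct (init 0%nat) as [|[M [HM H]]]; [contradiction|exists M; split; auto].
    intros k Hk; now replace k with 0%nat by lia.
  - destruct (init (S n)) as [|[M' [HM' H]]]; [contradiction|].
    exists (M + M'); split; [lra|]; intros k Hk.
    destruct (Nat.eq_dec k (S n)) as [->|].
    + apply mono with M'; auto; lra.
    + apply mono with M; [lra|]; apply IH; lia. }
destruct (up N) as [M [HM H]].
assert (all : forall k, P M k).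
{ induction k as [|k IH]; [apply H; lia|].
  destruct (Nat.le_gt_cases (S k) N); [now apply H|].
  apply step; auto. assert (INR N <= INR k) by (apply le_INR; lia); lra. }
exists M; intros k; rewrite Rabs_mult, (Rabs_right (r ^ k)) by (apply Rle_ge; auto).
apply all.
Qed.

Lemma coef_radius : CV_radius coef = p_infty.
Proof.
destruct (CV_radius_bounded coef) as [ub _].
assert (H : forall r, 0 <= r -> Rbar_le r (CV_radius coef)).
{ intros r Hr; apply ub, coef_bound, Hr. }
destruct (CV_radius coef) as [x| |]; auto.
- specialize (H (Rabs x + 1) ltac:(pose proof (Rabs_pos x); lra)); simpl in H.
  pose proof (Rle_abs x); lra.
- now specialize (H 0 (Rle_refl 0)).
Qed.

Definition phi (z : R) := PSeries coef z.
Definition phi1 (z : R) := PSeries (PS_derive coef) z.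
Definition phi2 (z : R) := PSeries (PS_derive (PS_derive coef)) z.

Lemma phi_derive z : is_derive phi z (phi1 z).
Proof. apply is_derive_PSeries; now rewrite coef_radius. Qed.

Lemma phi1_derive z : is_derive phi1 z (phi2 z).
Proof. apply is_derive_PSeries; now rewrite CV_radius_derive, coef_radius. Qed.

Lemma phi_ode z : 4 * z * phi2 z + 2 * (1 + 2 * nu) * phi1 z = (c0 - al * z + z ^ 2 / 4) * phi z.
Proof.
assert (ex : forall a, CV_radius a = p_infty -> ex_pseries a z).
{ intros a Ha; apply CV_radius_inside; now rewrite Ha. }
assert (r1 : CV_radius (PS_derive coef) = p_infty) by (rewrite CV_radius_derive; apply coef_radius).
assert (r2 : CV_radius (PS_derive (PS_derive coef)) = p_infty) by (rewrite CV_radius_derive; apply r1).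
assert (e0 := ex _ coef_radius); assert (e1 := ex _ r1); assert (e2 := ex _ r2).
replace (4 * z * phi2 z + 2 * (1 + 2 * nu) * phi1 z) with
  (PSeries (PS_plus (PS_scal 4 (PS_incr_1 (PS_derive (PS_derive coef))))
     (PS_scal (2 * (1 + 2 * nu)) (PS_derive coef))) z).
2:{ rewrite PSeries_plus, !PSeries_scal, PSeries_incr_1.
    - unfold phi1, phi2; ring.
    - apply ex_pseries_scal; [apply Rmult_comm|]; now apply ex_pseries_incr_1.
    - apply ex_pseries_scal; [apply Rmult_comm|]; auto. }
replace ((c0 - al * z + z ^ 2 / 4) * phi z) with
  (PSeries (PS_plus (PS_plus (PS_scal c0 coef) (PS_scal (- al) (PS_incr_1 coef)))
     (PS_scal (/ 4) (PS_incr_1 (PS_incr_1 coef)))) z).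
2:{ rewrite !PSeries_plus, !PSeries_scal, !PSeries_incr_1.
    - unfold phi; field.
    - apply ex_pseries_scal; [apply Rmult_comm|]; auto.
    - apply ex_pseries_scal; [apply Rmult_comm|]; now apply ex_pseries_incr_1.
    - apply ex_pseries_plus; apply ex_pseries_scal; try apply Rmult_comm; auto; now apply ex_pseries_incr_1.
    - apply ex_pseries_scal; [apply Rmult_comm|]; now repeat apply ex_pseries_incr_1. }
apply PSeries_ext; intros k.
assert (R0 := coef_rec k).
unfold PS_plus, PS_scal, scal, plus; simpl; unfold mult; simpl.
replace (c0 * coef k + - al * PS_incr_1 coef k + / 4 * PS_incr_1 (PS_incr_1 coef) k)
  with (c0 * coef k - al * PS_incr_1 coef k + PS_incr_1 (PS_incr_1 coef) k / 4) by field.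
rewrite <- R0.
destruct k as [|k].
- unfold PS_incr_1, PS_derive; simpl; unfold zero; simpl; ring.
- unfold PS_incr_1, PS_derive; rewrite !S_INR; ring.
Qed.

End PowerSeries.

(** * Fundamental system at 0 and constancy of Wronskians *)

Definition Qp (al lam t : R) : R := qM al t - lam.

Definition sol (al lam : R) (u u1 : R -> R) : Prop :=
  (forall t, is_derive u t (u1 t)) /\ (forall t, is_derive u1 t (Qp al lam t * u t)).

Definition ceven al lam t := phi (al ^ 2 - lam) al 0 (t ^ 2).
Definition ceven1 al lam t := 2 * t * phi1 (al ^ 2 - lam) al 0 (t ^ 2).
Definition sodd al lam t := t * phi (al ^ 2 - lam) al 1 (t ^ 2).
Definition sodd1 al lam t := phi (al ^ 2 - lam) al 1 (t ^ 2) + 2 * t ^ 2 * phi1 (al ^ 2 - lam) al 1 (t ^ 2).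

Lemma is_derive_comp_sq (f f1 : R -> R) t : (forall z, is_derive f z (f1 z)) ->
  is_derive (fun t => f (t ^ 2)) t (2 * t * f1 (t ^ 2)).
Proof.
intros H; apply (is_derive_comp f (fun t => t ^ 2) t (f1 (t ^ 2)) (2 * t)); auto.
auto_derive; auto; ring.
Qed.

Lemma ceven_sol al lam : sol al lam (ceven al lam) (ceven1 al lam).
Proof.
split; intros t; unfold ceven, ceven1.
- apply is_derive_comp_sq; intros; apply phi_derive; lra.
- assert (O := phi_ode (al ^ 2 - lam) al 0 (Rle_refl 0) (t ^ 2)).
  replace (Qp al lam t * phi (al ^ 2 - lam) al 0 (t ^ 2)) with
   (2 * phi1 (al ^ 2 - lam) al 0 (t ^ 2) + 2 * t * (2 * t * phi2 (al ^ 2 - lam) al 0 (t ^ 2))).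
  + apply (is_derive_mult (fun t => 2 * t) (fun t => phi1 (al ^ 2 - lam) al 0 (t ^ 2)));
    [auto_derive; auto; ring| |intros; apply Rmult_comm].
    apply is_derive_comp_sq; intros; apply phi1_derive; lra.
  + transitivity ((al ^ 2 - lam - al * t ^ 2 + (t ^ 2) ^ 2 / 4) * phi (al ^ 2 - lam) al 0 (t ^ 2)).
    * rewrite <- O; ring.
    * unfold Qp, qM; field.
Qed.

Lemma sodd_sol al lam : sol al lam (sodd al lam) (sodd1 al lam).
Proof.
assert (n1 : 0 <= 1) by lra.
assert (Hp : forall t, is_derive (fun t => phi (al ^ 2 - lam) al 1 (t ^ 2)) t (2 * t * phi1 (al ^ 2 - lam) al 1 (t ^ 2))).
{ intros; apply is_derive_comp_sq; intros; now apply phi_derive. }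
split; intros t; unfold sodd, sodd1.
- replace (phi (al ^ 2 - lam) al 1 (t ^ 2) + 2 * t ^ 2 * phi1 (al ^ 2 - lam) al 1 (t ^ 2)) with
   (1 * phi (al ^ 2 - lam) al 1 (t ^ 2) + t * (2 * t * phi1 (al ^ 2 - lam) al 1 (t ^ 2))) by ring.
  apply (is_derive_mult (fun t => t) (fun t => phi (al ^ 2 - lam) al 1 (t ^ 2))); auto.
  + apply (is_derive_id t).
  + intros; apply Rmult_comm.
- assert (O := phi_ode (al ^ 2 - lam) al 1 n1 (t ^ 2)).
  replace (Qp al lam t * (t * phi (al ^ 2 - lam) al 1 (t ^ 2))) with
   (2 * t * phi1 (al ^ 2 - lam) al 1 (t ^ 2) + (4 * t * phi1 (al ^ 2 - lam) al 1 (t ^ 2)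
     + 2 * t ^ 2 * (2 * t * phi2 (al ^ 2 - lam) al 1 (t ^ 2)))).
  + apply (is_derive_plus (fun t => phi (al ^ 2 - lam) al 1 (t ^ 2))); auto.
    apply (is_derive_mult (fun t => 2 * t ^ 2) (fun t => phi1 (al ^ 2 - lam) al 1 (t ^ 2)));
      [auto_derive; auto; ring| |intros; apply Rmult_comm].
    apply is_derive_comp_sq; intros; now apply phi1_derive.
  + transitivity (t * ((al ^ 2 - lam - al * t ^ 2 + (t ^ 2) ^ 2 / 4) * phi (al ^ 2 - lam) al 1 (t ^ 2))).
    * rewrite <- O; ring.
    * unfold Qp, qM; field.
Qed.

Lemma phi_0 c0 al nu : phi c0 al nu 0 = 1.
Proof. unfold phi; rewrite PSeries_0; reflexivity. Qed.

Lemma ceven_0 al lam : ceven al lam 0 = 1 /\ ceven1 al lam 0 = 0.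
Proof. unfold ceven, ceven1; rewrite pow_i, phi_0 by lia; split; ring. Qed.

Lemma sodd_0 al lam : sodd al lam 0 = 0 /\ sodd1 al lam 0 = 1.
Proof. unfold sodd, sodd1; rewrite pow_i, phi_0 by lia; split; ring. Qed.

Lemma ceven_neg al lam t : ceven al lam (- t) = ceven al lam t.
Proof. unfold ceven; now replace ((- t) ^ 2) with (t ^ 2) by ring. Qed.

Lemma sodd_neg al lam t : sodd al lam (- t) = - sodd al lam t.
Proof. unfold sodd; replace ((- t) ^ 2) with (t ^ 2) by ring; ring. Qed.

Lemma const_of_derive (f : R -> R) : (forall t, is_derive f t 0) -> forall s t, f s = f t.
Proof.
intros H.
assert (K : forall s t, s <= t -> f s = f t).
{ intros s t st; apply Rle_antisym.
  - apply (incr_of_derive f (fun _ => 0)); auto; intros; lra.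
  - assert (- f s <= - f t); [|lra].
    apply (incr_of_derive (fun t => - f t) (fun _ => -0)); auto.
    + intros; apply (is_derive_opp f); auto.
    + intros; lra. }
intros s t; destruct (Rle_dec s t); [auto|symmetry; apply K; lra].
Qed.

Lemma wronskian_derive al lam al' mu u u1 v v1 t : sol al lam u u1 -> sol al' mu v v1 ->
  is_derive (fun t => u t * v1 t - u1 t * v t) t ((Qp al' mu t - Qp al lam t) * u t * v t).
Proof.
intros [U1 U2] [V1 V2].
replace ((Qp al' mu t - Qp al lam t) * u t * v t) with
 ((u1 t * v1 t + u t * (Qp al' mu t * v t)) - ((Qp al lam t * u t) * v t + u1 t * v1 t)) by ring.
apply (is_derive_minus (fun t => u t * v1 t) (fun t => u1 t * v t)).
- apply (is_derive_mult u v1); auto; intros; apply Rmult_comm.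
- apply (is_derive_mult u1 v); auto; intros; apply Rmult_comm.
Qed.

Lemma wronskian_const al lam u u1 v v1 s t : sol al lam u u1 -> sol al lam v v1 ->
  u s * v1 s - u1 s * v s = u t * v1 t - u1 t * v t.
Proof.
intros U V.
apply (const_of_derive (fun t => u t * v1 t - u1 t * v t)); intros x.
replace 0 with ((Qp al lam x - Qp al lam x) * u x * v x) by ring.
eapply wronskian_derive; eauto.
Qed.

Lemma wronskian_cs al lam t :
  ceven al lam t * sodd1 al lam t - ceven1 al lam t * sodd al lam t = 1.
Proof.
rewrite (wronskian_const al lam _ _ _ _ t 0 (ceven_sol al lam) (sodd_sol al lam)).
destruct (ceven_0 al lam) as [-> ->]; destruct (sodd_0 al lam) as [-> ->]; ring.
Qed.

(** Cramer's rule: the Wronskians of [u] with [sodd] and [ceven] are constant, and their values at 0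
    are the Cauchy data of [u]. This gives uniqueness for the Cauchy problem. *)
Lemma sol_cs al lam u u1 : sol al lam u u1 -> forall t,
  u t = u 0 * ceven al lam t + u1 0 * sodd al lam t /\
  u1 t = u 0 * ceven1 al lam t + u1 0 * sodd1 al lam t.
Proof.
intros U t.
assert (W1 := wronskian_const al lam _ _ _ _ t 0 U (sodd_sol al lam)).
assert (W2 := wronskian_const al lam _ _ _ _ t 0 (ceven_sol al lam) U).
assert (W := wronskian_cs al lam t).
destruct (ceven_0 al lam) as [C0 C1]; destruct (sodd_0 al lam) as [S0 S1].
rewrite C0, C1 in W2; rewrite S0, S1 in W1.
assert (A : u 0 = u t * sodd1 al lam t - u1 t * sodd al lam t) by lra.
assert (B : u1 0 = ceven al lam t * u1 t - ceven1 al lam t * u t) by lra.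
rewrite A, B; split.
- transitivity (u t * (ceven al lam t * sodd1 al lam t - ceven1 al lam t * sodd al lam t)); [rewrite W|]; ring.
- transitivity (u1 t * (ceven al lam t * sodd1 al lam t - ceven1 al lam t * sodd al lam t)); [rewrite W|]; ring.
Qed.

Lemma sol_lin al lam a b u u1 v v1 : sol al lam u u1 -> sol al lam v v1 ->
  sol al lam (fun t => a * u t + b * v t) (fun t => a * u1 t + b * v1 t).
Proof.
intros [U1 U2] [V1 V2]; split; intros t.
- apply (is_derive_plus (fun t => a * u t) (fun t => b * v t)); now apply is_derive_scal.
- replace (Qp al lam t * (a * u t + b * v t)) with (a * (Qp al lam t * u t) + b * (Qp al lam t * v t)) by ring.
  apply (is_derive_plus (fun t => a * u1 t) (fun t => b * v1 t)); now apply is_derive_scal.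
Qed.

Lemma sol_zero al lam u u1 a : sol al lam u u1 -> u a = 0 -> u1 a = 0 -> forall t, u t = 0 /\ u1 t = 0.
Proof.
intros U Ha Hb t.
assert (W1 := wronskian_const al lam _ _ _ _ a 0 U (sodd_sol al lam)).
assert (W2 := wronskian_const al lam _ _ _ _ a 0 (ceven_sol al lam) U).
destruct (ceven_0 al lam) as [C0 C1]; destruct (sodd_0 al lam) as [S0 S1].
rewrite C0, C1, Ha, Hb in W2; rewrite S0, S1, Ha, Hb in W1.
destruct (sol_cs al lam u u1 U t) as [-> ->].
replace (u 0) with 0 by lra; replace (u1 0) with 0 by lra; split; ring.
Qed.

Lemma sol_cont al lam u u1 : sol al lam u u1 -> (forall t, continuous u t) /\ (forall t, continuous u1 t).
Proof. intros [U1 U2]; split; intros t; eapply is_derive_cont; eauto. Qed.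

Lemma sol_cauchy al lam T a b : exists u u1, sol al lam u u1 /\ u T = a /\ u1 T = b.
Proof.
exists (fun t => (a * sodd1 al lam T - b * sodd al lam T) * ceven al lam t
   + (b * ceven al lam T - a * ceven1 al lam T) * sodd al lam t),
 (fun t => (a * sodd1 al lam T - b * sodd al lam T) * ceven1 al lam t
   + (b * ceven al lam T - a * ceven1 al lam T) * sodd1 al lam t).
split; [apply sol_lin; auto using ceven_sol, sodd_sol|].
assert (W := wronskian_cs al lam T).
split.
- transitivity (a * (ceven al lam T * sodd1 al lam T - ceven1 al lam T * sodd al lam T)); [ring|rewrite W; ring].
- transitivity (b * (ceven al lam T * sodd1 al lam T - ceven1 al lam T * sodd al lam T)); [ring|rewrite W; ring].
Qed.

(** * The decaying solution *)

Lemma first_nonpos (f : R -> R) a b : a <= b -> (forall x, a <= x <= b -> continuous f x) ->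
  0 < f a -> f b <= 0 -> exists c, a < c <= b /\ f c <= 0 /\ forall x, a <= x < c -> 0 < f x.
Proof.
intros ab Hc Ha Hb.
set (S := fun x => a <= x <= b /\ forall y, a <= y <= x -> 0 < f y).
destruct (completeness S) as [c [Hub Hlub]].
{ exists b; intros x [Hx _]; lra. }
{ exists a; split; [lra|]; intros y Hy; now replace y with a by lra. }
assert (ac : a <= c) by (apply Hub; split; [lra|]; intros y Hy; now replace y with a by lra).
assert (cb : c <= b) by (apply Hlub; intros x [Hx _]; lra).
assert (Hlt : forall x, a <= x < c -> 0 < f x).
{ intros x Hx; destruct (Rlt_dec 0 (f x)) as [|Hn]; auto; exfalso.
  assert (c <= x); [|lra]. apply Hlub; intros z [Hz Hz2].
  destruct (Rle_dec z x); auto; exfalso; apply Hn, Hz2; lra. }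
assert (Hfc : f c <= 0).
{ destruct (Rle_dec (f c) 0) as [|Hn]; auto; exfalso.
  assert (fc : 0 < f c) by lra.
  destruct (Req_dec c b) as [->|ne]; [contradiction|].
  destruct (proj1 (filterlim_locally _ _) (Hc c (conj ac cb)) (mkposreal (f c) fc)) as [d Hd].
  set (e := Rmin (d / 2) (b - c)).
  assert (He : 0 < e) by (apply Rmin_pos; [pose proof (cond_pos d)|]; lra).
  assert (c + e <= c); [|lra].
  apply Hub; split; [pose proof (Rmin_r (d / 2) (b - c)); fold e in H; lra|].
  intros y Hy; destruct (Rlt_dec y c); [apply Hlt; lra|].
  assert (B : ball (f c) (f c) (f y)).
  { apply (Hd y); unfold ball; simpl; unfold AbsRing_ball, abs, minus, plus, opp; simpl.
    pose proof (Rmin_l (d / 2) (b - c)); pose proof (cond_pos d).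
    rewrite Rabs_right; unfold e in *; lra. }
  unfold ball in B; simpl in B; unfold AbsRing_ball, abs, minus, plus, opp in B; simpl in B.
  apply Rabs_def2 in B; lra. }
exists c; repeat split; auto. destruct (Req_dec a c); [subst; lra|lra].
Qed.

(** Start of the forbidden region. The lower bound 1 makes solutions convex away from zero; the
    growth of t^2 is what gives decay faster than every exponential. *)
Definition adm (al lam T : R) : Prop := 0 <= T /\ forall t, T <= t -> 1 + t ^ 2 <= Qp al lam t.

Lemma adm_exists al lam : adm al lam (3 + Rabs al + Rabs lam).
Proof.
pose proof (Rabs_pos al); pose proof (Rabs_pos lam).
split; [lra|]; intros t Ht; unfold Qp, qM.
pose proof (Rle_abs al); pose proof (Rle_abs lam).
assert (t + 1 + Rabs lam <= t ^ 2 / 2 - al).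
{ assert (0 <= (t - 2) ^ 2) by apply pow2_ge_0. nra. }
nra.
Qed.

Lemma adm_mono al lam T T' : adm al lam T -> T <= T' -> adm al lam T'.
Proof. intros [H0 H] HT; split; [lra|]; intros t Ht; apply H; lra. Qed.

Lemma sol_mult_derive al lam u u1 t : sol al lam u u1 ->
  is_derive (fun t => u t * u1 t) t (u1 t ^ 2 + Qp al lam t * u t ^ 2).
Proof.
intros [U1 U2].
replace (u1 t ^ 2 + Qp al lam t * u t ^ 2) with (u1 t * u1 t + u t * (Qp al lam t * u t)) by ring.
apply (is_derive_mult u u1); auto; intros; apply Rmult_comm.
Qed.

Lemma sol_sq_derive (u u1 : R -> R) t : is_derive u t (u1 t) ->
  is_derive (fun t => u t ^ 2) t (2 * (u t * u1 t)).
Proof.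
intros H. apply is_derive_ext with (fun t => u t * u t); [intros; simpl; ring|].
replace (2 * (u t * u1 t)) with (u1 t * u t + u t * u1 t) by ring.
apply (is_derive_mult u u); auto; intros; apply Rmult_comm.
Qed.

Section Decay.
Variables al lam T : R.
Hypothesis HT : adm al lam T.
Let Q := Qp al lam.

Lemma Qge1 t : T <= t -> 1 <= Q t.
Proof. intros H; pose proof (proj2 HT t H); pose proof (pow2_ge_0 t); unfold Q; lra. Qed.

Lemma grow1 u u1 : sol al lam u u1 -> u T = 1 -> u1 T = 0 -> forall t, T <= t -> 0 < u t.
Proof.
intros U H0 H1 t Ht; destruct (Rlt_dec 0 (u t)) as [|Hn]; auto; exfalso.
destruct (first_nonpos u T t) as [c [Hc [Hc1 Hc2]]]; try lra.
{ intros; apply (sol_cont al lam u u1 U). }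
assert (D1 : forall x, T <= x < c -> 0 <= u1 x).
{ intros x Hx; rewrite <- H1; apply (incr_of_derive u1 (fun t => Q t * u t)); [lra| |].
  - intros; apply U.
  - intros y Hy; apply Rmult_le_pos; [pose proof (Qge1 y); lra|]; left; apply Hc2; lra. }
assert (u T <= u c); [|lra].
apply (incr_of_derive_open u u1); [lra| | |].
- intros; apply (sol_cont al lam u u1 U).
- intros; apply U.
- intros; apply D1; lra.
Qed.

Lemma grow2 u u1 : sol al lam u u1 -> u T = 0 -> u1 T = 1 ->
  forall t, T <= t -> 1 <= u1 t /\ t - T <= u t.
Proof.
intros U H0 H1.
assert (P : forall t, T <= t -> 0 < u1 t).
{ intros t Ht; destruct (Rlt_dec 0 (u1 t)) as [|Hn]; auto; exfalso.
  destruct (first_nonpos u1 T t) as [c [Hc [Hc1 Hc2]]]; try lra.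
  { intros; apply (sol_cont al lam u u1 U). }
  assert (D1 : forall x, T <= x < c -> 0 <= u x).
  { intros x Hx; rewrite <- H0; apply (incr_of_derive u u1); [lra| |].
    - intros; apply U.
    - intros y Hy; left; apply Hc2; lra. }
  assert (u1 T <= u1 c); [|lra].
  apply (incr_of_derive_open u1 (fun t => Q t * u t)); [lra| | |].
  - intros; apply (sol_cont al lam u u1 U).
  - intros; apply U.
  - intros x Hx; apply Rmult_le_pos; [pose proof (Qge1 x); lra|]; apply D1; lra. }
assert (P0 : forall t, T <= t -> 0 <= u t).
{ intros t Ht; rewrite <- H0; apply (incr_of_derive u u1); [lra| |].
  - intros; apply U.
  - intros y Hy; left; apply P; lra. }
assert (P1 : forall t, T <= t -> 1 <= u1 t).
{ intros t Ht; rewrite <- H1; apply (incr_of_derive u1 (fun t => Q t * u t)); [lra| |].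
  - intros; apply U.
  - intros y Hy; apply Rmult_le_pos; [pose proof (Qge1 y); lra|]; apply P0; lra. }
intros t Ht; split; auto.
assert (u T - T <= u t - t); [|lra].
apply (incr_of_derive (fun t => u t - t) (fun t => u1 t - 1)); [lra| |].
- intros x Hx; apply (is_derive_minus u (fun t => t)); [apply U|apply (is_derive_id x)].
- intros x Hx; pose proof (P1 x); lra.
Qed.

(** For growing solutions f, g with Wronskian 1, f/g decreases to a limit L, and the decaying
    solution is f - L g. It is the limit of the solutions f - (f(N)/g(N)) g that vanish at N. *)
Lemma decay_sol_bounded : exists D D1, sol al lam D D1 /\ D T = 1 /\
  forall t, T <= t -> 0 <= D t <= 1.
Proof.
destruct (sol_cauchy al lam T 1 0) as [f [f1 [Hf [f0 f10]]]].
destruct (sol_cauchy al lam T 0 1) as [g [g1 [Hg [g0 g10]]]].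
assert (fp := grow1 f f1 Hf f0 f10). assert (gp := grow2 g g1 Hg g0 g10).
assert (W : forall t, f t * g1 t - f1 t * g t = 1).
{ intros t; rewrite (wronskian_const al lam _ _ _ _ t T Hf Hg), f0, f10, g0, g10; ring. }
assert (dec : forall s t, T < s -> s <= t -> f t / g t <= f s / g s).
{ intros s t Hs Hst.
  assert (- (f s / g s) <= - (f t / g t)); [|lra].
  apply (incr_of_derive (fun t => - (f t / g t)) (fun t => 1 / g t ^ 2)); auto.
  - intros x Hx; destruct (gp x) as [_ gx]; [lra|].
    replace (1 / g x ^ 2) with (opp ((f1 x * g x - f x * g1 x) / g x ^ 2)).
    2:{ unfold opp; simpl; replace (f1 x * g x - f x * g1 x) with (- (1)) by (rewrite <- (W x); ring). field; lra. }
    apply (is_derive_opp (fun t => f t / g t)).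
    apply (is_derive_div f g); [apply Hf|apply Hg|lra].
  - intros x Hx; destruct (gp x) as [_ gx]; [lra|].
    apply Rdiv_le_0_compat; [lra|apply pow_lt; lra]. }
set (N := fun n => T + 1 + INR n).
assert (NT : forall n, T < N n) by (intros n; unfold N; pose proof (pos_INR n); lra).
assert (gN : forall n, 0 < g (N n)) by (intros n; destruct (gp (N n)); pose proof (NT n); lra).
destruct (ex_finite_lim_seq_decr (fun n => f (N n) / g (N n)) 0) as [L HL].
{ intros n; apply dec; auto; unfold N; rewrite S_INR; lra. }
{ intros n; apply Rdiv_le_0_compat; auto; left; apply fp; pose proof (NT n); lra. }
assert (Lle : forall n, L <= f (N n) / g (N n)).
{ intros n; apply (is_lim_seq_decr_compare (fun n => f (N n) / g (N n))); auto.
  intros m; apply dec; auto; unfold N; rewrite S_INR; lra. }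
exists (fun t => 1 * f t + (- L) * g t), (fun t => 1 * f1 t + (- L) * g1 t).
split; [now apply sol_lin|]; split; [rewrite f0, g0; ring|].
(* For the approximant vanishing at [N n], the product of the function and its derivative increases
   up to 0, so its square decreases from the value 1 at [T]. *)
assert (Dn : forall n t, T <= t <= N n -> (1 * f t + (- (f (N n) / g (N n))) * g t) ^ 2 <= 1).
{ intros n t Ht; set (l := - (f (N n) / g (N n))).
  assert (S0 := sol_lin al lam 1 l f f1 g g1 Hf Hg).
  assert (Z : 1 * f (N n) + l * g (N n) = 0) by (unfold l; field; pose proof (gN n); lra).
  assert (S1 : forall x, T <= x <= N n -> (1 * f x + l * g x) * (1 * f1 x + l * g1 x) <= 0).
  { intros x Hx.
    replace 0 with ((1 * f (N n) + l * g (N n)) * (1 * f1 (N n) + l * g1 (N n))) by (rewrite Z; ring).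
    apply (incr_of_derive (fun x => (1 * f x + l * g x) * (1 * f1 x + l * g1 x)) (fun x => (1 * f1 x + l * g1 x) ^ 2 + Q x * (1 * f x + l * g x) ^ 2)); [lra| |].
    - intros y Hy; exact (sol_mult_derive al lam _ _ y S0).
    - intros y Hy; assert (1 <= Q y) by (apply Qge1; lra).
      pose proof (pow2_ge_0 (1 * f1 y + l * g1 y)); pose proof (pow2_ge_0 (1 * f y + l * g y)); nra. }
  replace 1 with ((1 * f T + l * g T) ^ 2) at 2 by (rewrite f0, g0; ring).
  cut (- (1 * f T + l * g T) ^ 2 <= - (1 * f t + l * g t) ^ 2); [lra|].
  apply (incr_of_derive (fun t => - (1 * f t + l * g t) ^ 2) (fun t => - (2 * ((1 * f t + l * g t) * (1 * f1 t + l * g1 t))))); [lra| |].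
  - intros x Hx; apply (is_derive_opp (fun t => (1 * f t + l * g t) ^ 2)).
    apply (sol_sq_derive (fun t => 1 * f t + l * g t) (fun t => 1 * f1 t + l * g1 t)), S0.
  - intros x Hx; specialize (S1 x); lra. }
intros t Ht.
assert (H0 : 0 <= 1 * f t + - L * g t).
{ destruct (Req_dec t T) as [->|ne]; [rewrite f0, g0; lra|].
  assert (gt : 0 < g t) by (destruct (gp t); lra).
  destruct (INR_unbounded (t - T)) as [n Hn].
  assert (A := dec t (N n) ltac:(lra) ltac:(unfold N; lra)); pose proof (Lle n).
  assert (L * g t <= f t); [|lra].
  replace (f t) with (f t / g t * g t) by (field; lra).
  apply Rmult_le_compat_r; lra. }
split; auto.
assert (H2 : (1 * f t + - L * g t) ^ 2 <= 1); [|nra].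
assert (lim : is_lim_seq (fun n => (1 * f t + - (f (N n) / g (N n)) * g t) ^ 2) ((1 * f t + - L * g t) ^ 2)).
{ simpl. assert (K : is_lim_seq (fun n => 1 * f t + - (f (N n) / g (N n)) * g t) (1 * f t + - L * g t)).
  { apply is_lim_seq_plus'; [apply is_lim_seq_const|].
    apply is_lim_seq_mult'; [|apply is_lim_seq_const].
    now apply (is_lim_seq_opp _ L). }
  apply is_lim_seq_mult'; auto. apply is_lim_seq_mult'; auto. apply is_lim_seq_const. }
apply (is_lim_seq_le_loc _ (fun _ => 1) _ 1) in lim; auto; [|apply is_lim_seq_const].
destruct (INR_unbounded (t - T)) as [n0 Hn0]; exists n0; intros n Hn.
apply Dn; apply le_INR in Hn; unfold N; lra.
Qed.

(** If D' were positive once, convexity would make D unbounded. If D' + k D were positive at t0 >=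
    k, then, since (D' + k D) exp(-k t) is nondecreasing there, D' + k D would stay above a
    constant; then D is bounded below, D'' too, and D' would become positive. *)
Lemma bounded_decay D D1 : sol al lam D D1 -> (forall t, T <= t -> 0 <= D t <= 1) ->
  (forall t, T <= t -> D1 t <= 0) /\
  forall k S, 1 <= k -> T <= S -> k <= S -> forall t, S <= t -> D1 t <= - k * D t.
Proof.
intros HD B.
assert (neg : forall t, T <= t -> D1 t <= 0).
{ intros t0 Ht0; destruct (Rle_dec (D1 t0) 0) as [|Hn]; auto; exfalso.
  set (m := D1 t0) in *.
  assert (D1m : forall t, t0 <= t -> m <= D1 t).
  { intros t Ht; apply (incr_of_derive D1 (fun t => Q t * D t)); [lra| |].
    - intros; apply HD.
    - intros x Hx; assert (1 <= Q x) by (apply Qge1; lra); destruct (B x); [lra|]; apply Rmult_le_pos; lra. }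
  assert (D t0 - m * t0 <= D (t0 + 2 / m) - m * (t0 + 2 / m)).
  { assert (0 < 2 / m) by (apply Rdiv_lt_0_compat; lra).
    apply (incr_of_derive (fun t => D t - m * t) (fun t => D1 t - m)); [lra| |].
    - intros x Hx; apply (is_derive_minus D (fun t => m * t)); [apply HD|].
      auto_derive; auto; ring.
    - intros x Hx; specialize (D1m x); lra. }
  assert (0 < 2 / m) by (apply Rdiv_lt_0_compat; lra).
  assert (E : m * (2 / m) = 2) by (field; lra).
  destruct (B t0 Ht0); destruct (B (t0 + 2 / m)); [lra|]. nra. }
split; auto.
intros k S k1 HS kS t0 Ht0.
destruct (Rle_dec (D1 t0) (- k * D t0)) as [|Hn]; auto; exfalso.
set (m0 := (D1 t0 + k * D t0)) in *.
assert (m0p : 0 < m0) by (unfold m0; lra).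
assert (Qk : forall t, t0 <= t -> k ^ 2 <= Q t).
{ intros t Ht; pose proof (proj2 HT t ltac:(lra)); unfold Q. assert (k ^ 2 <= t ^ 2) by (apply pow_incr; lra). lra. }
assert (P : forall t, t0 <= t -> m0 <= D1 t + k * D t).
{ intros t Ht.
  assert (m0 * exp (- (k * (t0 - t0))) <= (D1 t + k * D t) * exp (- (k * (t - t0)))).
  { apply (incr_of_derive (fun t => (D1 t + k * D t) * exp (- (k * (t - t0))))
      (fun t => (Q t * D t + k * D1 t) * exp (- (k * (t - t0))) + (D1 t + k * D t) * (- k * exp (- (k * (t - t0)))))); auto.
    - intros x Hx; apply (is_derive_mult (fun t => D1 t + k * D t) (fun t => exp (- (k * (t - t0))))).
      + apply (is_derive_plus D1 (fun t => k * D t)); [apply HD|apply is_derive_scal, HD].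
      + auto_derive; auto; unfold Rminus; ring.
      + intros; apply Rmult_comm.
    - intros x Hx.
      replace ((Q x * D x + k * D1 x) * exp (- (k * (x - t0))) + (D1 x + k * D x) * (- k * exp (- (k * (x - t0)))))
       with ((Q x - k ^ 2) * D x * exp (- (k * (x - t0)))) by ring.
      apply Rmult_le_pos; [|left; apply exp_pos].
      apply Rmult_le_pos; [pose proof (Qk x ltac:(lra)); lra|apply B; lra]. }
  replace (k * (t0 - t0)) with 0 in H by ring; rewrite Ropp_0, exp_0, Rmult_1_r in H.
  assert (exp (- (k * (t - t0))) <= 1).
  { rewrite <- exp_0; apply exp_mono. assert (0 <= k * (t - t0)) by (apply Rmult_le_pos; lra); lra. }
  pose proof (exp_pos (- (k * (t - t0)))). nra. }
assert (kD : forall t, t0 <= t -> m0 <= k * D t).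
{ intros t Ht; specialize (P t Ht); pose proof (neg t ltac:(lra)); lra. }
assert (G : forall t, t0 <= t -> D1 t0 - (m0 / k) * t0 <= D1 t - (m0 / k) * t).
{ intros t Ht; apply (incr_of_derive (fun t => D1 t - m0 / k * t) (fun t => Q t * D t - m0 / k)); auto.
  - intros x Hx; apply (is_derive_minus D1 (fun t => m0 / k * t)); [apply HD|]. auto_derive; auto; ring.
  - intros x Hx. assert (m0 / k <= D x).
    { apply Rmult_le_reg_l with k; [lra|]; replace (k * (m0 / k)) with m0 by (field; lra); apply kD; lra. }
    assert (1 <= Q x) by (apply Qge1; lra). destruct (B x); [lra|]. nra. }
assert (mk : 0 < m0 / k) by (apply Rdiv_lt_0_compat; lra).
assert (0 < (1 - D1 t0) / (m0 / k)) by (apply Rdiv_lt_0_compat; auto; pose proof (neg t0 ltac:(lra)); lra).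
specialize (G (t0 + (1 - D1 t0) / (m0 / k)) ltac:(lra)).
assert (E : m0 / k * ((1 - D1 t0) / (m0 / k)) = 1 - D1 t0) by (field; lra).
pose proof (neg (t0 + (1 - D1 t0) / (m0 / k)) ltac:(lra)). nra.
Qed.

Lemma fast_of_tail f : cont0 f ->
  (forall k, 1 <= k -> exists S C, forall t, S <= t -> Rabs (f t) <= C * exp (- (k * t))) -> fast f.
Proof.
intros Hc H; split; auto; intros k0.
set (k := Rmax 1 k0).
destruct (H k (Rmax_l _ _)) as [S [C HS]].
destruct (continuity_ab_maj (fun t => Rabs (f t) * exp (k * t)) 0 (Rmax 0 S) (Rmax_l _ _)) as [m [Hm Hm1]].
{ intros c Hcc; apply continuity_pt_filterlim.
  apply (continuous_mult (fun t => Rabs (f t)) (fun t => exp (k * t))).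
  - apply (continuous_comp f Rabs); [apply Hc; lra|apply continuous_Rabs].
  - apply (ex_derive_continuous (fun t => exp (k * t))); auto_derive; auto. }
set (M := Rabs (f m) * exp (k * m)).
exists (Rmax C M); intros t Ht.
assert (E1 : exp (- (k * t)) <= exp (- (k0 * t))).
{ apply exp_mono. assert (k0 * t <= k * t) by (apply Rmult_le_compat_r; auto; apply Rmax_r); lra. }
assert (M0 : 0 <= M) by (apply Rmult_le_pos; [apply Rabs_pos|left; apply exp_pos]).
assert (E2 : 0 < exp (- (k * t))) by apply exp_pos.
assert (E3 : Rabs (f t) <= Rmax C M * exp (- (k * t))).
{ destruct (Rle_dec t (Rmax 0 S)).
  - specialize (Hm t (conj Ht r)); fold M in Hm; cbv beta in Hm.
    assert (E4 : exp (k * t) * exp (- (k * t)) = 1) by (rewrite <- exp_plus, Rplus_opp_r; apply exp_0).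
    apply Rle_trans with (M * exp (- (k * t))).
    + replace (Rabs (f t)) with (Rabs (f t) * exp (k * t) * exp (- (k * t))) by (rewrite Rmult_assoc, E4; ring).
      apply Rmult_le_compat_r; lra.
    + apply Rmult_le_compat_r; [lra|apply Rmax_r].
  - eapply Rle_trans; [apply HS|].
    + pose proof (Rmax_r 0 S); lra.
    + apply Rmult_le_compat_r; [lra|apply Rmax_l]. }
eapply Rle_trans; [exact E3|]. apply Rmult_le_compat_l; auto.
apply Rle_trans with M; auto; apply Rmax_r.
Qed.

Lemma decay_exists : exists D D1, sol al lam D D1 /\ fast D /\ fast D1 /\ D T = 1.
Proof.
destruct decay_sol_bounded as [D [D1 [HD [D0 B]]]].
destruct (bounded_decay D D1 HD B) as [neg dec].
exists D, D1; split; auto.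
assert (exb : forall k, 1 <= k -> exists S, T <= S /\ forall t, S <= t -> D t <= exp (k * S) * exp (- (k * t))).
{ intros k k1; set (S := Rmax T k); exists S; split; [apply Rmax_l|].
  assert (TS : T <= S) by apply Rmax_l; assert (kS : k <= S) by apply Rmax_r.
  intros t Ht.
  assert (G : - (D S * exp (k * S)) <= - (D t * exp (k * t))).
  { apply (incr_of_derive (fun t => - (D t * exp (k * t))) (fun t => - (D1 t * exp (k * t) + D t * (k * exp (k * t))))); auto.
    - intros x Hx; apply (is_derive_opp (fun t => D t * exp (k * t))).
      apply (is_derive_mult D (fun t => exp (k * t))); [apply HD| |intros; apply Rmult_comm].
      auto_derive; auto; ring.
    - intros x Hx; pose proof (dec k S k1 TS kS x ltac:(lra)). pose proof (exp_pos (k * x)). nra. }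
  assert (D S * exp (k * S) <= exp (k * S)).
  { destruct (B S TS); pose proof (exp_pos (k * S)); nra. }
  assert (E4 : exp (k * t) * exp (- (k * t)) = 1) by (rewrite <- exp_plus, Rplus_opp_r; apply exp_0).
  replace (D t) with (D t * exp (k * t) * exp (- (k * t))) by (rewrite Rmult_assoc, E4; ring).
  apply Rmult_le_compat_r; [left; apply exp_pos|lra]. }
split; [|split]; auto.
- apply fast_of_tail; [intros t _; apply (sol_cont al lam D D1 HD)|].
  intros k k1; destruct (exb k k1) as [S [TS HS]]; exists S, (exp (k * S)); intros t Ht.
  rewrite Rabs_right by (apply Rle_ge; apply B; lra); auto.
- apply fast_of_tail; [intros t _; apply (sol_cont al lam D D1 HD)|].
  intros k k1; destruct (exb k k1) as [S [TS HS]]; exists (S + 1), (exp k * exp (k * S)); intros t Ht.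
  rewrite Rabs_left1 by (apply neg; lra).
  (* [D] is convex beyond [T], so |D'(t)| <= D(t-1) - D(t): the derivative inherits the decay of
     [D]. *)
  apply Rle_trans with (D (t - 1)).
  + assert (D t - D1 t * t <= D (t - 1) - D1 t * (t - 1)).
    { assert (- (D (t - 1) - D1 t * (t - 1)) <= - (D t - D1 t * t)); [|lra].
      apply (incr_of_derive (fun x => - (D x - D1 t * x)) (fun x => - (D1 x - D1 t))); [lra| |].
      - intros x Hx; apply (is_derive_opp (fun x => D x - D1 t * x)).
        apply (is_derive_minus D (fun x => D1 t * x)); [apply HD|auto_derive; auto; ring].
      - intros x Hx. assert (D1 x <= D1 t); [|lra].
        apply (incr_of_derive D1 (fun t => Q t * D t)); [lra| |].
        + intros; apply HD.
        + intros y Hy; assert (1 <= Q y) by (apply Qge1; lra); destruct (B y); [lra|]; apply Rmult_le_pos; lra. }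
    destruct (B t); [lra|]; lra.
  + eapply Rle_trans; [apply HS; lra|].
    replace (- (k * (t - 1))) with (k + - (k * t)) by ring; rewrite exp_plus; lra.
Qed.

Lemma le_of_fast F c t0 : 0 <= t0 -> fast F -> (forall t, t0 <= t -> c <= F t) -> c <= 0.
Proof.
intros Ht HF H; destruct (fast_exp1 F HF) as [C HC].
apply (is_lim_seq_le_loc (fun _ => c) (fun n => F (INR n)) c 0).
- destruct (INR_unbounded t0) as [N HN]; exists N; intros n Hn; apply H; apply le_INR in Hn; lra.
- apply is_lim_seq_const.
- now apply fast_lim0 with C 0.
Qed.

(** The product u u' is nondecreasing and tends to 0, hence is <= 0. If it vanished at one point it
    would vanish from there on, together with its derivative u'^2 + Q u^2, and u would be zero. *)
Lemma fast_sol_neg u u1 : sol al lam u u1 -> fast u -> fast u1 -> (exists t, u t <> 0) ->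
  forall t, T <= t -> u t * u1 t < 0.
Proof.
intros U Hu Hu1 [z Hz].
assert (inc : forall s t, T <= s -> s <= t -> u s * u1 s <= u t * u1 t).
{ intros s t Hs Hst.
  apply (incr_of_derive (fun t => u t * u1 t) (fun t => u1 t ^ 2 + Q t * u t ^ 2)); auto.
  - intros; now apply sol_mult_derive.
  - intros x Hx; assert (1 <= Q x) by (apply Qge1; lra).
    pose proof (pow2_ge_0 (u1 x)); pose proof (pow2_ge_0 (u x)); nra. }
assert (H0 : 0 <= T) by apply HT.
assert (le0 : forall t, T <= t -> u t * u1 t <= 0).
{ intros t Ht; apply le_of_fast with (fun t => u t * u1 t) t; [lra|sf|].
  intros s Hs; apply inc; lra. }
intros t Ht; destruct (le0 t Ht) as [|E]; auto; exfalso.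
assert (Z : forall s, t <= s -> u s * u1 s = 0).
{ intros s Hs; apply Rle_antisym; [apply le0; lra|]; rewrite <- E; apply inc; lra. }
assert (D0 : is_derive (fun s => u s * u1 s) (t + 1) 0).
{ apply is_derive_ext_loc with (fun _ => 0); [|apply (is_derive_const 0)].
  exists (mkposreal 1 Rlt_0_1); intros y Hy; symmetry; apply Z.
  unfold ball in Hy; simpl in Hy; unfold AbsRing_ball, abs, minus, plus, opp in Hy; simpl in Hy.
  apply Rabs_def2 in Hy; lra. }
apply is_derive_unique in D0.
rewrite (is_derive_unique _ _ _ (sol_mult_derive al lam u u1 (t + 1) U)) in D0.
assert (1 <= Qp al lam (t + 1)) by (apply Qge1; lra).
pose proof (pow2_ge_0 (u (t + 1))); pose proof (pow2_ge_0 (u1 (t + 1))).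
assert (u (t + 1) ^ 2 = 0) by nra. assert (u1 (t + 1) ^ 2 = 0) by nra.
apply Hz. apply (sol_zero al lam u u1 (t + 1)); auto.
- now apply Rsqr_0_uniq; rewrite Rsqr_pow2.
- now apply Rsqr_0_uniq; rewrite Rsqr_pow2.
Qed.
End Decay.

(** * The Prüfer angle *)

(** Backward Gronwall: as long as f > 0, f exp(-K t) is nonincreasing, so moving to the left f
    cannot reach 0. Comparisons of angles made near infinity are carried to 0 in this way. *)
Lemma pos_back (f f1 : R -> R) a b K : a <= b -> (forall t, a <= t <= b -> is_derive f t (f1 t)) ->
  (forall t, a <= t <= b -> f1 t <= K * Rabs (f t)) -> 0 < f b -> 0 < f a.
Proof.
intros ab Hd HK Hb; destruct (Rlt_dec 0 (f a)) as [|Hn]; auto; exfalso.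
destruct (first_nonpos (fun s => f (- s)) (- b) (- a)) as [c [Hc [Hc1 Hc2]]]; try lra.
{ intros x Hx; apply (continuous_comp Ropp f).
  - apply (ex_derive_continuous (fun x => - x)); auto_derive; auto.
  - apply (is_derive_cont f (- x) (f1 (- x))), Hd; lra. }
{ now rewrite Ropp_involutive. }
{ rewrite Ropp_involutive; lra. }
assert (P : forall x, - c < x <= b -> 0 < f x).
{ intros x Hx; specialize (Hc2 (- x)); rewrite Ropp_involutive in Hc2; apply Hc2; lra. }
assert (Hder : forall x, a <= x <= b -> is_derive (fun t => - (f t * exp (- (K * t)))) x
   (- (f1 x * exp (- (K * x)) + f x * (- K * exp (- (K * x)))))).
{ intros x Hx; apply (is_derive_opp (fun t => f t * exp (- (K * t)))).
  apply (is_derive_mult f (fun t => exp (- (K * t)))); [apply Hd; lra| |intros; apply Rmult_comm].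
  auto_derive; auto; ring. }
assert (- (f (- c) * exp (- (K * - c))) <= - (f b * exp (- (K * b)))).
{ apply (incr_of_derive_open (fun t => - (f t * exp (- (K * t))))
   (fun x => - (f1 x * exp (- (K * x)) + f x * (- K * exp (- (K * x)))))).
  - lra.
  - intros x Hx; eapply is_derive_cont, Hder; lra.
  - intros x Hx; apply Hder; lra.
  - intros x Hx; pose proof (exp_pos (- (K * x))).
    assert (F := HK x ltac:(lra)); rewrite Rabs_right in F by (left; apply P; lra).
    nra. }
pose proof (exp_pos (- (K * - c))); pose proof (exp_pos (- (K * b))).
assert (0 < f b * exp (- (K * b))) by (apply Rmult_lt_0_compat; auto).
nra.
Qed.

Lemma sin2_diff a b : sin a ^ 2 - sin b ^ 2 = sin (a - b) * sin (a + b).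
Proof.
rewrite sin_minus, sin_plus.
assert (A := sin2_cos2 a); assert (B := sin2_cos2 b); unfold Rsqr in A, B.
replace (sin a ^ 2 - sin b ^ 2) with (sin a ^ 2 * (sin b * sin b + cos b * cos b) - sin b ^ 2 * (sin a * sin a + cos a * cos a))
  by (rewrite A, B; ring). ring.
Qed.

Lemma sin_abs_le x : Rabs (sin x) <= Rabs x.
Proof.
assert (P : forall x, 0 <= x -> Rabs (sin x) <= x).
{ intros y Hy; apply Rabs_le; destruct (SIN_bound y) as [S1 S2].
  destruct (Rle_dec y 1).
  - assert (0 <= sin y) by (apply sin_ge_0; pose proof PI2_1; lra).
    destruct (Req_dec y 0) as [->|]; [rewrite sin_0; lra|].
    pose proof (sin_lt_x y); lra.
  - lra. }
destruct (Rle_dec 0 x) as [H|H].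
- rewrite (Rabs_right x) by lra; auto.
- rewrite (Rabs_left1 x) by lra; rewrite <- (Rabs_Ropp (sin x)), <- sin_neg; apply P; lra.
Qed.

Lemma sin2_lip a b : Rabs (sin a ^ 2 - sin b ^ 2) <= Rabs (a - b).
Proof.
rewrite sin2_diff, Rabs_mult.
pose proof (sin_abs_le (a - b)); pose proof (Rabs_pos (sin (a - b))).
assert (Rabs (sin (a + b)) <= 1) by (apply Rabs_le, SIN_bound).
pose proof (Rabs_pos (sin (a + b))); nra.
Qed.

Lemma sin2_gap a b c : 0 < a < PI / 2 -> 0 < b < PI / 2 -> 0 < c -> c <= a - b ->
  sin c ^ 2 <= sin a ^ 2 - sin b ^ 2.
Proof.
intros Ha Hb Hc Hab; rewrite sin2_diff; pose proof PI_RGT_0.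
assert (0 < sin c) by (apply sin_gt_0; lra).
assert (sin c <= sin (a - b)) by (apply sin_incr_1; lra).
assert (sin c <= sin (a + b)).
{ destruct (Rle_dec (a + b) (PI / 2)); [apply sin_incr_1; lra|].
  rewrite <- (sin_PI_x (a + b)); apply sin_incr_1; lra. }
nra.
Qed.

Lemma sin2_cos2_pow x : sin x ^ 2 + cos x ^ 2 = 1.
Proof. pose proof (sin2_cos2 x); unfold Rsqr in *; lra. Qed.

(* Prüfer angle of a decaying solution D = r sin psi, D' = - r cos psi. *)
Definition prufer (al lam : R) (psi : R -> R) : Prop :=
  (forall t, is_derive psi t (Qp al lam t * sin (psi t) ^ 2 - cos (psi t) ^ 2)) /\
  (forall T, adm al lam T -> forall t, T <= t -> 0 < psi t < PI / 2).

Lemma Qp_cont al lam t : continuous (Qp al lam) t.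
Proof. apply (ex_derive_continuous (Qp al lam)); unfold Qp, qM; auto_derive; auto. Qed.

Lemma ivt_between (f : R -> R) a b y : (forall t, continuous f t) -> f a <= y <= f b \/ f b <= y <= f a ->
  exists t, Rmin a b <= t <= Rmax a b /\ f t = y.
Proof.
intros Hc Hy.
destruct (IVT_gen f a b y) as [t Ht]; [intros t; apply continuity_pt_filterlim, Hc| |exists t; auto].
destruct Hy; [rewrite Rmin_left, Rmax_right|rewrite Rmin_right, Rmax_left]; lra.
Qed.

(** The angle is obtained by integrating its own derivative from an arctangent at [T0], which avoids
    lifting a curve on the circle; that it is the polar angle of (D, -D') is proved afterwards. *)
Lemma prufer_exists al lam : exists psi D D1, prufer al lam psi /\ sol al lam D D1 /\ fast D /\ fast D1 /\
  (exists t, D t <> 0) /\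
  forall t, exists r, 0 < r /\ D t = r * sin (psi t) /\ D1 t = - r * cos (psi t).
Proof.
set (T0 := 3 + Rabs al + Rabs lam).
assert (HT := adm_exists al lam); fold T0 in HT.
destruct (decay_exists al lam T0 HT) as [D [D1 [HD [FD [FD1 D0]]]]].
assert (nz : exists t, D t <> 0) by (exists T0; lra).
assert (neg := fun T H => fast_sol_neg al lam T H D D1 HD FD FD1 nz).
assert (r2 : forall t, 0 < D t ^ 2 + D1 t ^ 2).
{ intros t; destruct (Req_dec (D t) 0) as [E|E].
  - destruct (Req_dec (D1 t) 0) as [E1|E1].
    + exfalso; destruct nz as [z Hz]; apply Hz; apply (sol_zero al lam D D1 t); auto.
    + assert (0 < D1 t ^ 2) by (apply pow2_gt_0; auto); pose proof (pow2_ge_0 (D t)); lra.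
  - assert (0 < D t ^ 2) by (apply pow2_gt_0; auto); pose proof (pow2_ge_0 (D1 t)); lra. }
destruct (sol_cont al lam D D1 HD) as [cD cD1].
set (w := fun t => (Qp al lam t * D t ^ 2 - D1 t ^ 2) / (D t ^ 2 + D1 t ^ 2)).
assert (Dd : forall t, ex_derive D t) by (intros t; eexists; apply HD).
assert (Dd1 : forall t, ex_derive D1 t) by (intros t; eexists; apply HD).
assert (cw : forall t, continuous w t).
{ intros t; apply (ex_derive_continuous w); unfold w, Qp, qM; auto_derive.
  repeat split; auto. specialize (r2 t); simpl in r2; lra. }
set (a := D T0 / (- D1 T0)).
assert (D1n : D1 T0 < 0) by (specialize (neg T0 HT T0 (Rle_refl _)); rewrite D0 in neg; lra).
assert (apos : 0 < a) by (unfold a; rewrite D0; apply Rdiv_lt_0_compat; lra).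
set (psi := fun t => atan a + RInt w T0 t).
assert (dpsi : forall t, is_derive psi t (w t)).
{ intros t; unfold psi; rewrite <- (Rplus_0_l (w t)).
  apply (is_derive_plus (fun _ => atan a) (RInt w T0)); [apply (is_derive_const (atan a))|].
  apply (is_derive_RInt w (RInt w T0) T0 t); auto.
  exists (mkposreal 1 Rlt_0_1); intros y _; apply (RInt_correct (V := R_CompleteNormedModule)).
  apply (ex_RInt_continuous (V := R_CompleteNormedModule)); auto. }
assert (psi0 : psi T0 = atan a) by (unfold psi; rewrite RInt_point; unfold zero; simpl; ring).
set (r := fun t => sqrt (D t ^ 2 + D1 t ^ 2)).
assert (rp : forall t, 0 < r t) by (intros t; apply sqrt_lt_R0, r2).
assert (rr : forall t, r t * r t = D t ^ 2 + D1 t ^ 2) by (intros t; apply sqrt_sqrt; left; apply r2).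
assert (dr : forall t, is_derive r t ((D t * D1 t + D1 t * (Qp al lam t * D t)) / r t)).
{ intros t.
  replace ((D t * D1 t + D1 t * (Qp al lam t * D t)) / r t) with
    ((2 * (D t * D1 t) + 2 * (D1 t * (Qp al lam t * D t))) / (2 * r t))
    by (field; specialize (rp t); lra).
  apply (is_derive_comp sqrt (fun t => D t ^ 2 + D1 t ^ 2) t (/ (2 * r t))
    (2 * (D t * D1 t) + 2 * (D1 t * (Qp al lam t * D t)))).
  - apply is_derive_Reals. replace (/ (2 * r t)) with (/ (2 * sqrt (D t ^ 2 + D1 t ^ 2))) by reflexivity.
    apply derivable_pt_lim_sqrt, r2.
  - apply (is_derive_plus (fun t => D t ^ 2) (fun t => D1 t ^ 2)).
    + apply sol_sq_derive, HD.
    + apply (sol_sq_derive D1 (fun t => Qp al lam t * D t)), HD. }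
set (X := fun t => D t / r t). set (Y := fun t => - D1 t / r t).
assert (dX : forall t, is_derive X t (w t * Y t)).
{ intros t. replace (w t * Y t) with
   ((D1 t * r t - D t * ((D t * D1 t + D1 t * (Qp al lam t * D t)) / r t)) / r t ^ 2).
  - apply (is_derive_div D r); [apply HD|apply dr|specialize (rp t); lra].
  - unfold w, Y; rewrite <- rr. specialize (rp t). replace (r t * r t) with (r t ^ 2) by ring.
    transitivity ((D1 t * (r t * r t) - D t * (D t * D1 t + D1 t * (Qp al lam t * D t))) / r t ^ 3); [field; lra|].
    rewrite rr. transitivity ((D1 t ^ 3 - Qp al lam t * D t ^ 2 * D1 t) / r t ^ 3); [|field; lra].
    f_equal; ring. }
assert (dY : forall t, is_derive Y t (- (w t * X t))).
{ intros t. replace (- (w t * X t)) with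
   ((- (Qp al lam t * D t) * r t - - D1 t * ((D t * D1 t + D1 t * (Qp al lam t * D t)) / r t)) / r t ^ 2).
  - apply (is_derive_div (fun t => - D1 t) r); [apply (is_derive_opp D1), HD|apply dr|specialize (rp t); lra].
  - unfold w, X; rewrite <- rr. specialize (rp t). replace (r t * r t) with (r t ^ 2) by ring.
    transitivity ((- (Qp al lam t * D t) * (r t * r t) + D1 t * (D t * D1 t + D1 t * (Qp al lam t * D t))) / r t ^ 3); [field; lra|].
    rewrite rr. transitivity ((D1 t ^ 2 * D t - Qp al lam t * D t ^ 3) / r t ^ 3); [|field; lra].
    f_equal; ring. }
assert (XY : forall t, X t ^ 2 + Y t ^ 2 = 1).
{ intros t; unfold X, Y. specialize (rp t). transitivity ((D t ^ 2 + D1 t ^ 2) / (r t * r t)); [field; lra|].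
  rewrite rr; field. specialize (r2 t); lra. }
(* (X, Y) and (sin psi, cos psi) are unit vectors rotating with the same speed [w]; their scalar
   product is constant, equal to 1 at [T0], so they coincide. *)
assert (one : forall t, X t * sin (psi t) + Y t * cos (psi t) = 1).
{ intros t.
  rewrite (const_of_derive (fun t => X t * sin (psi t) + Y t * cos (psi t))) with (s := t) (t := T0).
  - rewrite psi0.
    assert (ca : 0 < cos (atan a)) by (destruct (atan_bound a); apply cos_gt_0; lra).
    assert (sa : sin (atan a) = a * cos (atan a)).
    { assert (E := tan_atan a); unfold tan in E.
      replace a with (sin (atan a) / cos (atan a)) at 2 by (rewrite E; reflexivity). field; lra. }
    assert (Xa : X T0 = a * Y T0) by (unfold X, Y, a; field; specialize (rp T0); lra).
    assert (Yp : 0 < Y T0) by (unfold Y; apply Rdiv_lt_0_compat; [lra|apply rp]).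
    assert (e1 := sin2_cos2_pow (atan a)); assert (e2 := XY T0); rewrite sa in *; rewrite Xa in *.
    assert (Y T0 = cos (atan a)) by nra.
    rewrite H; nra.
  - intros s.
    replace 0 with ((w s * Y s * sin (psi s) + X s * (w s * cos (psi s))) +
      (- (w s * X s) * cos (psi s) + Y s * (w s * - sin (psi s)))) by ring.
    apply (is_derive_plus (fun t => X t * sin (psi t)) (fun t => Y t * cos (psi t))).
    + apply (is_derive_mult X (fun t => sin (psi t))); auto; [|intros; apply Rmult_comm].
      apply (is_derive_comp sin psi); auto; apply is_derive_sin.
    + apply (is_derive_mult Y (fun t => cos (psi t))); auto; [|intros; apply Rmult_comm].
      apply (is_derive_comp cos psi); auto; apply is_derive_cos. }
assert (eqs : forall t, X t = sin (psi t) /\ Y t = cos (psi t)).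
{ intros t; specialize (one t); specialize (XY t); assert (E := sin2_cos2_pow (psi t)).
  assert (Z : (X t - sin (psi t)) ^ 2 + (Y t - cos (psi t)) ^ 2 = 0) by lra.
  pose proof (pow2_ge_0 (X t - sin (psi t))); pose proof (pow2_ge_0 (Y t - cos (psi t))).
  split; apply Rminus_diag_uniq; apply Rsqr_0_uniq; rewrite Rsqr_pow2; lra. }
assert (pol : forall t, D t = r t * sin (psi t) /\ D1 t = - r t * cos (psi t)).
{ intros t; destruct (eqs t) as [<- <-]; unfold X, Y; specialize (rp t); split; field; lra. }
exists psi, D, D1; split; [split|]; auto.
- intros t.
  replace (Qp al lam t * sin (psi t) ^ 2 - cos (psi t) ^ 2) with (w t); auto.
  destruct (eqs t) as [<- <-]; unfold w, X, Y. specialize (rp t). rewrite <- rr. field; lra.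
(* In the forbidden region D D' < 0, so sin psi and cos psi do not vanish; by the intermediate value
   theorem psi cannot leave the first quadrant, where it starts at [T0]. *)
- intros T HT' t Ht.
  set (m := Rmin T T0).
  assert (Hm : adm al lam m) by (unfold m, Rmin; destruct (Rle_dec T T0); auto).
  assert (nzs : forall s, m <= s -> sin (psi s) <> 0 /\ cos (psi s) <> 0).
  { intros s Hs; specialize (neg m Hm s Hs); destruct (pol s) as [-> E1] in neg; rewrite E1 in neg.
    split; intros E; rewrite E in neg; nra. }
  assert (mT : m <= T) by apply Rmin_l. assert (mT0 : m <= T0) by apply Rmin_r.
  assert (cpsi : forall s, continuous psi s) by (intros s; eapply is_derive_cont, dpsi).
  assert (p0 : 0 < psi T0 < PI / 2).
  { rewrite psi0; destruct (atan_bound a); split; auto; rewrite <- atan_0; now apply atan_increasing. }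
  assert (btw : forall s, Rmin t T0 <= s -> m <= s).
  { intros s Hs; assert (m <= Rmin t T0) by (apply Rmin_glb; lra); lra. }
  split.
  + destruct (Rlt_dec 0 (psi t)) as [|Hn]; auto; exfalso.
    destruct (ivt_between psi t T0 0 cpsi) as [s [Hs Es]]; [left; lra|].
    destruct (nzs s) as [A _]; [apply btw; lra|]. apply A; rewrite Es; apply sin_0.
  + destruct (Rlt_dec (psi t) (PI / 2)) as [|Hn]; auto; exfalso.
    destruct (ivt_between psi t T0 (PI / 2) cpsi) as [s [Hs Es]]; [right; lra|].
    destruct (nzs s) as [_ A]; [apply btw; lra|]. apply A; rewrite Es; apply cos_PI2.
- split; auto; split; auto; split; auto; split; auto.
  intros t; exists (r t); split; auto.
Qed.

Lemma prufer_diff al lam al' lam' psi chi t : prufer al lam psi -> prufer al' lam' chi ->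
  is_derive (fun t => psi t - chi t) t
   ((1 + Qp al lam t) * (sin (psi t) ^ 2 - sin (chi t) ^ 2) - (Qp al' lam' t - Qp al lam t) * sin (chi t) ^ 2).
Proof.
intros [P _] [C _].
replace ((1 + Qp al lam t) * (sin (psi t) ^ 2 - sin (chi t) ^ 2) - (Qp al' lam' t - Qp al lam t) * sin (chi t) ^ 2)
 with ((Qp al lam t * sin (psi t) ^ 2 - cos (psi t) ^ 2) - (Qp al' lam' t * sin (chi t) ^ 2 - cos (chi t) ^ 2)).
- apply (is_derive_minus psi chi); auto.
- assert (E1 := sin2_cos2_pow (psi t)); assert (E2 := sin2_cos2_pow (chi t)).
  replace (cos (psi t) ^ 2) with (1 - sin (psi t) ^ 2) by lra.
  replace (cos (chi t) ^ 2) with (1 - sin (chi t) ^ 2) by lra. ring.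
Qed.

(** In the forbidden region a gap of at least c between two angles grows at a rate at least sin(c)^2
    - eta, which would eventually exceed the quadrant that contains both. The perturbation is
    measured relative to 1 + Q, since changing [al] changes Q by a multiple of t^2. *)
Lemma prufer_no_gap al lam al' lam' psi chi T c eta : prufer al lam psi -> prufer al' lam' chi ->
  adm al lam T -> adm al' lam' T -> 0 < c < PI / 2 -> 0 <= eta < sin c ^ 2 ->
  (forall t, T <= t -> Qp al' lam' t - Qp al lam t <= eta * (1 + Qp al lam t)) ->
  psi T - chi T <= c.
Proof.
intros HP HC HT HT' Hc Heta HQ.
destruct (Rle_dec (psi T - chi T) c) as [|Hn]; auto; exfalso.
assert (der := fun t => prufer_diff _ _ _ _ _ _ t HP HC).
assert (rate : forall t, T <= t -> c <= psi t - chi t -> sin c ^ 2 - eta <=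
   (1 + Qp al lam t) * (sin (psi t) ^ 2 - sin (chi t) ^ 2) - (Qp al' lam' t - Qp al lam t) * sin (chi t) ^ 2).
{ intros t Ht Hd.
  assert (G := sin2_gap (psi t) (chi t) c (proj2 HP T HT t Ht) (proj2 HC T HT' t Ht) ltac:(lra) Hd).
  assert (Q1 := proj2 HT t Ht); pose proof (pow2_ge_0 t).
  specialize (HQ t Ht). pose proof (pow2_ge_0 (sin (chi t))).
  pose proof (sin2_cos2_pow (chi t)); pose proof (pow2_ge_0 (cos (chi t))).
  assert ((Qp al' lam' t - Qp al lam t) * sin (chi t) ^ 2 <= eta * (1 + Qp al lam t)).
  { assert (0 <= eta * (1 + Qp al lam t)) by (apply Rmult_le_pos; lra). nra. }
  assert ((1 + Qp al lam t) * sin c ^ 2 <= (1 + Qp al lam t) * (sin (psi t) ^ 2 - sin (chi t) ^ 2))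
    by (apply Rmult_le_compat_l; lra).
  nra. }
assert (stay : forall t, T <= t -> c < psi t - chi t).
{ intros t Ht; destruct (Rlt_dec c (psi t - chi t)) as [|Hm]; auto; exfalso.
  destruct (first_nonpos (fun t => psi t - chi t - c) T t) as [s [Hs [Hs1 Hs2]]]; try lra.
  { intros x Hx; apply (continuous_minus (fun t => psi t - chi t) (fun _ => c)); [|apply continuous_const].
    eapply is_derive_cont, der. }
  assert (psi T - chi T <= psi s - chi s); [|lra].
  apply (incr_of_derive_open (fun t => psi t - chi t) (fun t => (1 + Qp al lam t) * (sin (psi t) ^ 2 - sin (chi t) ^ 2) - (Qp al' lam' t - Qp al lam t) * sin (chi t) ^ 2)); [lra| | |].
  - intros x Hx; eapply is_derive_cont, der.
  - intros x Hx; apply der.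
  - intros x Hx; assert (R := rate x ltac:(lra)); assert (S := Hs2 x ltac:(lra)); cbv beta in S; lra. }
set (m := sin c ^ 2 - eta).
assert (mp : 0 < m) by (unfold m; lra).
assert (grow : psi T - chi T - m * T <= psi (T + PI / m) - chi (T + PI / m) - m * (T + PI / m)).
{ pose proof PI_RGT_0. assert (0 < PI / m) by (apply Rdiv_lt_0_compat; lra).
  apply (incr_of_derive (fun t => psi t - chi t - m * t) (fun t => (1 + Qp al lam t) * (sin (psi t) ^ 2 - sin (chi t) ^ 2) - (Qp al' lam' t - Qp al lam t) * sin (chi t) ^ 2 - m)); [lra| |].
  - intros x Hx; apply (is_derive_minus (fun t => psi t - chi t) (fun t => m * t)); [apply der|auto_derive; auto; ring].
  - intros x Hx; assert (R := rate x ltac:(lra)); assert (S := stay x ltac:(lra)). fold m in R; lra. }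
pose proof PI_RGT_0. assert (0 < PI / m) by (apply Rdiv_lt_0_compat; lra).
assert (E : m * (PI / m) = PI) by (field; lra).
destruct (proj2 HP T HT (T + PI / m)); [lra|].
destruct (proj2 HC T HT' (T + PI / m)); [lra|].
lra.
Qed.

Lemma Qp_bound_on al lam b : 0 <= b -> exists K, 0 <= K /\ forall t, 0 <= t <= b -> Rabs (1 + Qp al lam t) <= K.
Proof.
intros Hb.
destruct (continuity_ab_maj (fun t => Rabs (1 + Qp al lam t)) 0 b Hb) as [m [Hm _]].
{ intros c _; apply continuity_pt_filterlim.
  apply (continuous_comp (fun t => 1 + Qp al lam t) Rabs); [|apply continuous_Rabs].
  apply (continuous_plus (fun _ => 1) (Qp al lam)); [apply continuous_const|apply Qp_cont]. }
exists (Rabs (1 + Qp al lam m)); split; [apply Rabs_pos|auto].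
Qed.

(** [prufer_no_gap], applied both ways, makes the angles agree up to c at T; Gronwall for d^2 + c^2,
    where d is their difference, brings this back to 0. *)
Lemma prufer_cont al lam psi eps : prufer al lam psi -> 0 < eps -> exists eta, 0 < eta /\
  forall al' lam' chi, prufer al' lam' chi -> Rabs (al' - al) < eta -> Rabs (lam' - lam) < eta ->
  Rabs (chi 0 - psi 0) < eps.
Proof.
intros HP He.
pose proof (Rabs_pos al); pose proof (Rabs_pos lam).
(* 5 rather than 3, so that [T] is admissible for all parameters at distance at most 1. *)
set (T := 5 + Rabs al + Rabs lam).
destruct (Qp_bound_on al lam T) as [K [K0 HK]]; [unfold T; lra|].
set (M := exp ((2 * K + 1) * T)).
assert (Mp : 0 < M) by apply exp_pos.
(* Gronwall will give d(0)^2 <= 2 M c^2, which is below eps^2 for this c; c <= 1 keeps c under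
   pi/2. *)
set (c := Rmin 1 (eps / (2 * (M + 1)))).
assert (c0 : 0 < c) by (apply Rmin_pos; [lra|apply Rdiv_lt_0_compat; lra]).
assert (c1 : c <= 1) by apply Rmin_l.
assert (cM : c * (2 * (M + 1)) <= eps).
{ apply Rle_trans with (eps / (2 * (M + 1)) * (2 * (M + 1))).
  - apply Rmult_le_compat_r; [lra|apply Rmin_r].
  - right; field; lra. }
assert (sc : 0 < sin c) by (apply sin_gt_0; pose proof PI2_1; lra).
assert (sc2 : 0 < sin c ^ 2) by (apply pow_lt; auto).
set (B := (2 * Rabs al + 2) * (1 + T ^ 2)).
assert (B2 : 0 < 1 + T ^ 2) by (pose proof (pow2_ge_0 T); lra).
assert (Bp : 0 < B) by (apply Rmult_lt_0_compat; lra).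
assert (B1 : 2 * Rabs al + 2 <= B) by (unfold B; pose proof (pow2_ge_0 T); nra).
set (e := Rmin (c / B) (sin c ^ 2 / 2 / B)).
assert (ep : 0 < e) by (apply Rmin_pos; repeat apply Rdiv_lt_0_compat; lra).
assert (ec : e * B <= c).
{ apply Rle_trans with (c / B * B); [apply Rmult_le_compat_r; [lra|apply Rmin_l]|right; field; lra]. }
assert (es : e * B <= sin c ^ 2 / 2).
{ apply Rle_trans with (sin c ^ 2 / 2 / B * B); [apply Rmult_le_compat_r; [lra|apply Rmin_r]|right; field; lra]. }
exists (Rmin 1 e); split; [apply Rmin_pos; lra|].
intros al' lam' chi HC Ha Hl.
assert (ha1 : Rabs (al' - al) < 1) by (pose proof (Rmin_l 1 e); lra).
assert (hl1 : Rabs (lam' - lam) < 1) by (pose proof (Rmin_l 1 e); lra).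
assert (hae : Rabs (al' - al) < e) by (pose proof (Rmin_r 1 e); lra).
assert (hle : Rabs (lam' - lam) < e) by (pose proof (Rmin_r 1 e); lra).
assert (al'b : Rabs al' <= Rabs al + 1).
{ replace al' with (al' - al + al) by ring; pose proof (Rabs_triang (al' - al) al); lra. }
assert (lam'b : Rabs lam' <= Rabs lam + 1).
{ replace lam' with (lam' - lam + lam) by ring; pose proof (Rabs_triang (lam' - lam) lam); lra. }
assert (dQ : forall t, Rabs (Qp al' lam' t - Qp al lam t) <= e * (2 * Rabs al + 2) * (1 + t ^ 2)).
{ intros t; unfold Qp, qM.
  replace ((t ^ 2 / 2 - al') ^ 2 - lam' - ((t ^ 2 / 2 - al) ^ 2 - lam)) with
    ((al' - al) * (al' + al - t ^ 2) - (lam' - lam)) by field.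
  eapply Rle_trans; [apply Rabs_triang|]; rewrite Rabs_Ropp, Rabs_mult.
  assert (Rabs (al' + al - t ^ 2) <= 2 * Rabs al + 1 + t ^ 2).
  { eapply Rle_trans; [apply Rabs_triang|]; rewrite Rabs_Ropp, (Rabs_right (t ^ 2)) by (apply Rle_ge, pow2_ge_0).
    pose proof (Rabs_triang al' al); lra. }
  pose proof (Rabs_pos (al' - al)); pose proof (Rabs_pos (al' + al - t ^ 2)); pose proof (pow2_ge_0 t).
  apply Rle_trans with (e * (2 * Rabs al + 1 + t ^ 2) + e).
  - apply Rplus_le_compat; [|lra]. apply Rmult_le_compat; lra.
  - assert (0 <= e * (Rabs al * t ^ 2)) by (apply Rmult_le_pos; [lra|apply Rmult_le_pos; lra]). nra. }
assert (A1 : adm al lam T) by (apply adm_mono with (1 := adm_exists al lam); unfold T; lra).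
assert (A2 : adm al' lam' T) by (apply adm_mono with (1 := adm_exists al' lam'); unfold T; lra).
assert (cpi : 0 < c < PI / 2) by (pose proof PI2_1; lra).
assert (small : e * (2 * Rabs al + 2) <= sin c ^ 2 / 2).
{ apply Rle_trans with (e * B); auto; apply Rmult_le_compat_l; lra. }
assert (e0 : 0 <= e * (2 * Rabs al + 2)) by (apply Rmult_le_pos; lra).
assert (G1 : psi T - chi T <= c).
{ apply (prufer_no_gap al lam al' lam' psi chi T c (e * (2 * Rabs al + 2))); auto; [lra|].
  intros t Ht; specialize (dQ t). pose proof (Rle_abs (Qp al' lam' t - Qp al lam t)).
  pose proof (proj2 A1 t Ht); nra. }
assert (G2 : chi T - psi T <= c).
{ apply (prufer_no_gap al' lam' al lam chi psi T c (e * (2 * Rabs al + 2))); auto; [lra|].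
  intros t Ht; specialize (dQ t). rewrite Rabs_minus_sym in dQ. pose proof (Rle_abs (Qp al lam t - Qp al' lam' t)).
  pose proof (proj2 A2 t Ht); nra. }
assert (der := fun t => prufer_diff _ _ _ _ _ _ t HP HC).
set (d := fun t => psi t - chi t) in *.
set (d1 := fun t => (1 + Qp al lam t) * (sin (psi t) ^ 2 - sin (chi t) ^ 2) - (Qp al' lam' t - Qp al lam t) * sin (chi t) ^ 2) in *.
assert (d1b : forall t, 0 <= t <= T -> Rabs (d1 t) <= K * Rabs (d t) + c).
{ intros t Ht; unfold d1, d. eapply Rle_trans; [apply Rabs_triang|]; rewrite Rabs_Ropp, !Rabs_mult.
  apply Rplus_le_compat.
  - apply Rmult_le_compat; auto using Rabs_pos, sin2_lip.
  - apply Rle_trans with (Rabs (Qp al' lam' t - Qp al lam t) * 1).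
    + apply Rmult_le_compat_l; [apply Rabs_pos|].
      rewrite Rabs_right by (apply Rle_ge, pow2_ge_0).
      pose proof (sin2_cos2_pow (chi t)); pose proof (pow2_ge_0 (cos (chi t))); lra.
    + rewrite Rmult_1_r; eapply Rle_trans; [apply dQ|].
      apply Rle_trans with (e * B); auto. unfold B; rewrite <- Rmult_assoc.
      apply Rmult_le_compat_l; auto. assert (t ^ 2 <= T ^ 2) by (apply pow_incr; lra); lra. }
set (k := 2 * K + 1).
assert (Z : (d 0 ^ 2 + c ^ 2) * exp (k * 0) <= (d T ^ 2 + c ^ 2) * exp (k * T)).
{ apply (incr_of_derive (fun t => (d t ^ 2 + c ^ 2) * exp (k * t))
   (fun t => 2 * (d t * d1 t) * exp (k * t) + (d t ^ 2 + c ^ 2) * (k * exp (k * t)))); [unfold T; lra| |].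
  - intros x Hx; apply (is_derive_mult (fun t => d t ^ 2 + c ^ 2) (fun t => exp (k * t))).
    + rewrite <- (Rplus_0_r (2 * (d x * d1 x))).
      apply (is_derive_plus (fun t => d t ^ 2) (fun _ => c ^ 2)); [|apply (is_derive_const (c ^ 2))].
      apply sol_sq_derive, der.
    + auto_derive; auto; ring.
    + intros; apply Rmult_comm.
  - intros x Hx; specialize (d1b x Hx).
    replace (2 * (d x * d1 x) * exp (k * x) + (d x ^ 2 + c ^ 2) * (k * exp (k * x)))
     with ((2 * (d x * d1 x) + k * (d x ^ 2 + c ^ 2)) * exp (k * x)) by ring.
    apply Rmult_le_pos; [|left; apply exp_pos].
    assert (E : d x * d1 x >= - (Rabs (d x) * Rabs (d1 x))).
    { rewrite <- Rabs_mult. pose proof (Rle_abs (- (d x * d1 x))). rewrite Rabs_Ropp in H1; lra. }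
    assert (E2 : d x ^ 2 = Rabs (d x) ^ 2) by (rewrite pow2_abs; reflexivity).
    rewrite E2. pose proof (Rabs_pos (d x)); pose proof (Rabs_pos (d1 x)).
    assert (Rabs (d x) * Rabs (d1 x) <= Rabs (d x) * (K * Rabs (d x) + c)) by (apply Rmult_le_compat_l; auto).
    pose proof (pow2_ge_0 (Rabs (d x) - c)). unfold k. nra. }
rewrite Rmult_0_r, exp_0, Rmult_1_r in Z; fold M in Z.
replace (exp (k * T)) with M in Z by reflexivity.
assert (dT : d T ^ 2 <= c ^ 2) by (unfold d; nra).
rewrite Rabs_minus_sym; change (Rabs (d 0) < eps).
destruct (Rlt_dec (Rabs (d 0)) eps) as [|Hn]; auto; exfalso.
assert (E2 : d 0 ^ 2 = Rabs (d 0) ^ 2) by (rewrite pow2_abs; reflexivity).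
assert (eps ^ 2 <= d 0 ^ 2) by (rewrite E2; apply pow_incr; lra).
assert ((c * (2 * (M + 1))) ^ 2 <= eps ^ 2) by (apply pow_incr; split; auto; apply Rmult_le_pos; lra).
assert (0 < c ^ 2) by (apply pow_lt; auto).
nra.
Qed.

Lemma prufer_unique al lam psi chi : prufer al lam psi -> prufer al lam chi -> psi 0 = chi 0.
Proof.
intros HP HC; destruct (Req_dec (psi 0) (chi 0)) as [|ne]; auto; exfalso.
assert (0 < Rabs (chi 0 - psi 0)) by (apply Rabs_pos_lt; lra).
destruct (prufer_cont al lam psi _ HP H) as [eta [He H1]].
specialize (H1 al lam chi HC). rewrite !Rminus_diag, Rabs_R0 in H1. specialize (H1 He He); lra.
Qed.

Lemma prufer_pos al lam psi : prufer al lam psi -> forall t, 0 <= t -> 0 < psi t.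
Proof.
intros HP t Ht.
set (T := 3 + Rabs al + Rabs lam + t).
assert (HT : adm al lam T) by (apply adm_mono with (1 := adm_exists al lam); unfold T; lra).
assert (T0 : t <= T) by (unfold T; pose proof (Rabs_pos al); pose proof (Rabs_pos lam); lra).
destruct (Qp_bound_on al lam T) as [K [K0 HK]]; [lra|].
apply (pos_back psi (fun t => Qp al lam t * sin (psi t) ^ 2 - cos (psi t) ^ 2) t T K); auto.
- intros; apply HP.
- intros s Hs; specialize (HK s ltac:(lra)).
  assert (E := sin2_cos2_pow (psi s)).
  assert (L := sin2_lip (psi s) 0); rewrite sin_0, Rminus_0_r in L.
  replace (0 ^ 2) with 0 in L by ring; rewrite Rminus_0_r in L.
  replace (Qp al lam s * sin (psi s) ^ 2 - cos (psi s) ^ 2) with ((1 + Qp al lam s) * sin (psi s) ^ 2 - 1) by nra.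
  pose proof (Rle_abs ((1 + Qp al lam s) * sin (psi s) ^ 2)). rewrite Rabs_mult in H.
  assert (Rabs (1 + Qp al lam s) * Rabs (sin (psi s) ^ 2) <= K * Rabs (psi s)) by (apply Rmult_le_compat; auto using Rabs_pos).
  lra.
- apply (proj2 HP T HT); lra.
Qed.

(** For lam <= 0 one has Q >= 0, and pi/2 - psi satisfies the hypothesis of [pos_back]. With
    [prufer_high] this provides the two ends of the intermediate value argument in lam. *)
Lemma prufer_low al lam psi : prufer al lam psi -> lam <= 0 -> psi 0 < PI / 2.
Proof.
intros HP Hl.
set (T := 3 + Rabs al + Rabs lam).
assert (HT : adm al lam T) by apply adm_exists.
assert (T0 : 0 <= T) by apply HT.
assert (0 < PI / 2 - psi 0); [|lra].
apply (pos_back (fun t => PI / 2 - psi t) (fun t => 0 - (Qp al lam t * sin (psi t) ^ 2 - cos (psi t) ^ 2)) 0 T 1); auto.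
- intros t _; apply (is_derive_minus (fun _ => PI / 2) psi); [apply (is_derive_const (PI / 2))|apply HP].
- intros t _; rewrite Rmult_1_l.
  assert (L := sin2_lip (PI / 2 - psi t) 0); rewrite sin_0, Rminus_0_r, sin_shift in L.
  replace (0 ^ 2) with 0 in L by ring; rewrite Rminus_0_r in L.
  pose proof (Rle_abs (cos (psi t) ^ 2)). pose proof (pow2_ge_0 (sin (psi t))).
  assert (0 <= Qp al lam t) by (unfold Qp, qM; pose proof (pow2_ge_0 (t ^ 2 / 2 - al)); lra). nra.
- pose proof (proj2 HP T HT T (Rle_refl _)); lra.
Qed.

Lemma prufer_high al lam psi a : prufer al lam psi -> 0 <= a ->
  (forall t, 0 <= t <= a -> Qp al lam t <= - 1) -> a <= psi 0.
Proof.
intros HP Ha HQ.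
assert (0 < psi a) by (apply (prufer_pos al lam); auto).
assert (- psi 0 - 0 <= - psi a - a); [|lra].
apply (incr_of_derive (fun t => - psi t - t) (fun t => - (Qp al lam t * sin (psi t) ^ 2 - cos (psi t) ^ 2) - 1)); auto.
- intros t _; apply (is_derive_minus (fun t => - psi t) (fun t => t)); [apply (is_derive_opp psi), HP|apply (is_derive_id t)].
- intros t Ht; specialize (HQ t Ht); pose proof (sin2_cos2_pow (psi t)).
  pose proof (pow2_ge_0 (sin (psi t))). nra.
Qed.

(** Near infinity psi <= chi by [prufer_no_gap]; equality everywhere there contradicts the
    derivative of chi - psi, which would be -(mu - lam) sin^2. Strictness at one point is then
    carried back to 0. *)
Lemma prufer_mono al lam mu psi chi : lam < mu -> prufer al lam psi -> prufer al mu chi -> psi 0 < chi 0.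
Proof.
intros Hlm HP HC.
pose proof (Rabs_pos al); pose proof (Rabs_pos lam); pose proof (Rabs_pos mu).
set (T := 3 + Rabs al + Rabs lam + Rabs mu).
assert (A1 : forall t, T <= t -> adm al lam t) by (intros; apply adm_mono with (1 := adm_exists al lam); unfold T in *; lra).
assert (A2 : forall t, T <= t -> adm al mu t) by (intros; apply adm_mono with (1 := adm_exists al mu); unfold T in *; lra).
assert (le : forall t, T <= t -> psi t <= chi t).
{ intros t Ht; destruct (Rle_dec (psi t) (chi t)) as [|Hn]; auto; exfalso.
  set (c := Rmin 1 ((psi t - chi t) / 2)).
  assert (c0 : 0 < c) by (apply Rmin_pos; lra).
  assert (c1 : c <= 1) by apply Rmin_l. assert (c2 : c <= (psi t - chi t) / 2) by apply Rmin_r.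
  pose proof PI2_1.
  assert (0 < sin c) by (apply sin_gt_0; lra).
  assert (psi t - chi t <= c); [|lra].
  apply (prufer_no_gap al lam al mu psi chi t c 0); auto; [lra| |].
  - split; [lra|apply pow_lt; auto].
  - intros s Hs; unfold Qp; lra. }
assert (der := fun t => prufer_diff _ _ _ _ _ _ t HC HP).
assert (T0 : 0 <= T) by (unfold T; lra).
assert (ex : exists t, T <= t /\ psi t < chi t).
{ apply NNPP; intros Hn.
  assert (E : forall t, T <= t -> psi t = chi t).
  { intros t Ht; destruct (Rle_lt_or_eq_dec _ _ (le t Ht)); auto; exfalso; apply Hn; exists t; auto. }
  assert (D0 : is_derive (fun t => chi t - psi t) (T + 1) 0).
  { apply is_derive_ext_loc with (fun _ => 0); [|apply (is_derive_const 0)].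
    exists (mkposreal 1 Rlt_0_1); intros y Hy.
    unfold ball in Hy; simpl in Hy; unfold AbsRing_ball, abs, minus, plus, opp in Hy; simpl in Hy.
    apply Rabs_def2 in Hy. rewrite E by lra; simpl; ring. }
  apply is_derive_unique in D0; rewrite (is_derive_unique _ _ _ (der (T + 1))) in D0.
  rewrite (E (T + 1)) in D0 by lra.
  destruct (proj2 HC T (A2 T (Rle_refl _)) (T + 1)) as [P1 P2]; [lra|].
  assert (0 < sin (chi (T + 1))) by (apply sin_gt_0; lra).
  assert (0 < sin (chi (T + 1)) ^ 2) by (apply pow_lt; auto).
  unfold Qp in D0; nra. }
destruct ex as [t [Ht Hlt]].
assert (0 < chi 0 - psi 0); [|lra].
destruct (Qp_bound_on al mu t) as [K [K0 HK]]; [lra|].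
apply (pos_back (fun t => chi t - psi t) (fun t => (1 + Qp al mu t) * (sin (chi t) ^ 2 - sin (psi t) ^ 2) - (Qp al lam t - Qp al mu t) * sin (psi t) ^ 2) 0 t K); [lra|intros; apply der| |lra].
intros s Hs; specialize (HK s Hs).
replace (Qp al lam s - Qp al mu s) with (mu - lam) by (unfold Qp; ring).
pose proof (Rle_abs ((1 + Qp al mu s) * (sin (chi s) ^ 2 - sin (psi s) ^ 2))). rewrite Rabs_mult in H2.
assert (Rabs (1 + Qp al mu s) * Rabs (sin (chi s) ^ 2 - sin (psi s) ^ 2) <= K * Rabs (chi s - psi s))
  by (apply Rmult_le_compat; auto using Rabs_pos, sin2_lip).
pose proof (pow2_ge_0 (sin (psi s))). nra.
Qed.

(** * Characterization of the eigenvalues *)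

(** The angle at 0, well defined by [prufer_unique]. It equals j pi/2 exactly at the j-th
    eigenvalue: odd multiples mean u'(0) = 0, an even eigenfunction, and even multiples mean u(0) =
    0. *)
Definition Theta (al lam : R) : R :=
  epsilon (inhabits 0) (fun th => exists psi, prufer al lam psi /\ th = psi 0).

Lemma Theta_eq al lam psi : prufer al lam psi -> Theta al lam = psi 0.
Proof.
intros HP.
assert (H : exists chi, prufer al lam chi /\ Theta al lam = chi 0).
{ unfold Theta; apply (epsilon_spec (inhabits 0) (fun th => exists psi, prufer al lam psi /\ th = psi 0)).
  exists (psi 0), psi; auto. }
destruct H as [chi [HC ->]]. now apply (prufer_unique al lam).
Qed.

Lemma Theta_prufer al lam : exists psi, prufer al lam psi /\ Theta al lam = psi 0.
Proof. destruct (prufer_exists al lam) as [psi [_ [_ [HP _]]]]; exists psi; split; auto; now apply Theta_eq. Qed.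

Lemma Theta_mono al lam mu : lam < mu -> Theta al lam < Theta al mu.
Proof.
intros H; destruct (Theta_prufer al lam) as [psi [HP ->]]; destruct (Theta_prufer al mu) as [chi [HC ->]].
now apply (prufer_mono al lam mu).
Qed.

Lemma Theta_mono_le al lam mu : lam <= mu -> Theta al lam <= Theta al mu.
Proof. intros [H| ->]; [left; now apply Theta_mono|lra]. Qed.

Lemma Theta_low al lam : lam <= 0 -> Theta al lam < PI / 2.
Proof. intros H; destruct (Theta_prufer al lam) as [psi [HP ->]]; now apply (prufer_low al lam). Qed.

Lemma Theta_high al a : 0 <= a -> a <= Theta al (1 + (a ^ 2 / 2 + Rabs al) ^ 2).
Proof.
intros Ha; set (lam := 1 + (a ^ 2 / 2 + Rabs al) ^ 2).
destruct (Theta_prufer al lam) as [psi [HP ->]]; apply (prufer_high al lam); auto.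
intros t Ht; unfold Qp, qM, lam.
assert (t ^ 2 <= a ^ 2) by (apply pow_incr; lra). pose proof (pow2_ge_0 t).
assert ((t ^ 2 / 2 - al) ^ 2 <= (a ^ 2 / 2 + Rabs al) ^ 2); [|lra].
rewrite <- (pow2_abs (t ^ 2 / 2 - al)); apply pow_incr; split; [apply Rabs_pos|].
eapply Rle_trans; [apply Rabs_triang|]; rewrite Rabs_Ropp, (Rabs_right (t ^ 2 / 2)); lra.
Qed.

Lemma Theta_cont al lam eps : 0 < eps -> exists eta, 0 < eta /\
  forall al' lam', Rabs (al' - al) < eta -> Rabs (lam' - lam) < eta -> Rabs (Theta al' lam' - Theta al lam) < eps.
Proof.
intros He; destruct (Theta_prufer al lam) as [psi [HP E]].
destruct (prufer_cont al lam psi eps HP He) as [eta [H0 H]]; exists eta; split; auto.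
intros al' lam' Ha Hl; destruct (Theta_prufer al' lam') as [chi [HC ->]]; rewrite E; eauto.
Qed.

Lemma Theta_cont_lam al : continuity (Theta al).
Proof.
intros lam eps He; destruct (Theta_cont al lam eps He) as [eta [H0 H]]; exists eta; split; auto.
intros x [_ Hx]; apply H; auto; rewrite Rminus_diag, Rabs_R0; auto.
Qed.

Lemma Theta_cont_al lam al : continuity_pt (fun al => Theta al lam) al.
Proof.
intros eps He; destruct (Theta_cont al lam eps He) as [eta [H0 H]]; exists eta; split; auto.
intros x [_ Hx]; apply H; auto; rewrite Rminus_diag, Rabs_R0; auto.
Qed.

Lemma ev_exists j al : (1 <= j)%nat -> exists lam, Theta al lam = INR j * (PI / 2).
Proof.
intros Hj; assert (1 <= INR j) by (change 1 with (INR 1); now apply le_INR).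
pose proof PI_RGT_0.
assert (H1 : 0 <= INR j * (PI / 2)) by (apply Rmult_le_pos; lra).
assert (L := Theta_low al 0 (Rle_refl 0)); assert (U := Theta_high al _ H1).
set (b := 1 + ((INR j * (PI / 2)) ^ 2 / 2 + Rabs al) ^ 2) in *.
destruct (IVT_gen (Theta al) 0 b (INR j * (PI / 2))) as [x [_ Hx]]; [apply Theta_cont_lam| |eauto].
assert (PI / 2 <= INR j * (PI / 2)) by nra.
rewrite Rmin_left, Rmax_right; lra.
Qed.

Definition ev (j : nat) (al : R) : R := epsilon (inhabits 0) (fun lam => Theta al lam = INR j * (PI / 2)).

Lemma ev_spec j al : (1 <= j)%nat -> Theta al (ev j al) = INR j * (PI / 2).
Proof. intros Hj; unfold ev; apply epsilon_spec; now apply ev_exists. Qed.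

Lemma Theta_inj al lam mu : Theta al lam = Theta al mu -> lam = mu.
Proof.
intros H; destruct (Rtotal_order lam mu) as [K|[K|K]]; auto;
apply (Theta_mono al) in K; lra.
Qed.

Lemma ev_pos j al : (1 <= j)%nat -> 0 < ev j al.
Proof.
intros Hj; destruct (Rlt_dec 0 (ev j al)) as [|Hn]; auto; exfalso.
assert (L := Theta_low al (ev j al) ltac:(lra)); rewrite ev_spec in L by auto.
assert (1 <= INR j) by (change 1 with (INR 1); now apply le_INR). pose proof PI_RGT_0; nra.
Qed.

Lemma ev_lt i j al : (1 <= i)%nat -> (i < j)%nat -> ev i al < ev j al.
Proof.
intros Hi Hij; destruct (Rlt_dec (ev i al) (ev j al)) as [|Hn]; auto; exfalso.
assert (M := Theta_mono_le al (ev j al) (ev i al) ltac:(lra)).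
rewrite !ev_spec in M by lia. apply lt_INR in Hij. pose proof PI_RGT_0; nra.
Qed.

Lemma ev_cont j al eps : (1 <= j)%nat -> 0 < eps -> exists eta, 0 < eta /\
  forall al', Rabs (al' - al) < eta -> Rabs (ev j al' - ev j al) < eps.
Proof.
intros Hj He; set (l := ev j al).
assert (A := Theta_mono al (l - eps) l ltac:(lra)); assert (B := Theta_mono al l (l + eps) ltac:(lra)).
destruct (Theta_cont al (l - eps) (Theta al l - Theta al (l - eps)) ltac:(lra)) as [e1 [E1 H1]].
destruct (Theta_cont al (l + eps) (Theta al (l + eps) - Theta al l) ltac:(lra)) as [e2 [E2 H2]].
exists (Rmin e1 e2); split; [now apply Rmin_pos|].
intros al' Ha.
assert (Rabs (al' - al) < e1) by (pose proof (Rmin_l e1 e2); lra).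
assert (Rabs (al' - al) < e2) by (pose proof (Rmin_r e1 e2); lra).
specialize (H1 al' (l - eps) H); specialize (H2 al' (l + eps) H0).
rewrite Rminus_diag, Rabs_R0 in H1, H2. specialize (H1 E1); specialize (H2 E2).
apply Rabs_def2 in H1; apply Rabs_def2 in H2.
assert (S : Theta al l = Theta al' (ev j al')) by (unfold l; rewrite !ev_spec; auto).
apply Rabs_def1.
- destruct (Rlt_dec (ev j al') (l + eps)) as [|Hn]; [lra|exfalso].
  assert (M := Theta_mono_le al' (l + eps) (ev j al') ltac:(lra)); lra.
- destruct (Rlt_dec (l - eps) (ev j al')) as [|Hn]; [lra|exfalso].
  assert (M := Theta_mono_le al' (ev j al') (l - eps) ltac:(lra)); lra.
Qed.

(** * From square integrability to decay and parity *)

Lemma gen_integrable_small (f : R -> R) : ex_RInt_gen f (Rbar_locally m_infty) (Rbar_locally p_infty) ->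
  exists M N, (forall a b, M < a -> M < b -> Rabs (RInt f a b) < 2) /\
            (forall a b, a < N -> b < N -> Rabs (RInt f a b) < 2).
Proof.
intros [l Hl].
assert (Hb : locally l (fun y => Rabs (y - l) < 1)).
{ exists (mkposreal 1 Rlt_0_1); intros y Hy; exact Hy. }
specialize (Hl _ Hb). destruct Hl as [P Q0 [M1 HP] [M2 HQ] H].
assert (K : forall a b, a < M1 -> M2 < b -> exists y, is_RInt f a b y /\ Rabs (y - l) < 1).
{ intros a b Ha Hb'; apply (H a b); auto. }
exists M2, M1; split.
- intros a b Ha Hb'. destruct (K (M1 - 1) a ltac:(lra) Ha) as [y [Y1 Y2]]; destruct (K (M1 - 1) b ltac:(lra) Hb') as [z [Z1 Z2]].
  assert (E := is_RInt_Chasles f a (M1 - 1) b _ _ (is_RInt_swap _ _ _ _ Y1) Z1).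
  rewrite (is_RInt_unique _ _ _ _ E). unfold plus, opp; simpl.
  apply Rabs_def2 in Y2; apply Rabs_def2 in Z2; apply Rabs_def1; lra.
- intros a b Ha Hb'. destruct (K a (M2 + 1) Ha ltac:(lra)) as [y [Y1 Y2]]; destruct (K b (M2 + 1) Hb' ltac:(lra)) as [z [Z1 Z2]].
  assert (E := is_RInt_Chasles f a (M2 + 1) b _ _ Y1 (is_RInt_swap _ _ _ _ Z1)).
  rewrite (is_RInt_unique _ _ _ _ E). unfold plus, opp; simpl.
  apply Rabs_def2 in Y2; apply Rabs_def2 in Z2; apply Rabs_def1; lra.
Qed.

Lemma RInt_ge_3 (f : R -> R) a : (forall t, continuous f t) -> (forall t, a <= t <= a + 3 -> 1 <= f t) -> 3 <= RInt f a (a + 3).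
Proof.
intros Hc H.
replace 3 with (RInt (fun _ => 1) a (a + 3)) at 1
  by (rewrite RInt_const; unfold scal; simpl; unfold mult; simpl; ring).
apply RInt_le; [lra|apply ex_RInt_const| |intros; apply H; lra].
apply (ex_RInt_continuous (V := R_CompleteNormedModule)); auto.
Qed.

(** All that is kept of the L^2 condition: the integrand cannot stay above 1 near either end,
    because windows of length 3 far out have integral below 2. *)
Lemma gen_integrable_not_large (f : R -> R) : (forall t, continuous f t) ->
  ex_RInt_gen f (Rbar_locally m_infty) (Rbar_locally p_infty) ->
  forall M, ~ (forall t, M <= t -> 1 <= f t) /\ ~ (forall t, M <= t -> 1 <= f (- t)).
Proof.
intros Hc Hf M; destruct (gen_integrable_small f Hf) as [P [N [H1 H2]]]; split; intros H.
- set (a := Rmax M P + 1). pose proof (Rmax_l M P); pose proof (Rmax_r M P).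
  assert (A := RInt_ge_3 f a Hc). specialize (H1 a (a + 3) ltac:(unfold a; lra) ltac:(unfold a; lra)).
  pose proof (Rle_abs (RInt f a (a + 3))).
  assert (3 <= RInt f a (a + 3)) by (apply A; intros; apply H; unfold a in *; lra). lra.
- set (a := - Rmax M (- N) - 4). pose proof (Rmax_l M (- N)); pose proof (Rmax_r M (- N)).
  assert (A := RInt_ge_3 f a Hc). specialize (H2 a (a + 3) ltac:(unfold a; lra) ltac:(unfold a; lra)).
  pose proof (Rle_abs (RInt f a (a + 3))).
  assert (3 <= RInt f a (a + 3)); [|lra].
  apply A; intros t Ht; rewrite <- (Ropp_involutive t); apply H; unfold a in *; lra.
Qed.

(** Expand u on the decaying solution and on a solution growing at least linearly; a nonzero
    coefficient on the latter would force u^2 >= 1 far out. *)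
Lemma sol_decaying_multiple al lam D D1 u u1 : sol al lam D D1 -> fast D -> (exists t, D t <> 0) ->
  fast D1 -> sol al lam u u1 ->
  (forall M, ~ (forall t, M <= t -> 1 <= u t ^ 2)) ->
  exists a, forall t, u t = a * D t /\ u1 t = a * D1 t.
Proof.
intros HD FD nz FD1 U Hn.
assert (HT := adm_exists al lam). set (T := 3 + Rabs al + Rabs lam) in *.
assert (neg := fast_sol_neg al lam T HT D D1 HD FD FD1 nz T (Rle_refl T)).
assert (DT : D T <> 0) by (intros E; rewrite E in neg; lra).
destruct (sol_cauchy al lam T 0 1) as [g [g1 [Hg [g0 g10]]]].
assert (gr := grow2 al lam T HT g g1 Hg g0 g10).
set (a := u T / D T). set (b := u1 T - a * D1 T).
assert (E : forall t, u t = a * D t + b * g t /\ u1 t = a * D1 t + b * g1 t).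
{ assert (S := sol_lin al lam 1 (-1) _ _ _ _ U (sol_lin al lam a b _ _ _ _ HD Hg)).
  intros t; destruct (sol_zero al lam _ _ T S) with (t := t) as [Z Z1].
  - rewrite g0; unfold a; field; auto.
  - rewrite g10; unfold b; ring.
  - split; lra. }
destruct (Req_dec b 0) as [b0|b0].
{ exists a; intros t; destruct (E t) as [-> ->]; rewrite b0; split; ring. }
exfalso. destruct (proj2 FD 0) as [C HC].
assert (HC' : forall t, 0 <= t -> Rabs (D t) <= C) by (intros t Ht; specialize (HC t Ht); rewrite Rmult_0_l, Ropp_0, exp_0 in HC; lra).
assert (bp : 0 < Rabs b) by (apply Rabs_pos_lt; auto).
assert (C0 : 0 <= C) by (pose proof (HC' 0 (Rle_refl 0)); pose proof (Rabs_pos (D 0)); lra).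
apply (Hn (T + (1 + Rabs a * C) / Rabs b)).
assert (0 <= (1 + Rabs a * C) / Rabs b).
{ apply Rdiv_le_0_compat; auto. assert (0 <= Rabs a * C) by (apply Rmult_le_pos; auto using Rabs_pos); lra. }
intros t Ht. destruct (E t) as [-> _]. destruct (gr t) as [_ gt]; [lra|].
assert (T0 : 0 <= T) by apply HT.
assert (X : 1 <= Rabs (a * D t + b * g t)).
{ assert (Y : 1 + Rabs a * C <= Rabs b * g t).
  { replace (1 + Rabs a * C) with (Rabs b * ((1 + Rabs a * C) / Rabs b)) by (field; lra).
    apply Rmult_le_compat_l; lra. }
  assert (Z : Rabs (a * D t) <= Rabs a * C) by (rewrite Rabs_mult; apply Rmult_le_compat_l; auto using Rabs_pos; apply HC'; lra).
  assert (Rabs (b * g t) = Rabs b * g t) by (rewrite Rabs_mult, (Rabs_right (g t)); lra).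
  replace (b * g t) with (a * D t + b * g t - a * D t) in H0 by ring.
  pose proof (Rabs_triang (a * D t + b * g t) (- (a * D t))). rewrite Rabs_Ropp in H1.
  unfold Rminus in H0; lra. }
rewrite <- pow2_abs. nra.
Qed.

(** The potential is even, so u(t) and u(-t) are both multiples of D; comparing values and
    derivatives at 0 leaves only D(0) = 0 or D'(0) = 0. *)
Lemma eigen_BC al lam D D1 : sol al lam D D1 -> fast D -> fast D1 -> (exists t, D t <> 0) ->
  is_eigenvalue al lam -> D 0 * D1 0 = 0.
Proof.
intros HD FD FD1 nz [u [u1 [[z Hz] [U1 [U2 L2]]]]].
assert (U : sol al lam u u1) by (split; auto).
assert (cu : forall t, continuous (fun t => u t ^ 2) t).
{ intros t; eapply is_derive_cont, (sol_sq_derive u u1), U1. }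
assert (NL := gen_integrable_not_large _ cu L2).
destruct (sol_decaying_multiple al lam D D1 u u1 HD FD nz FD1 U) as [a Ha]; [intros M; apply NL|].
assert (V : sol al lam (fun t => u (- t)) (fun t => - u1 (- t))).
{ assert (No : forall t, is_derive Ropp t (-1)) by (intros t; auto_derive; auto).
  split; intros t.
  - replace (- u1 (- t)) with (-1 * u1 (- t)) by ring.
    apply (is_derive_comp u Ropp); auto.
  - replace (Qp al lam t * u (- t)) with (- (-1 * (Qp al lam (- t) * u (- t)))).
    + apply (is_derive_opp (fun t => u1 (- t))); apply (is_derive_comp u1 Ropp); [apply U|auto].
    + unfold Qp, qM; field. }
destruct (sol_decaying_multiple al lam D D1 _ _ HD FD nz FD1 V) as [b Hb]; [intros M; apply NL|].
destruct (Ha 0) as [A1 A2]; destruct (Hb 0) as [B1 B2]. rewrite Ropp_0 in B1, B2.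
assert (a0 : a <> 0) by (intros E; apply Hz; destruct (Ha z) as [-> _]; rewrite E; ring).
assert (E1 : (a - b) * D 0 = 0) by lra. assert (E2 : (a + b) * D1 0 = 0) by lra.
apply Rmult_integral in E1; apply Rmult_integral in E2.
destruct E1 as [E1|E1]; [|rewrite E1; ring].
destruct E2 as [E2|E2]; [|rewrite E2; ring]. exfalso; apply a0; lra.
Qed.

Lemma sin_cos_zero x : 0 < x -> sin x * cos x = 0 -> exists j, (1 <= j)%nat /\ x = INR j * (PI / 2).
Proof.
intros Hx H. assert (E : sin (2 * x) = 0) by (rewrite sin_2a; lra).
apply sin_eq_0_0 in E; destruct E as [k Hk]. pose proof PI_RGT_0.
assert (0 < IZR k) by nra. apply lt_IZR in H1.
exists (Z.to_nat k); split; [lia|]. rewrite INR_IZR_INZ, Z2Nat.id by lia. lra.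
Qed.

Lemma fast_tail_small f : fast f -> exists C, 0 <= C /\ forall b, 0 <= b -> Rabs (II f - RInt f 0 b) <= C * exp (- b).
Proof.
intros Hf; destruct (fast_RInt_small f Hf) as [C [C0 HC]]; exists C; split; auto; intros b Hb.
change (II f - RInt f 0 b) with (IIfrom b f).
assert (L := IIfrom_lim b f Hf Hb).
assert (A : is_lim_seq (fun n => Rabs (RInt f b (INR n))) (Rabs (IIfrom b f))).
{ apply (is_lim_seq_abs _ (IIfrom b f)); auto. }
apply (is_lim_seq_le_loc _ (fun _ => C * exp (- b)) _ (C * exp (- b))) in A; auto; [|apply is_lim_seq_const].
destruct (INR_unbounded b) as [N HN]; exists N; intros n Hn; apply le_INR in Hn; apply HC; lra.
Qed.

Lemma even_fast_integrable f : fast f -> (forall t, f (- t) = f t) ->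
  ex_RInt_gen f (Rbar_locally m_infty) (Rbar_locally p_infty).
Proof.
intros Hf Ev; exists (2 * II f).
destruct (fast_tail_small f Hf) as [C [C0 HC]].
intros P [eps HP].
destruct (exp_INR_small (2 * C) eps (cond_pos eps)) as [N HN].
specialize (HN N (Nat.le_refl N)).
apply (Filter_prod _ _ _ (fun a => a < - INR N) (fun b => INR N < b)).
- exists (- INR N); auto.
- exists (INR N); auto.
- intros a b Ha Hb; pose proof (pos_INR N); simpl.
  exists (RInt f 0 (- a) + RInt f 0 b); split.
  + apply (is_RInt_Chasles f a 0 b (RInt f 0 (- a)) (RInt f 0 b)).
    * assert (K : is_RInt (fun y => scal (-1) (f (-1 * y + 0))) a 0 (opp (RInt f 0 (- a)))).
      { apply (is_RInt_comp_lin f (-1) 0 a 0).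
        replace (-1 * 0 + 0) with 0 by ring; replace (-1 * a + 0) with (- a) by ring.
        apply (is_RInt_swap f), (RInt_correct (V := R_CompleteNormedModule)), fast_ex_RInt; auto; lra. }
      apply is_RInt_opp in K; rewrite opp_opp in K.
      eapply is_RInt_ext, K; intros y _; unfold opp, scal; simpl; unfold mult; simpl.
      replace (-1 * y + 0) with (- y) by ring; rewrite Ev; ring.
    * apply (RInt_correct (V := R_CompleteNormedModule)), fast_ex_RInt; auto; lra.
  + apply HP.
    assert (A1 := HC (- a) ltac:(lra)); assert (A2 := HC b ltac:(lra)).
    assert (exp (- - a) <= exp (- INR N)) by (apply exp_mono; lra).
    assert (exp (- b) <= exp (- INR N)) by (apply exp_mono; lra).
    assert (C * exp (- - a) <= C * exp (- INR N)) by (apply Rmult_le_compat_l; auto).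
    assert (C * exp (- b) <= C * exp (- INR N)) by (apply Rmult_le_compat_l; auto).
    change (Rabs (RInt f 0 (- a) + RInt f 0 b - 2 * II f) < eps).
    apply Rabs_le_between in A1; apply Rabs_le_between in A2; apply Rabs_def1; lra.
Qed.

Lemma sin_cos_parity j : (if Nat.even j then sin (INR j * (PI / 2)) else cos (INR j * (PI / 2))) = 0.
Proof.
destruct (Nat.even j) eqn:E.
- apply Nat.even_spec in E; destruct E as [m ->].
  rewrite mult_INR, INR_IZR_INZ; simpl (INR 2).
  apply sin_eq_0_1; exists (Z.of_nat m); rewrite INR_IZR_INZ; simpl; field.
- assert (O : Nat.odd j = true) by (unfold Nat.odd; now rewrite E).
  apply Nat.odd_spec in O; destruct O as [m ->].
  rewrite plus_INR, mult_INR; simpl (INR 2); simpl (INR 1).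
  apply cos_eq_0_1; exists (Z.of_nat m); rewrite INR_IZR_INZ; simpl; field.
Qed.

Lemma eigen_iff al lam : is_eigenvalue al lam <-> exists j, (1 <= j)%nat /\ Theta al lam = INR j * (PI / 2).
Proof.
destruct (prufer_exists al lam) as [psi [D [D1 [HP [HD [FD [FD1 [nz pol]]]]]]]].
rewrite (Theta_eq al lam psi HP).
destruct (pol 0) as [r [rp [E0 E1]]].
assert (sc := sol_cs al lam D D1 HD).
split.
- intros He; assert (B := eigen_BC al lam D D1 HD FD FD1 nz He).
  apply sin_cos_zero; [apply (prufer_pos al lam); auto; lra|].
  rewrite E0, E1 in B.
  assert (r * r * (sin (psi 0) * cos (psi 0)) = 0) by lra.
  apply Rmult_integral in H; destruct H; [nra|auto].
(* The decaying solution exists on the whole line, and the condition at 0 makes it even or odd. Its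
   square is even, so decay at +oo gives integrability at both ends. *)
- intros [j [Hj Ej]]; exists D, D1; split; [auto|split; [apply HD|split; [apply HD|]]].
  apply even_fast_integrable; [now apply fast_pow2|].
  intros t; rewrite (proj1 (sc t)), (proj1 (sc (- t))), ceven_neg, sodd_neg.
  assert (P := sin_cos_parity j); rewrite <- Ej in P.
  destruct (Nat.even j); rewrite P, Rmult_0_r in *; [rewrite E0|rewrite E1]; ring.
Qed.

Lemma jth_list j al : (1 <= j)%nat -> let l := map (fun i => ev i al) (seq 1 (j - 1)) in
  NoDup l /\ length l = (j - 1)%nat /\ forall mu, In mu l <-> is_eigenvalue al mu /\ mu < ev j al.
Proof.
intros Hj l; split; [|split].
- unfold l. apply FinFun.Injective_map_NoDup_in; [|apply seq_NoDup].
  intros x y Hx Hy E; apply in_seq in Hx; apply in_seq in Hy.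
  destruct (Nat.lt_trichotomy x y) as [K|[K|K]]; auto; apply (ev_lt _ _ al) in K; lra || lia.
- unfold l; rewrite length_map, length_seq; auto.
- intros mu; unfold l; rewrite in_map_iff; split.
  + intros [i [<- Hi]]; apply in_seq in Hi; split.
    * apply eigen_iff; exists i; split; [lia|apply ev_spec; lia].
    * apply ev_lt; lia.
  + intros [He Hm]; apply eigen_iff in He; destruct He as [i [Hi Ei]].
    assert (E : mu = ev i al) by (apply (Theta_inj al); rewrite ev_spec; auto).
    exists i; split; auto; apply in_seq; split; auto.
    destruct (Nat.lt_ge_cases i j); [lia|exfalso].
    destruct (Nat.eq_dec i j) as [->|]; [lra|].
    assert (ev j al < ev i al) by (apply ev_lt; lia); lra.
Qed.

(** The specified value is some [ev i al]; the list of smaller eigenvalues has length j - 1 by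
    specification and i - 1 by [jth_list], so i = j. *)
Lemma lambda_ev j al : (1 <= j)%nat -> lambda j al = ev j al.
Proof.
intros Hj.
assert (H : is_jth_eigenvalue j al (lambda j al)).
{ unfold lambda; apply (epsilon_spec (inhabits 0) (fun lam => is_jth_eigenvalue j al lam)).
  exists (ev j al); split.
  - apply eigen_iff; exists j; split; auto; now apply ev_spec.
  - exists (map (fun i => ev i al) (seq 1 (j - 1))); now apply jth_list. }
destruct H as [He [l [Nd [Hlen Hl]]]].
apply eigen_iff in He; destruct He as [i [Hi Ei]].
assert (E : lambda j al = ev i al) by (apply (Theta_inj al); rewrite ev_spec; auto).
destruct (jth_list i al Hi) as [Nd' [Hlen' Hl']].
assert (P : Permutation l (map (fun i => ev i al) (seq 1 (i - 1)))).
{ apply NoDup_Permutation; auto; intros x; rewrite Hl, Hl', E; tauto. }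
apply Permutation_length in P. rewrite Hlen, Hlen' in P.
rewrite E; f_equal; lia.
Qed.

(* Cauchy data at 0 of the j-th eigenfunction, which is even for odd j and odd for even j: only the half-line needs to be studied. *)
Definition data0 (j : nat) : R := if Nat.even j then 0 else 1.
Definition data1 (j : nat) : R := if Nat.even j then 1 else 0.

Lemma eigenfunction j al : (1 <= j)%nat -> exists u u1, sol al (ev j al) u u1 /\ fast u /\ fast u1 /\ u 0 = data0 j /\ u1 0 = data1 j.
Proof.
intros Hj; set (lam := ev j al).
destruct (prufer_exists al lam) as [psi [D [D1 [HP [HD [FD [FD1 [nz pol]]]]]]]].
destruct (pol 0) as [r [rp [E0 E1]]].
rewrite <- (Theta_eq al lam psi HP) in E0, E1. unfold lam in E0, E1; rewrite ev_spec in E0, E1 by auto.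
assert (P := sin_cos_parity j); assert (S := sin2_cos2_pow (INR j * (PI / 2))).
set (x := INR j * (PI / 2)) in *.
assert (sc : forall a, a <> 0 -> sol al lam (fun t => a * D t) (fun t => a * D1 t)).
{ intros a Ha; split; intros t; [apply is_derive_scal, HD|].
  replace (Qp al lam t * (a * D t)) with (a * (Qp al lam t * D t)) by ring. apply is_derive_scal, HD. }
unfold data0, data1; destruct (Nat.even j).
- assert (D1 0 <> 0) by (rewrite E1; intros Z; rewrite P in S; nra).
  exists (fun t => / D1 0 * D t), (fun t => / D1 0 * D1 t).
  split; [apply sc, Rinv_neq_0_compat; auto|split; [sf|split; [sf|split]]].
  + rewrite E0, P; ring.
  + field; auto.
- assert (D 0 <> 0) by (rewrite E0; intros Z; rewrite P in S; nra).
  exists (fun t => / D 0 * D t), (fun t => / D 0 * D1 t).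
  split; [apply sc, Rinv_neq_0_compat; auto|split; [sf|split; [sf|split]]].
  + field; auto.
  + rewrite E1, P; ring.
Qed.

(** * The Feynman-Hellmann formula *)

Lemma quadratic_disc A B C : (forall s, 0 <= A * s ^ 2 + 2 * B * s + C) -> 0 <= A -> B ^ 2 <= A * C.
Proof.
intros H HA; destruct (Req_dec A 0) as [->|ne].
- destruct (Req_dec B 0) as [->|nB]; [lra|].
  specialize (H (- (C + 1) / (2 * B))).
  replace (2 * B * (- (C + 1) / (2 * B))) with (- (C + 1)) in H by (field; auto). lra.
- specialize (H (- B / A)).
  replace (A * (- B / A) ^ 2 + 2 * B * (- B / A) + C) with ((A * C - B ^ 2) / A) in H by (field; auto).
  assert (0 < A) by lra.
  apply Rmult_le_compat_r with (r := A) in H; [|lra].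
  replace ((A * C - B ^ 2) / A * A) with (A * C - B ^ 2) in H by (field; auto). lra.
Qed.

Definition nrm (f : R -> R) : R := sqrt (II (fun t => f t ^ 2)).

Lemma II_sq_ge0 f : fast f -> 0 <= II (fun t => f t ^ 2).
Proof. intros Hf; apply II_ge0; [sf|]; intros; apply pow2_ge_0. Qed.

Lemma nrm_ge0 f : 0 <= nrm f.
Proof. apply sqrt_pos. Qed.

Lemma nrm_sq f : fast f -> nrm f ^ 2 = II (fun t => f t ^ 2).
Proof. intros; unfold nrm; apply pow2_sqrt, II_sq_ge0; auto. Qed.

Lemma II_CS f g : fast f -> fast g -> Rabs (II (fun t => f t * g t)) <= nrm f * nrm g.
Proof.
intros Hf Hg.
assert (K : (II (fun t => f t * g t)) ^ 2 <= II (fun t => f t ^ 2) * II (fun t => g t ^ 2)).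
{ apply quadratic_disc; [|now apply II_sq_ge0].
  intros s.
  replace (II (fun t => f t ^ 2) * s ^ 2 + 2 * II (fun t => f t * g t) * s + II (fun t => g t ^ 2))
   with (II (fun t => (s * f t + g t) ^ 2)).
  - apply II_sq_ge0; sf.
  - replace (II (fun t => f t ^ 2) * s ^ 2) with (s ^ 2 * II (fun t => f t ^ 2)) by ring.
    replace (2 * II (fun t => f t * g t) * s) with (2 * s * II (fun t => f t * g t)) by ring.
    rewrite <- !II_scal, <- !II_plus by sf. apply II_ext; [sf|sf|]. intros; ring. }
apply Rsqr_incr_0_var; [|apply Rmult_le_pos; apply nrm_ge0].
rewrite <- Rsqr_abs, !Rsqr_pow2, Rpow_mult_distr, !nrm_sq; auto.
Qed.

Lemma nrm_triang f g : fast f -> fast g -> nrm (fun t => f t + g t) <= nrm f + nrm g.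
Proof.
intros Hf Hg.
apply Rsqr_incr_0_var; [|pose proof (nrm_ge0 f); pose proof (nrm_ge0 g); lra].
rewrite !Rsqr_pow2, nrm_sq by sf.
assert (E : II (fun t => (f t + g t) ^ 2) = II (fun t => f t ^ 2) + 2 * II (fun t => f t * g t) + II (fun t => g t ^ 2)).
{ rewrite <- !II_scal, <- !II_plus by sf. apply II_ext; [sf|sf|]; intros; ring. }
rewrite E, <- !nrm_sq by auto.
pose proof (II_CS f g Hf Hg); pose proof (Rle_abs (II (fun t => f t * g t))); lra.
Qed.

Lemma nrm_scal c f : fast f -> nrm (fun t => c * f t) = Rabs c * nrm f.
Proof.
intros Hf; unfold nrm.
rewrite (II_ext _ (fun t => c ^ 2 * f t ^ 2)); [|sf|sf|intros; ring].
rewrite II_scal by sf. rewrite sqrt_mult_alt by apply pow2_ge_0.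
f_equal. rewrite <- sqrt_Rsqr_abs, Rsqr_pow2; auto.
Qed.

Lemma nrm_le f g : fast f -> fast g -> (forall t, 0 <= t -> Rabs (f t) <= Rabs (g t)) -> nrm f <= nrm g.
Proof.
intros Hf Hg H; apply sqrt_le_1_alt, II_le; [sf|sf|].
intros t Ht; rewrite <- (pow2_abs (f t)), <- (pow2_abs (g t)); apply pow_incr; split; auto using Rabs_pos.
Qed.

Lemma IIfrom_le_II a f : 0 <= a -> fast f -> (forall t, 0 <= t -> 0 <= f t) -> IIfrom a f <= II f.
Proof.
intros Ha Hf H; unfold IIfrom.
assert (0 <= RInt f 0 a); [|lra].
apply RInt_ge_0; auto; [apply fast_ex_RInt; auto; lra|intros; apply H; lra].
Qed.

Lemma RInt_le_II a f : 0 <= a -> fast f -> (forall t, 0 <= t -> 0 <= f t) -> RInt f 0 a <= II f.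
Proof.
intros Ha Hf H; rewrite (II_split a f).
assert (0 <= IIfrom a f); [|lra].
replace 0 with (IIfrom a (fun _ => 0)).
- apply IIfrom_le; auto using fast_0; intros; apply H; lra.
- unfold IIfrom; rewrite II_0, RInt_const; unfold scal; simpl; unfold mult; simpl; ring.
Qed.

Lemma RInt_le_const f a M : 0 <= a -> cont0 f -> (forall t, 0 <= t <= a -> f t <= M) -> RInt f 0 a <= a * M.
Proof.
intros Ha Hf H.
replace (a * M) with (RInt (fun _ => M) 0 a)
  by (rewrite RInt_const; unfold scal; simpl; unfold mult; simpl; ring).
apply RInt_le; auto; [|apply ex_RInt_const|intros; apply H; lra].
apply (ex_RInt_continuous (V := R_CompleteNormedModule)); intros z Hz; apply Hf.
rewrite Rmin_left in Hz; lra.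
Qed.

Lemma is_derive_sq_sum (v v1 : R -> R) w t : is_derive v t (v1 t) -> is_derive v1 t w ->
  is_derive (fun t => v t ^ 2 + v1 t ^ 2) t (2 * (v t * v1 t) + 2 * (v1 t * w)).
Proof.
intros H1 H2; apply (is_derive_plus (fun t => v t ^ 2) (fun t => v1 t ^ 2)).
- now apply sol_sq_derive.
- now apply (sol_sq_derive v1 (fun _ => w)).
Qed.

(** Applied to the difference of two eigenfunctions with the same Cauchy data, this gives L^2
    continuity in the parameter. On [0, T] it is Gronwall for v^2 + v'^2; beyond T the multiplier v
    uses that Q is at least 1. *)
Lemma zero_data_bound al lam : exists C, 0 <= C /\ forall v v1 f,
  (forall t, 0 <= t -> is_derive v t (v1 t)) ->
  (forall t, 0 <= t -> is_derive v1 t (Qp al lam t * v t + f t)) ->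
  fast v -> fast v1 -> fast f -> v 0 = 0 -> v1 0 = 0 -> nrm v <= C * nrm f.
Proof.
assert (HT := adm_exists al lam); set (T := 3 + Rabs al + Rabs lam) in *.
assert (T0 : 0 <= T) by apply HT.
destruct (Qp_bound_on al lam T T0) as [K0 [K00 HK]].
set (K := K0 + 1). set (M := exp (K * T)).
assert (Mp : 0 < M) by apply exp_pos.
exists (sqrt (T * M + 1 + M)); split; [apply sqrt_pos|].
intros v v1 f Hv Hv1 Fv Fv1 Ff v0 v10.
set (N := II (fun t => f t ^ 2)).
assert (N0 : 0 <= N) by (apply II_sq_ge0; auto).
assert (E1 : forall s, 0 <= s <= T -> v s ^ 2 + v1 s ^ 2 <= M * N).
{ intros s Hs.
  assert (G : RInt (fun _ => 0) 0 s <= RInt (fun t => f t ^ 2) 0 s +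
    - ((v s ^ 2 + v1 s ^ 2) * exp (- (K * s))) - - ((v 0 ^ 2 + v1 0 ^ 2) * exp (- (K * 0)))).
  { apply (RInt_le_deriv (fun _ => 0) (fun t => f t ^ 2) (fun t => - ((v t ^ 2 + v1 t ^ 2) * exp (- (K * t))))
     (fun t => - ((2 * (v t * v1 t) + 2 * (v1 t * (Qp al lam t * v t + f t))) * exp (- (K * t)) + (v t ^ 2 + v1 t ^ 2) * (- K * exp (- (K * t))))) 0 s); [lra| | | |].
    - intros; apply continuous_const.
    - intros t Ht; apply (fast_pow2 f Ff); lra.
    - intros t Ht; apply (is_derive_opp (fun t => (v t ^ 2 + v1 t ^ 2) * exp (- (K * t)))).
      apply (is_derive_mult (fun t => v t ^ 2 + v1 t ^ 2) (fun t => exp (- (K * t)))).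
      + apply is_derive_sq_sum; [apply Hv|apply Hv1]; lra.
      + auto_derive; auto; ring.
      + intros; apply Rmult_comm.
    - intros t Ht; set (e := exp (- (K * t))).
      assert (e0 : 0 < e) by apply exp_pos.
      assert (e1 : e <= 1).
      { unfold e; rewrite <- exp_0; apply exp_mono. assert (0 <= K * t) by (apply Rmult_le_pos; unfold K; lra); lra. }
      replace (- ((2 * (v t * v1 t) + 2 * (v1 t * (Qp al lam t * v t + f t))) * e + (v t ^ 2 + v1 t ^ 2) * (- K * e)))
       with ((K * (v t ^ 2 + v1 t ^ 2) - 2 * ((1 + Qp al lam t) * (v t * v1 t)) - 2 * (v1 t * f t)) * e) by ring.
      specialize (HK t ltac:(lra)).
      assert (A1 : 2 * ((1 + Qp al lam t) * (v t * v1 t)) <= K0 * (v t ^ 2 + v1 t ^ 2)).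
      { pose proof (Rle_abs (2 * ((1 + Qp al lam t) * (v t * v1 t)))).
        rewrite !Rabs_mult, (Rabs_right 2) in H by lra.
        assert (2 * (Rabs (v t) * Rabs (v1 t)) <= v t ^ 2 + v1 t ^ 2).
        { rewrite <- (pow2_abs (v t)), <- (pow2_abs (v1 t)). pose proof (pow2_ge_0 (Rabs (v t) - Rabs (v1 t))). lra. }
        assert (0 <= Rabs (v t) * Rabs (v1 t)) by (apply Rmult_le_pos; apply Rabs_pos).
        assert (Rabs (1 + Qp al lam t) * (2 * (Rabs (v t) * Rabs (v1 t))) <= K0 * (v t ^ 2 + v1 t ^ 2))
          by (apply Rmult_le_compat; auto using Rabs_pos; lra). lra. }
      assert (A2 : 2 * (v1 t * f t) <= v1 t ^ 2 + f t ^ 2) by (pose proof (pow2_ge_0 (v1 t - f t)); lra).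
      pose proof (pow2_ge_0 (v t)). pose proof (pow2_ge_0 (f t)).
      assert (- f t ^ 2 <= K * (v t ^ 2 + v1 t ^ 2) - 2 * ((1 + Qp al lam t) * (v t * v1 t)) - 2 * (v1 t * f t)) by (unfold K; lra).
      nra. }
  rewrite RInt_const, v0, v10 in G; unfold scal in G; simpl in G; unfold mult in G; simpl in G.
  assert (G2 : RInt (fun t => f t ^ 2) 0 s <= N) by (apply RInt_le_II; [lra|sf|intros; apply pow2_ge_0]).
  assert (G3 : (v s ^ 2 + v1 s ^ 2) * exp (- (K * s)) <= N) by (simpl in *; lra).
  assert (E4 : exp (- (K * s)) * exp (K * s) = 1) by (rewrite <- exp_plus, Rplus_opp_l; apply exp_0).
  assert (E5 : exp (K * s) <= M) by (apply exp_mono, Rmult_le_compat_l; unfold K; lra).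
  pose proof (exp_pos (K * s)).
  replace (v s ^ 2 + v1 s ^ 2) with ((v s ^ 2 + v1 s ^ 2) * exp (- (K * s)) * exp (K * s)) by (rewrite Rmult_assoc, E4; ring).
  apply Rle_trans with (N * exp (K * s)); [apply Rmult_le_compat_r; lra|].
  rewrite (Rmult_comm M); apply Rmult_le_compat_l; auto. }
assert (I1 : RInt (fun t => v t ^ 2) 0 T <= T * (M * N)).
{ apply RInt_le_const; auto; [apply (fast_pow2 v Fv)|]. intros t Ht; specialize (E1 t Ht); pose proof (pow2_ge_0 (v1 t)); lra. }
assert (I2 : IIfrom T (fun t => v t ^ 2) <= IIfrom T (fun t => f t ^ 2) - 2 * (v T * v1 T)).
{ destruct (fast_exp1 (fun t => 2 * (v t * v1 t)) ltac:(sf)) as [C HC].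
  apply (IIfrom_le_deriv (fun t => v t ^ 2) (fun t => f t ^ 2) (fun t => 2 * (v t * v1 t))
    (fun t => 2 * (v1 t * v1 t + v t * (Qp al lam t * v t + f t))) C); auto; [sf|sf| | |].
  - intros t Ht; apply is_derive_scal, (is_derive_mult v v1); [apply Hv; lra|apply Hv1; lra|intros; apply Rmult_comm].
  - intros t Ht; apply HC; lra.
  - intros t Ht; assert (Q1 := proj2 HT t Ht); pose proof (pow2_ge_0 t).
    pose proof (pow2_ge_0 (v1 t)); pose proof (pow2_ge_0 (v t)); pose proof (pow2_ge_0 (f t + v t)). nra. }
assert (I3 : IIfrom T (fun t => f t ^ 2) <= N) by (apply IIfrom_le_II; auto; [sf|intros; apply pow2_ge_0]).
assert (I4 : - 2 * (v T * v1 T) <= M * N).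
{ specialize (E1 T ltac:(lra)); pose proof (pow2_ge_0 (v T + v1 T)); lra. }
unfold nrm. rewrite <- sqrt_mult_alt by nra. apply sqrt_le_1_alt.
rewrite (II_split T (fun t => v t ^ 2)). fold N. lra.
Qed.

Lemma sol_energy al lam u u1 : sol al lam u u1 -> fast u -> fast u1 -> u 0 * u1 0 = 0 ->
  II (fun t => u1 t ^ 2) + II (fun t => qM al t * u t ^ 2) = lam * II (fun t => u t ^ 2).
Proof.
intros U Fu Fu1 H0.
assert (Sq : slow (qM al)).
{ unfold qM; sf. }
rewrite <- II_scal, <- II_plus by sf.
rewrite (II_eq_deriv (fun t => u1 t ^ 2 + qM al t * u t ^ 2) (fun t => lam * u t ^ 2) (fun t => u t * u1 t)
  (fun t => u1 t ^ 2 + Qp al lam t * u t ^ 2)).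
- rewrite H0; ring.
- sf.
- sf.
- sf.
- intros; now apply sol_mult_derive.
- intros; unfold Qp; ring.
Qed.

Lemma sol_norm_pos al lam u u1 : sol al lam u u1 -> fast u -> u 0 <> 0 \/ u1 0 <> 0 -> 0 < II (fun t => u t ^ 2).
Proof.
intros U Fu nz.
destruct (classic (exists t, 0 <= t /\ u t <> 0)) as [[t [Ht Hn]]|Hn].
- apply II_pos_point with t; auto; [sf|intros; apply pow2_ge_0|now apply pow2_gt_0].
- exfalso.
  assert (Z : forall t, 0 <= t -> u t = 0).
  { intros t Ht; destruct (Req_dec (u t) 0); auto; exfalso; apply Hn; eauto. }
  assert (D0 : is_derive u 1 0).
  { apply is_derive_ext_loc with (fun _ => 0); [|apply (is_derive_const 0)].
    exists (mkposreal 1 Rlt_0_1); intros y Hy; symmetry; apply Z.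
    unfold ball in Hy; simpl in Hy; unfold AbsRing_ball, abs, minus, plus, opp in Hy; simpl in Hy.
    apply Rabs_def2 in Hy; lra. }
  apply is_derive_unique in D0; rewrite (is_derive_unique _ _ _ (proj1 U 1)) in D0.
  destruct (sol_zero al lam u u1 1 U (Z 1 ltac:(lra)) D0 0); tauto.
Qed.

Lemma sq3 a b c : (a + b + c) ^ 2 <= 3 * (a ^ 2 + b ^ 2 + c ^ 2).
Proof. pose proof (pow2_ge_0 (a - b)); pose proof (pow2_ge_0 (b - c)); pose proof (pow2_ge_0 (a - c)); lra. Qed.

Lemma data_prod j : data0 j * data1 j = 0.
Proof. unfold data0, data1; destruct (Nat.even j); ring. Qed.

Lemma data_nz j : data0 j <> 0 \/ data1 j <> 0.
Proof. unfold data0, data1; destruct (Nat.even j); lra. Qed.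

Definition eigf j al u u1 := sol al (ev j al) u u1 /\ fast u /\ fast u1 /\ u 0 = data0 j /\ u1 0 = data1 j.

(** For eigenfunctions u at al and v at al + h with equal Cauchy data, the Wronskian identity has no
    boundary term and is exact; the formula follows as v tends to u in L^2. *)
Lemma ev_derive j al u u1 : (1 <= j)%nat -> eigf j al u u1 ->
  is_derive (ev j) al (- 2 * II (fun t => (t ^ 2 / 2 - al) * u t ^ 2) / II (fun t => u t ^ 2)).
Proof.
intros Hj [U [Fu [Fu1 [u0 u10]]]].
set (N := II (fun t => u t ^ 2)). set (Y := II (fun t => (t ^ 2 / 2 - al) * u t ^ 2)).
assert (Np : 0 < N) by (apply (sol_norm_pos al (ev j al) u u1); auto; rewrite u0, u10; apply data_nz).
destruct (zero_data_bound al (ev j al)) as [C [C0 HC]].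
set (lam := ev j al) in *.
set (n := nrm u). assert (nN : n ^ 2 = N) by (apply nrm_sq; auto).
assert (np : 0 < n) by (unfold n, nrm; apply sqrt_lt_R0; auto).
set (m := nrm (fun t => (t ^ 2 / 2 - al) * u t)). assert (m0 : 0 <= m) by apply nrm_ge0.
set (B := 4 * (Rabs Y * n + N * m) / N ^ 2).
assert (B0 : 0 <= B).
{ apply Rdiv_le_0_compat; [|apply pow_lt; auto]. pose proof (Rabs_pos Y). assert (0 <= Rabs Y * n) by (apply Rmult_le_pos; lra).
  assert (0 <= N * m) by (apply Rmult_le_pos; lra). lra. }
apply is_derive_Reals; intros eps Heps.
(* Tolerance on the norm of v - u: n/2 keeps the scalar product of u and v above N/2, and the other
   bound makes the error in the quotient, at most [B * w0], less than eps/2. *)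
set (w0 := Rmin (n / 2) (eps / (2 * (B + 1)))).
assert (w0p : 0 < w0) by (apply Rmin_pos; [lra|apply Rdiv_lt_0_compat; lra]).
assert (w0n : w0 <= n / 2) by apply Rmin_l.
assert (w0B : B * w0 < eps / 2).
{ apply Rle_lt_trans with (B * (eps / (2 * (B + 1)))).
  - apply Rmult_le_compat_l; [lra|apply Rmin_r].
  - apply Rmult_lt_reg_r with (2 * (B + 1)); [lra|].
    replace (B * (eps / (2 * (B + 1))) * (2 * (B + 1))) with (B * eps) by (field; lra). nra. }
(* Will bound the norm of [f] by [k0] times that of v: C k0 <= 1/2 allows the norm of v to be
   absorbed into 2 n, and then C k0 (2 n) <= w0. *)
set (k0 := Rmin (1 / (2 * (C + 1))) (w0 / (2 * n * (C + 1)))).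
assert (k0p : 0 < k0).
{ apply Rmin_pos; apply Rdiv_lt_0_compat; try lra. apply Rmult_lt_0_compat; lra. }
(* h^2, h^4 and mu^2 will all be at most [e0]; with the energy bound lam + 1 for the potential term,
   the square of the norm of [f] is then at most k0^2 times that of v. *)
set (e0 := k0 ^ 2 / (3 * (4 * (lam + 1) + 2))).
assert (lamp : 0 < lam) by (apply ev_pos; auto).
assert (e0p : 0 < e0) by (apply Rdiv_lt_0_compat; [apply pow_lt; auto|lra]).
set (e1 := Rmin 1 e0). assert (e1p : 0 < e1) by (apply Rmin_pos; lra).
destruct (ev_cont j al e1 Hj e1p) as [eta [etap Heta]].
set (dl := Rmin (Rmin eta e1) (eps / 2)).
assert (dlp : 0 < dl) by (apply Rmin_pos; [apply Rmin_pos; auto|lra]).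
exists (mkposreal dl dlp); simpl; intros h h0 hd.
assert (h1 : Rabs h < eta) by (unfold dl in hd; pose proof (Rmin_l (Rmin eta e1) (eps / 2)); pose proof (Rmin_l eta e1); lra).
assert (h2 : Rabs h < e1) by (unfold dl in hd; pose proof (Rmin_l (Rmin eta e1) (eps / 2)); pose proof (Rmin_r eta e1); lra).
assert (h3 : Rabs h < eps / 2) by (unfold dl in hd; pose proof (Rmin_r (Rmin eta e1) (eps / 2)); lra).
set (al' := al + h). set (lam' := ev j al'). set (mu := lam' - lam).
assert (Hmu : Rabs mu < e1) by (apply Heta; unfold al'; replace (al + h - al) with h by ring; auto).
destruct (eigenfunction j al' Hj) as [v [v1 [V [Fv [Fv1 [v0 v10]]]]]]. fold lam' in V.
set (z := fun t => v t - u t). set (z1 := fun t => v1 t - u1 t).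
assert (Fz : fast z) by (unfold z; sf). assert (Fz1 : fast z1) by (unfold z1; sf).
assert (Sq : forall a b, slow (Qp a b)) by (intros a b; unfold Qp, qM; sf).
set (f := fun t => (Qp al' lam' t - Qp al lam t) * v t).
assert (S1 := Sq al' lam'). assert (S2 := Sq al lam).
assert (Ff : fast f) by (unfold f; sf).
assert (Zb : nrm z <= C * nrm f).
{ apply (HC z z1 f); auto.
  - intros t _; apply (is_derive_minus v u); [apply V|apply U].
  - intros t _; replace (Qp al lam t * z t + f t) with (Qp al' lam' t * v t - Qp al lam t * u t) by (unfold z, f; ring).
    apply (is_derive_minus v1 u1); [apply V|apply U].
  - unfold z; rewrite u0, v0; lra.
  - unfold z1; rewrite u10, v10; lra. }
assert (En := sol_energy al' lam' v v1 V Fv Fv1 ltac:(rewrite v0, v10; apply data_prod)).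
assert (Fb : nrm f <= k0 * nrm v).
{ apply Rsqr_incr_0_var; [|apply Rmult_le_pos; [lra|apply nrm_ge0]].
  rewrite !Rsqr_pow2, Rpow_mult_distr, !nrm_sq by auto.
  assert (L : II (fun t => f t ^ 2) <= 3 * (4 * h ^ 2 * II (fun t => qM al' t * v t ^ 2) + (h ^ 4 + mu ^ 2) * II (fun t => v t ^ 2))).
  { assert (SqM : slow (qM al')) by (unfold qM; sf).
    rewrite <- !II_scal, <- II_plus, <- II_scal by sf.
    apply II_le; [sf|sf|]. intros t _; unfold f.
    replace (Qp al' lam' t - Qp al lam t) with (- 2 * (t ^ 2 / 2 - al') * h + - h ^ 2 + - mu)
      by (unfold Qp, qM, mu, al'; field).
    rewrite Rpow_mult_distr.
    pose proof (sq3 (- 2 * (t ^ 2 / 2 - al') * h) (- h ^ 2) (- mu)). pose proof (pow2_ge_0 (v t)).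
    unfold qM. nra. }
  assert (II1 : 0 <= II (fun t => v1 t ^ 2)) by (apply II_sq_ge0; auto).
  set (Nv := II (fun t => v t ^ 2)) in *.
  assert (Nv0 : 0 <= Nv) by (apply II_sq_ge0; auto).
  assert (lam'b : lam' <= lam + 1).
  { pose proof (Rle_abs mu); pose proof (Rmin_l 1 e0); fold e1 in H0; unfold mu in *; lra. }
  assert (h2' : h ^ 2 <= e0 /\ h ^ 4 <= e0 /\ mu ^ 2 <= e0).
  { assert (A : forall x, Rabs x < e1 -> x ^ 2 <= e0 /\ x ^ 2 <= 1).
    { intros x Hx; rewrite <- pow2_abs. pose proof (Rabs_pos x); pose proof (Rmin_l 1 e0); pose proof (Rmin_r 1 e0); fold e1 in H0, H1.
      split; nra. }
    destruct (A h h2); destruct (A mu Hmu). pose proof (pow2_ge_0 h).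
    replace (h ^ 4) with (h ^ 2 * h ^ 2) by ring. split; [lra|split; [nra|lra]]. }
  destruct h2' as [a1 [a2 a3]].
  assert (Eq : II (fun t => qM al' t * v t ^ 2) <= (lam + 1) * Nv).
  { apply Rle_trans with (lam' * Nv); [lra|apply Rmult_le_compat_r; auto]. }
  assert (4 * h ^ 2 * II (fun t => qM al' t * v t ^ 2) <= 4 * e0 * ((lam + 1) * Nv)).
  { apply Rle_trans with (4 * h ^ 2 * ((lam + 1) * Nv)).
    - apply Rmult_le_compat_l; auto. pose proof (pow2_ge_0 h); lra.
    - apply Rmult_le_compat_r; [apply Rmult_le_pos; lra|lra]. }
  assert ((h ^ 4 + mu ^ 2) * Nv <= 2 * e0 * Nv) by (apply Rmult_le_compat_r; lra).
  replace (k0 ^ 2 * Nv) with (3 * (4 * e0 * ((lam + 1) * Nv) + 2 * e0 * Nv)); [lra|].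
  unfold e0; field; lra. }
assert (Zk : nrm z <= C * k0 * nrm v).
{ apply Rle_trans with (1 := Zb). rewrite Rmult_assoc; apply Rmult_le_compat_l; auto. }
assert (Ck1 : C * k0 <= 1 / 2).
{ apply Rle_trans with (C * (1 / (2 * (C + 1)))); [apply Rmult_le_compat_l; [lra|apply Rmin_l]|].
  apply Rmult_le_reg_r with (2 * (C + 1)); [lra|].
  replace (C * (1 / (2 * (C + 1))) * (2 * (C + 1))) with C by (field; lra). lra. }
assert (Ck2 : C * k0 * (2 * n) <= w0).
{ apply Rle_trans with (C * (w0 / (2 * n * (C + 1))) * (2 * n)).
  - apply Rmult_le_compat_r; [lra|]. apply Rmult_le_compat_l; [lra|apply Rmin_r].
  - replace (C * (w0 / (2 * n * (C + 1))) * (2 * n)) with (w0 * (C / (C + 1))) by (field; lra).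
    rewrite <- (Rmult_1_r w0) at 2. apply Rmult_le_compat_l; [lra|].
    apply Rmult_le_reg_r with (C + 1); [lra|]. replace (C / (C + 1) * (C + 1)) with C by (field; lra). lra. }
assert (Vn : nrm v <= 2 * n).
{ assert (nrm v <= n + nrm z).
  { replace (nrm v) with (nrm (fun t => u t + z t)); [now apply nrm_triang|].
    unfold nrm; f_equal; apply II_ext; [sf|sf|]; intros; unfold z; ring. }
  pose proof (nrm_ge0 v). nra. }
assert (Zw : nrm z <= w0).
{ apply Rle_trans with (1 := Zk). apply Rle_trans with (2 := Ck2).
  apply Rmult_le_compat_l; auto. apply Rmult_le_pos; lra. }
set (P := II (fun t => u t * v t)). set (R0 := II (fun t => (t ^ 2 / 2 - al) * u t * v t)).
assert (HP : Rabs (P - N) <= n * w0).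
{ unfold P, N. rewrite <- II_minus by sf.
  rewrite (II_ext _ (fun t => u t * z t)); [|sf|sf|intros; unfold z; ring].
  apply Rle_trans with (n * nrm z); [now apply II_CS|]. apply Rmult_le_compat_l; lra. }
assert (HR : Rabs (R0 - Y) <= m * w0).
{ unfold R0, Y. rewrite <- II_minus by sf.
  rewrite (II_ext _ (fun t => (t ^ 2 / 2 - al) * u t * z t)); [|sf|sf|intros; unfold z; ring].
  apply Rle_trans with (m * nrm z); [apply (II_CS (fun t => (t ^ 2 / 2 - al) * u t)); [sf|auto]|]. apply Rmult_le_compat_l; lra. }
(* The integrated Wronskian: the difference of the potentials is -2 h (t^2/2 - al) + h^2 - mu, and u
   v' - u' v vanishes at 0. *)
assert (Id : mu * P = - 2 * h * R0 + h ^ 2 * P).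
{ assert (Z : II (fun t => (Qp al' lam' t - Qp al lam t) * u t * v t) = II (fun _ => 0) - (u 0 * v1 0 - u1 0 * v 0)).
  { apply (II_eq_deriv _ (fun _ => 0) (fun t => u t * v1 t - u1 t * v t) (fun t => (Qp al' lam' t - Qp al lam t) * u t * v t)); [sf|apply fast_0|sf| |].
    - intros t _; exact (wronskian_derive al lam al' lam' u u1 v v1 t U V).
    - intros; ring. }
  rewrite II_0, u0, u10, v0, v10 in Z.
  assert (Z2 : - 2 * h * R0 + h ^ 2 * P - mu * P = II (fun t => (Qp al' lam' t - Qp al lam t) * u t * v t)).
  { unfold R0, P. rewrite <- !II_scal, <- II_plus, <- II_minus by sf. apply II_ext; [sf|sf|].
    intros t _; unfold Qp, qM, mu, al'; field. }
  rewrite Z in Z2. rewrite (Rmult_comm (data1 j)) in Z2. lra. }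
assert (Pp : N / 2 <= P).
{ apply Rabs_le_between in HP. assert (n * w0 <= n * (n / 2)) by (apply Rmult_le_compat_l; lra). nra. }
change (Rabs (mu / h - - 2 * Y / N) < eps).
replace (mu / h - - 2 * Y / N) with (h + 2 * (Y * (P - N) - N * (R0 - Y)) / (P * N)).
2:{ replace (mu / h) with (mu * P / (h * P)) by (field; lra). rewrite Id. field. lra. }
eapply Rle_lt_trans; [apply Rabs_triang|].
assert (X : Rabs (2 * (Y * (P - N) - N * (R0 - Y)) / (P * N)) <= B * w0).
{ unfold Rdiv; rewrite Rabs_mult, Rabs_inv, (Rabs_right (P * N)) by nra.
  rewrite Rabs_mult, (Rabs_right 2) by lra.
  assert (X1 : Rabs (Y * (P - N) - N * (R0 - Y)) <= (Rabs Y * n + N * m) * w0).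
  { eapply Rle_trans; [apply Rabs_triang|]; rewrite Rabs_Ropp, !Rabs_mult, (Rabs_right N) by lra.
    pose proof (Rabs_pos Y).
    assert (Rabs Y * Rabs (P - N) <= Rabs Y * (n * w0)) by (apply Rmult_le_compat_l; auto).
    assert (N * Rabs (R0 - Y) <= N * (m * w0)) by (apply Rmult_le_compat_l; lra). lra. }
  apply Rle_trans with (2 * ((Rabs Y * n + N * m) * w0) * (2 / N ^ 2)).
  - apply Rmult_le_compat; [pose proof (Rabs_pos (Y * (P - N) - N * (R0 - Y))); lra| |lra|].
    + left; apply Rinv_0_lt_compat; nra.
    + replace (2 / N ^ 2) with (/ (N / 2 * N)) by (field; lra). apply Rinv_le_contravar; nra.
  - right; unfold B; field; lra. }
lra.
Qed.

(** * Sign of the derivative for nonpositive and for large alpha *)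

Lemma is_derive_mulr (f : R -> R) c t l : is_derive f t l -> is_derive (fun t => f t * c) t (l * c).
Proof.
intros H; replace (l * c) with (l * c + f t * 0) by ring.
apply (is_derive_mult f (fun _ => c)); auto; [apply (is_derive_const c)|intros; apply Rmult_comm].
Qed.

Lemma sol_nz_point al lam u u1 : sol al lam u u1 -> u 0 <> 0 \/ u1 0 <> 0 -> exists t, 0 < t /\ u t <> 0.
Proof.
intros U nz; apply NNPP; intros Hn.
assert (Z : forall t, 0 < t -> u t = 0).
{ intros t Ht; destruct (Req_dec (u t) 0); auto; exfalso; apply Hn; eauto. }
assert (D0 : is_derive u 1 0).
{ apply is_derive_ext_loc with (fun _ => 0); [|apply (is_derive_const 0)].
  exists (mkposreal 1 Rlt_0_1); intros y Hy; symmetry; apply Z.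
  unfold ball in Hy; simpl in Hy; unfold AbsRing_ball, abs, minus, plus, opp in Hy; simpl in Hy.
  apply Rabs_def2 in Hy; lra. }
apply is_derive_unique in D0; rewrite (is_derive_unique _ _ _ (proj1 U 1)) in D0.
destruct (sol_zero al lam u u1 1 U (Z 1 ltac:(lra)) D0 0); tauto.
Qed.

Lemma nonpos_al_moment al lam u u1 : sol al lam u u1 -> fast u -> u 0 <> 0 \/ u1 0 <> 0 -> al <= 0 ->
  0 < II (fun t => (t ^ 2 / 2 - al) * u t ^ 2).
Proof.
intros U Fu nz Hal; destruct (sol_nz_point al lam u u1 U nz) as [t [Ht Hut]].
apply II_pos_point with t; [sf| |lra|].
- intros s Hs; apply Rmult_le_pos; [pose proof (pow2_ge_0 s); lra|apply pow2_ge_0].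
- apply Rmult_lt_0_compat; [assert (0 < t ^ 2) by (apply pow_lt; auto); lra|now apply pow2_gt_0].
Qed.

(** Its derivative -Q' u^2 contains no u', so products of [Jen] with a multiplier yield weighted
    moments of u^2. *)
Definition Jen al lam (u u1 : R -> R) (t : R) : R := u1 t ^ 2 - Qp al lam t * u t ^ 2.

Lemma Qp_derive al lam t : is_derive (Qp al lam) t (2 * (t ^ 2 / 2 - al) * t).
Proof. unfold Qp, qM; auto_derive; auto; field. Qed.

Lemma Jen_derive al lam u u1 t : sol al lam u u1 ->
  is_derive (Jen al lam u u1) t (- (2 * (t ^ 2 / 2 - al) * t) * u t ^ 2).
Proof.
intros [U1 U2].
replace (- (2 * (t ^ 2 / 2 - al) * t) * u t ^ 2) with
  (2 * (u1 t * (Qp al lam t * u t)) - ((2 * (t ^ 2 / 2 - al) * t) * u t ^ 2 + Qp al lam t * (2 * (u t * u1 t)))) by ring.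
apply (is_derive_minus (fun t => u1 t ^ 2) (fun t => Qp al lam t * u t ^ 2)).
- apply (sol_sq_derive u1 (fun t => Qp al lam t * u t)), U2.
- apply (is_derive_mult (Qp al lam) (fun t => u t ^ 2)); [apply Qp_derive|apply sol_sq_derive, U1|intros; apply Rmult_comm].
Qed.

(* Multiplier [t / a^2] on [0, a] and [1 / t] on [a, oo), where a lies inside the barrier:
   the boundary terms at a cancel except [u(a)^2], and a Hardy-type square absorbs the far region. *)
Lemma deep_well_bound al lam u u1 a : sol al lam u u1 -> fast u -> fast u1 -> u 0 * u1 0 = 0 -> 0 < a ->
  a ^ 2 / 2 <= al ->
  II (fun t => (t ^ 2 / 2 - al) * u t ^ 2) <=
  u a ^ 2 / (4 * a ^ 3) - / a ^ 2 * RInt (fun t => Qp al lam t * u t ^ 2) 0 a.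
Proof.
intros U Fu Fu1 H0 Ha Hal.
assert (SQ : slow (Qp al lam)) by (unfold Qp, qM; sf).
assert (FJ : fast (Jen al lam u u1)) by (unfold Jen; sf).
set (A := fun t => (t ^ 2 / 2 - al) * u t ^ 2).
assert (FA : fast A) by (unfold A; sf).
rewrite (II_split a A).
set (J := Jen al lam u u1) in *.
assert (dJ : forall t, is_derive J t (- (2 * (t ^ 2 / 2 - al) * t) * u t ^ 2)) by (intros; now apply Jen_derive).
assert (dp : forall t, is_derive (fun t => u t * u1 t) t (u1 t ^ 2 + Qp al lam t * u t ^ 2)) by (intros; now apply sol_mult_derive).
assert (I1 : RInt A 0 a <= RInt (fun t => - / a ^ 2 * (Qp al lam t * u t ^ 2)) 0 a
   + (- a * J a + u a * u1 a) * / (2 * a ^ 2) - (- 0 * J 0 + u 0 * u1 0) * / (2 * a ^ 2)).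
{ apply (RInt_le_deriv A (fun t => - / a ^ 2 * (Qp al lam t * u t ^ 2)) (fun t => (- t * J t + u t * u1 t) * / (2 * a ^ 2))
    (fun t => (((-1) * J t + - t * (- (2 * (t ^ 2 / 2 - al) * t) * u t ^ 2)) + (u1 t ^ 2 + Qp al lam t * u t ^ 2)) * / (2 * a ^ 2))); [lra| | | |].
  - intros t Ht; apply FA; lra.
  - intros t Ht; assert (fast (fun t => - / a ^ 2 * (Qp al lam t * u t ^ 2))) by sf. apply H; lra.
  - intros t Ht; apply (is_derive_mulr (fun t => - t * J t + u t * u1 t)).
    apply (is_derive_plus (fun t => - t * J t)); auto.
    apply (is_derive_mult (fun t => - t) J); auto; [auto_derive; auto|intros; apply Rmult_comm].
  - intros t Ht; unfold J, Jen, A.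
    assert (t ^ 2 <= a ^ 2) by (apply pow_incr; lra).
    assert (a2 : 0 < a ^ 2) by (apply pow_lt; auto).
    replace (- / a ^ 2 * (Qp al lam t * u t ^ 2) + (-1 * (u1 t ^ 2 - Qp al lam t * u t ^ 2) + - t * (- (2 * (t ^ 2 / 2 - al) * t) * u t ^ 2) +
     (u1 t ^ 2 + Qp al lam t * u t ^ 2)) * / (2 * a ^ 2)) with ((t ^ 2 / 2 - al) * u t ^ 2 - (al - t ^ 2 / 2) * u t ^ 2 * (t ^ 2 / a ^ 2 - 1))
     by (field; lra).
    assert (0 <= (al - t ^ 2 / 2) * u t ^ 2) by (apply Rmult_le_pos; [lra|apply pow2_ge_0]).
    assert (t ^ 2 / a ^ 2 <= 1) by (apply Rmult_le_reg_r with (a ^ 2); auto; unfold Rdiv; rewrite Rmult_assoc, Rinv_l; lra).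
    nra. }
set (Fo := fun t => - J t * / (2 * t) + u t * u1 t * / (2 * t ^ 2) - u t ^ 2 * / (4 * t ^ 3)).
assert (I2 : IIfrom a A <= IIfrom a (fun _ => 0) - Fo a).
{ destruct (fast_exp1 J FJ) as [C1 H1]. destruct (fast_exp1 (fun t => u t * u1 t) ltac:(sf)) as [C2 H2].
  destruct (fast_exp1 (fun t => u t ^ 2) ltac:(sf)) as [C3 H3].
  apply (IIfrom_le_deriv A (fun _ => 0) Fo
   (fun t => (- - (2 * (t ^ 2 / 2 - al) * t) * u t ^ 2) * / (2 * t) + - J t * (- / (2 * t ^ 2))
     + ((u1 t ^ 2 + Qp al lam t * u t ^ 2) * / (2 * t ^ 2) + u t * u1 t * (- / t ^ 3))
     - ((2 * (u t * u1 t)) * / (4 * t ^ 3) + u t ^ 2 * (- 3 * / (4 * t ^ 4))))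
   (C1 * / (2 * a) + C2 * / (2 * a ^ 2) + C3 * / (4 * a ^ 3))); auto using fast_0; [lra| | |].
  - intros t Ht.
    apply (is_derive_minus (fun t => - J t * / (2 * t) + u t * u1 t * / (2 * t ^ 2)) (fun t => u t ^ 2 * / (4 * t ^ 3))).
    + apply (is_derive_plus (fun t => - J t * / (2 * t)) (fun t => u t * u1 t * / (2 * t ^ 2))).
      * apply (is_derive_mult (fun t => - J t) (fun t => / (2 * t))); [|auto_derive; [lra|field; lra]|intros; apply Rmult_comm].
        replace (- - (2 * (t ^ 2 / 2 - al) * t) * u t ^ 2) with (- (- (2 * (t ^ 2 / 2 - al) * t) * u t ^ 2)) by ring.
        apply (is_derive_opp J); auto.
      * apply (is_derive_mult (fun t => u t * u1 t) (fun t => / (2 * t ^ 2))); auto; [|intros; apply Rmult_comm].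
        auto_derive; [nra|field; lra].
    + apply (is_derive_mult (fun t => u t ^ 2) (fun t => / (4 * t ^ 3))); [apply sol_sq_derive, U| |intros; apply Rmult_comm].
      assert (t * (t * (t * 1)) <> 0) by (repeat apply Rmult_integral_contrapositive_currified; lra).
      auto_derive; [lra|field; lra].
  - intros t Ht; unfold Fo.
    specialize (H1 t ltac:(lra)); specialize (H2 t ltac:(lra)); specialize (H3 t ltac:(lra)); cbv beta in H2, H3.
    assert (b1 : 0 < / (2 * t) <= / (2 * a)) by (split; [apply Rinv_0_lt_compat; lra|apply Rinv_le_contravar; lra]).
    assert (0 < a ^ 2) by (apply pow_lt; auto). assert (0 < a ^ 3) by (apply pow_lt; auto).
    assert (a ^ 2 <= t ^ 2) by (apply pow_incr; lra). assert (a ^ 3 <= t ^ 3) by (apply pow_incr; lra).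
    assert (b2 : 0 < / (2 * t ^ 2) <= / (2 * a ^ 2)) by (split; [apply Rinv_0_lt_compat; lra|apply Rinv_le_contravar; lra]).
    assert (b3 : 0 < / (4 * t ^ 3) <= / (4 * a ^ 3)) by (split; [apply Rinv_0_lt_compat; lra|apply Rinv_le_contravar; lra]).
    eapply Rle_trans; [apply Rabs_triang|].
    eapply Rle_trans; [apply Rplus_le_compat_r, Rabs_triang|].
    rewrite !Rabs_Ropp, (Rabs_mult (- J t)), (Rabs_mult (u t * u1 t)), (Rabs_mult (u t ^ 2)), Rabs_Ropp.
    rewrite (Rabs_right (/ (2 * t))), (Rabs_right (/ (2 * t ^ 2))), (Rabs_right (/ (4 * t ^ 3))) by lra.
    assert (M : forall x c k l e, Rabs x <= c * e -> 0 < k <= l -> Rabs x * k <= c * l * e).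
    { intros x c k l e E1 E2. pose proof (Rabs_pos x). apply Rle_trans with (Rabs x * l); [nra|]. nra. }
    pose proof (M _ _ _ _ _ H1 b1). pose proof (M _ _ _ _ _ H2 b2). pose proof (M _ _ _ _ _ H3 b3). lra.
  - intros t Ht; unfold J, Jen, A.
    assert (t0 : 0 < t) by lra.
    set (X := u1 t / t). set (Yv := u t / t ^ 2).
    assert (S : 0 <= X ^ 2 - 3 / 2 * X * Yv + 3 / 4 * Yv ^ 2).
    { pose proof (pow2_ge_0 (X - 3 / 4 * Yv)); pose proof (pow2_ge_0 Yv); lra. }
    match goal with |- _ <= 0 + ?E => replace E with ((t ^ 2 / 2 - al) * u t ^ 2 + (X ^ 2 - 3 / 2 * X * Yv + 3 / 4 * Yv ^ 2)) end; [lra|].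
    unfold X, Yv; field; lra. }
assert (Z0 : IIfrom a (fun _ => 0) = 0).
{ unfold IIfrom; rewrite II_0, RInt_const; unfold scal; simpl; unfold mult; simpl; ring. }
assert (E1 : RInt (fun t => - / a ^ 2 * (Qp al lam t * u t ^ 2)) 0 a = - / a ^ 2 * RInt (fun t => Qp al lam t * u t ^ 2) 0 a).
{ apply (RInt_scal (fun t => Qp al lam t * u t ^ 2)). apply fast_ex_RInt; [sf|lra|lra]. }
rewrite E1 in I1. rewrite H0 in I1.
assert (E2 : (- a * J a + u a * u1 a) * / (2 * a ^ 2) - Fo a = u a ^ 2 / (4 * a ^ 3)) by (unfold Fo; field; lra).
lra.
Qed.

(** With a = sqrt(al)/2, Q >= (49/64 - 4/9) al^2 >= 3/10 al^2 on [0, a]: the whole interval is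
    forbidden and u u' increases from 0 there. Near a, u^2 is comparable with u(a)^2, so the
    integral of Q u^2 in [deep_well_bound] beats the boundary term. *)
Lemma deep_well al lam u u1 : 16 <= al -> lam <= 4 / 9 * al ^ 2 -> 0 < lam -> sol al lam u u1 -> fast u -> fast u1 ->
  u 0 * u1 0 = 0 -> u 0 <> 0 \/ u1 0 <> 0 -> II (fun t => (t ^ 2 / 2 - al) * u t ^ 2) < 0.
Proof.
intros Hal Hl Hl0 U Fu Fu1 H0 nz.
set (a := sqrt al / 2).
assert (s2 : sqrt al * sqrt al = al) by (apply sqrt_sqrt; lra).
assert (s4 : 4 <= sqrt al) by (replace 4 with (sqrt 16); [apply sqrt_le_1_alt; auto|replace 16 with (4 * 4) by ring; apply sqrt_square; lra]).
assert (a2 : a ^ 2 = al / 4) by (unfold a; lra).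
assert (ap : 2 <= a) by (unfold a; lra).
assert (Qb : forall t, 0 <= t <= a -> 3 / 10 * al ^ 2 <= Qp al lam t <= al ^ 2).
{ intros t Ht; assert (t ^ 2 <= a ^ 2) by (apply pow_incr; lra). pose proof (pow2_ge_0 t).
  unfold Qp, qM. assert (7 / 8 * al <= al - t ^ 2 / 2 <= al) by lra.
  replace ((t ^ 2 / 2 - al) ^ 2) with ((al - t ^ 2 / 2) ^ 2) by ring.
  assert ((7 / 8 * al) ^ 2 <= (al - t ^ 2 / 2) ^ 2) by (apply pow_incr; lra).
  assert ((al - t ^ 2 / 2) ^ 2 <= al ^ 2) by (apply pow_incr; lra). split; nra. }
assert (Q0 : forall t, 0 <= t <= a -> 0 <= Qp al lam t) by (intros t Ht; specialize (Qb t Ht); pose proof (pow2_ge_0 al); lra).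
set (p := fun t => u t * u1 t).
assert (dp : forall t, is_derive p t (u1 t ^ 2 + Qp al lam t * u t ^ 2)) by (intros; now apply sol_mult_derive).
assert (dp0 : forall t, 0 <= t <= a -> 0 <= Qp al lam t * u t ^ 2).
{ intros t Ht; apply Rmult_le_pos; auto; apply pow2_ge_0. }
assert (p_inc : forall s t, 0 <= s <= t -> t <= a -> p s <= p t).
{ intros s t Hs Ht; apply (incr_of_derive p (fun t => u1 t ^ 2 + Qp al lam t * u t ^ 2)); [lra|auto|].
  intros x Hx; pose proof (dp0 x ltac:(lra)); pose proof (pow2_ge_0 (u1 x)); lra. }
assert (p0 : forall t, 0 <= t <= a -> 0 <= p t).
{ intros t Ht; replace 0 with (p 0) by (unfold p; auto); apply p_inc; lra. }
assert (u1inc : forall t, 0 <= t <= a -> u1 0 ^ 2 <= u1 t ^ 2).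
{ intros t Ht; apply (incr_of_derive (fun t => u1 t ^ 2) (fun t => 2 * (u1 t * (Qp al lam t * u t)))); [lra| |].
  - intros x _; apply (sol_sq_derive u1 (fun t => Qp al lam t * u t)), U.
  - intros x Hx. replace (2 * (u1 x * (Qp al lam x * u x))) with (2 * (Qp al lam x * p x)) by (unfold p; ring).
    assert (0 <= Qp al lam x * p x) by (apply Rmult_le_pos; [apply Q0|apply p0]; lra). lra. }
assert (plow : forall t, 0 <= t <= a -> u1 0 ^ 2 * t <= p t).
{ intros t Ht. assert (p 0 - u1 0 ^ 2 * 0 <= p t - u1 0 ^ 2 * t).
  { apply (incr_of_derive (fun t => p t - u1 0 ^ 2 * t) (fun t => u1 t ^ 2 + Qp al lam t * u t ^ 2 - u1 0 ^ 2)); [lra| |].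
    - intros x _; apply (is_derive_minus p (fun t => u1 0 ^ 2 * t)); auto. auto_derive; auto; ring.
    - intros x Hx; pose proof (dp0 x ltac:(lra)); pose proof (u1inc x ltac:(lra)); lra. }
  replace (p 0) with 0 in H by (unfold p; auto). lra. }
set (W := u a ^ 2).
assert (wlow : u 0 ^ 2 + u1 0 ^ 2 * a ^ 2 <= W).
{ assert (u 0 ^ 2 - u1 0 ^ 2 * 0 ^ 2 <= u a ^ 2 - u1 0 ^ 2 * a ^ 2).
  { apply (incr_of_derive (fun t => u t ^ 2 - u1 0 ^ 2 * t ^ 2) (fun t => 2 * (u t * u1 t) - 2 * (u1 0 ^ 2 * t))); [lra| |].
    - intros x _; apply (is_derive_minus (fun t => u t ^ 2) (fun t => u1 0 ^ 2 * t ^ 2)); [apply sol_sq_derive, U|auto_derive; auto; ring].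
    - intros x Hx; pose proof (plow x ltac:(lra)) as P; unfold p in P; lra. }
  unfold W; lra. }
assert (Wp : 0 < W).
{ pose proof (pow2_ge_0 (u 0)); pose proof (pow2_ge_0 (u1 0)).
  assert (0 < a ^ 2) by (apply pow_lt; lra).
  assert (0 <= u1 0 ^ 2 * a ^ 2) by (apply Rmult_le_pos; lra).
  destruct nz as [nz|nz]; apply pow2_gt_0 in nz; [lra|].
  assert (0 < u1 0 ^ 2 * a ^ 2) by (apply Rmult_lt_0_compat; lra). lra. }
assert (u1a : u1 a ^ 2 <= 2 * al ^ 2 * W).
{ assert (al ^ 2 * u 0 ^ 2 - u1 0 ^ 2 <= al ^ 2 * u a ^ 2 - u1 a ^ 2).
  { apply (incr_of_derive (fun t => al ^ 2 * u t ^ 2 - u1 t ^ 2) (fun t => al ^ 2 * (2 * (u t * u1 t)) - 2 * (u1 t * (Qp al lam t * u t)))); [lra| |].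
    - intros x _; apply (is_derive_minus (fun t => al ^ 2 * u t ^ 2) (fun t => u1 t ^ 2)).
      + apply is_derive_scal, sol_sq_derive, U.
      + apply (sol_sq_derive u1 (fun t => Qp al lam t * u t)), U.
    - intros x Hx. replace (al ^ 2 * (2 * (u x * u1 x)) - 2 * (u1 x * (Qp al lam x * u x))) with (2 * ((al ^ 2 - Qp al lam x) * p x)) by (unfold p; ring).
      assert (0 <= (al ^ 2 - Qp al lam x) * p x) by (apply Rmult_le_pos; [pose proof (Qb x ltac:(lra)); lra|apply p0; lra]). lra. }
  pose proof (pow2_ge_0 (u 0)). fold W in H. rewrite a2 in wlow.
  assert (16 * u1 0 ^ 2 <= al * u1 0 ^ 2) by (apply Rmult_le_compat_r; [apply pow2_ge_0|lra]).
  assert (1 * W <= al ^ 2 * W) by (apply Rmult_le_compat_r; nra).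
  assert (0 <= al ^ 2 * u 0 ^ 2) by (apply Rmult_le_pos; [apply pow2_ge_0|lra]).
  pose proof (pow2_ge_0 (u1 0)). lra. }
assert (pa : 2 * p a <= 4 * al * W).
{ assert (p a ^ 2 <= (2 * al * W) ^ 2).
  { unfold p; rewrite Rpow_mult_distr; fold W. assert (0 < al ^ 2) by (apply pow_lt; lra). nra. }
  assert (0 <= 2 * al * W) by nra. pose proof (p0 a ltac:(lra)). nra. }
(* The derivative of u^2 is at most 2 p(a) <= 4 al W on [0, a], so over a length 1/(8 al) next to a
   the square loses at most W/2. *)
set (b := a - 1 / (8 * al)).
assert (i8 : 0 < 1 / (8 * al) <= 1).
{ split; [apply Rdiv_lt_0_compat; lra|]. apply Rmult_le_reg_r with (8 * al); [lra|]. replace (1 / (8 * al) * (8 * al)) with 1 by (field; lra). lra. }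
assert (whalf : forall t, b <= t <= a -> W / 2 <= u t ^ 2).
{ intros t Ht. assert (bt : 0 <= a - t <= 1 / (8 * al)) by (unfold b in Ht; lra).
  assert (b0 : 0 <= t) by (unfold b in Ht; lra).
  assert (pa0 := p0 a ltac:(lra)).
  assert (P : (a - t) * (2 * p a) <= 1 / (8 * al) * (4 * al * W)) by (apply Rmult_le_compat; lra).
  replace (1 / (8 * al) * (4 * al * W)) with (W / 2) in P by (field; lra).
  assert (- (u t ^ 2 - 2 * p a * t) <= - (u a ^ 2 - 2 * p a * a)); [|fold W in H; lra].
  apply (incr_of_derive (fun t => - (u t ^ 2 - 2 * p a * t)) (fun t => - (2 * (u t * u1 t) - 2 * p a))); [lra| |].
  - intros x _; apply (is_derive_opp (fun t => u t ^ 2 - 2 * p a * t)).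
    apply (is_derive_minus (fun t => u t ^ 2) (fun t => 2 * p a * t)); [apply sol_sq_derive, U|auto_derive; auto; ring].
  - intros x Hx; assert (p x <= p a) by (apply p_inc; lra). unfold p in *; lra. }
assert (B := deep_well_bound al lam u u1 a U Fu Fu1 H0 ltac:(lra) ltac:(lra)).
assert (SQ : slow (Qp al lam)) by (unfold Qp, qM; sf).
assert (FQ : fast (fun t => Qp al lam t * u t ^ 2)) by sf.
assert (L : 3 / 10 * al ^ 2 * (W / 2) * (1 / (8 * al)) <= RInt (fun t => Qp al lam t * u t ^ 2) 0 a).
{ rewrite <- (RInt_Chasles _ 0 b a); [|apply fast_ex_RInt; auto; unfold b; lra|apply fast_ex_RInt; auto; unfold b; lra].
  unfold plus; simpl.
  assert (0 <= RInt (fun t => Qp al lam t * u t ^ 2) 0 b).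
  { apply RInt_ge_0; [unfold b; lra|apply fast_ex_RInt; auto; unfold b; lra|]. intros x Hx; apply dp0; unfold b in Hx; lra. }
  assert (3 / 10 * al ^ 2 * (W / 2) * (1 / (8 * al)) <= RInt (fun t => Qp al lam t * u t ^ 2) b a); [|simpl in *; lra].
  replace (3 / 10 * al ^ 2 * (W / 2) * (1 / (8 * al))) with (RInt (fun _ => 3 / 10 * al ^ 2 * (W / 2)) b a).
  - apply RInt_le; [unfold b; lra|apply ex_RInt_const|apply fast_ex_RInt; auto; unfold b; lra|].
    intros x Hx. assert (0 <= 3 / 10 * al ^ 2) by (pose proof (pow2_ge_0 al); lra).
    apply Rmult_le_compat; [auto|lra|apply Qb; unfold b in Hx; lra|apply whalf; lra].
  - rewrite RInt_const; unfold scal; simpl; unfold mult; simpl. unfold b; field; lra. }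
apply Rle_lt_trans with (1 := B).
fold W.
assert (L2 : / a ^ 2 * (3 / 10 * al ^ 2 * (W / 2) * (1 / (8 * al))) <= / a ^ 2 * RInt (fun t => Qp al lam t * u t ^ 2) 0 a).
{ apply Rmult_le_compat_l; auto. left; apply Rinv_0_lt_compat, pow_lt; lra. }
assert (W / (4 * a ^ 3) < / a ^ 2 * (3 / 10 * al ^ 2 * (W / 2) * (1 / (8 * al)))); [|lra].
replace (/ a ^ 2 * (3 / 10 * al ^ 2 * (W / 2) * (1 / (8 * al)))) with (W / (4 * a ^ 3) * (3 / 40 * (al * a))) by (field; lra).
assert (0 < W / (4 * a ^ 3)).
{ apply Rdiv_lt_0_compat; auto. assert (0 < a ^ 3) by (apply pow_lt; lra). lra. }
assert (1 < 3 / 40 * (al * a)) by nra.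
nra.
Qed.

(** * The classical multiplier *)

Lemma locally_Rabs (x : R) (P : R -> Prop) d : 0 < d -> (forall z, Rabs (z - x) < d -> P z) -> locally x P.
Proof. intros Hd H; exists (mkposreal d Hd); intros z Hz; apply H; exact Hz. Qed.

Lemma locally_gt (x a : R) : a < x -> locally x (fun z => a < z).
Proof. intros H; apply locally_Rabs with (x - a); [lra|]; intros z Hz; apply Rabs_def2 in Hz; lra. Qed.

Section Param.
Variables (be : R) (K K1 : R -> R) (n : nat).
Hypothesis HK : forall s, - be < s -> is_derive K s (K1 s).
Hypothesis HK1 : forall s, - be < s -> continuous K1 s.
Hypothesis be1 : be < 1.
Hypothesis be0 : 0 < be.

Lemma param_arg y t : - be < y -> 0 <= t <= 1 -> - be < 1 - (1 - y) * t ^ 2.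
Proof. intros Hy Ht; assert (0 <= t ^ 2 <= 1) by nra. destruct (Rle_dec y 1); nra. Qed.

Lemma param_cont y : - be < y -> forall t, 0 <= t <= 1 -> continuous (fun t => t ^ n * K (1 - (1 - y) * t ^ 2)) t.
Proof.
intros Hy t Ht; apply (continuous_mult (fun t => t ^ n) (fun t => K (1 - (1 - y) * t ^ 2))).
- apply (ex_derive_continuous (fun t => t ^ n)); auto_derive; auto.
- apply (continuous_comp (fun t => 1 - (1 - y) * t ^ 2) K).
  + apply (ex_derive_continuous (fun t => 1 - (1 - y) * t ^ 2)); auto_derive; auto.
  + apply (is_derive_cont K _ (K1 (1 - (1 - y) * t ^ 2))), HK, param_arg; auto.
Qed.

Lemma param_derive_pt y t : - be < 1 - (1 - y) * t ^ 2 ->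
  is_derive (fun y => t ^ n * K (1 - (1 - y) * t ^ 2)) y (t ^ (n + 2) * K1 (1 - (1 - y) * t ^ 2)).
Proof.
intros H; rewrite pow_add.
replace (t ^ n * t ^ 2 * K1 (1 - (1 - y) * t ^ 2)) with (t ^ n * (t ^ 2 * K1 (1 - (1 - y) * t ^ 2))) by ring.
apply is_derive_scal.
apply (is_derive_comp K (fun y => 1 - (1 - y) * t ^ 2) y (K1 (1 - (1 - y) * t ^ 2)) (t ^ 2)); auto.
auto_derive; auto; ring.
Qed.

Lemma param_derive y : - be < y ->
  is_derive (fun y => RInt (fun t => t ^ n * K (1 - (1 - y) * t ^ 2)) 0 1) y
    (RInt (fun t => t ^ (n + 2) * K1 (1 - (1 - y) * t ^ 2)) 0 1).
Proof.
intros Hy.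
rewrite <- (RInt_ext (fun t => Derive (fun u => t ^ n * K (1 - (1 - u) * t ^ 2)) y)).
2:{ intros t Ht; rewrite Rmin_left, Rmax_right in Ht by lra; apply is_derive_unique, param_derive_pt, param_arg; auto; lra. }
apply (is_derive_RInt_param (fun y t => t ^ n * K (1 - (1 - y) * t ^ 2)) 0 1 y).
- apply (filter_imp (fun z => - be < z)); [|now apply locally_gt].
  intros z Hz t Ht; rewrite Rmin_left, Rmax_right in Ht by lra.
  eexists; apply param_derive_pt, param_arg; auto.
- intros t Ht; rewrite Rmin_left, Rmax_right in Ht by lra.
  assert (C2 : forall u v, continuity_2d_pt (fun u v => 1 - (1 - u) * v ^ 2) u v).
  { intros u v; apply continuity_2d_pt_ext with (fun u v => 1 - (1 - u) * (v * v)); [intros; ring|].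
    apply continuity_2d_pt_minus; [apply continuity_2d_pt_const|].
    apply continuity_2d_pt_mult; [|apply continuity_2d_pt_mult; apply continuity_2d_pt_id2].
    apply continuity_2d_pt_minus; [apply continuity_2d_pt_const|apply continuity_2d_pt_id1]. }
  assert (pos : - be < 1 - (1 - y) * t ^ 2) by (apply param_arg; auto).
  apply continuity_2d_pt_ext_loc with (fun u v => v ^ (n + 2) * K1 (1 - (1 - u) * v ^ 2)).
  + destruct (C2 y t (mkposreal (1 - (1 - y) * t ^ 2 + be) ltac:(lra))) as [d Hd].
    exists d; intros u v Hu Hv; symmetry; apply is_derive_unique, param_derive_pt.
    specialize (Hd u v Hu Hv); simpl in Hd; apply Rabs_def2 in Hd; simpl; lra.
  + apply continuity_2d_pt_mult.
    * apply (continuity_1d_2d_pt_comp (fun v => v ^ (n + 2)) (fun _ v => v)); [|apply continuity_2d_pt_id2].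
      apply continuity_pt_filterlim, (ex_derive_continuous (fun v => v ^ (n + 2))); auto_derive; auto.
    * apply (continuity_1d_2d_pt_comp K1 (fun u v => 1 - (1 - u) * v ^ 2)); auto.
      apply continuity_pt_filterlim, HK1; auto.
- apply (filter_imp (fun z => - be < z)); [|now apply locally_gt].
  intros z Hz; apply (ex_RInt_continuous (V := R_CompleteNormedModule)).
  intros t Ht; rewrite Rmin_left, Rmax_right in Ht by lra; apply param_cont; auto.
Qed.
End Param.

Section Multiplier.
Variable be : R.
Hypothesis be0 : 0 < be.
Hypothesis be1 : be < 1.

(* Solving (1 - y^2) P' = gm + 3 x y P from the turning point y = 1 gives
   P = x (1 + y)^(-3/2) S(y) with (1 - y) S' = (3/2) S - Rf, whence the integral [Sf] below. *)
Definition Rf (s : R) : R := sqrt (1 + s) / sqrt (2 * (s + be)) ^ 3.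
(** Logarithmic derivative of [Rf], so that the successive derivatives of [Rf] are [Rf] times
    polynomials in [rho] and its derivatives. *)
Definition rho (s : R) : R := / (2 * (1 + s)) - 3 / (2 * (s + be)).
Definition rho1 (s : R) : R := - / (2 * (1 + s) ^ 2) + 3 / (2 * (s + be) ^ 2).
Definition rho2 (s : R) : R := / (1 + s) ^ 3 - 3 / (s + be) ^ 3.
Definition Rf1 (s : R) : R := Rf s * rho s.
Definition Rf2 (s : R) : R := Rf s * (rho s ^ 2 + rho1 s).
Definition Rf3 (s : R) : R := Rf s * (rho s ^ 3 + 3 * rho s * rho1 s + rho2 s).

Lemma Rf_pos s : - be < s -> 0 < Rf s.
Proof. intros Hs; unfold Rf; apply Rdiv_lt_0_compat; [apply sqrt_lt_R0; lra|apply pow_lt, sqrt_lt_R0; lra]. Qed.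

Lemma Rf_derive s : - be < s -> is_derive Rf s (Rf1 s).
Proof.
intros Hs; unfold Rf1, rho.
set (v := sqrt (1 + s)). set (w := sqrt (2 * (s + be))).
assert (vp : 0 < v) by (apply sqrt_lt_R0; lra). assert (wp : 0 < w) by (apply sqrt_lt_R0; lra).
assert (v2 : v * v = 1 + s) by (apply sqrt_sqrt; lra). assert (w2 : w * w = 2 * (s + be)) by (apply sqrt_sqrt; lra).
replace (Rf s * (/ (2 * (1 + s)) - 3 / (2 * (s + be)))) with
  ((/ (2 * v) * w ^ 3 - v * (3 * / w * w ^ 2)) / (w ^ 3) ^ 2).
2:{ unfold Rf; fold v w; rewrite <- v2, <- w2; field; lra. }
apply (is_derive_div (fun s => sqrt (1 + s)) (fun s => sqrt (2 * (s + be)) ^ 3)).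
- unfold v; auto_derive; [lra|]. field. fold v; lra.
- assert (D : is_derive (fun s => sqrt (2 * (s + be))) s (/ w)).
  { unfold w; auto_derive; [lra|]. field. fold w; lra. }
  replace (3 * / w * w ^ 2) with (INR 3 * / w * w ^ (pred 3)) by (simpl; ring).
  apply (is_derive_pow (fun s => sqrt (2 * (s + be))) 3 s (/ w)); auto.
- fold w; apply pow_nonzero; lra.
Qed.

Lemma rho_derive s : - be < s -> is_derive rho s (rho1 s).
Proof. intros Hs; unfold rho, rho1; auto_derive; [split; [lra|split; [lra|auto]]|field; lra]. Qed.

Lemma rho1_derive s : - be < s -> is_derive rho1 s (rho2 s).
Proof.
intros Hs; unfold rho1, rho2; auto_derive; [|field; lra].
split; [|split; auto]; apply Rmult_integral_contrapositive_currified; try lra;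
repeat apply Rmult_integral_contrapositive_currified; lra.
Qed.

Lemma Rf1_derive s : - be < s -> is_derive Rf1 s (Rf2 s).
Proof.
intros Hs; unfold Rf1.
replace (Rf2 s) with (Rf1 s * rho s + Rf s * rho1 s) by (unfold Rf2, Rf1; ring).
apply (is_derive_mult Rf rho); [now apply Rf_derive|now apply rho_derive|intros; apply Rmult_comm].
Qed.

Lemma Rf2_derive s : - be < s -> is_derive Rf2 s (Rf3 s).
Proof.
intros Hs; unfold Rf2.
replace (Rf3 s) with (Rf1 s * (rho s ^ 2 + rho1 s) + Rf s * (2 * rho s * rho1 s + rho2 s)) by (unfold Rf3, Rf1; ring).
apply (is_derive_mult Rf (fun s => rho s ^ 2 + rho1 s)); [now apply Rf_derive| |intros; apply Rmult_comm].
apply (is_derive_plus (fun s => rho s ^ 2) rho1); [|now apply rho1_derive].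
replace (2 * rho s * rho1 s) with (INR 2 * rho1 s * rho s ^ (pred 2)) by (simpl; ring).
apply (is_derive_pow rho 2); now apply rho_derive.
Qed.

Lemma Rf3_cont s : - be < s -> continuous Rf3 s.
Proof.
intros Hs; unfold Rf3; apply (continuous_mult Rf); [eapply is_derive_cont, Rf_derive; auto|].
apply (ex_derive_continuous (fun s => rho s ^ 3 + 3 * rho s * rho1 s + rho2 s)).
assert (ex_derive rho s) by (eexists; apply rho_derive; auto).
assert (ex_derive rho1 s) by (eexists; apply rho1_derive; auto).
assert (ex_derive rho2 s).
{ unfold rho2; auto_derive. split; [|split; auto]; repeat apply Rmult_integral_contrapositive_currified; lra. }
auto_derive; auto.
Qed.

(** This is (1 - y)^(-3/2) times the integral of (1 - s)^(1/2) Rf(s) from y to 1, after s = 1 - (1 -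
    y) t^2. In this form it makes sense and is smooth on both sides of y = 1; any other solution of
    [Sf_ode] differs by a multiple of (1 - y)^(-3/2) and blows up. *)
Definition Sf (y : R) : R := 2 * RInt (fun t => t ^ 2 * Rf (1 - (1 - y) * t ^ 2)) 0 1.
Definition Sf1 (y : R) : R := 2 * RInt (fun t => t ^ 4 * Rf1 (1 - (1 - y) * t ^ 2)) 0 1.
Definition Sf2 (y : R) : R := 2 * RInt (fun t => t ^ 6 * Rf2 (1 - (1 - y) * t ^ 2)) 0 1.

Lemma Sf_derive y : - be < y -> is_derive Sf y (Sf1 y).
Proof.
intros Hy; apply is_derive_scal, (param_derive be Rf Rf1 2); auto.
- apply Rf_derive.
- intros s Hs; eapply is_derive_cont, Rf1_derive; auto.
Qed.

Lemma Sf1_derive y : - be < y -> is_derive Sf1 y (Sf2 y).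
Proof.
intros Hy; apply is_derive_scal, (param_derive be Rf1 Rf2 4); auto.
- apply Rf1_derive.
- intros s Hs; eapply is_derive_cont, Rf2_derive; auto.
Qed.

Lemma Sf2_cont y : - be < y -> continuous Sf2 y.
Proof.
intros Hy; eapply is_derive_cont, is_derive_scal, (param_derive be Rf2 Rf3 6); auto.
- apply Rf2_derive.
- apply Rf3_cont.
Qed.

(** Integration by parts: integrate over [0, 1] the derivative in t of t^3 Rf(1 - (1 - y) t^2). *)
Lemma Sf_ode y : - be < y -> (1 - y) * Sf1 y = 3 / 2 * Sf y - Rf y.
Proof.
intros Hy; unfold Sf, Sf1.
set (A := fun t => t ^ 2 * Rf (1 - (1 - y) * t ^ 2)). set (B := fun t => t ^ 4 * Rf1 (1 - (1 - y) * t ^ 2)).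
assert (cA : forall t, 0 <= t <= 1 -> continuous A t).
{ intros t Ht; apply (param_cont be Rf Rf1 2); auto; apply Rf_derive. }
assert (cB : forall t, 0 <= t <= 1 -> continuous B t).
{ intros t Ht; apply (param_cont be Rf1 Rf2 4); auto; apply Rf1_derive. }
assert (I : is_RInt (fun t => 3 * A t - 2 * (1 - y) * B t) 0 1
   (minus (1 ^ 3 * Rf (1 - (1 - y) * 1 ^ 2)) (0 ^ 3 * Rf (1 - (1 - y) * 0 ^ 2)))).
{ apply (is_RInt_derive (fun t => t ^ 3 * Rf (1 - (1 - y) * t ^ 2))).
  - intros t Ht; rewrite Rmin_left, Rmax_right in Ht by lra.
    replace (3 * A t - 2 * (1 - y) * B t) with
     (3 * t ^ 2 * Rf (1 - (1 - y) * t ^ 2) + t ^ 3 * (- (1 - y) * (2 * t) * Rf1 (1 - (1 - y) * t ^ 2)))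
     by (unfold A, B; ring).
    apply (is_derive_mult (fun t => t ^ 3) (fun t => Rf (1 - (1 - y) * t ^ 2))); [auto_derive; auto; ring| |intros; apply Rmult_comm].
    apply (is_derive_comp Rf (fun t => 1 - (1 - y) * t ^ 2)); [apply Rf_derive, param_arg; auto|auto_derive; auto; ring].
  - intros t Ht; rewrite Rmin_left, Rmax_right in Ht by lra.
    apply (continuous_minus (fun t => 3 * A t) (fun t => 2 * (1 - y) * B t)).
    + apply (continuous_scal_r 3 A); auto.
    + apply (continuous_scal_r (2 * (1 - y)) B); auto. }
assert (eA : ex_RInt A 0 1) by (apply (ex_RInt_continuous (V := R_CompleteNormedModule)); intros t Ht; rewrite Rmin_left, Rmax_right in Ht by lra; auto).
assert (eB : ex_RInt B 0 1) by (apply (ex_RInt_continuous (V := R_CompleteNormedModule)); intros t Ht; rewrite Rmin_left, Rmax_right in Ht by lra; auto).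
assert (J : is_RInt (fun t => 3 * A t - 2 * (1 - y) * B t) 0 1 (minus (3 * RInt A 0 1) (2 * (1 - y) * RInt B 0 1))).
{ apply (is_RInt_minus (fun t => 3 * A t) (fun t => 2 * (1 - y) * B t)).
  - apply (is_RInt_scal A 0 1 3), (RInt_correct (V := R_CompleteNormedModule)), eA.
  - apply (is_RInt_scal B 0 1 (2 * (1 - y))), (RInt_correct (V := R_CompleteNormedModule)), eB. }
assert (I' := is_RInt_unique _ _ _ _ I); assert (J' := is_RInt_unique _ _ _ _ J); rewrite I' in J'; clear I J; rename J' into J.
unfold minus, plus, opp in J; simpl in J.
replace (1 - (1 - y) * (1 * (1 * 1))) with y in J by ring. lra.
Qed.

Lemma Sf_pos y : - be < y -> 0 < Sf y.
Proof.
intros Hy; unfold Sf; apply Rmult_lt_0_compat; [lra|].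
apply RInt_gt_0; [lra| |].
- intros t Ht; apply Rmult_lt_0_compat; [apply pow_lt; lra|apply Rf_pos, param_arg; auto; lra].
- intros t Ht; apply (param_cont be Rf Rf1 2); auto; apply Rf_derive.
Qed.

(** For s >= 1, Rf(s) <= 1/(2 s), and t^2/(2 s) <= 1/(1 + y) when s = 1 - (1 - y) t^2. This is the
    source of the decay of the multiplier at infinity. *)
Lemma Sf_bound y : 1 <= y -> Sf y * (1 + y) <= 2.
Proof.
intros Hy; unfold Sf.
assert (RInt (fun t => t ^ 2 * Rf (1 - (1 - y) * t ^ 2)) 0 1 <= RInt (fun _ => / (1 + y)) 0 1).
{ apply RInt_le; [lra| |apply ex_RInt_const|].
  - apply (ex_RInt_continuous (V := R_CompleteNormedModule)); intros t Ht; rewrite Rmin_left, Rmax_right in Ht by lra.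
    apply (param_cont be Rf Rf1 2); auto; [apply Rf_derive|lra].
  - intros t Ht. set (s := 1 - (1 - y) * t ^ 2).
    assert (t2 : 0 < t ^ 2 <= 1) by nra.
    assert (s1 : 1 <= s) by (unfold s; nra).
    assert (Rs : Rf s <= / (2 * s)).
    { unfold Rf. set (w := sqrt (2 * (s + be))).
      assert (wp : 0 < w) by (apply sqrt_lt_R0; lra).
      assert (w2 : w * w = 2 * (s + be)) by (apply sqrt_sqrt; lra).
      assert (sqrt (1 + s) <= w) by (apply sqrt_le_1_alt; lra).
      apply Rle_trans with (/ (w * w)).
      - replace (/ (w * w)) with (w / w ^ 3) by (field; lra).
        apply Rmult_le_compat_r; auto. left; apply Rinv_0_lt_compat, pow_lt; auto.
      - apply Rinv_le_contravar; lra. }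
    apply Rle_trans with (t ^ 2 * / (2 * s)); [apply Rmult_le_compat_l; lra|].
    apply Rmult_le_reg_r with (2 * s * (1 + y)); [nra|].
    replace (t ^ 2 * / (2 * s) * (2 * s * (1 + y))) with (t ^ 2 * (1 + y)) by (field; lra).
    replace (/ (1 + y) * (2 * s * (1 + y))) with (2 * s) by (field; lra). unfold s in *; nra. }
rewrite RInt_const in H; unfold scal in H; simpl in H; unfold mult in H; simpl in H.
replace ((1 - 0) * / (1 + y)) with (/ (1 + y)) in H by ring.
apply Rmult_le_compat_r with (r := 2 * (1 + y)) in H; [|lra].
replace (/ (1 + y) * (2 * (1 + y))) with 2 in H by (field; lra). simpl in *; lra.
Qed.

(** In the scaled problem at energy 1, [yy] is the signed root of the potential, [p2] the squared
    classical momentum and [xp] the turning point. *)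
Definition yy (x : R) : R := x ^ 2 / 2 - be.
Definition p2 (x : R) : R := 1 - yy x ^ 2.
Definition xp : R := sqrt (2 * (1 + be)).
Definition qq (x : R) : R := sqrt (1 + yy x).
(** Equal to both (1 + x gm) / (1 - y^2) and gm' / y, and smooth where these quotients
    degenerate. *)
Definition Pm (x : R) : R := x * Sf (yy x) / qq x ^ 3.
Definition Pm1 (x : R) : R := Sf (yy x) / qq x ^ 3 + x ^ 2 * Sf1 (yy x) / qq x ^ 3 - 3 / 2 * x ^ 2 * Sf (yy x) / qq x ^ 5.
Definition Pm2 (x : R) : R := 3 * x * Sf1 (yy x) / qq x ^ 3 + x ^ 3 * Sf2 (yy x) / qq x ^ 3
  - 9 / 2 * x * Sf (yy x) / qq x ^ 5 - 3 * x ^ 3 * Sf1 (yy x) / qq x ^ 5 + 15 / 4 * x ^ 3 * Sf (yy x) / qq x ^ 7.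
(* [gm] solves (1 - y^2) gm' = y (1 + x gm) and is smooth across the turning point [xp];
   it vanishes at 0 under the zero-flux condition [Zcond] below. *)
Definition gm (x : R) : R := (p2 x * Pm x - 1) / x.

Lemma yy_derive x : is_derive yy x x.
Proof. unfold yy; auto_derive; auto; field. Qed.

Lemma yy_gt x : 0 < x -> - be < yy x.
Proof. intros Hx; unfold yy; assert (0 < x ^ 2) by (apply pow_lt; auto); lra. Qed.

Lemma yy_ge x : - be <= yy x.
Proof. unfold yy; pose proof (pow2_ge_0 x); lra. Qed.

Lemma qq_pos x : 0 < qq x.
Proof. apply sqrt_lt_R0; pose proof (yy_ge x); lra. Qed.

Lemma qq_sq x : qq x ^ 2 = 1 + yy x.
Proof. unfold qq; rewrite pow2_sqrt; auto; pose proof (yy_ge x); lra. Qed.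

Lemma qq_derive x : is_derive qq x (x / (2 * qq x)).
Proof.
pose proof (yy_ge x). unfold qq, yy in *; auto_derive; [lra|].
assert (0 < sqrt (1 + (x ^ 2 / 2 - be))) by (apply sqrt_lt_R0; lra).
replace (x * (x * 1)) with (x ^ 2) by ring. unfold Rdiv, Rminus in *; field; lra.
Qed.

Lemma qqinv_derive x n : is_derive (fun x => / qq x ^ n) x (- (INR n / 2) * x * / qq x ^ (n + 2)).
Proof.
pose proof (qq_pos x).
replace (- (INR n / 2) * x * / qq x ^ (n + 2)) with (- (INR n * (x / (2 * qq x)) * qq x ^ (pred n)) / (qq x ^ n) ^ 2).
- apply (is_derive_inv (fun x => qq x ^ n)).
  + apply (is_derive_pow qq n x), qq_derive.
  + apply pow_nonzero; lra.
- destruct n as [|n]; [simpl; field; lra|].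
  rewrite pow_add; simpl pred; change (qq x ^ S n) with (qq x * qq x ^ n). field.
  split; try lra; apply pow_nonzero; lra.
Qed.

Lemma Sfy_derive x : 0 < x -> is_derive (fun x => Sf (yy x)) x (x * Sf1 (yy x)).
Proof. intros Hx; apply (is_derive_comp Sf yy); [apply Sf_derive, yy_gt; auto|apply yy_derive]. Qed.

Lemma Sf1y_derive x : 0 < x -> is_derive (fun x => Sf1 (yy x)) x (x * Sf2 (yy x)).
Proof. intros Hx; apply (is_derive_comp Sf1 yy); [apply Sf1_derive, yy_gt; auto|apply yy_derive]. Qed.

Lemma monom_derive c k (f f1 : R -> R) n x : is_derive f x (x * f1 x) ->
  is_derive (fun x => c * x ^ k * f x / qq x ^ n) x
   ((c * (INR k * x ^ pred k) * f x + c * x ^ k * (x * f1 x)) / qq x ^ n + c * x ^ k * f x * (- (INR n / 2) * x * / qq x ^ (n + 2))).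
Proof.
intros H.
apply (is_derive_mult (fun x => c * x ^ k * f x) (fun x => / qq x ^ n)); [|apply qqinv_derive|intros; apply Rmult_comm].
apply (is_derive_mult (fun x => c * x ^ k) f); auto; [|intros; apply Rmult_comm].
auto_derive; auto; ring.
Qed.

Lemma Pm_derive x : 0 < x -> is_derive Pm x (Pm1 x).
Proof.
intros Hx; pose proof (qq_pos x).
apply is_derive_ext with (fun x => 1 * x ^ 1 * Sf (yy x) / qq x ^ 3); [intros z; unfold Pm; simpl; unfold Rdiv; ring|].
assert (D := monom_derive 1 1 (fun x => Sf (yy x)) (fun x => Sf1 (yy x)) 3 x (Sfy_derive x Hx)).
match type of D with is_derive _ _ ?l => replace (Pm1 x) with l; [exact D|] end.
unfold Pm1; simpl; field; lra.
Qed.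

Lemma Pm1_derive x : 0 < x -> is_derive Pm1 x (Pm2 x).
Proof.
intros Hx; pose proof (qq_pos x).
apply is_derive_ext with (fun x => 1 * x ^ 0 * Sf (yy x) / qq x ^ 3 + 1 * x ^ 2 * Sf1 (yy x) / qq x ^ 3 + (- (3 / 2)) * x ^ 2 * Sf (yy x) / qq x ^ 5);
  [intros z; unfold Pm1; simpl; unfold Rdiv; ring|].
assert (D1 := monom_derive 1 0 (fun x => Sf (yy x)) (fun x => Sf1 (yy x)) 3 x (Sfy_derive x Hx)).
assert (D2 := monom_derive 1 2 (fun x => Sf1 (yy x)) (fun x => Sf2 (yy x)) 3 x (Sf1y_derive x Hx)).
assert (D3 := monom_derive (- (3 / 2)) 2 (fun x => Sf (yy x)) (fun x => Sf1 (yy x)) 5 x (Sfy_derive x Hx)).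
assert (D := is_derive_plus _ _ _ _ _ (is_derive_plus _ _ _ _ _ D1 D2) D3).
match type of D with is_derive _ _ ?l => replace (Pm2 x) with l; [exact D|] end.
unfold Pm2, plus; simpl; field; lra.
Qed.

Lemma Pm2_cont x : 0 < x -> continuous Pm2 x.
Proof.
intros Hx; pose proof (qq_pos x).
assert (c2 : continuous (fun x => Sf2 (yy x)) x).
{ apply (continuous_comp yy Sf2); [eapply is_derive_cont, yy_derive|apply Sf2_cont, yy_gt; auto]. }
assert (e0 : ex_derive (fun x => Sf x) (yy x)) by (eexists; apply Sf_derive, yy_gt; auto).
assert (e2 : ex_derive (fun x => yy x) x) by (eexists; apply yy_derive).
assert (e1 : ex_derive (fun x => Sf1 x) (yy x)) by (eexists; apply Sf1_derive, yy_gt; auto).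
assert (eq1 : ex_derive (fun x => qq x) x) by (eexists; apply qq_derive).
apply (continuous_ext (fun x => (3 * x * Sf1 (yy x) / qq x ^ 3 - 9 / 2 * x * Sf (yy x) / qq x ^ 5 - 3 * x ^ 3 * Sf1 (yy x) / qq x ^ 5 + 15 / 4 * x ^ 3 * Sf (yy x) / qq x ^ 7) + (x ^ 3 / qq x ^ 3) * Sf2 (yy x))).
{ intros z; unfold Pm2, Rdiv; simpl; ring. }
assert (N : forall n, qq x ^ n <> 0) by (intros n; apply pow_nonzero; lra).
apply (continuous_plus (fun x => 3 * x * Sf1 (yy x) / qq x ^ 3 - 9 / 2 * x * Sf (yy x) / qq x ^ 5 - 3 * x ^ 3 * Sf1 (yy x) / qq x ^ 5 + 15 / 4 * x ^ 3 * Sf (yy x) / qq x ^ 7) (fun x => (x ^ 3 / qq x ^ 3) * Sf2 (yy x))).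
- apply (ex_derive_continuous (fun x => 3 * x * Sf1 (yy x) / qq x ^ 3 - 9 / 2 * x * Sf (yy x) / qq x ^ 5 - 3 * x ^ 3 * Sf1 (yy x) / qq x ^ 5 + 15 / 4 * x ^ 3 * Sf (yy x) / qq x ^ 7)).
  auto_derive; repeat split; auto; try apply (N 3%nat); try apply (N 5%nat); try apply (N 7%nat).
- apply (continuous_mult (fun x => x ^ 3 / qq x ^ 3)); auto.
  apply (ex_derive_continuous (fun x => x ^ 3 / qq x ^ 3)). auto_derive; repeat split; auto; apply (N 3%nat).
Qed.

Lemma Rf_yy x : 0 < x -> Rf (yy x) = qq x / x ^ 3.
Proof.
intros Hx; unfold Rf, qq. replace (2 * (yy x + be)) with (x ^ 2) by (unfold yy; field).
replace (sqrt (x ^ 2)) with x; auto. replace (x ^ 2) with (x * x) by ring; rewrite sqrt_square; lra.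
Qed.

Lemma Pm_ode x : 0 < x -> x * p2 x * Pm1 x = (p2 x + 3 * x ^ 2 * yy x) * Pm x - 1.
Proof.
intros Hx; pose proof (qq_pos x). pose proof (qq_sq x) as Q2.
assert (O := Sf_ode (yy x) (yy_gt x Hx)). rewrite Rf_yy in O by auto.
assert (Ey : yy x = qq x ^ 2 - 1) by lra.
unfold Pm1, Pm, p2.
replace (x * (1 - yy x ^ 2) * (Sf (yy x) / qq x ^ 3 + x ^ 2 * Sf1 (yy x) / qq x ^ 3 - 3 / 2 * x ^ 2 * Sf (yy x) / qq x ^ 5))
 with ((1 + yy x) * (x * (1 - yy x) * Sf (yy x) / qq x ^ 3 + x ^ 3 * ((1 - yy x) * Sf1 (yy x)) / qq x ^ 3 - 3 / 2 * x ^ 3 * (1 - yy x) * Sf (yy x) / qq x ^ 5))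
 by (field; lra).
rewrite O. set (S := Sf (yy x)). rewrite Ey. field. split; lra.
Qed.

Lemma gm_eq x : 0 < x -> 1 + x * gm x = p2 x * Pm x.
Proof. intros Hx; unfold gm; field; lra. Qed.

Lemma p2_derive x : is_derive p2 x (- 2 * yy x * x).
Proof. unfold p2, yy; auto_derive; auto; field. Qed.

Lemma Pm1_eq x : 0 < x -> p2 x * Pm1 x = gm x + 3 * x * yy x * Pm x.
Proof.
intros Hx; assert (O := Pm_ode x Hx); assert (E := gm_eq x Hx).
apply Rmult_eq_reg_l with x; [|lra]. nra.
Qed.

Lemma gm_derive x : 0 < x -> is_derive gm x (yy x * Pm x).
Proof.
intros Hx; unfold gm.
replace (yy x * Pm x) with (((- 2 * yy x * x * Pm x + p2 x * Pm1 x - 0) * x - (p2 x * Pm x - 1) * 1) / x ^ 2).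
- apply (is_derive_div (fun x => p2 x * Pm x - 1) (fun x => x)); [|apply (is_derive_id x)|lra].
  apply (is_derive_minus (fun x => p2 x * Pm x) (fun _ => 1)); [|apply (is_derive_const 1)].
  apply (is_derive_mult p2 Pm); [apply p2_derive|apply Pm_derive; auto|intros; apply Rmult_comm].
- assert (O := Pm_ode x Hx).
  replace ((- 2 * yy x * x * Pm x + p2 x * Pm1 x - 0) * x - (p2 x * Pm x - 1) * 1) with
   (- 2 * yy x * x ^ 2 * Pm x + x * p2 x * Pm1 x - p2 x * Pm x + 1) by ring.
  rewrite O; field; lra.
Qed.

(** Differentiate both sides of [Pm1_eq]. Together with [gm_eq] and [Pm1_eq] it expresses everything
    through lower order terms divided by [p2], which bounds the derivatives wherever [p2] is away
    from 0. *)
Lemma Pm2_eq x : 0 < x -> p2 x * Pm2 x = 4 * yy x * Pm x + 3 * x ^ 2 * Pm x + 5 * x * yy x * Pm1 x.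
Proof.
intros Hx.
assert (D1 : is_derive (fun x => p2 x * Pm1 x) x (- 2 * yy x * x * Pm1 x + p2 x * Pm2 x)).
{ apply (is_derive_mult p2 Pm1); [apply p2_derive|apply Pm1_derive; auto|intros; apply Rmult_comm]. }
assert (D2 : is_derive (fun x => gm x + 3 * x * yy x * Pm x) x (yy x * Pm x + ((3 * yy x + 3 * x * x) * Pm x + 3 * x * yy x * Pm1 x))).
{ apply (is_derive_plus gm (fun x => 3 * x * yy x * Pm x)); [apply gm_derive; auto|].
  apply (is_derive_mult (fun x => 3 * x * yy x) Pm); [|apply Pm_derive; auto|intros; apply Rmult_comm].
  replace (3 * yy x + 3 * x * x) with (3 * yy x + 3 * x * x) by ring.
  apply (is_derive_mult (fun x => 3 * x) yy); [auto_derive; auto; ring|apply yy_derive|intros; apply Rmult_comm]. }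
assert (E : - 2 * yy x * x * Pm1 x + p2 x * Pm2 x = yy x * Pm x + ((3 * yy x + 3 * x * x) * Pm x + 3 * x * yy x * Pm1 x)); [|lra].
apply is_derive_unique in D1; apply is_derive_unique in D2; rewrite <- D1, <- D2.
apply Derive_ext_loc. apply (filter_imp (fun z => 0 < z)); [|now apply locally_gt].
intros z Hz; now apply Pm1_eq.
Qed.

Lemma Pm_pos x : 0 < x -> 0 < Pm x.
Proof.
intros Hx; unfold Pm; apply Rdiv_lt_0_compat; [|apply pow_lt, qq_pos].
apply Rmult_lt_0_compat; auto; apply Sf_pos, yy_gt; auto.
Qed.

Lemma Pm_bound_far x : 1 <= yy x -> 0 < x -> (1 + yy x ^ 2) * Pm x <= 4.
Proof.
intros Hy Hx; pose proof (qq_pos x); pose proof (qq_sq x) as Q2.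
assert (B := Sf_bound (yy x) Hy). assert (Sp := Sf_pos (yy x) (yy_gt x Hx)).
assert (xq : x <= 2 * qq x).
{ apply Rsqr_incr_0_var; [|lra]. rewrite !Rsqr_pow2, Rpow_mult_distr, Q2. unfold yy; pose proof (pow2_ge_0 x); lra. }
assert (PB : Pm x <= 2 * Sf (yy x) / qq x ^ 2).
{ unfold Pm. replace (2 * Sf (yy x) / qq x ^ 2) with (2 * qq x * Sf (yy x) / qq x ^ 3) by (field; lra).
  apply Rmult_le_compat_r; [left; apply Rinv_0_lt_compat, pow_lt; auto|]. apply Rmult_le_compat_r; lra. }
rewrite Q2 in PB.
apply Rle_trans with ((1 + yy x ^ 2) * (2 * Sf (yy x) / (1 + yy x))).
- apply Rmult_le_compat_l; auto. pose proof (pow2_ge_0 (yy x)); lra.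
- apply Rmult_le_reg_r with (1 + yy x); [lra|].
  replace ((1 + yy x ^ 2) * (2 * Sf (yy x) / (1 + yy x)) * (1 + yy x)) with (2 * (1 + yy x ^ 2) * Sf (yy x)) by (field; lra).
  assert ((1 + yy x ^ 2) * Sf (yy x) <= (1 + yy x) * (Sf (yy x) * (1 + yy x))) by nra. nra.
Qed.
End Multiplier.

(** * Bounds on the multiplier *)

(** Relations divided by [p2] bound f near 0 and at infinity but degenerate at the turning point;
    that point lies in the middle region, where continuity on a compact interval suffices. *)
Lemma three_regions (f : R -> R) a X : 0 < a -> a <= X -> (forall x, 0 < x -> continuous f x) ->
  (exists C, forall x, 0 < x <= a -> Rabs (f x) <= C) -> (exists C, forall x, X <= x -> Rabs (f x) <= C) ->
  exists C, 1 <= C /\ forall x, 0 < x -> Rabs (f x) <= C.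
Proof.
intros Ha HX Hc [C1 H1] [C3 H3].
destruct (continuity_ab_maj (fun x => Rabs (f x)) a X HX) as [m [Hm _]].
{ intros c Hcc; apply continuity_pt_filterlim, (continuous_comp f Rabs); [apply Hc; lra|apply continuous_Rabs]. }
exists (1 + Rabs C1 + Rabs (f m) + Rabs C3).
pose proof (Rabs_pos C1); pose proof (Rabs_pos C3); pose proof (Rabs_pos (f m)).
pose proof (Rle_abs C1); pose proof (Rle_abs C3).
split; [lra|]; intros x Hx.
destruct (Rle_dec x a); [specialize (H1 x ltac:(lra)); lra|].
destruct (Rle_dec x X); [specialize (Hm x ltac:(lra)); cbv beta in Hm; lra|specialize (H3 x ltac:(lra)); lra].
Qed.

Lemma Rabs_le_mult a b A B : Rabs a <= A -> Rabs b <= B -> Rabs (a * b) <= A * B.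
Proof. intros; rewrite Rabs_mult; apply Rmult_le_compat; auto using Rabs_pos. Qed.

Lemma Rabs_le_plus a b A B : Rabs a <= A -> Rabs b <= B -> Rabs (a + b) <= A + B.
Proof. intros; eapply Rle_trans; [apply Rabs_triang|lra]. Qed.

Lemma Rabs_le_minus a b A B : Rabs a <= A -> Rabs b <= B -> Rabs (a - b) <= A + B.
Proof. intros; apply Rabs_le_plus; auto; now rewrite Rabs_Ropp. Qed.

Section Bounds.
Variable be : R.
Hypothesis be0 : 0 < be.
Hypothesis be1 : be < 1.
Let y := yy be.
Let P := Pm be.
Let P1 := Pm1 be.
Let P2 := Pm2 be.
Let g := gm be.
Let p := p2 be.
Let XP := xp be.

Definition Acl (be x : R) : R := RInt (fun s => yy be s / sqrt (p2 be s)) 0 x.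
(* int_0^xp y / sqrt (1 - y^2) = 0, as an improper integral; for be = 1 / sqrt E this is F E = 0. *)
Definition Zcond (be : R) : Prop := forall eps, 0 < eps -> exists d, 0 < d /\
  forall x, 0 < x -> xp be - d < x < xp be -> Rabs (Acl be x) < eps.

Lemma xp_sq : XP ^ 2 = 2 * (1 + be).
Proof. unfold XP, xp; apply pow2_sqrt; lra. Qed.

Lemma xp_pos : 0 < XP.
Proof. apply sqrt_lt_R0; lra. Qed.

Lemma xp_le2 : XP <= 2.
Proof. pose proof xp_sq; pose proof xp_pos; nra. Qed.

Lemma p2_pos x : - XP < x < XP -> 0 < p x.
Proof.
intros Hx; pose proof xp_sq; pose proof xp_pos; pose proof (yy_ge be x) as G.
assert (x ^ 2 < XP ^ 2) by nra.
unfold p, p2; assert (yy be x < 1) by (unfold yy; lra). nra.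
Qed.

Lemma p2_cont x : continuous p x.
Proof. eapply is_derive_cont, p2_derive. Qed.

Lemma sqrtp_derive x : - XP < x < XP -> is_derive (fun x => sqrt (p x)) x (- y x * x / sqrt (p x)).
Proof.
intros Hx; pose proof (p2_pos x Hx).
replace (- y x * x / sqrt (p x)) with ((-2 * y x * x) * / (2 * sqrt (p x))).
- apply (is_derive_comp sqrt p x (/ (2 * sqrt (p x))) (-2 * y x * x)).
  + apply is_derive_Reals, derivable_pt_lim_sqrt; auto.
  + apply p2_derive.
- assert (0 < sqrt (p x)) by (apply sqrt_lt_R0; auto). field; lra.
Qed.

Lemma Acl_integrand_cont x : - XP < x < XP -> continuous (fun s => y s / sqrt (p s)) x.
Proof.
intros Hx; pose proof (p2_pos x Hx). assert (0 < sqrt (p x)) by (apply sqrt_lt_R0; auto).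
apply (continuous_mult y (fun s => / sqrt (p s))).
- eapply is_derive_cont, yy_derive.
- eapply is_derive_cont, (is_derive_inv (fun s => sqrt (p s))); [apply sqrtp_derive; auto|lra].
Qed.

Lemma Acl_derive x : - XP < x < XP -> is_derive (Acl be) x (y x / sqrt (p x)).
Proof.
intros Hx; apply (is_derive_RInt (fun s => y s / sqrt (p s)) (Acl be) 0 x); [|now apply Acl_integrand_cont].
apply locally_Rabs with (Rmin (XP - x) (x + XP)); [apply Rmin_pos; lra|].
intros z Hz; apply (RInt_correct (V := R_CompleteNormedModule)), (ex_RInt_continuous (V := R_CompleteNormedModule)).
intros w Hw; apply Acl_integrand_cont. pose proof xp_pos.
pose proof (Rmin_l (XP - x) (x + XP)); pose proof (Rmin_r (XP - x) (x + XP)).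
apply Rabs_def2 in Hz.
assert (- XP < Rmin 0 z) by (apply Rmin_glb_lt; lra).
assert (Rmax 0 z < XP) by (apply Rmax_lub_lt; lra). lra.
Qed.

Hypothesis HZ : Zcond be.

(** Both sides have derivative y / sqrt p on (0, XP) and tend to 0 at the turning point: the left
    one because g is continuous there, the right one by [Zcond]. As [Acl] vanishes at 0, so does
    g. *)
Lemma gm_Acl x : 0 < x < XP -> g x * sqrt (p x) = Acl be x.
Proof.
intros Hx; pose proof xp_pos as Xp.
set (h := fun x => g x * sqrt (p x) - Acl be x).
assert (dh : forall z, 0 < z < XP -> is_derive h z 0).
{ intros z Hz; assert (pz := p2_pos z ltac:(lra)). assert (s0 : 0 < sqrt (p z)) by (apply sqrt_lt_R0; auto).
  replace 0 with ((y z * P z * sqrt (p z) + g z * (- y z * z / sqrt (p z))) - y z / sqrt (p z)).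
  - apply (is_derive_minus (fun x => g x * sqrt (p x)) (Acl be)); [|apply Acl_derive; lra].
    apply (is_derive_mult g (fun x => sqrt (p x))); [apply gm_derive; auto; lra|apply sqrtp_derive; lra|intros; apply Rmult_comm].
  - assert (E := gm_eq be z ltac:(lra)). fold P p g in E.
    assert (s2 : sqrt (p z) * sqrt (p z) = p z) by (apply sqrt_sqrt; lra).
    replace (y z * P z * sqrt (p z) + g z * (- y z * z / sqrt (p z)) - y z / sqrt (p z))
     with ((y z * (P z * (sqrt (p z) * sqrt (p z))) - y z * (z * g z) - y z) / sqrt (p z)) by (field; lra).
    rewrite s2. replace (P z * p z) with (1 + z * g z) by lra. field; lra. }
assert (hc : forall a b, 0 < a -> a <= b -> b < XP -> h a = h b).
{ intros a b Ha Hab Hb; apply Rle_antisym.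
  - apply (incr_of_derive h (fun _ => 0)); auto; [intros; apply dh; lra|intros; lra].
  - assert (- h a <= - h b); [|lra].
    apply (incr_of_derive (fun x => - h x) (fun _ => - 0)); auto; [intros z Hz; apply (is_derive_opp h), dh; lra|intros; lra]. }
assert (h x = 0); [|unfold h in *; lra].
destruct (Req_dec (h x) 0) as [|ne]; auto; exfalso.
assert (ep : 0 < Rabs (h x) / 2) by (pose proof (Rabs_pos_lt _ ne); lra).
destruct (HZ _ ep) as [d1 [d1p Hd1]].
assert (cg : continuous (fun z => g z * sqrt (p z)) XP).
{ apply (continuous_mult g (fun z => sqrt (p z))).
  - eapply is_derive_cont, gm_derive; auto.
  - apply (continuous_comp p sqrt); [apply p2_cont|apply continuous_sqrt]. }
assert (v0 : g XP * sqrt (p XP) = 0).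
{ assert (p XP = 0).
  { unfold p, p2, yy. rewrite xp_sq. field. }
  rewrite H, sqrt_0; ring. }
destruct (proj1 (filterlim_locally _ _) cg (mkposreal _ ep)) as [d2 Hd2].
set (b := Rmax x (XP - Rmin d1 d2 / 2)).
pose proof (cond_pos d2). assert (mp : 0 < Rmin d1 d2) by (apply Rmin_pos; auto).
pose proof (Rmin_l d1 d2); pose proof (Rmin_r d1 d2).
assert (xb : x <= b) by apply Rmax_l. assert (bX : XP - Rmin d1 d2 / 2 <= b) by apply Rmax_r.
assert (bXP : b < XP) by (apply Rmax_lub_lt; lra).
specialize (Hd1 b ltac:(lra) ltac:(unfold XP in *; lra)).
assert (Hb : Rabs (g b * sqrt (p b) - g XP * sqrt (p XP)) < Rabs (h x) / 2).
{ apply Hd2. unfold ball; simpl; unfold AbsRing_ball, abs, minus, plus, opp; simpl. apply Rabs_def1; lra. }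
rewrite v0, Rminus_0_r in Hb.
assert (E := hc x b ltac:(lra) xb bXP).
assert (Rabs (h b) < Rabs (h x)).
{ unfold h at 1. eapply Rle_lt_trans; [apply Rabs_triang|]. rewrite Rabs_Ropp; lra. }
rewrite E in H2; lra.
Qed.

(** On (0, a0], y lies between -be and 1/2, so p is at least [c1] and relations multiplied by p can
    be divided by it. *)
Let a0 := XP / 2.
Let c1 := 1 - Rmax be (1 / 2) ^ 2.

Lemma c1_pos : 0 < c1.
Proof.
unfold c1; assert (0 < Rmax be (1 / 2) < 1); [|nra].
split; [apply Rlt_le_trans with (1 := be0), Rmax_l|apply Rmax_lub_lt; lra].
Qed.

Lemma near_facts x : 0 < x <= a0 -> Rabs (y x) <= 1 /\ c1 <= p x /\ x <= 1 /\ x < XP.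
Proof.
intros Hx; pose proof xp_sq; pose proof xp_le2; pose proof xp_pos; unfold a0 in Hx.
pose proof (yy_ge be x) as G. fold y in G.
assert (x ^ 2 <= (XP / 2) ^ 2) by (apply pow_incr; lra).
pose proof (Rmax_l be (1 / 2)); pose proof (Rmax_r be (1 / 2)).
assert (U : y x <= 1 / 2) by (unfold y, yy; lra).
assert (B : Rabs (y x) <= Rmax be (1 / 2)) by (apply Rabs_le; lra).
split; [|split; [|split; lra]].
- apply Rle_trans with (1 := B); apply Rmax_lub; lra.
- unfold p, p2, c1. assert (y x ^ 2 <= Rmax be (1 / 2) ^ 2); [|unfold y in *; lra].
  rewrite <- pow2_abs; apply pow_incr; split; auto; apply Rabs_pos.
Qed.

Lemma near_div x v M : 0 < x <= a0 -> Rabs (p x * v) <= M -> Rabs v <= M / c1.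
Proof.
intros Hx H; destruct (near_facts x Hx) as [_ [H1 _]]; pose proof c1_pos.
rewrite Rabs_mult, (Rabs_right (p x)) in H by lra.
apply Rmult_le_reg_r with c1; auto. replace (M / c1 * c1) with M by (field; lra).
pose proof (Rabs_pos v); nra.
Qed.

Lemma far_facts x : 3 <= x -> 2 <= y x /\ x ^ 2 <= 3 * y x /\ x <= 2 * y x /\ (1 + y x ^ 2) / 3 <= - p x.
Proof.
intros Hx. assert (2 <= y x) by (unfold y, yy; nra).
assert (x ^ 2 <= 3 * y x) by (unfold y, yy in *; lra).
split; [auto|split; [auto|split; [nra|]]]. unfold p, p2; fold y; nra.
Qed.

Lemma far_div x v M : 3 <= x -> Rabs (p x * v) <= M * (1 + y x ^ 2) -> Rabs v <= 3 * M.
Proof.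
intros Hx H; destruct (far_facts x Hx) as [Hy [_ [_ Hp]]].
rewrite Rabs_mult, (Rabs_left (p x)) in H by (pose proof (pow2_ge_0 (y x)); lra).
pose proof (Rabs_pos v). pose proof (pow2_ge_0 (y x)).
apply Rmult_le_reg_r with (1 + y x ^ 2); [lra|]. nra.
Qed.

Lemma cont_yy x : continuous y x.
Proof. eapply is_derive_cont, yy_derive. Qed.
Lemma cont_P x : 0 < x -> continuous P x.
Proof. intros; eapply is_derive_cont, Pm_derive; auto. Qed.
Lemma cont_P1 x : 0 < x -> continuous P1 x.
Proof. intros; eapply is_derive_cont, Pm1_derive; auto. Qed.
Lemma cont_g x : 0 < x -> continuous g x.
Proof. intros; eapply is_derive_cont, gm_derive; auto. Qed.
Lemma cont_idR (x : R) : continuous (fun x : R => x) x.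
Proof. apply continuous_id. Qed.
Lemma cont_inv x : 0 < x -> continuous (fun x => / x) x.
Proof. intros; apply (ex_derive_continuous (fun x => / x)); auto_derive; lra. Qed.

Ltac ct := repeat match goal with
 | H : 0 < ?x |- continuous P ?x => apply cont_P; exact H
 | H : 0 < ?x |- continuous P1 ?x => apply cont_P1; exact H
 | H : 0 < ?x |- continuous (fun z => P z) ?x => apply cont_P; exact H
 | H : 0 < ?x |- continuous (fun z => P1 z) ?x => apply cont_P1; exact H
 | H : 0 < ?x |- continuous (fun z => P2 z) ?x => apply Pm2_cont; auto
 | H : 0 < ?x |- continuous (fun z => g z) ?x => apply cont_g; exact H
 | |- continuous (fun z => y z) ?x => apply cont_yy
 | |- continuous (fun z => z) ?x => apply cont_idR
 | |- continuous (fun _ => ?c) ?x => apply continuous_const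
 | H : 0 < ?x |- continuous (fun z => / z) ?x => apply cont_inv; exact H
 | |- continuous (fun z => @?f z + @?h z) ?x => apply (continuous_plus f h)
 | |- continuous (fun z => @?f z - @?h z) ?x => apply (continuous_minus f h)
 | |- continuous (fun z => @?f z * @?h z) ?x => apply (continuous_mult f h)
 end.

(** The only use of the zero-flux condition in the bounds: g is O(x) at 0, so the boundary terms of
    the virial identities vanish there. *)
Lemma g_over_x : exists C, 1 <= C /\ forall x, 0 < x <= a0 -> Rabs (g x) <= C * x.
Proof.
pose proof c1_pos as c0. pose proof xp_pos as Xp.
assert (sc : 0 < sqrt c1) by (apply sqrt_lt_R0; auto).
exists (/ (sqrt c1 * sqrt c1)). split.
{ rewrite sqrt_sqrt by lra. rewrite <- Rinv_1; apply Rinv_le_contravar; auto.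
  unfold c1; pose proof (pow2_ge_0 (Rmax be (1 / 2))); lra. }
intros x Hx; destruct (near_facts x Hx) as [_ [H1 [_ xX]]].
assert (E := gm_Acl x ltac:(lra)).
assert (sp : sqrt c1 <= sqrt (p x)) by (apply sqrt_le_1_alt; auto).
assert (A : Rabs (Acl be x) <= x * / sqrt c1).
{ unfold Acl.
  assert (ex : ex_RInt (fun s => y s / sqrt (p s)) 0 x).
  { apply (ex_RInt_continuous (V := R_CompleteNormedModule)); intros z Hz; rewrite Rmin_left, Rmax_right in Hz by lra.
    apply Acl_integrand_cont; lra. }
  replace (x * / sqrt c1) with (RInt (fun _ => / sqrt c1) 0 x)
    by (rewrite RInt_const; unfold scal; simpl; unfold mult; simpl; ring).
  eapply Rle_trans; [apply abs_RInt_le; [lra|exact ex]|].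
  apply RInt_le; [lra|apply (ex_RInt_norm _ _ _ ex)|apply ex_RInt_const|].
  intros z Hz; destruct (near_facts z ltac:(lra)) as [B1 [B2 _]].
  assert (sqrt c1 <= sqrt (p z)) by (apply sqrt_le_1_alt; auto).
  unfold Rdiv; fold y p; rewrite Rabs_mult, Rabs_inv, (Rabs_right (sqrt (p z))) by lra.
  rewrite <- (Rmult_1_l (/ sqrt c1)). apply Rmult_le_compat; auto using Rabs_pos.
  - left; apply Rinv_0_lt_compat; lra.
  - apply Rinv_le_contravar; lra. }
rewrite <- E, Rabs_mult, (Rabs_right (sqrt (p x))) in A by lra.
apply Rmult_le_reg_r with (sqrt c1); auto.
replace (/ (sqrt c1 * sqrt c1) * x * sqrt c1) with (x * / sqrt c1) by (field; lra).
pose proof (Rabs_pos (g x)). nra.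
Qed.

(** The quantities needed to control the virial functional and its error. The last one is the second
    derivative of y P, that is gm''', which carries the O(hh) error. *)
Lemma g_bounds : exists C, 1 <= C /\ forall x, 0 < x ->
  (1 + y x ^ 2) * P x <= C /\ Rabs (x * g x) <= C /\ Rabs (g x) <= C * x /\ Rabs (g x) <= C /\
  (1 + y x ^ 2) * Rabs (P1 x) <= C /\ Rabs (P1 x) <= C * x /\ Rabs (P x + 2 * x * P1 x + y x * P2 x) <= C.
Proof.
pose proof c1_pos as c1p. pose proof xp_pos as Xp. pose proof xp_le2 as X2.
assert (a0p : 0 < a0) by (unfold a0; lra). assert (a03 : a0 <= 3) by (unfold a0; lra).
destruct g_over_x as [Cg [Cg1 HCg]].
assert (Pp : forall x, 0 < x -> 0 < P x) by (intros; apply Pm_pos; auto).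
assert (eP : forall x, 0 < x -> p x * P x = 1 + x * g x) by (intros; symmetry; apply gm_eq; auto).
assert (eP1 : forall x, 0 < x -> p x * P1 x = g x + 3 * x * y x * P x) by (intros; apply Pm1_eq; auto).
assert (eP2 : forall x, 0 < x -> p x * P2 x = 4 * y x * P x + 3 * x ^ 2 * P x + 5 * x * y x * P1 x) by (intros; apply Pm2_eq; auto).
destruct (three_regions (fun x => (1 + y x * y x) * P x) a0 3 a0p a03) as [K [K1 HK]].
{ intros x Hx; ct. }
{ exists (2 * ((1 + Cg) / c1)); intros x Hx; destruct (near_facts x Hx) as [Y1 [_ [x1 _]]].
  specialize (HCg x Hx).
  assert (Rabs (P x) <= (1 + Cg) / c1).
  { apply (near_div x); auto. rewrite eP by lra. apply Rabs_le_plus; [rewrite Rabs_R1; lra|].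
    rewrite Rabs_mult, (Rabs_right x) by lra. pose proof (Rabs_pos (g x)). nra. }
  apply Rabs_le_mult; auto. rewrite Rabs_right by nra. apply Rabs_le_between in Y1. nra. }
{ exists 4; intros x Hx; destruct (far_facts x Hx) as [Y2 _].
  assert (B := Pm_bound_far be be0 be1 x ltac:(unfold y in *; lra) ltac:(lra)). fold y P in B.
  rewrite Rabs_right; [nra|]. specialize (Pp x ltac:(lra)). nra. }
assert (bK : forall x, 0 < x -> (1 + y x ^ 2) * P x <= K).
{ intros x Hx; specialize (HK x Hx). pose proof (Rle_abs ((1 + y x * y x) * P x)). simpl in *; lra. }
assert (PK : forall x, 0 < x -> P x <= K).
{ intros x Hx; specialize (bK x Hx); specialize (Pp x Hx); pose proof (pow2_ge_0 (y x)); nra. }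
assert (bxg : forall x, 0 < x -> Rabs (x * g x) <= K + 1).
{ intros x Hx; replace (x * g x) with (p x * P x - 1) by (rewrite eP; auto; ring).
  apply Rabs_le_minus; [|rewrite Rabs_R1; lra].
  rewrite Rabs_mult, (Rabs_right (P x)) by (left; apply Pp; auto).
  apply Rle_trans with ((1 + y x ^ 2) * P x); auto. apply Rmult_le_compat_r; [left; apply Pp; auto|].
  unfold p, p2; fold y; apply Rabs_le; pose proof (pow2_ge_0 (y x)); lra. }
assert (bgf : forall x, a0 <= x -> Rabs (g x) <= (K + 1) / a0).
{ intros x Hx; specialize (bxg x ltac:(lra)). rewrite Rabs_mult, (Rabs_right x) in bxg by lra.
  apply Rmult_le_reg_r with a0; auto. replace ((K + 1) / a0 * a0) with (K + 1) by (field; lra).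
  pose proof (Rabs_pos (g x)); nra. }
set (G := Cg + (K + 1) / a0 + (K + 1) / a0 / a0).
assert (q1 : 0 < (K + 1) / a0) by (apply Rdiv_lt_0_compat; lra).
assert (q2 : 0 < (K + 1) / a0 / a0) by (apply Rdiv_lt_0_compat; lra).
assert (bgx : forall x, 0 < x -> Rabs (g x) <= G * x).
{ intros x Hx; destruct (Rle_dec x a0).
  - specialize (HCg x ltac:(lra)). unfold G; nra.
  - specialize (bgf x ltac:(lra)). assert ((K + 1) / a0 <= (K + 1) / a0 / a0 * x); [|unfold G; nra].
    replace ((K + 1) / a0) with ((K + 1) / a0 / a0 * a0) at 1 by (field; lra). apply Rmult_le_compat_l; lra. }
assert (bg : forall x, 0 < x -> Rabs (g x) <= G).
{ intros x Hx; destruct (Rle_dec x a0).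
  - specialize (HCg x ltac:(lra)). assert (x <= 1) by (apply near_facts; lra). unfold G; nra.
  - specialize (bgf x ltac:(lra)). unfold G; lra. }
destruct (three_regions (fun x => (1 + y x * y x) * P1 x) a0 3 a0p a03) as [M1 [M11 HM1]].
{ intros x Hx; ct. }
{ exists (2 * ((G + 3 * K) / c1)); intros x Hx; destruct (near_facts x Hx) as [Y1 [_ [x1 _]]].
  apply Rabs_le_mult; [rewrite Rabs_right by nra; apply Rabs_le_between in Y1; nra|].
  apply (near_div x); auto. rewrite eP1 by lra. apply Rabs_le_plus; [apply bg; lra|].
  rewrite Rabs_mult, (Rabs_right (P x)) by (left; apply Pp; lra).
  apply Rmult_le_compat; [apply Rabs_pos|left; apply Pp; lra| |apply PK; lra].
  rewrite Rabs_mult, (Rabs_right (3 * x)) by lra. pose proof (Rabs_pos (y x)). nra. }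
{ exists (3 * (G + 6 * K)); intros x Hx; destruct (far_facts x Hx) as [Y2 [X3 [X4 _]]].
  specialize (bK x ltac:(lra)); specialize (bg x ltac:(lra)); specialize (Pp x ltac:(lra)).
  apply (far_div x); auto.
  replace (p x * ((1 + y x * y x) * P1 x)) with ((g x + 3 * x * y x * P x) * (1 + y x ^ 2)) by (rewrite <- eP1 by lra; ring).
  rewrite Rabs_mult, (Rabs_right (1 + y x ^ 2)) by nra. apply Rmult_le_compat_r; [nra|].
  apply Rabs_le_plus; auto. assert (0 <= 3 * x * y x <= 6 * (1 + y x ^ 2)) by nra.
  rewrite Rabs_right by (apply Rle_ge, Rmult_le_pos; lra).
  nra. }
assert (bP1 : forall x, 0 < x -> (1 + y x ^ 2) * Rabs (P1 x) <= M1).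
{ intros x Hx; specialize (HM1 x Hx); cbv beta in HM1. rewrite Rabs_mult, (Rabs_right (1 + y x * y x)) in HM1 by nra.
  replace (1 + y x ^ 2) with (1 + y x * y x) by ring; auto. }
assert (P1M : forall x, 0 < x -> Rabs (P1 x) <= M1).
{ intros x Hx; specialize (bP1 x Hx); pose proof (Rabs_pos (P1 x)); pose proof (pow2_ge_0 (y x)); nra. }
set (N1 := (G + 3 * K) / c1 + M1 / a0).
assert (q3 : 0 < (G + 3 * K) / c1) by (apply Rdiv_lt_0_compat; unfold G; lra).
assert (q4 : 0 < M1 / a0) by (apply Rdiv_lt_0_compat; lra).
assert (bP1x : forall x, 0 < x -> Rabs (P1 x) <= N1 * x).
{ intros x Hx; destruct (Rle_dec x a0).
  - assert (Hx' : 0 < x <= a0) by lra. destruct (near_facts x Hx') as [Y1 [_ [x1 _]]].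
    assert (Rabs (P1 x) <= (G + 3 * K) * x / c1).
    { apply (near_div x); auto. rewrite eP1 by lra.
      replace ((G + 3 * K) * x) with (G * x + 3 * x * 1 * K) by ring.
      apply Rabs_le_plus; [apply bgx; lra|].
      rewrite Rabs_mult, (Rabs_right (P x)) by (left; apply Pp; lra).
      apply Rmult_le_compat; [apply Rabs_pos|left; apply Pp; lra| |apply PK; lra].
      rewrite Rabs_mult, (Rabs_right (3 * x)) by lra. apply Rmult_le_compat_l; lra. }
    unfold N1; replace ((G + 3 * K) * x / c1) with ((G + 3 * K) / c1 * x) in H by (field; lra). nra.
  - specialize (P1M x Hx). assert (M1 <= M1 / a0 * x).
    { replace M1 with (M1 / a0 * a0) at 1 by (field; lra). apply Rmult_le_compat_l; lra. }
    unfold N1; nra. }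
destruct (three_regions (fun x => P x + 2 * x * P1 x + y x * P2 x) a0 3 a0p a03) as [L [L1 HL]].
{ intros x Hx; ct. }
{ exists (K + 2 * M1 + 1 * ((7 * K + 5 * M1) / c1)); intros x Hx; destruct (near_facts x Hx) as [Y1 [_ [x1 _]]].
  specialize (PK x ltac:(lra)); specialize (P1M x ltac:(lra)); specialize (Pp x ltac:(lra)).
  apply Rabs_le_plus; [apply Rabs_le_plus|].
  - rewrite Rabs_right; lra.
  - rewrite Rabs_mult, (Rabs_right (2 * x)) by lra. pose proof (Rabs_pos (P1 x)). nra.
  - apply Rabs_le_mult; auto. apply (near_div x); auto. rewrite eP2 by lra.
    replace (7 * K + 5 * M1) with (4 * K + 3 * K + 5 * M1) by ring.
    pose proof (Rabs_pos (y x)). pose proof (Rabs_pos (P1 x)).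
    apply Rabs_le_plus; [apply Rabs_le_plus|].
    + rewrite !Rabs_mult, (Rabs_right 4), (Rabs_right (P x)) by lra. nra.
    + assert (0 <= x ^ 2 <= 1) by nra. rewrite Rabs_right by (apply Rle_ge, Rmult_le_pos; lra). nra.
    + rewrite !Rabs_mult, (Rabs_right 5), (Rabs_right x) by lra.
      assert (x * Rabs (y x) <= 1) by nra. assert (0 <= x * Rabs (y x)) by nra.
      assert (x * Rabs (y x) * Rabs (P1 x) <= 1 * M1) by (apply Rmult_le_compat; auto). nra. }
{ exists (K + 2 * M1 + 3 * (13 * K + 10 * M1)); intros x Hx; destruct (far_facts x Hx) as [Y2 [X3 [X4 _]]].
  assert (PK' := PK x ltac:(lra)); specialize (bP1 x ltac:(lra)); specialize (bK x ltac:(lra)); specialize (Pp x ltac:(lra)).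
  pose proof (Rabs_pos (P1 x)).
  apply Rabs_le_plus; [apply Rabs_le_plus|].
  - rewrite Rabs_right; lra.
  - rewrite Rabs_mult, (Rabs_right (2 * x)) by lra. assert (x <= 1 + y x ^ 2) by nra.
    assert (x * Rabs (P1 x) <= (1 + y x ^ 2) * Rabs (P1 x)) by (apply Rmult_le_compat_r; lra). lra.
  - apply (far_div x); auto.
    replace (p x * (y x * P2 x)) with (y x * (4 * y x * P x + 3 * x ^ 2 * P x + 5 * x * y x * P1 x)) by (rewrite <- eP2 by lra; ring).
    replace (y x * (4 * y x * P x + 3 * x ^ 2 * P x + 5 * x * y x * P1 x)) with
      ((4 * y x ^ 2 + 3 * x ^ 2 * y x) * P x + 5 * x * y x ^ 2 * P1 x) by ring.
    replace ((13 * K + 10 * M1) * (1 + y x ^ 2)) with ((1 + y x ^ 2) * (13 * K) + (1 + y x ^ 2) * (10 * M1)) by ring.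
    assert (0 <= x ^ 2 * y x <= 3 * y x ^ 2) by nra.
    apply Rabs_le_plus.
    + rewrite Rabs_right by nra. nra.
    + rewrite Rabs_mult, (Rabs_right (5 * x * y x ^ 2)) by nra.
      assert (y x ^ 2 * Rabs (P1 x) <= M1) by (pose proof (pow2_ge_0 (y x)); nra).
      replace (5 * x * y x ^ 2 * Rabs (P1 x)) with (5 * x * (y x ^ 2 * Rabs (P1 x))) by ring.
      apply Rle_trans with (5 * x * M1); [apply Rmult_le_compat_l; lra|].
      assert (5 * x <= 10 * (1 + y x ^ 2)) by nra.
      replace ((1 + y x ^ 2) * (10 * M1)) with (10 * (1 + y x ^ 2) * M1) by ring. apply Rmult_le_compat_r; lra. }
assert (bL := HL).
exists (K + 1 + G + M1 + N1 + L).
assert (0 < G) by (unfold G; lra). assert (0 < N1) by (unfold N1; lra).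
split; [lra|]; intros x Hx.
specialize (bK x Hx); specialize (bxg x Hx); specialize (bgx x Hx); specialize (bg x Hx).
specialize (bP1 x Hx); specialize (bP1x x Hx); specialize (bL x Hx); cbv beta in bL.
split; [lra|split; [lra|split; [|split; [lra|split; [lra|split; [|lra]]]]]].
- apply Rle_trans with (1 := bgx); apply Rmult_le_compat_r; lra.
- apply Rle_trans with (1 := bP1x); apply Rmult_le_compat_r; lra.
Qed.
End Bounds.

(** * The multiplier for the second variation *)

Section Second.
Variable be : R.
Hypothesis be0 : 0 < be.
Hypothesis be1 : be < 1.
Hypothesis HZ : Zcond be.
Let y := yy be.
Let P := Pm be.
Let P1 := Pm1 be.
Let P2 := Pm2 be.
Let g := gm be.
Let p := p2 be.
Let a0 := xp be / 2.
Let P0 := / (1 - be ^ 2).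
Definition r0 : R := / (2 * (1 - be ^ 2)).

(* [Pm], defined on (0, oo), extended by its limit at 0. *)
Definition Pc (x : R) : R := if Rle_dec x 0 then / (1 - be ^ 2) else Pm be x.

Lemma omb : 0 < 1 - be ^ 2.
Proof. nra. Qed.

Lemma a0_pos : 0 < a0.
Proof. unfold a0; pose proof (xp_pos be be0); lra. Qed.

Lemma a0_le1 : a0 <= 1.
Proof. unfold a0; pose proof (xp_le2 be be0 be1); lra. Qed.

(** [P0] is the limit of Pm at 0. Second order contact is needed because [mm] divides a combination
    of Pm by x and must still be O(x). *)
Lemma Pm_near0 : exists C, 0 < C /\ forall x, 0 < x <= a0 -> Rabs (P x - P0) <= C * x ^ 2.
Proof.
destruct (g_bounds be be0 be1 HZ) as [C [C1 HC]].
assert (cp := c1_pos be be0 be1). pose proof omb as ob.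
set (c1 := 1 - Rmax be (1 / 2) ^ 2) in *.
assert (p0 : 0 < P0) by (apply Rinv_0_lt_compat; auto).
exists ((C + P0) / c1); split; [apply Rdiv_lt_0_compat; lra|].
intros x Hx. destruct (near_facts be be0 be1 x Hx) as [Y1 [_ [x1 _]]].
replace ((C + P0) / c1 * x ^ 2) with ((C * x ^ 2 + P0 * x ^ 2) / c1) by (field; lra).
apply (near_div be be0 be1 x); auto.
destruct (HC x ltac:(lra)) as [_ [_ [H3 _]]].
assert (E := gm_eq be x ltac:(lra)).
replace (p2 be x * (P x - P0)) with (x * g x + P0 * ((y x - be) * (x ^ 2 / 2))).
2:{ unfold P; replace (p2 be x * (Pm be x - P0)) with (p2 be x * Pm be x - p2 be x * P0) by ring.
    rewrite <- E; unfold g, P0, p2, y, yy; field; lra. }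
apply Rabs_le_plus.
- rewrite Rabs_mult, (Rabs_right x) by lra. unfold g; nra.
- rewrite Rabs_mult, (Rabs_right P0) by lra. apply Rmult_le_compat_l; [lra|].
  rewrite Rabs_mult, (Rabs_right (x ^ 2 / 2)) by nra.
  fold y in Y1; assert (Rabs (y x - be) <= 2) by (apply Rabs_le_between in Y1; apply Rabs_le; lra).
  nra.
Qed.

Lemma Pc_cont0 : cont0 Pc.
Proof.
intros t Ht; destruct (Req_dec t 0) as [->|ne].
- destruct Pm_near0 as [C [C0 HC]]. pose proof a0_pos.
  apply filterlim_locally; intros eps.
  assert (e0 : 0 < eps / C) by (apply Rdiv_lt_0_compat; [apply cond_pos|auto]).
  apply locally_Rabs with (Rmin (Rmin a0 1) (eps / C)); [repeat apply Rmin_pos; lra|].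
  intros z Hz; unfold Pc at 2. unfold Pc. destruct (Rle_dec 0 0); [|lra].
  pose proof (Rmin_l (Rmin a0 1) (eps / C)); pose proof (Rmin_r (Rmin a0 1) (eps / C)).
  pose proof (Rmin_l a0 1); pose proof (Rmin_r a0 1).
  rewrite Rminus_0_r in Hz.
  destruct (Rle_dec z 0); [apply ball_center|].
  rewrite Rabs_right in Hz by lra.
  unfold ball; simpl; unfold AbsRing_ball, abs, minus, plus, opp; simpl.
  change (Rabs (P z - P0) < eps).
  eapply Rle_lt_trans; [apply HC; lra|].
  assert (z ^ 2 <= z) by nra.
  assert (C * z < eps).
  { apply Rlt_le_trans with (C * (eps / C)); [apply Rmult_lt_compat_l; lra|right; field; lra]. }
  nra.
- assert (0 < t) by lra.
  apply (continuous_ext_loc Pc P t).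
  + apply (filter_imp (fun z => 0 < z)); [|now apply locally_gt].
    intros z Hz; unfold Pc; destruct (Rle_dec z 0); [lra|auto].
  + eapply is_derive_cont, Pm_derive; auto.
Qed.

Lemma Pc_eq x : 0 < x -> Pc x = Pm be x.
Proof. intros; unfold Pc; destruct (Rle_dec x 0); [lra|auto]. Qed.

Lemma Pc_pos x : 0 <= x -> 0 < Pc x.
Proof.
intros Hx; unfold Pc; destruct (Rle_dec x 0); [apply Rinv_0_lt_compat, omb|apply Pm_pos; auto; lra].
Qed.

Lemma Pc_bound : exists C, 1 <= C /\ forall x, 0 <= x -> (1 + y x ^ 2) * Pc x <= C.
Proof.
destruct (g_bounds be be0 be1 HZ) as [C [C1 HC]].
assert (p0 : 0 < P0) by (apply Rinv_0_lt_compat, omb).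
exists (C + 2 * P0); split; [lra|].
intros x Hx; destruct (Req_dec x 0) as [->|ne].
- unfold Pc; destruct (Rle_dec 0 0); [|lra]. fold P0.
  assert (y 0 ^ 2 <= 1) by (unfold y, yy; nra). nra.
- rewrite Pc_eq by lra. destruct (HC x ltac:(lra)) as [H _]. unfold y; lra.
Qed.

Lemma Pc_lower X : 0 <= X -> exists c, 0 < c /\ forall x, 0 <= x <= X -> c <= Pc x.
Proof.
intros HX; destruct (continuity_ab_min Pc 0 X HX) as [m [Hm Hm1]].
{ intros c Hc; apply continuity_pt_filterlim, Pc_cont0; lra. }
exists (Pc m); split; [apply Pc_pos; lra|auto].
Qed.

(** The constant is 2 be r0 = be P0 = -y(0) P(0), so F vanishes at 0, to second order by
    [Pm_near0]. *)
Let F x := y x * P x + 2 * be * r0.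
Let F1 x := x * P x + y x * P1 x.
Let F2 x := P x + 2 * x * P1 x + y x * P2 x.

Lemma yP_derive x : 0 < x -> is_derive (fun x => y x * P x) x (F1 x).
Proof.
intros Hx; apply (is_derive_mult y P); [apply yy_derive|apply Pm_derive; auto|intros; apply Rmult_comm].
Qed.

Lemma F_derive x : 0 < x -> is_derive F x (F1 x).
Proof.
intros Hx; unfold F; rewrite <- (Rplus_0_r (F1 x)).
apply (is_derive_plus (fun x => y x * P x) (fun _ => 2 * be * r0)); [apply yP_derive; auto|apply (is_derive_const (2 * be * r0))].
Qed.

Lemma F1_derive x : 0 < x -> is_derive F1 x (F2 x).
Proof.
intros Hx; unfold F1.
replace (F2 x) with ((1 * P x + x * P1 x) + (x * P1 x + y x * P2 x)) by (unfold F2; ring).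
apply (is_derive_plus (fun x => x * P x) (fun x => y x * P1 x)).
- apply (is_derive_mult (fun x => x) P); [apply (is_derive_id x)|apply Pm_derive; auto|intros; apply Rmult_comm].
- apply (is_derive_mult y P1); [apply yy_derive|apply Pm1_derive; auto|intros; apply Rmult_comm].
Qed.

(* [mm] solves (1 - y^2) mm' - x y mm = (1 + y^2) P - r0 without singularity, which forces the value of r0. *)
Definition mm (x : R) : R := (yy be x * Pm be x + 2 * be * r0) * / x + be * r0 * gm be x.
Definition mm1 (x : R) : R := (x * Pm be x + yy be x * Pm1 be x) * / x + (yy be x * Pm be x + 2 * be * r0) * (- / x ^ 2)
  + be * r0 * (yy be x * Pm be x).
Definition mm2 (x : R) : R := (F2 x * / x + F1 x * (- / x ^ 2)) + (F1 x * (- / x ^ 2) + F x * (2 * / x ^ 3)) + be * r0 * F1 x.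

Lemma inv_derive x : 0 < x -> is_derive (fun x => / x) x (- / x ^ 2).
Proof. intros; auto_derive; [lra|field; lra]. Qed.

Lemma inv2_derive x : 0 < x -> is_derive (fun x => - / x ^ 2) x (2 * / x ^ 3).
Proof. intros; auto_derive; [nra|field; lra]. Qed.

Lemma mm_derive x : 0 < x -> is_derive mm x (mm1 x).
Proof.
intros Hx; apply (is_derive_plus (fun x => F x * / x) (fun x => be * r0 * g x)).
- apply (is_derive_mult F (fun x => / x)); [apply F_derive; auto|apply inv_derive; auto|intros; apply Rmult_comm].
- apply is_derive_scal, gm_derive; auto.
Qed.

Lemma mm1_derive x : 0 < x -> is_derive mm1 x (mm2 x).
Proof.
intros Hx; apply (is_derive_plus (fun x => F1 x * / x + F x * (- / x ^ 2)) (fun x => be * r0 * (y x * P x))).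
- apply (is_derive_plus (fun x => F1 x * / x) (fun x => F x * (- / x ^ 2))).
  + apply (is_derive_mult F1 (fun x => / x)); [apply F1_derive; auto|apply inv_derive; auto|intros; apply Rmult_comm].
  + apply (is_derive_mult F (fun x => - / x ^ 2)); [apply F_derive; auto|apply inv2_derive; auto|intros; apply Rmult_comm].
- apply is_derive_scal, yP_derive; auto.
Qed.

Lemma mm_ode x : 0 < x -> p x * mm1 x = y x * x * mm x + (1 + y x ^ 2) * P x - r0.
Proof.
intros Hx. pose proof omb.
assert (E := gm_eq be x Hx). assert (E1 := Pm1_eq be be0 be1 x Hx).
assert (Eg : gm be x = (p2 be x * Pm be x - 1) / x) by (unfold gm; reflexivity).
unfold p, y, P, mm1, mm.
replace (p2 be x * ((x * Pm be x + yy be x * Pm1 be x) * / x + (yy be x * Pm be x + 2 * be * r0) * - / x ^ 2 + be * r0 * (yy be x * Pm be x)))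
 with (p2 be x * Pm be x + yy be x * (p2 be x * Pm1 be x) * / x + p2 be x * ((yy be x * Pm be x + 2 * be * r0) * - / x ^ 2 + be * r0 * (yy be x * Pm be x)))
 by (field; lra).
rewrite E1, Eg. unfold p2.
apply Rminus_diag_uniq.
(* The terms in Pm have cancelled. Substituting x^2 = 2 (y + be), the numerator collapses to (2 r0
   (1 - be^2) - 1) y, which vanishes for this value of [r0]. *)
match goal with |- ?l = 0 => replace l with ((- yy be x - (1 - yy be x ^ 2) * (2 * be * r0) - x ^ 2 * yy be x * (2 * be * r0) + be * r0 * x ^ 2 * yy be x + x ^ 2 * r0) / x ^ 2) by (field; lra) end.
unfold r0, yy; field. split; [lra|nra].
Qed.

Lemma mm2_ode x : 0 < x -> p x * mm2 x = 3 * (y x * x * mm1 x) + (x ^ 2 + y x) * mm x + 2 * x * y x * P x + (1 + y x ^ 2) * P1 x.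
Proof.
intros Hx.
assert (D1 : is_derive (fun x => p x * mm1 x) x (- 2 * y x * x * mm1 x + p x * mm2 x)).
{ apply (is_derive_mult p mm1); [apply p2_derive|apply mm1_derive; auto|intros; apply Rmult_comm]. }
assert (D2 : is_derive (fun x => y x * x * mm x + (1 + y x ^ 2) * P x - r0) x
  (((x * x + y x * 1) * mm x + y x * x * mm1 x) + (2 * (y x * x) * P x + (1 + y x ^ 2) * P1 x) - 0)).
{ apply (is_derive_minus (fun x => y x * x * mm x + (1 + y x ^ 2) * P x) (fun _ => r0)); [|apply (is_derive_const r0)].
  apply (is_derive_plus (fun x => y x * x * mm x) (fun x => (1 + y x ^ 2) * P x)).
  - apply (is_derive_mult (fun x => y x * x) mm); [|apply mm_derive; auto|intros; apply Rmult_comm].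
    apply (is_derive_mult y (fun x => x)); [apply yy_derive|apply (is_derive_id x)|intros; apply Rmult_comm].
  - apply (is_derive_mult (fun x => 1 + y x ^ 2) P); [|apply Pm_derive; auto|intros; apply Rmult_comm].
    unfold y, yy; auto_derive; auto; field. }
assert (E : - 2 * y x * x * mm1 x + p x * mm2 x = ((x * x + y x * 1) * mm x + y x * x * mm1 x) + (2 * (y x * x) * P x + (1 + y x ^ 2) * P1 x) - 0); [|lra].
apply is_derive_unique in D1; apply is_derive_unique in D2; rewrite <- D1, <- D2.
apply Derive_ext_loc. apply (filter_imp (fun z => 0 < z)); [|now apply locally_gt].
intros z Hz; now apply mm_ode.
Qed.

Lemma r0_pos : 0 < r0.
Proof. apply Rinv_0_lt_compat; pose proof omb; lra. Qed.

(** Near 0 the bound by C x comes from F = O(x^2) and gm = O(x), and makes the virial functional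
    vanish at 0. Derivatives are bounded near 0 and far out through [mm_ode] and [mm2_ode] divided
    by p. *)
Lemma mm_bounds : exists C, 1 <= C /\ forall x, 0 < x ->
  Rabs (mm x) <= C * x /\ Rabs (mm x) <= C /\ Rabs (x * mm x) <= C /\ Rabs (mm1 x) <= C /\ Rabs (mm2 x) <= C.
Proof.
destruct (g_bounds be be0 be1 HZ) as [C [C1 HC]]. destruct Pm_near0 as [CP [CP0 HCP]].
assert (cp := c1_pos be be0 be1). set (c1 := 1 - Rmax be (1 / 2) ^ 2) in *.
pose proof omb as ob; pose proof r0_pos as rp. pose proof a0_pos as a0p. pose proof a0_le1 as a01.
assert (br : 0 < be * r0) by (apply Rmult_lt_0_compat; auto).
assert (PK : forall x, 0 < x -> 0 < P x /\ P x <= C).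
{ intros x Hx; assert (0 < P x) by (apply Pm_pos; auto). split; auto.
  destruct (HC x Hx) as [H' _]; fold P in H'. pose proof (pow2_ge_0 (yy be x)). nra. }
assert (bF : forall x, 0 < x <= a0 -> Rabs (F x) <= (C + CP) * x ^ 2).
{ intros x Hx. destruct (PK x ltac:(lra)).
  replace (F x) with (x ^ 2 / 2 * P x - be * (P x - P0)) by (unfold F, y, yy, P0, r0; field; nra).
  replace ((C + CP) * x ^ 2) with (x ^ 2 * C + 1 * (CP * x ^ 2)) by ring.
  apply Rabs_le_minus.
  - assert (0 <= x ^ 2) by apply pow2_ge_0. rewrite Rabs_right by (apply Rle_ge, Rmult_le_pos; lra). nra.
  - apply Rabs_le_mult; auto. rewrite Rabs_right; lra. }
assert (cF : forall x, 0 < x -> continuous F x) by (intros; eapply is_derive_cont, F_derive; auto).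
assert (cm : forall x, 0 < x -> continuous mm x) by (intros; eapply is_derive_cont, mm_derive; auto).
assert (cm1 : forall x, 0 < x -> continuous mm1 x) by (intros; eapply is_derive_cont, mm1_derive; auto).
assert (bm : forall x, 0 < x <= a0 -> Rabs (mm x) <= (C + CP + be * r0 * C) * x).
{ intros x Hx. replace ((C + CP + be * r0 * C) * x) with ((C + CP) * x ^ 2 * / x + be * r0 * (C * x)) by (field; lra).
  unfold mm; apply Rabs_le_plus.
  - apply Rabs_le_mult; [apply (bF x Hx)|]. rewrite Rabs_right; [lra|]. apply Rle_ge; left; apply Rinv_0_lt_compat; lra.
  - rewrite Rabs_mult, (Rabs_right (be * r0)) by lra. apply Rmult_le_compat_l; [lra|]. apply HC; lra. }
assert (A3 : a0 <= 3) by lra.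
destruct (three_regions (fun x => x * mm x) a0 3 a0p A3) as [M [M1 HM]].
{ intros x Hx; apply (continuous_mult (fun x => x) mm); [apply continuous_id|auto]. }
{ exists (1 * ((C + CP + be * r0 * C) * 1)); intros x Hx. apply Rabs_le_mult; [rewrite Rabs_right; lra|].
  eapply Rle_trans; [apply bm; auto|]. apply Rmult_le_compat_l; [nra|lra]. }
{ exists (C + 2 * be * r0 + be * r0 * C); intros x Hx.
  replace (x * mm x) with (F x + be * r0 * (x * g x)) by (unfold mm, F, y, P, g; field; lra).
  destruct (HC x ltac:(lra)) as [H1 [H2 _]]. destruct (far_facts be be0 be1 x Hx) as [Y2 _].
  destruct (PK x ltac:(lra)).
  apply Rabs_le_plus.
  - unfold F; apply Rabs_le_plus; [|rewrite Rabs_right; lra].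
    fold y P in H1. fold y in Y2. rewrite Rabs_right by nra. nra.
  - rewrite Rabs_mult, (Rabs_right (be * r0)) by lra. apply Rmult_le_compat_l; [lra|auto]. }
assert (bmx : exists D, 1 <= D /\ forall x, 0 < x -> Rabs (mm x) <= D * x).
{ set (D := C + CP + be * r0 * C + M / (a0 * a0)).
  assert (0 < M / (a0 * a0)) by (apply Rdiv_lt_0_compat; nra).
  exists D; split; [unfold D; nra|]. intros x Hx. destruct (Rle_dec x a0).
  - eapply Rle_trans; [apply bm; lra|]. apply Rmult_le_compat_r; unfold D; lra.
  - specialize (HM x Hx); cbv beta in HM. rewrite Rabs_mult, (Rabs_right x) in HM by lra.
    assert (Rabs (mm x) <= M / (a0 * a0) * x).
    { apply Rmult_le_reg_l with x; auto. apply Rle_trans with (1 := HM).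
      replace M with (M / (a0 * a0) * (a0 * a0)) at 1 by (field; lra).
      replace (x * (M / (a0 * a0) * x)) with (M / (a0 * a0) * (x * x)) by ring.
      apply Rmult_le_compat_l; nra. }
    unfold D. assert (0 < C + CP + be * r0 * C) by nra. nra. }
destruct bmx as [D [D1 HD]].
assert (bmc : forall x, 0 < x -> Rabs (mm x) <= D + M).
{ intros x Hx; destruct (Rle_dec x 1).
  - specialize (HD x Hx). nra.
  - specialize (HM x Hx); cbv beta in HM. rewrite Rabs_mult, (Rabs_right x) in HM by lra. pose proof (Rabs_pos (mm x)). nra. }
assert (yb : forall x, Rabs (y x) <= 1 + y x ^ 2).
{ intros x; rewrite <- (pow2_abs (y x)). pose proof (Rabs_pos (y x)). nra. }
assert (bm1 : forall x, 0 < x -> Rabs (p x * mm1 x) <= (M + C + r0) * (1 + y x ^ 2)).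
{ intros x Hx. rewrite mm_ode by auto. destruct (HC x Hx) as [H1 _]. fold y P in H1. destruct (PK x Hx).
  specialize (HM x Hx); cbv beta in HM. pose proof (pow2_ge_0 (y x)).
  replace ((M + C + r0) * (1 + y x ^ 2)) with ((1 + y x ^ 2) * M + C * (1 + y x ^ 2) + r0 * (1 + y x ^ 2)) by ring.
  apply Rabs_le_minus; [apply Rabs_le_plus|].
  - rewrite Rmult_assoc; apply Rabs_le_mult; auto.
  - rewrite Rabs_right by (apply Rle_ge, Rmult_le_pos; lra). nra.
  - rewrite Rabs_right by lra. nra. }
destruct (three_regions mm1 a0 3 a0p A3) as [E [E1 HE]]; auto.
{ exists ((M + C + r0) * 2 / c1); intros x Hx. apply (near_div be be0 be1 x); auto.
  eapply Rle_trans; [apply bm1; lra|]. apply Rmult_le_compat_l; [lra|].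
  destruct (near_facts be be0 be1 x Hx) as [Y1 _]. fold y in Y1. rewrite <- (pow2_abs (y x)). pose proof (Rabs_pos (y x)). nra. }
{ exists (3 * (M + C + r0)); intros x Hx. apply (far_div be be0 be1 x); auto. apply bm1; lra. }
assert (bm2 : forall x, 0 < x -> x <= 2 * (1 + Rabs (y x)) -> Rabs (p x * mm2 x) <= (12 * E + 12 * (D + M) + 8 * C + C) * (1 + y x ^ 2)).
{ intros x Hx X1. rewrite mm2_ode by auto. destruct (HC x Hx) as [H1 [_ [_ [_ [H5 _]]]]]. fold y P P1 in H1, H5. destruct (PK x Hx).
  specialize (HE x Hx); specialize (bmc x Hx). pose proof (Rabs_pos (y x)). pose proof (pow2_abs (y x)) as S2.
  set (a := Rabs (y x)) in *. rewrite <- S2.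
  assert (X2 : x * a <= 4 * (1 + a ^ 2)) by nra.
  assert (X3 : x ^ 2 <= 2 * (1 + a)) by (assert (X4 : x ^ 2 = 2 * (y x + be)) by (unfold y, yy; field); pose proof (Rle_abs (y x)) as X5; fold a in X5; lra).
  replace ((12 * E + 12 * (D + M) + 8 * C + C) * (1 + a ^ 2)) with (3 * (4 * (1 + a ^ 2) * E) + 12 * (1 + a ^ 2) * (D + M) + 8 * (1 + a ^ 2) * C + C * (1 + a ^ 2)) by ring.
  apply Rabs_le_plus; [apply Rabs_le_plus; [apply Rabs_le_plus|]|].
  - rewrite Rabs_mult, (Rabs_right 3) by lra. apply Rmult_le_compat_l; [lra|].
    apply Rabs_le_mult; auto. rewrite Rabs_mult, (Rabs_right x) by lra. fold a; lra.
  - apply Rabs_le_mult; auto. eapply Rle_trans; [apply Rabs_triang|]. fold a.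
    rewrite (Rabs_right (x ^ 2)) by (apply Rle_ge, pow2_ge_0). nra.
  - apply Rabs_le_mult; [|rewrite Rabs_right; lra].
    rewrite !Rabs_mult, (Rabs_right 2), (Rabs_right x) by lra. fold a; lra.
  - rewrite Rabs_mult, Rabs_right by (pose proof (pow2_ge_0 (y x)); lra).
    rewrite <- S2 in H5. assert (0 <= C * a ^ 2) by (apply Rmult_le_pos; [lra|apply pow2_ge_0]). lra. }
destruct (three_regions (fun x => mm2 x) a0 3 a0p A3) as [L [L1 HL]].
{ intros x Hx. assert (c0 : continuous (fun x => / x) x) by (eapply is_derive_cont, inv_derive; auto).
  assert (c2 : continuous (fun x => - / x ^ 2) x) by (eapply is_derive_cont, inv2_derive; auto).
  assert (c3 : continuous (fun x => 2 * / x ^ 3) x).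
  { apply (ex_derive_continuous (fun x => 2 * / x ^ 3)); auto_derive. repeat apply Rmult_integral_contrapositive_currified; lra. }
  assert (cF1 : continuous F1 x) by (eapply is_derive_cont, F1_derive; auto).
  assert (cF2 : continuous F2 x).
  { unfold F2. apply (continuous_plus (fun x => P x + 2 * x * P1 x) (fun x => y x * P2 x)).
    - apply (continuous_plus P (fun x => 2 * x * P1 x)); [eapply is_derive_cont, Pm_derive; auto|].
      apply (continuous_mult (fun x => 2 * x) P1); [|eapply is_derive_cont, Pm1_derive; auto].
      apply (ex_derive_continuous (fun x => 2 * x)); auto_derive; auto.
    - apply (continuous_mult y P2); [eapply is_derive_cont, yy_derive|apply Pm2_cont; auto]. }
  unfold mm2.
  apply (continuous_plus (fun x => (F2 x * / x + F1 x * - / x ^ 2) + (F1 x * - / x ^ 2 + F x * (2 * / x ^ 3))) (fun x => be * r0 * F1 x)).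
  - apply (continuous_plus (fun x => F2 x * / x + F1 x * - / x ^ 2) (fun x => F1 x * - / x ^ 2 + F x * (2 * / x ^ 3))).
    + apply (continuous_plus (fun x => F2 x * / x) (fun x => F1 x * - / x ^ 2)).
      * apply (continuous_mult F2 (fun x => / x)); auto.
      * apply (continuous_mult F1 (fun x => - / x ^ 2)); auto.
    + apply (continuous_plus (fun x => F1 x * - / x ^ 2) (fun x => F x * (2 * / x ^ 3))).
      * apply (continuous_mult F1 (fun x => - / x ^ 2)); auto.
      * apply (continuous_mult F (fun x => 2 * / x ^ 3)); auto.
  - apply (continuous_mult (fun _ => be * r0) F1); auto. apply continuous_const. }
{ exists ((12 * E + 12 * (D + M) + 8 * C + C) * 2 / c1); intros x Hx.
  destruct (near_facts be be0 be1 x Hx) as [Y1 [_ [x1 _]]]. fold y in Y1. pose proof (Rabs_pos (y x)).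
  apply (near_div be be0 be1 x); auto. eapply Rle_trans; [apply bm2; lra|].
  apply Rmult_le_compat_l; [lra|]. rewrite <- (pow2_abs (y x)). nra. }
{ exists (3 * (12 * E + 12 * (D + M) + 8 * C + C)); intros x Hx.
  destruct (far_facts be be0 be1 x Hx) as [Y2 [_ [Y3 _]]]. fold y in Y2, Y3. apply (far_div be be0 be1 x); auto. apply bm2; [lra|].
  rewrite Rabs_right; lra. }
exists (D + M + E + L); split; [lra|]; intros x Hx.
specialize (HD x Hx); specialize (bmc x Hx); specialize (HM x Hx); specialize (HE x Hx); specialize (HL x Hx); cbv beta in *.
split; [|split; [lra|split; [lra|split; lra]]].
apply Rle_trans with (1 := HD), Rmult_le_compat_r; lra.
Qed.
End Second.

(** * Semiclassical virial identities *)

Lemma fast_abs f : fast f -> fast (fun t => Rabs (f t)).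
Proof.
intros [Hc Hb]; split.
- intros t Ht; apply (continuous_comp f Rabs); [auto|apply continuous_Rabs].
- intros k; destruct (Hb k) as [C HC]; exists C; intros t Ht; rewrite Rabs_Rabsolu; auto.
Qed.

Lemma fast_dilate f l : 0 < l -> fast f -> fast (fun x => f (l * x)).
Proof.
intros Hl [Fc Fb]; split.
- intros t Ht; apply (continuous_comp (fun x => l * x) f); [|apply Fc, Rmult_le_pos; lra].
  apply (ex_derive_continuous (fun x => l * x)); auto_derive; auto.
- intros k; destruct (Fb (k / l)) as [C HC]; exists C; intros t Ht.
  specialize (HC (l * t) ltac:(apply Rmult_le_pos; lra)).
  replace (k / l * (l * t)) with (k * t) in HC by (field; lra); auto.
Qed.

Lemma RInt_small_near0 f : cont0 f -> exists M, 0 < M /\ forall e, 0 <= e <= 1 -> Rabs (RInt f 0 e) <= M * e.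
Proof.
intros Hc.
destruct (continuity_ab_maj (fun x => Rabs (f x)) 0 1 Rle_0_1) as [m [Hm _]].
{ intros c Hcc; apply continuity_pt_filterlim, (continuous_comp f Rabs); [apply Hc; lra|apply continuous_Rabs]. }
exists (Rabs (f m) + 1); split; [pose proof (Rabs_pos (f m)); lra|]. intros e He.
assert (ex : ex_RInt f 0 e).
{ apply (ex_RInt_continuous (V := R_CompleteNormedModule)); intros z Hz; apply Hc; rewrite Rmin_left in Hz; lra. }
eapply Rle_trans; [apply abs_RInt_le; [lra|exact ex]|].
replace ((Rabs (f m) + 1) * e) with (RInt (fun _ => Rabs (f m) + 1) 0 e)
  by (rewrite RInt_const; unfold scal; simpl; unfold mult; simpl; ring).
apply RInt_le; [lra|apply (ex_RInt_norm _ _ _ ex)|apply ex_RInt_const|].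
intros x Hx; specialize (Hm x ltac:(lra)); cbv beta in Hm; lra.
Qed.

(* Version of [II_le_deriv] whose primitive F need only exist on (0, oo) and vanish at 0+. *)
Lemma II_le_deriv0 (A B F F1 Phi : R -> R) : fast A -> fast B -> fast Phi -> Phi 0 = 0 ->
  (forall t, 0 < t -> is_derive F t (F1 t)) -> (forall t, 0 < t -> Rabs (F t) <= Phi t) ->
  (forall t, 0 < t -> A t <= B t + F1 t) -> II A <= II B.
Proof.
intros HA HB HP P0 Hd Hb H.
destruct (Rle_dec (II A) (II B)) as [|Hn]; auto; exfalso.
set (eta := II A - II B). assert (ep : 0 < eta) by (unfold eta; lra).
destruct (RInt_small_near0 A (proj1 HA)) as [MA [MA0 HMA]].
destruct (RInt_small_near0 B (proj1 HB)) as [MB [MB0 HMB]].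
destruct (proj1 (filterlim_locally _ _) (proj1 HP 0 (Rle_refl 0)) (mkposreal (eta / 3) ltac:(lra))) as [d Hd0].
destruct (fast_exp1 Phi HP) as [C HC].
(* Cut at e: the integrals over [0, e] contribute at most eta/3 and the boundary term at most eta/3,
   less than the assumed gap eta. *)
set (e := Rmin (Rmin 1 (d / 2)) (eta / (3 * (MA + MB)))).
pose proof (cond_pos d).
assert (e0 : 0 < e) by (repeat apply Rmin_pos; try lra; apply Rdiv_lt_0_compat; lra).
assert (e1 : e <= 1) by (unfold e; eapply Rle_trans; [apply Rmin_l|apply Rmin_l]).
assert (e2 : e <= d / 2) by (unfold e; eapply Rle_trans; [apply Rmin_l|apply Rmin_r]).
assert (e3 : (MA + MB) * e <= eta / 3).
{ apply Rle_trans with ((MA + MB) * (eta / (3 * (MA + MB)))); [apply Rmult_le_compat_l; [lra|apply Rmin_r]|right; field; lra]. }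
assert (K : IIfrom e A <= IIfrom e B - F e).
{ apply (IIfrom_le_deriv A B F F1 C); auto; [lra| | |].
  - intros t Ht; apply Hd; lra.
  - intros t Ht; eapply Rle_trans; [apply Hb; lra|]. eapply Rle_trans; [apply Rle_abs|]. apply HC; lra.
  - intros t Ht; apply H; lra. }
assert (Pe : Rabs (Phi e) < eta / 3).
{ assert (Bl : ball (Phi 0) (eta / 3) (Phi e)).
  { apply Hd0; unfold ball; simpl; unfold AbsRing_ball, abs, minus, plus, opp; simpl.
    rewrite Rabs_right; lra. }
  unfold ball in Bl; simpl in Bl; unfold AbsRing_ball, abs, minus, plus, opp in Bl; simpl in Bl.
  rewrite P0, Ropp_0, Rplus_0_r in Bl; auto. }
assert (Fe : - F e <= eta / 3).
{ specialize (Hb e e0). pose proof (Rle_abs (- F e)); rewrite Rabs_Ropp in H1. pose proof (Rle_abs (Phi e)); lra. }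
specialize (HMA e ltac:(lra)); specialize (HMB e ltac:(lra)).
pose proof (Rle_abs (RInt A 0 e)); pose proof (Rle_abs (- RInt B 0 e)); rewrite Rabs_Ropp in H2.
unfold IIfrom in K. assert (eta < eta); [|lra].
unfold eta at 1. pose proof (Rabs_pos (RInt A 0 e)). nra.
Qed.

Lemma II_abs_deriv0 (A B F F1 Phi : R -> R) : fast A -> fast B -> fast Phi -> Phi 0 = 0 ->
  (forall t, 0 < t -> is_derive F t (F1 t)) -> (forall t, 0 < t -> Rabs (F t) <= Phi t) ->
  (forall t, 0 < t -> Rabs (A t - F1 t) <= B t) -> Rabs (II A) <= II B.
Proof.
intros HA HB HP P0 Hd Hb H; apply Rabs_le; split.
- assert (II (fun t => - A t) <= II B) as K.
  { apply (II_le_deriv0 (fun t => - A t) B (fun t => - F t) (fun t => - F1 t) Phi); auto; [sf| | |].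
    - intros t Ht; apply (is_derive_opp F); auto.
    - intros t Ht; rewrite Rabs_Ropp; auto.
    - intros t Ht; specialize (H t Ht); apply Rabs_le_between in H; lra. }
  assert (E : II (fun t => - A t) = (-1) * II A).
  { rewrite <- II_scal by auto; apply II_ext; [sf|sf|]; intros; ring. }
  lra.
- apply (II_le_deriv0 A B F F1 Phi); auto.
  intros t Ht; specialize (H t Ht); apply Rabs_le_between in H; lra.
Qed.

(** * The scaled equation on the half-line *)

Definition Ys (b x : R) : R := x ^ 2 / 2 - b.
Definition Qs (b e x : R) : R := Ys b x ^ 2 - e.

(** Only [0, oo) is considered; the product condition at 0 covers both parities and is what removes
    the boundary term U U'. *)
Definition ssol (hh b e : R) (U U1 : R -> R) : Prop :=
  (forall t, 0 <= t -> is_derive U t (U1 t)) /\ (forall t, 0 <= t -> is_derive U1 t (Qs b e t / hh * U t)) /\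
  fast U /\ fast U1 /\ U 0 * U1 0 = 0.

(** The scale l is left free: a neighbouring eigenfunction will be scaled with the l of the critical
    one, so both share hh while the energy of the neighbour is e instead of 1. *)
Lemma ssol_of_sol al lam l u u1 : 0 < l -> sol al lam u u1 -> fast u -> fast u1 -> u 0 * u1 0 = 0 ->
  ssol (/ l ^ 6) (al / l ^ 2) (lam / l ^ 4) (fun x => u (l * x)) (fun x => l * u1 (l * x)).
Proof.
intros Hl [S1 S2] Fu Fu1 H0.
assert (dl : forall t, is_derive (fun x => l * x) t l) by (intros; auto_derive; auto; ring).
assert (F0 := fast_dilate u l Hl Fu). assert (F1 := fast_dilate u1 l Hl Fu1).
split; [|split; [|split; [|split]]].
- intros t _; apply (is_derive_comp u (fun x => l * x)); auto.
- intros t _. replace (Qs (al / l ^ 2) (lam / l ^ 4) t / / l ^ 6 * u (l * t)) with (l * (l * (Qp al lam (l * t) * u (l * t)))).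
  + apply is_derive_scal. apply (is_derive_comp u1 (fun x => l * x)); auto.
  + unfold Qs, Ys, Qp, qM; field; lra.
- auto.
- sf.
- rewrite Rmult_0_r. transitivity (l * (u 0 * u1 0)); [ring|rewrite H0; ring].
Qed.

Lemma slow_Ys b : slow (Ys b).
Proof. unfold Ys; sf. Qed.

Section SSol.
Variables (hh b e : R) (U U1 : R -> R).
Hypothesis Hh : 0 < hh.
Hypothesis HU : ssol hh b e U U1.

Definition Js (t : R) : R := hh * U1 t ^ 2 - Qs b e t * U t ^ 2.

Lemma ssol_pderive t : 0 <= t -> is_derive (fun t => U t * U1 t) t (U1 t ^ 2 + Qs b e t / hh * U t ^ 2).
Proof.
intros Ht; destruct HU as [S1 [S2 _]].
replace (U1 t ^ 2 + Qs b e t / hh * U t ^ 2) with (U1 t * U1 t + U t * (Qs b e t / hh * U t)) by ring.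
apply (is_derive_mult U U1); auto; intros; apply Rmult_comm.
Qed.

Lemma Qs_derive b' e' t : is_derive (Qs b' e') t (2 * Ys b' t * t).
Proof. unfold Qs, Ys; auto_derive; auto; field. Qed.

Lemma Js_derive t : 0 <= t -> is_derive Js t (- (2 * Ys b t * t) * U t ^ 2).
Proof.
intros Ht; destruct HU as [S1 [S2 _]].
replace (- (2 * Ys b t * t) * U t ^ 2) with
  (hh * (2 * (U1 t * (Qs b e t / hh * U t))) - (2 * Ys b t * t * U t ^ 2 + Qs b e t * (2 * (U t * U1 t)))) by (field; lra).
apply (is_derive_minus (fun t => hh * U1 t ^ 2) (fun t => Qs b e t * U t ^ 2)).
- apply is_derive_scal, (sol_sq_derive U1 (fun t => Qs b e t / hh * U t)), S2; auto.
- apply (is_derive_mult (Qs b e) (fun t => U t ^ 2)); [apply Qs_derive|apply sol_sq_derive, S1; auto|intros; apply Rmult_comm].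
Qed.

Lemma ssol_energy : hh * II (fun t => U1 t ^ 2) + II (fun t => Ys b t ^ 2 * U t ^ 2) = e * II (fun t => U t ^ 2).
Proof.
destruct HU as [S1 [S2 [FU [FU1 H0]]]].
assert (SY := slow_Ys b).
rewrite <- !II_scal, <- II_plus by sf.
rewrite (II_eq_deriv (fun t => hh * U1 t ^ 2 + Ys b t ^ 2 * U t ^ 2) (fun t => e * U t ^ 2) (fun t => hh * (U t * U1 t))
  (fun t => hh * (U1 t ^ 2 + Qs b e t / hh * U t ^ 2))).
- rewrite H0; ring.
- sf.
- sf.
- sf.
- intros t Ht; apply is_derive_scal, ssol_pderive; auto.
- intros t Ht; unfold Qs; field; lra.
Qed.

(* Virial identities: multiply the equation by [2 G U' + G' U]. *)
Lemma virial_derive2 (G G1 G2 : R -> R) t : 0 < t -> is_derive G t (G1 t) -> is_derive G1 t (G2 t) ->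
  is_derive (fun t => G t * Js t - hh * (G1 t * (U t * U1 t))) t
   (- 2 * (G1 t * Qs b e t + G t * Ys b t * t) * U t ^ 2 - hh * (G2 t * (U t * U1 t))).
Proof.
intros Ht D1 D2.
replace (- 2 * (G1 t * Qs b e t + G t * Ys b t * t) * U t ^ 2 - hh * (G2 t * (U t * U1 t))) with
 ((G1 t * Js t + G t * (- (2 * Ys b t * t) * U t ^ 2)) - hh * (G2 t * (U t * U1 t) + G1 t * (U1 t ^ 2 + Qs b e t / hh * U t ^ 2)))
 by (unfold Js; field; lra).
apply (is_derive_minus (fun t => G t * Js t) (fun t => hh * (G1 t * (U t * U1 t)))).
- apply (is_derive_mult G Js); auto; [apply Js_derive; lra|intros; apply Rmult_comm].
- apply is_derive_scal, (is_derive_mult G1 (fun t => U t * U1 t)); auto; [apply ssol_pderive; lra|intros; apply Rmult_comm].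
Qed.

(** One more integration by parts than [virial_derive2]: the error hh G'' U U', of size sqrt hh,
    becomes hh G''' U^2, of size hh. That order is what gives be - b = O(hh) at a critical point. *)
Lemma virial_derive3 (G G1 G2 G3 : R -> R) t : 0 < t -> is_derive G t (G1 t) -> is_derive G1 t (G2 t) -> is_derive G2 t (G3 t) ->
  is_derive (fun t => G t * Js t - hh * (G1 t * (U t * U1 t)) + hh / 2 * (G2 t * U t ^ 2)) t
   (- 2 * (G1 t * Qs b e t + G t * Ys b t * t) * U t ^ 2 + hh / 2 * (G3 t * U t ^ 2)).
Proof.
intros Ht D1 D2 D3; destruct HU as [S1 _].
replace (- 2 * (G1 t * Qs b e t + G t * Ys b t * t) * U t ^ 2 + hh / 2 * (G3 t * U t ^ 2)) with
 ((- 2 * (G1 t * Qs b e t + G t * Ys b t * t) * U t ^ 2 - hh * (G2 t * (U t * U1 t))) + hh / 2 * (G3 t * U t ^ 2 + G2 t * (2 * (U t * U1 t)))) by (field; lra).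
apply (is_derive_plus (fun t => G t * Js t - hh * (G1 t * (U t * U1 t))) (fun t => hh / 2 * (G2 t * U t ^ 2))).
- now apply virial_derive2.
- apply is_derive_scal, (is_derive_mult G2 (fun t => U t ^ 2)); auto; [apply sol_sq_derive, S1; lra|intros; apply Rmult_comm].
Qed.

Lemma fast_Js : fast Js.
Proof.
destruct HU as [S1 [S2 [FU [FU1 H0]]]]. assert (SY := slow_Ys b). unfold Js, Qs; sf.
Qed.
End SSol.

Section Semi.
Variable be : R.
Hypothesis be0 : 0 < be.
Hypothesis be1 : be < 1.
Hypothesis HZ : Zcond be.
Let y := yy be.
Let P := Pm be.

(** The third derivative of [gm], since gm' = y P. *)
Definition G3 (x : R) : R := Pm be x + 2 * x * Pm1 be x + yy be x * Pm2 be x.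

Lemma yP_derive2 x : 0 < x -> is_derive (fun x => yy be x * Pm be x) x (x * Pm be x + yy be x * Pm1 be x).
Proof.
intros Hx; apply (is_derive_mult (yy be) (Pm be)); [apply yy_derive|apply Pm_derive; auto|intros; apply Rmult_comm].
Qed.

Lemma xP_derive2 x : 0 < x -> is_derive (fun x => x * Pm be x + yy be x * Pm1 be x) x (G3 x).
Proof.
intros Hx; unfold G3.
replace (Pm be x + 2 * x * Pm1 be x + yy be x * Pm2 be x) with ((1 * Pm be x + x * Pm1 be x) + (x * Pm1 be x + yy be x * Pm2 be x)) by ring.
apply (is_derive_plus (fun x => x * Pm be x) (fun x => yy be x * Pm1 be x)).
- apply (is_derive_mult (fun x => x) (Pm be)); [apply (is_derive_id x)|apply Pm_derive; auto|intros; apply Rmult_comm].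
- apply (is_derive_mult (yy be) (Pm1 be)); [apply yy_derive|apply Pm1_derive; auto|intros; apply Rmult_comm].
Qed.

Lemma Ys_yy b x : Ys b x = yy be x + (be - b).
Proof. unfold Ys, yy; ring. Qed.

(** The functional of [virial_derive3] for the multiplier [gm]. *)
Definition VF hh b e U U1 (t : R) : R :=
  gm be t * Js hh b e U U1 t - hh * (yy be t * Pm be t * (U t * U1 t)) + hh / 2 * ((t * Pm be t + yy be t * Pm1 be t) * U t ^ 2).

(** With Ys = y + (be - b), the equation of [gm] converts the virial weight into Ys, up to one term
    proportional to be - b, with weight K = Pc (1 + y Ys), and one proportional to 1 - e. *)
Lemma VF_derive hh b e U U1 t : 0 < hh -> ssol hh b e U U1 -> 0 < t -> is_derive (VF hh b e U U1) t
  (2 * (Ys b t * U t ^ 2 - (be - b) * (Pc be t * (1 + yy be t * Ys b t)) * U t ^ 2 - (1 - e) * (yy be t * Pc be t) * U t ^ 2)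
    + hh / 2 * (G3 t * U t ^ 2)).
Proof.
intros Hh HU Ht.
assert (D := virial_derive3 hh b e U U1 Hh HU (gm be) (fun x => yy be x * Pm be x) (fun x => x * Pm be x + yy be x * Pm1 be x) G3 t Ht
  (gm_derive be be0 be1 t Ht) (yP_derive2 t Ht) (xP_derive2 t Ht)).
match type of D with is_derive _ _ ?l => match goal with |- is_derive _ _ ?r => replace r with l; [exact D|] end end.
rewrite Pc_eq by auto. assert (E := gm_eq be t Ht). unfold p2 in E.
cbv beta. unfold Qs; rewrite (Ys_yy b). set (d := be - b). set (v := yy be t) in *. set (Q := Pm be t) in *. set (w := gm be t) in *.
assert (Ew : w * t = (1 - v ^ 2) * Q - 1) by lra.
apply Rminus_diag_uniq.
transitivity (- 2 * (v + d) * U t ^ 2 * (w * t - ((1 - v ^ 2) * Q - 1))); [ring|rewrite Ew; ring].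
Qed.

(** The majorant is [fast] and vanishes at 0, by gm = O(t) and U(0) U'(0) = 0, as [II_abs_deriv0]
    requires. *)
Lemma VF_bound : exists C, 1 <= C /\ forall hh b e U U1 t, 0 < hh <= 1 -> 0 < t ->
  Rabs (VF hh b e U U1 t) <= C * (t * Rabs (Js hh b e U U1 t) + Rabs (U t * U1 t) + t * (1 + yy be t ^ 2) * U t ^ 2).
Proof.
destruct (g_bounds be be0 be1 HZ) as [C [C1 HC]]; exists C; split; auto.
intros hh b e U U1 t Hh Ht; destruct (HC t Ht) as [H1 [_ [H3 [_ [_ [H6 _]]]]]].
assert (Pp : 0 < Pm be t) by (apply Pm_pos; auto).
set (v := yy be t) in *. pose proof (pow2_ge_0 v).
assert (vv : Rabs v <= 1 + v ^ 2) by (rewrite <- (pow2_abs v); pose proof (Rabs_pos v); nra).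
assert (PC : Pm be t <= C) by nra.
assert (vP : Rabs (v * Pm be t) <= C).
{ rewrite Rabs_mult, (Rabs_right (Pm be t)) by lra. pose proof (Rabs_pos v). nra. }
assert (G2b : Rabs (t * Pm be t + v * Pm1 be t) <= 2 * C * (t * (1 + v ^ 2))).
{ replace (2 * C * (t * (1 + v ^ 2))) with (t * (C * (1 + v ^ 2)) + (1 + v ^ 2) * (C * t)) by ring. apply Rabs_le_plus.
  - rewrite Rabs_right by nra. apply Rmult_le_compat_l; nra.
  - apply Rabs_le_mult; auto. }
unfold VF; fold v.
replace (C * (t * Rabs (Js hh b e U U1 t) + Rabs (U t * U1 t) + t * (1 + v ^ 2) * U t ^ 2))
 with (C * t * Rabs (Js hh b e U U1 t) + C * Rabs (U t * U1 t) + 1 / 2 * (2 * C * (t * (1 + v ^ 2)) * U t ^ 2)) by field.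
apply Rabs_le_plus; [apply Rabs_le_minus|].
- rewrite Rabs_mult; apply Rmult_le_compat_r; [apply Rabs_pos|auto].
- rewrite Rabs_mult, (Rabs_right hh), Rabs_mult by lra. pose proof (Rabs_pos (U t * U1 t)).
  assert (Rabs (v * Pm be t) * Rabs (U t * U1 t) <= C * Rabs (U t * U1 t)) by (apply Rmult_le_compat_r; auto).
  assert (0 <= Rabs (v * Pm be t) * Rabs (U t * U1 t)) by (apply Rmult_le_pos; auto using Rabs_pos). nra.
- apply Rabs_le_mult; [rewrite Rabs_right; lra|]. apply Rabs_le_mult; auto.
  rewrite Rabs_right; [lra|]. apply Rle_ge, pow2_ge_0.
Qed.

Lemma slow_Pc : slow (Pc be).
Proof.
destruct (Pc_bound be be0 be1 HZ) as [C [C1 HC]]. apply slow_bounded with C; [apply Pc_cont0; auto|].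
intros t Ht; specialize (HC t Ht). assert (0 < Pc be t) by (apply Pc_pos; auto).
rewrite Rabs_right by lra. pose proof (pow2_ge_0 (yy be t)); nra.
Qed.

Lemma slow_yy : slow (yy be).
Proof. unfold yy; sf. Qed.

Lemma fast_Phi hh b e U U1 C : ssol hh b e U U1 ->
  fast (fun t => C * (t * Rabs (Js hh b e U U1 t) + Rabs (U t * U1 t) + t * (1 + yy be t ^ 2) * U t ^ 2)).
Proof.
intros HU; assert (FJ := fast_Js hh b e U U1 HU). destruct HU as [S1 [S2 [FU [FU1 H0]]]].
assert (A1 := fast_abs _ FJ). assert (A2 : fast (fun t => Rabs (U t * U1 t))) by (apply (fast_abs (fun t => U t * U1 t)); sf).
assert (Sy := slow_yy).
apply (slow_fast (fun _ => C) (fun t => t * Rabs (Js hh b e U U1 t) + Rabs (U t * U1 t) + t * (1 + yy be t ^ 2) * U t ^ 2)); [sf|].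
apply (fast_plus (fun t => t * Rabs (Js hh b e U U1 t) + Rabs (U t * U1 t))); [|sf].
apply (fast_plus (fun t => t * Rabs (Js hh b e U U1 t))); [|exact A2].
apply (slow_fast (fun t => t) (fun t => Rabs (Js hh b e U U1 t))); [sf|exact A1].
Qed.

Lemma Phi_0 hh b e U U1 C : ssol hh b e U U1 ->
  C * (0 * Rabs (Js hh b e U U1 0) + Rabs (U 0 * U1 0) + 0 * (1 + yy be 0 ^ 2) * U 0 ^ 2) = 0.
Proof. intros [_ [_ [_ [_ H0]]]]; rewrite H0, Rabs_R0; ring. Qed.

(* The multiplier gm turns [II (Ys b U^2) = 0] into [(be - b) * II (K U^2) = O(hh)], where K = Pc (1 + yy Ys) >= Pc / 4. *)
Lemma critical_ratio : exists C, 0 < C /\ forall hh b U U1, 0 < hh <= 1 -> Rabs (be - b) <= 3 / 2 -> ssol hh b 1 U U1 ->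
  0 < II (fun t => U t ^ 2) -> II (fun t => Ys b t * U t ^ 2) = 0 -> Rabs (be - b) <= C * hh.
Proof.
destruct (g_bounds be be0 be1 HZ) as [C [C1 HC]]. destruct VF_bound as [CV [CV1 HCV]].
destruct (Pc_lower be be0 be1 HZ 4) as [c [cp Hc]]; [lra|].
exists (2 * C / c); split; [apply Rdiv_lt_0_compat; lra|].
intros hh b U U1 Hh Hd HU Np H0.
assert (Sy := slow_yy). assert (SP := slow_Pc). assert (SY := slow_Ys b).
assert (FPhi := fast_Phi hh b 1 U U1 CV HU). assert (P0 := Phi_0 hh b 1 U U1 CV HU).
assert (En := ssol_energy hh b 1 U U1 (proj1 Hh) HU).
assert (HU' := HU). destruct HU' as [S1 [S2 [FU [FU1 HB]]]].
set (N := II (fun t => U t ^ 2)) in *. set (d := be - b) in *.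
assert (K : Rabs (II (fun t => Ys b t * U t ^ 2 - d * (Pc be t * (1 + yy be t * Ys b t)) * U t ^ 2)) <= II (fun t => hh / 4 * C * U t ^ 2)).
{ apply (II_abs_deriv0 _ _ (fun t => / 2 * VF hh b 1 U U1 t)
   (fun t => / 2 * (2 * (Ys b t * U t ^ 2 - d * (Pc be t * (1 + yy be t * Ys b t)) * U t ^ 2 - (1 - 1) * (yy be t * Pc be t) * U t ^ 2)
    + hh / 2 * (G3 t * U t ^ 2)))
   (fun t => CV * (t * Rabs (Js hh b 1 U U1 t) + Rabs (U t * U1 t) + t * (1 + yy be t ^ 2) * U t ^ 2))); auto; [sf|sf| | |].
  - intros t Ht; apply is_derive_scal, VF_derive; auto; lra.
  - intros t Ht; rewrite Rabs_mult, (Rabs_right (/ 2)) by lra.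
    specialize (HCV hh b 1 U U1 t Hh Ht). pose proof (Rabs_pos (VF hh b 1 U U1 t)). lra.
  - intros t Ht. match goal with |- Rabs ?e <= _ => replace e with (- (hh / 4) * (G3 t * U t ^ 2)) by field end.
    destruct (HC t Ht) as [_ [_ [_ [_ [_ [_ H7]]]]]]. fold (G3 t) in H7.
    rewrite !Rabs_mult, Rabs_Ropp, (Rabs_right (hh / 4)), (Rabs_right (U t ^ 2)) by (try apply Rle_ge, pow2_ge_0; lra).
    replace (hh / 4 * C * U t ^ 2) with (hh / 4 * (C * U t ^ 2)) by ring.
    apply Rmult_le_compat_l; [lra|]. apply Rmult_le_compat_r; [apply pow2_ge_0|auto]. }
rewrite II_scal in K by sf. fold N in K.
assert (E : II (fun t => Ys b t * U t ^ 2 - d * (Pc be t * (1 + yy be t * Ys b t)) * U t ^ 2) =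
   0 - d * II (fun t => Pc be t * (1 + yy be t * Ys b t) * U t ^ 2)).
{ rewrite <- H0, <- II_scal, <- II_minus by sf. apply II_ext; [sf|sf|]. intros; ring. }
rewrite E in K; clear E.
set (KU := II (fun t => Pc be t * (1 + yy be t * Ys b t) * U t ^ 2)) in *.
(* 1 + v (v + d) >= 1 - d^2/4 >= 7/16, because |d| <= 3/2. *)
assert (L1 : 1 / 4 * II (fun t => Pc be t * U t ^ 2) <= KU).
{ rewrite <- II_scal by sf. apply II_le; [sf|unfold KU; sf|].
  intros t Ht. assert (Pt : 0 < Pc be t) by (apply Pc_pos; auto).
  rewrite (Ys_yy b). fold d. set (v := yy be t).
  assert (1 / 4 <= 1 + v * (v + d)).
  { apply Rabs_le_between in Hd. pose proof (pow2_ge_0 (v + d / 2)). assert (d ^ 2 <= 9 / 4) by nra. lra. }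
  pose proof (pow2_ge_0 (U t)).   assert (0 <= Pc be t * U t ^ 2) by (apply Rmult_le_pos; lra). nra. }
(* Mass cannot escape to infinity, where Pc is small: on [0, 4] Pc >= c, and beyond 4 Ys >= 2, so
   there the mass is paid for by the potential energy, which is at most N. *)
assert (L2 : N <= / c * II (fun t => Pc be t * U t ^ 2) + 1 / 2 * II (fun t => Ys b t ^ 2 * U t ^ 2)).
{ rewrite <- !II_scal, <- II_plus by sf. apply II_le; [sf|sf|].
  intros t Ht. pose proof (pow2_ge_0 (U t)).
  assert (Pt : 0 < Pc be t) by (apply Pc_pos; auto).
  assert (1 <= / c * Pc be t + 1 / 2 * Ys b t ^ 2).
  { assert (ic : 0 < / c) by (apply Rinv_0_lt_compat; auto). assert (ci : / c * c = 1) by (field; lra).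
    pose proof (pow2_ge_0 (Ys b t)).
    destruct (Rle_dec t 4).
    - specialize (Hc t ltac:(lra)). nra.
    - assert (2 <= Ys b t) by (unfold Ys; apply Rabs_le_between in Hd; unfold d in Hd; nra).
      assert (0 <= / c * Pc be t) by (apply Rmult_le_pos; lra). nra. }
  replace (/ c * (Pc be t * U t ^ 2) + 1 / 2 * (Ys b t ^ 2 * U t ^ 2)) with ((/ c * Pc be t + 1 / 2 * Ys b t ^ 2) * U t ^ 2) by ring.
  rewrite <- (Rmult_1_l (U t ^ 2)) at 1. apply Rmult_le_compat_r; auto. }
assert (I1 : 0 <= II (fun t => U1 t ^ 2)) by (apply II_sq_ge0; auto).
assert (L3 : c / 2 * N <= II (fun t => Pc be t * U t ^ 2)).
{ apply Rmult_le_reg_l with (/ c); [apply Rinv_0_lt_compat; auto|].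
  replace (/ c * (c / 2 * N)) with (N / 2) by (field; lra). nra. }
assert (L4 : c / 8 * N <= KU) by lra.
replace (0 - d * KU) with (- (d * KU)) in K by ring. rewrite Rabs_Ropp, Rabs_mult, (Rabs_right KU) in K by nra.
apply Rmult_le_reg_r with (c / 8 * N); [nra|].
replace (2 * C / c * hh * (c / 8 * N)) with (hh / 4 * C * N) by (field; lra).
apply Rle_trans with (2 := K). apply Rmult_le_compat_l; [apply Rabs_pos|auto].
Qed.
End Semi.

(** * Second variation at a critical point *)

Section Semi2.
Variable be : R.
Hypothesis be0 : 0 < be.
Hypothesis be1 : be < 1.
Hypothesis HZ : Zcond be.

(* The multiplier mm replaces (1 + y^2) P by the constant r0. *)
Lemma mean_K : exists C, 1 <= C /\ forall hh b e U U1, 0 < hh <= 1 -> Rabs (be - b) <= 1 -> Rabs (1 - e) <= 1 ->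
  ssol hh b e U U1 ->
  Rabs (II (fun t => (1 + yy be t ^ 2) * Pc be t * U t ^ 2) - r0 be * II (fun t => U t ^ 2))
   <= C * (sqrt hh + Rabs (be - b) + Rabs (1 - e)) * II (fun t => U t ^ 2).
Proof.
destruct (mm_bounds be be0 be1 HZ) as [C [C1 HC]].
exists (9 * C); split; [lra|].
intros hh b e U U1 Hh Hd He HU.
assert (Sy := slow_yy be). assert (SP := slow_Pc be be0 be1 HZ). assert (SY := slow_Ys b).
assert (FPhi := fast_Phi be hh b e U U1 C HU). assert (P0 := Phi_0 be hh b e U U1 C HU).
assert (En := ssol_energy hh b e U U1 (proj1 Hh) HU).
assert (HU' := HU). destruct HU' as [S1 [S2 [FU [FU1 HB]]]].
set (N := II (fun t => U t ^ 2)) in *. set (d := be - b) in *. set (s := sqrt hh).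
assert (sp : 0 < s) by (apply sqrt_lt_R0; lra). assert (ss : s * s = hh) by (apply sqrt_sqrt; lra).
assert (K : Rabs (II (fun t => ((1 + yy be t ^ 2) * Pc be t - r0 be) * U t ^ 2)) <=
  II (fun t => C * (Rabs d * (5 + 2 * Ys b t ^ 2) + Rabs (1 - e)) * U t ^ 2 + C * s / 4 * (U t ^ 2 + hh * U1 t ^ 2))).
(* [mm_bounds] controls two derivatives of [mm], so [virial_derive2] is used; its term hh U U' is
   bounded by sqrt hh (U^2 + hh U'^2)/2 and then by the energy identity. *)
{ apply (II_abs_deriv0 _ _ (fun t => / 2 * (mm be t * Js hh b e U U1 t - hh * (mm1 be t * (U t * U1 t))))
   (fun t => / 2 * (- 2 * (mm1 be t * Qs b e t + mm be t * Ys b t * t) * U t ^ 2 - hh * (mm2 be t * (U t * U1 t))))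
   (fun t => C * (t * Rabs (Js hh b e U U1 t) + Rabs (U t * U1 t) + t * (1 + yy be t ^ 2) * U t ^ 2))); auto; [sf|sf| | |].
  - intros t Ht; apply is_derive_scal, (virial_derive2 hh b e U U1); auto; [lra|apply mm_derive; auto|apply mm1_derive; auto].
  - intros t Ht; rewrite Rabs_mult, (Rabs_right (/ 2)) by lra.
    destruct (HC t Ht) as [H1 [_ [_ [H4 _]]]].
    assert (A : Rabs (mm be t * Js hh b e U U1 t - hh * (mm1 be t * (U t * U1 t))) <= C * t * Rabs (Js hh b e U U1 t) + 1 * (C * Rabs (U t * U1 t))).
    { apply Rabs_le_minus; [apply Rabs_le_mult; lra|]. apply Rabs_le_mult; [rewrite Rabs_right; lra|apply Rabs_le_mult; lra]. }
    assert (0 <= C * (t * (1 + yy be t ^ 2) * U t ^ 2)).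
    { pose proof (pow2_ge_0 (yy be t)); pose proof (pow2_ge_0 (U t)).
      apply Rmult_le_pos; [lra|apply Rmult_le_pos; [apply Rmult_le_pos; lra|lra]]. }
    pose proof (Rabs_pos (mm be t * Js hh b e U U1 t - hh * (mm1 be t * (U t * U1 t)))). lra.
  - intros t Ht. destruct (HC t Ht) as [_ [_ [H3 [H4 H5]]]].
    assert (O := mm_ode be be0 be1 t Ht). rewrite Pc_eq by auto.
    match goal with |- Rabs ?E <= _ => replace E with
      ((mm1 be t * (2 * yy be t * d + d ^ 2 + (1 - e)) + d * (t * mm be t)) * U t ^ 2 + hh / 2 * (mm2 be t * (U t * U1 t))) end.
    2:{ unfold Qs; rewrite (Ys_yy be b). fold d. unfold p2 in O.
        set (v := yy be t) in *. set (a := mm be t) in *. set (a1 := mm1 be t) in *.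
        apply Rminus_diag_uniq. transitivity ((v * t * a + (1 + v ^ 2) * Pm be t - r0 be - (1 - v ^ 2) * a1) * - U t ^ 2); [field|rewrite <- O; ring]. }
    pose proof (pow2_ge_0 (U t)). pose proof (Rabs_pos d). pose proof (Rabs_pos (1 - e)).
    apply Rabs_le_plus.
    + apply Rabs_le_mult; [|rewrite Rabs_right; lra].
      replace (C * (Rabs d * (5 + 2 * Ys b t ^ 2) + Rabs (1 - e))) with
        (C * (Rabs d * (3 + 2 * Ys b t ^ 2) + Rabs d + Rabs (1 - e)) + Rabs d * C) by ring.
      apply Rabs_le_plus; [|apply Rabs_le_mult; lra].
      apply Rabs_le_mult; auto. apply Rabs_le_plus; [apply Rabs_le_plus|lra].
      * replace (2 * yy be t * d) with (d * (2 * yy be t)) by ring. rewrite Rabs_mult. apply Rmult_le_compat_l; auto.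
        assert (E1 : yy be t = Ys b t - d) by (rewrite (Ys_yy be b); unfold d; ring).
        rewrite E1. apply Rabs_le_between in Hd. apply Rabs_le; split; pose proof (pow2_ge_0 (Ys b t + 1)); pose proof (pow2_ge_0 (Ys b t - 1)); nra.
      * rewrite <- (pow2_abs d), Rabs_right by (apply Rle_ge, pow2_ge_0). nra.
    + rewrite Rabs_mult, (Rabs_right (hh / 2)), Rabs_mult by lra.
      assert (X : hh * Rabs (U t * U1 t) <= s / 2 * (U t ^ 2 + hh * U1 t ^ 2)).
      { rewrite Rabs_mult. rewrite <- (pow2_abs (U t)), <- (pow2_abs (U1 t)), <- ss.
        pose proof (pow2_ge_0 (Rabs (U t) - s * Rabs (U1 t))). nra. }
      pose proof (Rabs_pos (U t * U1 t)). pose proof (Rabs_pos (mm2 be t)).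
      assert (Rabs (mm2 be t) * (hh * Rabs (U t * U1 t)) <= C * (s / 2 * (U t ^ 2 + hh * U1 t ^ 2))).
      { apply Rmult_le_compat; auto. apply Rmult_le_pos; lra. }
      lra. }
assert (E1 : II (fun t => ((1 + yy be t ^ 2) * Pc be t - r0 be) * U t ^ 2) =
  II (fun t => (1 + yy be t ^ 2) * Pc be t * U t ^ 2) - r0 be * N).
{ unfold N; rewrite <- II_scal, <- II_minus by sf. apply II_ext; [sf|sf|]. intros; ring. }
rewrite <- E1. apply Rle_trans with (1 := K).
assert (E2 : II (fun t => C * (Rabs d * (5 + 2 * Ys b t ^ 2) + Rabs (1 - e)) * U t ^ 2 + C * s / 4 * (U t ^ 2 + hh * U1 t ^ 2)) =
  C * (5 * Rabs d + Rabs (1 - e)) * N + C * s / 4 * N + (2 * C * Rabs d) * II (fun t => Ys b t ^ 2 * U t ^ 2) + C * s / 4 * hh * II (fun t => U1 t ^ 2)).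
{ unfold N; rewrite <- !II_scal, <- !II_plus by sf. apply II_ext; [sf|sf|]. intros; field. }
rewrite E2; clear E2 K E1.
assert (I1 : 0 <= II (fun t => U1 t ^ 2)) by (apply II_sq_ge0; auto).
assert (I2 : 0 <= II (fun t => Ys b t ^ 2 * U t ^ 2)).
{ apply II_ge0; [sf|]. intros t _; apply Rmult_le_pos; apply pow2_ge_0. }
assert (N0 : 0 <= N) by (apply II_sq_ge0; auto).
assert (e2 : e <= 2) by (apply Rabs_le_between in He; lra).
assert (B1 : hh * II (fun t => U1 t ^ 2) <= 2 * N) by nra.
assert (B2 : II (fun t => Ys b t ^ 2 * U t ^ 2) <= 2 * N) by nra.
pose proof (Rabs_pos d). pose proof (Rabs_pos (1 - e)).
assert (2 * C * Rabs d * II (fun t => Ys b t ^ 2 * U t ^ 2) <= 2 * C * Rabs d * (2 * N)).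
{ apply Rmult_le_compat_l; auto. repeat apply Rmult_le_pos; lra. }
assert (C * s / 4 * hh * II (fun t => U1 t ^ 2) <= C * s / 4 * (2 * N)).
{ rewrite Rmult_assoc. apply Rmult_le_compat_l; auto. assert (0 <= C * s) by (apply Rmult_le_pos; lra). lra. }
assert (0 <= C * s * N) by (repeat apply Rmult_le_pos; lra).
assert (0 <= C * Rabs (1 - e) * N) by (repeat apply Rmult_le_pos; lra).
fold s. lra.
Qed.

(* Zero Cauchy data at 0: Gronwall where p^2 is bounded below, then the multiplier U' beyond. *)
Lemma zero_data_semi : exists C, 1 <= C /\ forall hh b w w1 f, 0 < hh <= 1 -> 0 <= b <= (1 + be) / 2 ->
  (forall t, 0 <= t -> is_derive w t (w1 t)) ->
  (forall t, 0 <= t -> is_derive w1 t ((Qs b 1 t * w t + f t) / hh)) ->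
  fast w -> fast w1 -> fast f -> w 0 = 0 -> w1 0 = 0 -> nrm w <= C / sqrt hh * nrm f.
Proof.
set (b1 := (1 + be) / 2). assert (b1b : 1 / 2 < b1 < 1) by (unfold b1; lra).
set (c1 := 1 - b1 ^ 2). assert (c1p : 0 < c1 <= 1) by (unfold c1; nra).
(* Gronwall rate: 1 absorbs the product w' f, and 4/c1 absorbs 2 Ys t w^2, where |Ys t| <= 2 on
   [0, a] and the energy dominates c1 w^2. *)
set (K := 1 + 4 / c1). assert (K0 : 0 < K) by (unfold K; assert (0 < 4 / c1) by (apply Rdiv_lt_0_compat; lra); lra).
set (M := exp (K * 2)). assert (M0 : 1 <= M).
{ unfold M; rewrite <- exp_0; apply exp_mono; lra. }
set (C2 := 2 * M / c1 + 7 + M / c1 + 2 * M). 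
assert (Mc : 0 < M / c1) by (apply Rdiv_lt_0_compat; lra).
assert (C20 : 1 <= C2) by (unfold C2; assert (2 * M / c1 = 2 * (M / c1)) by (field; lra); lra).
exists (sqrt C2); split; [rewrite <- sqrt_1; apply sqrt_le_1_alt; auto|].
intros hh b w w1 f Hh Hb Dw Dw1 Fw Fw1 Ff w0 w10.
assert (SY := slow_Ys b). assert (SQ : slow (Qs b 1)) by (unfold Qs; sf).
set (N := II (fun t => f t ^ 2)). assert (N0 : 0 <= N) by (apply II_sq_ge0; auto).
(* The point where Ys = 1/2. Before it 1 - Ys^2 >= c1, so the energy E is positive; after it Ys t >=
   1/2, so the force term controls w^2. The turning point lies in the second region. *)
set (a := sqrt (2 * b + 1)). assert (a2 : a ^ 2 = 2 * b + 1) by (apply pow2_sqrt; lra).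
assert (a1 : 1 <= a) by (rewrite <- sqrt_1; apply sqrt_le_1_alt; lra).
assert (ab : a <= 2) by nra.
assert (Yb : forall t, 0 <= t <= a -> - b1 <= Ys b t <= b1 /\ c1 <= - Qs b 1 t).
{ intros t Ht; assert (0 <= t ^ 2 <= a ^ 2) by (split; [apply pow2_ge_0|apply pow_incr; lra]).
  assert (- b1 <= Ys b t <= b1) by (unfold Ys; lra). split; auto. unfold Qs, c1. nra. }
set (E := fun t => hh * w1 t ^ 2 - Qs b 1 t * w t ^ 2).
assert (dE : forall t, 0 <= t -> is_derive E t (2 * (w1 t * f t) - 2 * Ys b t * t * w t ^ 2)).
{ intros t Ht.
  replace (2 * (w1 t * f t) - 2 * Ys b t * t * w t ^ 2) with (hh * (2 * (w1 t * ((Qs b 1 t * w t + f t) / hh))) - (2 * Ys b t * t * w t ^ 2 + Qs b 1 t * (2 * (w t * w1 t)))) by (field; lra).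
  apply (is_derive_minus (fun t => hh * w1 t ^ 2) (fun t => Qs b 1 t * w t ^ 2)).
  - apply is_derive_scal, (sol_sq_derive w1 (fun t => (Qs b 1 t * w t + f t) / hh)); auto.
  - apply (is_derive_mult (Qs b 1) (fun t => w t ^ 2)); [apply Qs_derive|apply sol_sq_derive; auto|intros; apply Rmult_comm]. }
assert (Elow : forall t, 0 <= t <= a -> hh * w1 t ^ 2 + c1 * w t ^ 2 <= E t).
{ intros t Ht; destruct (Yb t Ht) as [_ Hq]. unfold E. pose proof (pow2_ge_0 (w t)). nra. }
assert (E1 : forall s, 0 <= s <= a -> E s <= M * (N / hh)).
{ intros s Hs.
  assert (G : RInt (fun _ => 0) 0 s <= RInt (fun t => / hh * f t ^ 2) 0 s + - (E s * exp (- (K * s))) - - (E 0 * exp (- (K * 0)))).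
  { apply (RInt_le_deriv (fun _ => 0) (fun t => / hh * f t ^ 2) (fun t => - (E t * exp (- (K * t))))
     (fun t => - ((2 * (w1 t * f t) - 2 * Ys b t * t * w t ^ 2) * exp (- (K * t)) + E t * (- K * exp (- (K * t))))) 0 s); [lra| | | |].
    - intros; apply continuous_const.
    - intros t Ht; assert (fast (fun t => / hh * f t ^ 2)) as Fh by sf. apply Fh; lra.
    - intros t Ht; apply (is_derive_opp (fun t => E t * exp (- (K * t)))).
      apply (is_derive_mult E (fun t => exp (- (K * t)))); [apply dE; lra| |intros; apply Rmult_comm].
      auto_derive; auto; ring.
    - intros t Ht; set (x := exp (- (K * t))).
      assert (x0 : 0 < x) by apply exp_pos.
      assert (x1 : x <= 1).
      { unfold x; rewrite <- exp_0; apply exp_mono. assert (0 <= K * t) by (apply Rmult_le_pos; lra); lra. }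
      replace (- ((2 * (w1 t * f t) - 2 * Ys b t * t * w t ^ 2) * x + E t * (- K * x))) with ((K * E t - 2 * (w1 t * f t) + 2 * Ys b t * t * w t ^ 2) * x) by ring.
      destruct (Yb t ltac:(lra)) as [Y1 _]. specialize (Elow t ltac:(lra)).
      assert (A1 : 2 * (w1 t * f t) <= hh * w1 t ^ 2 + / hh * f t ^ 2).
      { assert (0 <= hh * (w1 t - f t / hh) ^ 2) by (apply Rmult_le_pos; [lra|apply pow2_ge_0]).
        replace (hh * (w1 t - f t / hh) ^ 2) with (hh * w1 t ^ 2 - 2 * (w1 t * f t) + / hh * f t ^ 2) in H by (field; lra). lra. }
      pose proof (pow2_ge_0 (w t)). pose proof (pow2_ge_0 (w1 t)).
      assert (A2 : - (4 * w t ^ 2) <= 2 * Ys b t * t * w t ^ 2).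
      { assert (- 2 <= Ys b t * t) by nra. nra. }
      assert (A3 : (hh * w1 t ^ 2 + c1 * w t ^ 2) * K <= K * E t) by (rewrite (Rmult_comm K); apply Rmult_le_compat_r; lra).
      assert (A4 : (hh * w1 t ^ 2 + c1 * w t ^ 2) * K = hh * w1 t ^ 2 + c1 * w t ^ 2 + 4 * (hh / c1) * w1 t ^ 2 + 4 * w t ^ 2) by (unfold K; field; lra).
      assert (0 <= 4 * (hh / c1) * w1 t ^ 2).
      { apply Rmult_le_pos; auto. assert (0 < hh / c1) by (apply Rdiv_lt_0_compat; lra). lra. }
      assert (0 <= c1 * w t ^ 2) by (apply Rmult_le_pos; lra).
      assert (A5 : - (/ hh * f t ^ 2) <= K * E t - 2 * (w1 t * f t) + 2 * Ys b t * t * w t ^ 2) by lra.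
      assert (0 <= / hh * f t ^ 2) by (apply Rmult_le_pos; [left; apply Rinv_0_lt_compat; lra|apply pow2_ge_0]).
      nra. }
  rewrite RInt_const in G; unfold scal in G; simpl in G; unfold mult in G; simpl in G.
  assert (EE0 : E 0 = 0) by (unfold E; rewrite w0, w10; ring).
  rewrite EE0 in G.
  assert (Fh : fast (fun t => / hh * f t ^ 2)) by sf.
  assert (ih : 0 < / hh) by (apply Rinv_0_lt_compat; lra).
  assert (G2 : RInt (fun t => / hh * f t ^ 2) 0 s <= N / hh).
  { replace (N / hh) with (II (fun t => / hh * f t ^ 2)) by (rewrite II_scal by sf; unfold N, Rdiv; ring).
    apply RInt_le_II; [lra|auto|]. intros t _; apply Rmult_le_pos; [lra|apply pow2_ge_0]. }
  assert (G3' : E s * exp (- (K * s)) <= N / hh) by (simpl in *; lra).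
  assert (E4 : exp (- (K * s)) * exp (K * s) = 1) by (rewrite <- exp_plus, Rplus_opp_l; apply exp_0).
  assert (E5 : exp (K * s) <= M) by (apply exp_mono, Rmult_le_compat_l; lra).
  pose proof (exp_pos (K * s)).
  assert (Nh : 0 <= N / hh) by (apply Rdiv_le_0_compat; lra).
  replace (E s) with (E s * exp (- (K * s)) * exp (K * s)) by (rewrite Rmult_assoc, E4; ring).
  apply Rle_trans with (N / hh * exp (K * s)); [apply Rmult_le_compat_r; lra|].
  rewrite (Rmult_comm M); apply Rmult_le_compat_l; auto. }
set (Fq := N / hh). assert (Fq0 : 0 <= Fq) by (apply Rdiv_le_0_compat; lra).
assert (I1 : RInt (fun t => w t ^ 2) 0 a <= 2 * M / c1 * Fq).
{ apply Rle_trans with (a * (M * Fq / c1)).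
  - apply RInt_le_const; [lra|apply (fast_pow2 w Fw)|]. intros t Ht; specialize (E1 t Ht); specialize (Elow t Ht).
    apply Rmult_le_reg_r with c1; [lra|]. replace (M * Fq / c1 * c1) with (M * Fq) by (field; lra).
    fold Fq in E1. assert (0 <= hh * w1 t ^ 2) by (apply Rmult_le_pos; [lra|apply pow2_ge_0]). lra.
  - replace (2 * M / c1 * Fq) with (2 * (M * Fq / c1)) by (field; lra). apply Rmult_le_compat_r; auto.
    apply Rdiv_le_0_compat; [apply Rmult_le_pos; lra|lra]. }
assert (FE : fast E) by (unfold E; sf).
assert (I2 : IIfrom a (fun t => w t ^ 2) <= IIfrom a (fun t => 7 / hh * f t ^ 2) - (2 / 3 * (hh * (w a * w1 a)) - 2 * E a)).
{ destruct (fast_exp1 (fun t => 2 / 3 * (hh * (w t * w1 t)) - 2 * E t) ltac:(sf)) as [C HC].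
  (* The energy gives 4 Ys t w^2 >= 2 w^2, while 2/3 (hh w w')' supplies 2/3 hh w'^2 to absorb 4 w'
     f at the price 6 f^2/hh. It costs 2/3 w^2 through Q >= -1 and 1/3 w^2 through w f, which leaves
     exactly w^2; the remaining f^2/3 fits in 7 f^2/hh. *)
  apply (IIfrom_le_deriv (fun t => w t ^ 2) (fun t => 7 / hh * f t ^ 2) (fun t => 2 / 3 * (hh * (w t * w1 t)) - 2 * E t)
   (fun t => 2 / 3 * (hh * (w1 t * w1 t + w t * ((Qs b 1 t * w t + f t) / hh))) - 2 * (2 * (w1 t * f t) - 2 * Ys b t * t * w t ^ 2)) C); [lra|sf|sf| | |].
  - intros t Ht; apply (is_derive_minus (fun t => 2 / 3 * (hh * (w t * w1 t))) (fun t => 2 * E t)).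
    + do 2 apply is_derive_scal. apply (is_derive_mult w w1); [apply Dw; lra|apply Dw1; lra|intros; apply Rmult_comm].
    + apply is_derive_scal, dE; lra.
  - intros t Ht; apply HC; lra.
  - intros t Ht.
    assert (Y2 : 1 / 2 <= Ys b t) by (unfold Ys; assert (a ^ 2 <= t ^ 2) by (apply pow_incr; lra); lra).
    assert (Yt : 1 / 2 <= Ys b t * t) by nra.
    assert (Q1 : - 1 <= Qs b 1 t) by (unfold Qs; pose proof (pow2_ge_0 (Ys b t)); lra).
    replace (2 / 3 * (hh * (w1 t * w1 t + w t * ((Qs b 1 t * w t + f t) / hh)))) with (2 / 3 * (hh * w1 t ^ 2 + Qs b 1 t * w t ^ 2 + w t * f t)) by (field; lra).
    assert (ih : 1 <= / hh) by (rewrite <- Rinv_1; apply Rinv_le_contravar; lra).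
    assert (A1 : 4 * (w1 t * f t) <= 2 / 3 * (hh * w1 t ^ 2) + 6 * (/ hh * f t ^ 2)).
    { assert (0 <= 2 / 3 * hh * (w1 t - 3 * f t / hh) ^ 2) by (apply Rmult_le_pos; [lra|apply pow2_ge_0]).
      replace (2 / 3 * hh * (w1 t - 3 * f t / hh) ^ 2) with (2 / 3 * (hh * w1 t ^ 2) - 4 * (w1 t * f t) + 6 * (/ hh * f t ^ 2)) in H by (field; lra). lra. }
    pose proof (pow2_ge_0 (w t)). pose proof (pow2_ge_0 (f t)). pose proof (pow2_ge_0 (w t + f t)).
    assert (A2 : - w t ^ 2 <= Qs b 1 t * w t ^ 2) by nra.
    assert (A3 : 2 * w t ^ 2 <= 4 * Ys b t * t * w t ^ 2) by nra.
    assert (A4 : f t ^ 2 <= / hh * f t ^ 2) by (rewrite <- (Rmult_1_l (f t ^ 2)) at 1; apply Rmult_le_compat_r; auto).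
    unfold Rdiv at 1. lra. }
assert (I3 : IIfrom a (fun t => 7 / hh * f t ^ 2) <= 7 * Fq).
{ replace (7 * Fq) with (II (fun t => 7 / hh * f t ^ 2)) by (rewrite II_scal by sf; unfold Fq, N; field; lra).
  apply IIfrom_le_II; [lra|sf|]. intros t _; apply Rmult_le_pos; [|apply pow2_ge_0]. apply Rdiv_le_0_compat; lra. }
assert (Ea := E1 a ltac:(lra)). assert (Ea2 := Elow a ltac:(lra)). fold Fq in Ea.
assert (I4 : - (2 / 3 * (hh * (w a * w1 a))) <= M / c1 * Fq).
{ assert (X : E a <= M * Fq) by auto.
  assert (- (hh * (w a * w1 a)) <= 1 / 2 * (hh * w1 a ^ 2 + w a ^ 2)).
  { pose proof (pow2_ge_0 (w a + w1 a)). pose proof (pow2_ge_0 (w a)).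
    assert (hh * (w a + w1 a) ^ 2 >= 0) by (apply Rle_ge, Rmult_le_pos; lra). nra. }
  assert (hh * w1 a ^ 2 + w a ^ 2 <= M / c1 * Fq).
  { apply Rmult_le_reg_r with c1; [lra|]. replace (M / c1 * Fq * c1) with (M * Fq) by (field; lra).
    assert (0 <= hh * w1 a ^ 2) by (apply Rmult_le_pos; [lra|apply pow2_ge_0]). nra. }
  assert (0 <= M / c1 * Fq) by (apply Rmult_le_pos; lra). lra. }
assert (T : II (fun t => w t ^ 2) <= C2 / hh * N).
{ rewrite (II_split a). replace (C2 / hh * N) with (C2 * Fq) by (unfold Fq; field; lra). unfold C2. lra. }
unfold nrm. fold N.
replace (sqrt C2 / sqrt hh) with (sqrt (C2 / hh)) by (apply sqrt_div_alt; lra).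
rewrite <- sqrt_mult_alt by (apply Rdiv_le_0_compat; lra). apply sqrt_le_1_alt; auto.
Qed.

(** Subtract the virial identities of v and u rather than using that of v alone. The main error
    becomes (|be - b| + hh) times the integral of |v^2 - u^2|. The first factor is O(hh) by
    criticality of u, the second O(|de| / sqrt hh) by [zero_data_semi]. The number eta records that
    the energy moves by o(|de|), as lambda' vanishes at the critical point. *)
Lemma second_variation : exists C h1, 1 <= C /\ 0 < h1 <= 1 /\ forall hh b u u1, 0 < hh <= h1 -> Rabs (be - b) <= 3 / 2 ->
  ssol hh b 1 u u1 -> 0 < II (fun t => u t ^ 2) -> II (fun t => Ys b t * u t ^ 2) = 0 ->
  forall de et eta v v1, Rabs de <= 1 / 2 -> C * Rabs de <= sqrt hh -> 0 <= eta <= 1 -> Rabs (1 - et) <= eta * Rabs de ->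
  ssol hh (b + de) et v v1 -> v 0 = u 0 -> v1 0 = u1 0 ->
  Rabs (II (fun t => Ys (b + de) t * v t ^ 2) + de * r0 be * II (fun t => v t ^ 2)) <=
    C * (sqrt hh + Rabs de + eta) * Rabs de * II (fun t => v t ^ 2).
Proof.
destruct (critical_ratio be be0 be1 HZ) as [Cc [Cc0 HCc]].
destruct mean_K as [Cm [Cm1 HCm]]. destruct zero_data_semi as [Ce [Ce1 HCe]].
destruct (g_bounds be be0 be1 HZ) as [Cg [Cg1 HCg]]. destruct (VF_bound be be0 be1 HZ) as [CV [CV1 HCV]].
destruct (Pc_bound be be0 be1 HZ) as [Cp [Cp1 HCp]].
(* For hh <= h1, [critical_ratio] places b between be/2 and (1 + be)/2, as [zero_data_semi]
   demands. *)
set (h1 := Rmin 1 (Rmin (be / Cc / 2) ((1 - be) / Cc / 2))).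
assert (h1p : 0 < h1).
{ unfold h1; repeat apply Rmin_pos; try lra; repeat apply Rdiv_lt_0_compat; lra. }
assert (h11 : h1 <= 1) by apply Rmin_l.
assert (h1a : Cc * h1 <= be / 2).
{ replace (be / 2) with (Cc * (be / Cc / 2)) by (field; lra). apply Rmult_le_compat_l; [lra|].
  unfold h1; eapply Rle_trans; [apply Rmin_r|apply Rmin_l]. }
assert (h1b : Cc * h1 <= (1 - be) / 2).
{ replace ((1 - be) / 2) with (Cc * ((1 - be) / Cc / 2)) by (field; lra). apply Rmult_le_compat_l; [lra|].
  unfold h1; eapply Rle_trans; [apply Rmin_r|apply Rmin_r]. }
set (C := 6 * Ce + (2 * Cp * Cc + Cg) * (18 * Ce) + 2 * (Cm + Cp) * (2 + Cc)).
exists C, h1.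
assert (prods : 0 < Cp * Cc * Ce /\ 0 < Cg * Ce /\ 0 < Cm * Cc /\ 0 < Cp * Cc).
{ repeat split; repeat apply Rmult_lt_0_compat; lra. }
assert (C1 : 1 <= C) by (unfold C; nra).
split; [auto|split; [auto|]].
intros hh b u u1 Hh Hd HU Np H0 de et eta v v1 Hde HCde Heta Het HV Ev0 Ev1.
assert (Hh1 : 0 < hh <= 1) by lra.
assert (Hdc := HCc hh b u u1 Hh1 Hd HU Np H0).
set (s := sqrt hh) in *. assert (sp : 0 < s) by (apply sqrt_lt_R0; lra). assert (ss : s * s = hh) by (apply sqrt_sqrt; lra).
assert (s1 : s <= 1) by (unfold s; rewrite <- sqrt_1; apply sqrt_le_1_alt; lra).
set (d := be - b) in *.
assert (Cch : Cc * hh <= Cc * h1) by (apply Rmult_le_compat_l; lra).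
assert (db : Rabs d <= 1 / 2) by lra.
assert (ds : Rabs d <= Cc * s) by (apply Rle_trans with (1 := Hdc); apply Rmult_le_compat_l; nra).
assert (bb : 0 <= b <= (1 + be) / 2) by (apply Rabs_le_between in Hdc; unfold d in Hdc; lra).
set (N := II (fun t => v t ^ 2)).
assert (Sy := slow_yy be). assert (SP := slow_Pc be be0 be1 HZ). assert (SY := slow_Ys b). assert (SY' := slow_Ys (b + de)).
assert (EnV := ssol_energy hh (b + de) et v v1 (proj1 Hh) HV).
assert (PhU := fast_Phi be hh b 1 u u1 CV HU). assert (PhU0 := Phi_0 be hh b 1 u u1 CV HU).
assert (PhV := fast_Phi be hh (b + de) et v v1 CV HV). assert (PhV0 := Phi_0 be hh (b + de) et v v1 CV HV).
assert (HU' := HU). assert (HV' := HV).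
destruct HU' as [SU1 [SU2 [FU [FU1 HBU]]]]. destruct HV' as [SV1 [SV2 [FV [FV1 HBV]]]].
assert (N0 : 0 <= N) by (apply II_sq_ge0; auto).
pose proof (Rabs_pos de) as de0. pose proof (Rabs_pos (1 - et)) as et0.
assert (et1 : Rabs (1 - et) <= Rabs de) by nra.
assert (etb : 0 <= et <= 2) by (apply Rabs_le_between in et1; lra).
set (w := fun t => v t - u t). set (w1 := fun t => v1 t - u1 t).
assert (Fw : fast w) by (unfold w; sf). assert (Fw1 : fast w1) by (unfold w1; sf).
set (f := fun t => (Qs (b + de) et t - Qs b 1 t) * v t).
assert (SQ1 : slow (Qs (b + de) et)) by (unfold Qs; sf). assert (SQ2 : slow (Qs b 1)) by (unfold Qs; sf).
assert (Ff : fast f) by (unfold f; sf).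
assert (Wb : nrm w <= Ce / s * nrm f).
{ apply (HCe hh b w w1 f); auto.
  - intros t Ht; apply (is_derive_minus v u); auto.
  - intros t Ht; replace ((Qs b 1 t * w t + f t) / hh) with (Qs (b + de) et t / hh * v t - Qs b 1 t / hh * u t) by (unfold w, f; field; lra).
    apply (is_derive_minus v1 u1); auto.
  - unfold w; lra.
  - unfold w1; lra. }
set (n := nrm v). assert (n0 : 0 <= n) by apply nrm_ge0. assert (nN : n ^ 2 = N) by (apply nrm_sq; auto).
assert (Fb : nrm f <= 6 * Rabs de * n).
{ apply Rsqr_incr_0_var; [|repeat apply Rmult_le_pos; lra].
  rewrite !Rsqr_pow2, !Rpow_mult_distr, nN, nrm_sq, pow2_abs by auto.
  assert (L : II (fun t => f t ^ 2) <= 12 * de ^ 2 * II (fun t => Ys (b + de) t ^ 2 * v t ^ 2) + 3 * (de ^ 4 + (1 - et) ^ 2) * N).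
  { unfold N; rewrite <- !II_scal, <- II_plus by sf. apply II_le; [sf|sf|]. intros t _; unfold f.
    replace (Qs (b + de) et t - Qs b 1 t) with (- 2 * Ys (b + de) t * de + - de ^ 2 + (1 - et)) by (unfold Qs, Ys; field).
    rewrite Rpow_mult_distr. pose proof (sq3 (- 2 * Ys (b + de) t * de) (- de ^ 2) (1 - et)). pose proof (pow2_ge_0 (v t)).
    nra. }
  assert (I1 : 0 <= II (fun t => v1 t ^ 2)) by (apply II_sq_ge0; auto).
  assert (II (fun t => Ys (b + de) t ^ 2 * v t ^ 2) <= 2 * N) by (fold N in EnV; nra).
  assert (D2 : 0 <= de ^ 2 <= 1) by (rewrite <- (pow2_abs de); nra).
  assert ((1 - et) ^ 2 <= de ^ 2) by (rewrite <- (pow2_abs (1 - et)), <- (pow2_abs de); apply pow_incr; lra).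
  assert (de ^ 4 <= de ^ 2) by (replace (de ^ 4) with (de ^ 2 * de ^ 2) by ring; nra).
  assert (12 * de ^ 2 * II (fun t => Ys (b + de) t ^ 2 * v t ^ 2) <= 12 * de ^ 2 * (2 * N)) by (apply Rmult_le_compat_l; lra).
  assert (3 * (de ^ 4 + (1 - et) ^ 2) * N <= 3 * (de ^ 2 + de ^ 2) * N) by (apply Rmult_le_compat_r; lra).
  assert (0 <= de ^ 2 * N) by (apply Rmult_le_pos; lra). lra. }
assert (Wd : nrm w <= 6 * Ce * Rabs de / s * n).
{ apply Rle_trans with (1 := Wb). replace (6 * Ce * Rabs de / s * n) with (Ce / s * (6 * Rabs de * n)) by (field; lra).
  apply Rmult_le_compat_l; auto. apply Rdiv_le_0_compat; lra. }
assert (Wn : nrm w <= n).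
{ apply Rle_trans with (1 := Wd). rewrite <- (Rmult_1_l n) at 2. apply Rmult_le_compat_r; auto.
  apply Rmult_le_reg_r with s; auto. replace (6 * Ce * Rabs de / s * s) with (6 * Ce * Rabs de) by (field; lra).
  rewrite Rmult_1_l. apply Rle_trans with (2 := HCde). apply Rmult_le_compat_r; auto. unfold C; nra. }
assert (UV : nrm (fun t => v t + u t) <= 3 * n).
{ replace (nrm (fun t => v t + u t)) with (nrm (fun t => 2 * v t + (-1) * w t)).
  - assert (Fa : fast (fun t => 2 * v t)) by sf. assert (Fb' : fast (fun t => -1 * w t)) by sf.
    eapply Rle_trans; [apply (nrm_triang (fun t => 2 * v t) (fun t => (-1) * w t)); auto|].
    rewrite !nrm_scal by auto. rewrite (Rabs_right 2), (Rabs_left (-1)) by lra. fold n; lra.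
  - unfold nrm; f_equal; apply II_ext; [sf|sf|]; intros; unfold w; ring. }
set (ab := fun t => Rabs (v t ^ 2 - u t ^ 2)).
assert (Fab : fast ab) by (unfold ab; apply (fast_abs (fun t => v t ^ 2 - u t ^ 2)); sf).
assert (AB : II ab <= 18 * Ce * Rabs de / s * N).
{ assert (Fx : fast (fun t => Rabs (w t))) by (apply fast_abs; auto).
  assert (Fs : fast (fun t => v t + u t)) by sf.
  assert (Fy : fast (fun t => Rabs (v t + u t))) by (apply (fast_abs (fun t => v t + u t)); auto).
  assert (nabs : forall g, fast g -> fast (fun t => Rabs (g t)) -> nrm (fun t => Rabs (g t)) <= nrm g).
  { intros g Hg Hg'; apply nrm_le; auto. intros; rewrite Rabs_Rabsolu; lra. }
  assert (X := II_CS _ _ Fx Fy).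
  replace (II ab) with (II (fun t => Rabs (w t) * Rabs (v t + u t))).
  - eapply Rle_trans; [apply Rle_abs|]. eapply Rle_trans; [exact X|].
    assert (Y1 := nabs w Fw Fx). assert (Y2 := nabs (fun t => v t + u t) Fs Fy).
    apply Rle_trans with (6 * Ce * Rabs de / s * n * (3 * n)).
    + apply Rmult_le_compat; try apply nrm_ge0; lra.
    + right. rewrite <- nN. field; lra.
  - apply II_ext; [sf|auto|]. intros; unfold ab, w. rewrite <- Rabs_mult. f_equal; ring. }
set (Kb := fun t => Pc be t * (1 + yy be t * Ys (b + de) t)).
set (B := fun t => (2 * Cp * Rabs d + Cg * hh) * ab t + (Cp * Rabs d * Rabs de + Cp * Rabs (1 - et)) * v t ^ 2).
assert (SK : slow Kb) by (unfold Kb; sf).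
assert (FB : fast B) by (unfold B; sf).
(* The difference of the two functionals [VF]. The moment of u, zero by hypothesis, is kept inside
   the integrand so that the K and gm''' terms appear with the factor v^2 - u^2. *)
assert (K1 : Rabs (II (fun t => Ys (b + de) t * v t ^ 2 - Ys b t * u t ^ 2 + de * (Kb t * v t ^ 2))) <= II B).
{ apply (II_abs_deriv0 _ _ (fun t => / 2 * VF be hh (b + de) et v v1 t - / 2 * VF be hh b 1 u u1 t)
   (fun t => / 2 * (2 * (Ys (b + de) t * v t ^ 2 - (be - (b + de)) * (Pc be t * (1 + yy be t * Ys (b + de) t)) * v t ^ 2 - (1 - et) * (yy be t * Pc be t) * v t ^ 2)
    + hh / 2 * (G3 be t * v t ^ 2)) - / 2 * (2 * (Ys b t * u t ^ 2 - (be - b) * (Pc be t * (1 + yy be t * Ys b t)) * u t ^ 2 - (1 - 1) * (yy be t * Pc be t) * u t ^ 2)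
    + hh / 2 * (G3 be t * u t ^ 2)))
   (fun t => CV * (t * Rabs (Js hh (b + de) et v v1 t) + Rabs (v t * v1 t) + t * (1 + yy be t ^ 2) * v t ^ 2)
     + CV * (t * Rabs (Js hh b 1 u u1 t) + Rabs (u t * u1 t) + t * (1 + yy be t ^ 2) * u t ^ 2))); auto; [sf|apply fast_plus; auto|lra| | |].
  - intros t Ht; apply (is_derive_minus (fun t => / 2 * VF be hh (b + de) et v v1 t) (fun t => / 2 * VF be hh b 1 u u1 t));
    apply is_derive_scal, VF_derive; auto; lra.
  - intros t Ht. assert (X1 := HCV hh (b + de) et v v1 t Hh1 Ht). assert (X2 := HCV hh b 1 u u1 t Hh1 Ht).
    apply Rabs_le_minus.
    + rewrite Rabs_mult, (Rabs_right (/ 2)) by lra. pose proof (Rabs_pos (VF be hh (b + de) et v v1 t)). lra.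
    + rewrite Rabs_mult, (Rabs_right (/ 2)) by lra. pose proof (Rabs_pos (VF be hh b 1 u u1 t)). lra.
  - intros t Ht.
    match goal with |- Rabs ?E <= _ => replace E with
     (d * (Pc be t * (1 + yy be t * Ys b t)) * (v t ^ 2 - u t ^ 2) - hh / 4 * (G3 be t * (v t ^ 2 - u t ^ 2)) + ((1 - et) * (yy be t * Pc be t) - d * de * (yy be t * Pc be t)) * v t ^ 2) end.
    2:{ unfold Kb, d. replace (Ys (b + de) t) with (Ys b t - de) by (unfold Ys; ring). field. }
    destruct (HCg t Ht) as [_ [_ [_ [_ [_ [_ H7]]]]]]. fold (G3 be t) in H7.
    specialize (HCp t ltac:(lra)). assert (Pp : 0 < Pc be t) by (apply Pc_pos; auto; lra).
    assert (Ey : Ys b t = yy be t + d) by (rewrite (Ys_yy be b); auto).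
    set (y := yy be t) in *.
    assert (yP : Rabs (y * Pc be t) <= Cp).
    { rewrite Rabs_mult, (Rabs_right (Pc be t)) by lra. apply Rle_trans with (2 := HCp). apply Rmult_le_compat_r; [lra|].
      rewrite <- (pow2_abs y). pose proof (Rabs_pos y). nra. }
    assert (KP : Rabs (Pc be t * (1 + y * Ys b t)) <= 2 * Cp).
    { rewrite Ey. replace (Pc be t * (1 + y * (y + d))) with ((1 + y ^ 2) * Pc be t + d * (y * Pc be t)) by ring.
      replace (2 * Cp) with (Cp + 1 * Cp) by ring. apply Rabs_le_plus.
      - rewrite Rabs_right; auto. apply Rle_ge, Rmult_le_pos; [pose proof (pow2_ge_0 y); lra|lra].
      - apply Rabs_le_mult; auto; lra. }
    pose proof (pow2_ge_0 (v t)). pose proof (Rabs_pos d).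
    unfold B. apply Rabs_le_plus.
    + replace ((2 * Cp * Rabs d + Cg * hh) * ab t) with (Rabs d * (2 * Cp) * ab t + hh * (Cg * ab t)) by ring.
      apply Rabs_le_minus.
      * apply Rabs_le_mult; [apply Rabs_le_mult; auto; lra|unfold ab; lra].
      * apply Rabs_le_mult; [rewrite Rabs_right; lra|]. apply Rabs_le_mult; [auto|unfold ab; lra].
    + apply Rabs_le_mult; [|rewrite Rabs_right; lra].
      replace (Cp * Rabs d * Rabs de + Cp * Rabs (1 - et)) with (Rabs (1 - et) * Cp + Rabs d * Rabs de * Cp) by ring.
      apply Rabs_le_minus; apply Rabs_le_mult; auto; [lra|rewrite Rabs_mult; lra]. }
(* O(hh) times O(|de| / s) is O(s |de|), since s^2 = hh; the terms in v^2 need no such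
   compensation. *)
assert (IB : II B <= (2 * Cp * Cc + Cg) * (18 * Ce) * s * Rabs de * N + Cp * (Cc * s + eta) * Rabs de * N).
{ unfold B. rewrite II_plus, !II_scal by sf. fold N. pose proof (Rabs_pos d).
  assert (IA : 0 <= II ab) by (apply II_ge0; auto; intros; apply Rabs_pos).
  apply Rplus_le_compat.
  - apply Rle_trans with ((2 * Cp * Cc + Cg) * hh * (18 * Ce * Rabs de / s * N)).
    + apply Rmult_le_compat; auto.
      * assert (0 <= Cp * Rabs d) by (apply Rmult_le_pos; lra). assert (0 <= Cg * hh) by (apply Rmult_le_pos; lra). lra.
      * assert (Cp * Rabs d <= Cp * (Cc * hh)) by (apply Rmult_le_compat_l; lra). lra.
    + right. rewrite <- ss. field; lra.
  - apply Rmult_le_compat_r; auto.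
    assert (Cp * Rabs d * Rabs de <= Cp * (Cc * s) * Rabs de) by (apply Rmult_le_compat_r; auto; apply Rmult_le_compat_l; lra).
    assert (Cp * Rabs (1 - et) <= Cp * (eta * Rabs de)) by (apply Rmult_le_compat_l; lra). lra. }
assert (E1 : II (fun t => Ys (b + de) t * v t ^ 2 - Ys b t * u t ^ 2 + de * (Kb t * v t ^ 2)) =
  II (fun t => Ys (b + de) t * v t ^ 2) + de * II (fun t => Kb t * v t ^ 2)).
{ rewrite II_plus, II_minus, II_scal by sf. rewrite H0; ring. }
rewrite E1 in K1; clear E1.
assert (dd : Rabs (be - (b + de)) <= Rabs d + Rabs de).
{ replace (be - (b + de)) with (d - de) by (unfold d; ring). unfold Rminus; eapply Rle_trans; [apply Rabs_triang|]. rewrite Rabs_Ropp; lra. }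
assert (MK := HCm hh (b + de) et v v1 Hh1 ltac:(lra) ltac:(lra) HV). fold s N in MK.
assert (K2 : Rabs (II (fun t => Kb t * v t ^ 2) - II (fun t => (1 + yy be t ^ 2) * Pc be t * v t ^ 2)) <= (Rabs d + Rabs de) * Cp * N).
{ rewrite <- II_minus by sf. unfold N; rewrite <- II_scal by sf. apply II_abs; [sf|sf|]. intros t Ht.
  replace (Kb t * v t ^ 2 - (1 + yy be t ^ 2) * Pc be t * v t ^ 2) with ((be - (b + de)) * (yy be t * Pc be t) * v t ^ 2)
   by (unfold Kb; rewrite (Ys_yy be (b + de)); ring).
  specialize (HCp t Ht). assert (Pp : 0 < Pc be t) by (apply Pc_pos; auto).
  apply Rabs_le_mult; [|rewrite Rabs_right; [lra|apply Rle_ge, pow2_ge_0]].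
  apply Rabs_le_mult; auto. rewrite Rabs_mult, (Rabs_right (Pc be t)) by lra. apply Rle_trans with (2 := HCp). apply Rmult_le_compat_r; [lra|].
  rewrite <- (pow2_abs (yy be t)). pose proof (Rabs_pos (yy be t)). nra. }
set (X := II (fun t => Ys (b + de) t * v t ^ 2)) in *. set (KV := II (fun t => Kb t * v t ^ 2)) in *.
set (KC := II (fun t => (1 + yy be t ^ 2) * Pc be t * v t ^ 2)) in *.
(* The weight K at b + de is replaced by (1 + y^2) Pc at cost |d| + |de| ([K2]), and that by r0 at
   the cost given by [mean_K] ([MK]); both errors are multiplied by de. *)
replace (X + de * r0 be * N) with ((X + de * KV) - de * ((KV - KC) + (KC - r0 be * N))) by ring.
pose proof (Rabs_pos d).
assert (eta1 : Rabs (1 - et) <= eta) by nra.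
assert (S1 : Rabs (KV - KC + (KC - r0 be * N)) <= (Cm + Cp) * ((1 + Cc) * s + 2 * Rabs de + eta) * N).
{ eapply Rle_trans; [apply Rabs_triang|].
  assert (A1 : Rabs (KV - KC) <= Cp * ((1 + Cc) * s + 2 * Rabs de + eta) * N).
  { apply Rle_trans with (1 := K2). apply Rmult_le_compat_r; auto. rewrite (Rmult_comm _ Cp). apply Rmult_le_compat_l; lra. }
  assert (A2 : Rabs (KC - r0 be * N) <= Cm * ((1 + Cc) * s + 2 * Rabs de + eta) * N).
  { apply Rle_trans with (1 := MK). apply Rmult_le_compat_r; auto. apply Rmult_le_compat_l; lra. }
  lra. }
eapply Rle_trans; [apply Rabs_triang|]. rewrite Rabs_Ropp, Rabs_mult.
assert (S2 : Rabs de * Rabs (KV - KC + (KC - r0 be * N)) <= Rabs de * ((Cm + Cp) * ((1 + Cc) * s + 2 * Rabs de + eta) * N))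
 by (apply Rmult_le_compat_l; auto).
set (A := (2 * Cp * Cc + Cg) * (18 * Ce)) in *.
assert (A0 : 0 <= A) by (unfold A; apply Rmult_le_pos; lra).
apply Rle_trans with ((A * s + Cp * (Cc * s + eta) + (Cm + Cp) * ((1 + Cc) * s + 2 * Rabs de + eta)) * (Rabs de * N)); [lra|].
replace (C * (s + Rabs de + eta) * Rabs de * N) with (C * (s + Rabs de + eta) * (Rabs de * N)) by ring.
apply Rmult_le_compat_r; [apply Rmult_le_pos; auto|]. unfold C.
assert (0 <= Ce * s) by (apply Rmult_le_pos; lra). assert (0 <= Ce * Rabs de) by (apply Rmult_le_pos; lra). assert (0 <= Ce * eta) by (apply Rmult_le_pos; lra).
assert (0 <= A * Rabs de) by (apply Rmult_le_pos; lra). assert (0 <= A * eta) by (apply Rmult_le_pos; lra).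
assert (forall z, 0 <= z -> 0 <= Cm * z /\ 0 <= Cp * z /\ 0 <= Cm * Cc * z /\ 0 <= Cp * Cc * z) as Z.
{ intros z Hz; repeat split; apply Rmult_le_pos; auto; lra. }
destruct (Z s ltac:(lra)) as [? [? [? ?]]]. destruct (Z (Rabs de) ltac:(lra)) as [? [? [? ?]]]. destruct (Z eta ltac:(lra)) as [? [? [? ?]]].
lra.
Qed.
End Semi2.

(** * The functions F and G *)

Lemma ex_RInt_cont (f : R -> R) a b : (forall t, continuous f t) -> ex_RInt f a b.
Proof. intros H; apply (ex_RInt_continuous (V := R_CompleteNormedModule)); auto. Qed.

(** Reduction of elliptic integrals: modulo an exact derivative, an integrand is a combination of
    two basic ones. Continuity of [P1] is read off from the relation itself. *)
Lemma RInt_relation (f f2 f3 P P1 : R -> R) a b c2 c3 :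
  (forall t, continuous f t) -> (forall t, continuous f2 t) -> (forall t, continuous f3 t) ->
  (forall t, is_derive P t (P1 t)) -> (forall t, f t = c2 * f2 t + c3 * f3 t + P1 t) ->
  RInt f a b = c2 * RInt f2 a b + c3 * RInt f3 a b + (P b - P a).
Proof.
intros Cf C2 C3 HP E.
assert (CP : forall t, continuous P1 t).
{ intros t; apply (continuous_ext (fun t => f t - (c2 * f2 t + c3 * f3 t))); [intros; rewrite E; simpl; ring|].
  apply (continuous_minus f (fun t => c2 * f2 t + c3 * f3 t)); auto.
  apply (continuous_plus (fun t => c2 * f2 t) (fun t => c3 * f3 t));
  [apply (continuous_scal_r c2 f2)|apply (continuous_scal_r c3 f3)]; auto. }
apply is_RInt_unique.
apply (is_RInt_ext (fun t => c2 * f2 t + c3 * f3 t + P1 t)); [intros; rewrite E; auto|].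
apply (is_RInt_plus (fun t => c2 * f2 t + c3 * f3 t) P1).
- apply (is_RInt_plus (fun t => c2 * f2 t) (fun t => c3 * f3 t)).
  + apply (is_RInt_scal f2 a b c2), (RInt_correct (V := R_CompleteNormedModule)), ex_RInt_cont, C2.
  + apply (is_RInt_scal f3 a b c3), (RInt_correct (V := R_CompleteNormedModule)), ex_RInt_cont, C3.
- apply (is_RInt_derive P P1); auto.
Qed.

Lemma RInt_scal_ext (f g : R -> R) a b c : a <= b -> (forall t, continuous g t) -> (forall t, a < t < b -> f t = c * g t) ->
  RInt f a b = c * RInt g a b.
Proof.
intros Hab Cg H; apply is_RInt_unique. apply (is_RInt_ext (fun t => c * g t)).
- intros t Ht; rewrite Rmin_left, Rmax_right in Ht by lra; rewrite H; auto.
- apply (is_RInt_scal g a b c), (RInt_correct (V := R_CompleteNormedModule)), ex_RInt_cont, Cg.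
Qed.

(* The substitution x = X sin phi removes the inverse square root singularity at the turning point X. *)
Section SinSubst.
Variables (X : R) (f k : R -> R).
Hypothesis X0 : 0 < X.
Hypothesis Cf : forall x, 0 <= x < X -> continuous f x.
Hypothesis Ck : forall t, continuous k t.
Hypothesis Hfk : forall t, 0 <= t < PI / 2 -> X * cos t * f (X * sin t) = k t.

Lemma sin_subst_lt th : 0 <= th < PI / 2 -> is_RInt f 0 (X * sin th) (RInt k 0 th).
Proof.
intros Ht.
assert (S : forall t, 0 <= t <= th -> 0 <= X * sin t < X).
{ intros t Htt; assert (0 <= sin t) by (apply sin_ge_0; lra).
  assert (sin t < 1) by (rewrite <- sin_PI2; apply sin_increasing_1; lra). nra. }
assert (E : RInt k 0 th = RInt f 0 (X * sin th)).
{ transitivity (RInt (fun t => scal (X * cos t) (f (X * sin t))) 0 th).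
  - apply RInt_ext; intros t Htt; rewrite Rmin_left, Rmax_right in Htt by lra.
    unfold scal; simpl; unfold mult; simpl. rewrite Hfk; auto; lra.
  - transitivity (RInt f (X * sin 0) (X * sin th)); [|rewrite sin_0, Rmult_0_r; auto].
    apply (RInt_comp f (fun t => X * sin t) (fun t => X * cos t)).
    + intros t Htt; rewrite Rmin_left, Rmax_right in Htt by lra. apply Cf, S; lra.
    + intros t _; split.
      * apply is_derive_scal. apply is_derive_Reals, derivable_pt_lim_sin.
      * apply (ex_derive_continuous (fun t => X * cos t)); auto_derive; auto. }
rewrite E; apply (RInt_correct (V := R_CompleteNormedModule)).
apply (ex_RInt_continuous (V := R_CompleteNormedModule)).
specialize (S th ltac:(lra)). intros z Hz; rewrite Rmin_left, Rmax_right in Hz by lra; apply Cf; lra.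
Qed.

Lemma sin_subst eps : 0 < eps -> exists d, 0 < d /\ forall x, 0 <= x -> X - d < x < X ->
  exists l, is_RInt f 0 x l /\ Rabs (l - RInt k 0 (PI / 2)) < eps.
Proof.
intros He. pose proof PI2_1 as P1.
destruct (continuity_ab_maj (fun x => Rabs (k x)) 0 (PI / 2) ltac:(lra)) as [m [Hm _]].
{ intros c _; apply continuity_pt_filterlim, (continuous_comp k Rabs); [apply Ck|apply continuous_Rabs]. }
set (M := Rabs (k m) + 1). assert (M0 : 0 < M) by (unfold M; pose proof (Rabs_pos (k m)); lra).
set (r := Rmin (PI / 2) (eps / (2 * M))).
assert (r0 : 0 < r) by (apply Rmin_pos; [lra|apply Rdiv_lt_0_compat; lra]).
assert (r1 : r <= PI / 2) by apply Rmin_l.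
assert (r2 : M * r < eps).
{ apply Rle_lt_trans with (M * (eps / (2 * M))); [apply Rmult_le_compat_l; [lra|apply Rmin_r]|].
  replace (M * (eps / (2 * M))) with (eps / 2) by (field; lra); lra. }
assert (sr : sin (PI / 2 - r) < 1) by (rewrite <- sin_PI2; apply sin_increasing_1; lra).
exists (X * (1 - sin (PI / 2 - r))); split; [apply Rmult_lt_0_compat; lra|].
intros x Hx0 Hx.
assert (z1 : 0 <= x / X < 1).
{ split; [apply Rdiv_le_0_compat; lra|]. apply Rmult_lt_reg_r with X; auto. replace (x / X * X) with x by (field; lra). lra. }
assert (z2 : sin (PI / 2 - r) < x / X).
{ apply Rmult_lt_reg_r with X; auto. replace (x / X * X) with x by (field; lra). lra. }
set (th := asin (x / X)). assert (sth : sin th = x / X) by (apply sin_asin; lra).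
pose proof (asin_bound (x / X)) as B; fold th in B.
assert (T1 : 0 <= th).
{ destruct (Rle_dec 0 th); auto. assert (sin th < sin 0) by (apply sin_increasing_1; lra). rewrite sin_0 in *; lra. }
assert (T2 : th < PI / 2).
{ destruct (Rlt_dec th (PI / 2)); auto. replace th with (PI / 2) in sth by lra. rewrite sin_PI2 in sth; lra. }
assert (T3 : PI / 2 - r < th).
{ apply sin_increasing_0; try lra. }
exists (RInt k 0 th); split.
- replace x with (X * sin th) by (rewrite sth; field; lra). apply sin_subst_lt; lra.
- rewrite <- (RInt_Chasles k 0 th (PI / 2)) by (apply ex_RInt_cont, Ck).
  unfold plus; simpl. replace (RInt k 0 th - (RInt k 0 th + RInt k th (PI / 2))) with (- RInt k th (PI / 2)) by ring.
  rewrite Rabs_Ropp. apply Rle_lt_trans with (2 := r2).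
  assert (ex : ex_RInt k th (PI / 2)) by (apply ex_RInt_cont, Ck).
  eapply Rle_trans; [apply abs_RInt_le; [lra|exact ex]|].
  apply Rle_trans with (RInt (fun _ => M) th (PI / 2)).
  + apply RInt_le; [lra|apply (ex_RInt_norm _ _ _ ex)|apply ex_RInt_const|].
    intros t Ht; specialize (Hm t ltac:(lra)); cbv beta in Hm; unfold M; lra.
  + rewrite RInt_const; unfold scal; simpl; unfold mult; simpl. rewrite Rmult_comm. apply Rmult_le_compat_l; lra.
Qed.

Lemma sin_subst_gen : RInt_gen f (at_point 0) (at_left X) = RInt k 0 (PI / 2).
Proof.
apply is_RInt_gen_unique. intros P [eps HP].
destruct (sin_subst eps (cond_pos eps)) as [d [d0 Hd]].
apply (Filter_prod _ _ _ (fun a => a = 0) (fun b => 0 <= b /\ X - d < b < X)).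
- reflexivity.
- assert (m0 : 0 < Rmin d X) by (apply Rmin_pos; auto). exists (mkposreal _ m0); intros z Hz Hz1.
  unfold ball in Hz; simpl in Hz; unfold AbsRing_ball, abs, minus, plus, opp in Hz; simpl in Hz.
  apply Rabs_def2 in Hz. pose proof (Rmin_l d X); pose proof (Rmin_r d X). lra.
- intros a b -> [Hb0 Hb]; destruct (Hd b Hb0 Hb) as [l [Hl1 Hl2]].
  exists l; split; [exact Hl1|]. apply HP. exact Hl2.
Qed.
End SinSubst.

(** With e = sqrt E and x = X sin t, E - V(x) = (1 + e) cos(t)^2 Wt(e, t). Hence F E = 2 sqrt 2 Phi
    e, and the integral of (E - V)^(-1/2) is sqrt 2 tau e. *)
Definition Wt (e t : R) : R := (e - 1) + (1 + e) * sin t ^ 2.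
Definition tau (e : R) : R := RInt (fun t => / sqrt (Wt e t)) 0 (PI / 2).
Definition Phi (e : R) : R := RInt (fun t => (1 - (1 + e) * sin t ^ 2) * / sqrt (Wt e t)) 0 (PI / 2).
Definition Phi1 (e t : R) : R := - sin t ^ 2 * / sqrt (Wt e t) + - (1 - (1 + e) * sin t ^ 2) * (1 + sin t ^ 2) / 2 * (/ sqrt (Wt e t)) ^ 3.

Lemma Wt_pos e t : 1 < e -> 0 < Wt e t.
Proof. intros He; unfold Wt; pose proof (pow2_ge_0 (sin t)); nra. Qed.

Lemma sW e t : 1 < e -> 0 < sqrt (Wt e t) /\ sqrt (Wt e t) ^ 2 = Wt e t.
Proof. intros He; pose proof (Wt_pos e t He); split; [apply sqrt_lt_R0; auto|apply pow2_sqrt; lra]. Qed.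

Lemma Wt_cont e t : continuous (Wt e) t.
Proof. apply (ex_derive_continuous (Wt e)); unfold Wt; auto_derive; auto. Qed.

Lemma sqrtW_cont e t : continuous (fun t => sqrt (Wt e t)) t.
Proof. apply (continuous_comp (Wt e) sqrt); [apply Wt_cont|apply continuous_sqrt]. Qed.

Lemma isqrtW_cont e t : 1 < e -> continuous (fun t => / sqrt (Wt e t)) t.
Proof. intros He; apply (continuous_Rinv_comp (fun t => sqrt (Wt e t))); [apply sqrtW_cont|destruct (sW e t He); lra]. Qed.

Lemma Phi_cont e t : 1 < e -> continuous (fun t => (1 - (1 + e) * sin t ^ 2) * / sqrt (Wt e t)) t.
Proof.
intros He; apply (continuous_mult (fun t => 1 - (1 + e) * sin t ^ 2) (fun t => / sqrt (Wt e t))); [|apply isqrtW_cont; auto].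
apply (ex_derive_continuous (fun t => 1 - (1 + e) * sin t ^ 2)); auto_derive; auto.
Qed.

Lemma isq_derive z : 0 < z -> is_derive (fun z => / sqrt z) z (- / 2 * (/ sqrt z) ^ 3).
Proof.
intros Hz; assert (s0 : 0 < sqrt z) by (apply sqrt_lt_R0; auto). assert (s2 : sqrt z * sqrt z = z) by (apply sqrt_sqrt; lra).
auto_derive; [split; [auto|split; [lra|auto]]|]. field; lra.
Qed.

Lemma Phi_pt e t : 0 < Wt e t -> is_derive (fun e => (1 - (1 + e) * sin t ^ 2) * / sqrt (Wt e t)) e (Phi1 e t).
Proof.
intros Hw. unfold Phi1.
replace (- sin t ^ 2 * / sqrt (Wt e t) + - (1 - (1 + e) * sin t ^ 2) * (1 + sin t ^ 2) / 2 * (/ sqrt (Wt e t)) ^ 3) with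
 (- sin t ^ 2 * / sqrt (Wt e t) + (1 - (1 + e) * sin t ^ 2) * ((1 + sin t ^ 2) * (- / 2 * (/ sqrt (Wt e t)) ^ 3))) by (unfold Rdiv; ring).
apply (is_derive_mult (fun e => 1 - (1 + e) * sin t ^ 2) (fun e => / sqrt (Wt e t))); [auto_derive; auto; ring| |intros; apply Rmult_comm].
apply (is_derive_comp (fun z => / sqrt z) (fun e => Wt e t)); [apply isq_derive; auto|].
unfold Wt; auto_derive; auto; ring.
Qed.

Lemma Phi1_2d e t : 1 < e -> continuity_2d_pt Phi1 e t.
Proof.
intros He.
assert (Cs : continuity_2d_pt (fun _ v => sin v) e t).
{ apply (continuity_1d_2d_pt_comp sin (fun _ v => v)); [apply continuity_sin|apply continuity_2d_pt_id2]. }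
assert (Cs2 : continuity_2d_pt (fun _ v => sin v ^ 2) e t).
{ apply continuity_2d_pt_ext with (fun _ v => sin v * sin v); [intros; ring|]. now apply continuity_2d_pt_mult. }
assert (Cq : continuity_2d_pt (fun u v => (1 + u) * sin v ^ 2) e t).
{ apply continuity_2d_pt_mult; auto. apply continuity_2d_pt_plus; [apply continuity_2d_pt_const|apply continuity_2d_pt_id1]. }
assert (Ci : continuity_2d_pt (fun u v => / sqrt (Wt u v)) e t).
{ apply (continuity_1d_2d_pt_comp (fun z => / sqrt z) Wt).
  - apply continuity_pt_filterlim. exact (is_derive_cont (fun z => / sqrt z) _ _ (isq_derive _ (Wt_pos e t He))).
  - unfold Wt; apply continuity_2d_pt_plus; auto.
    apply continuity_2d_pt_minus; [apply continuity_2d_pt_id1|apply continuity_2d_pt_const]. }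
apply continuity_2d_pt_ext with (fun u v => - sin v ^ 2 * / sqrt (Wt u v) +
  (- / 2 * (1 - (1 + u) * sin v ^ 2)) * (1 + sin v ^ 2) * (/ sqrt (Wt u v) * (/ sqrt (Wt u v) * / sqrt (Wt u v)))).
{ intros u v; unfold Phi1, Rdiv; ring. }
apply continuity_2d_pt_plus; apply continuity_2d_pt_mult; auto.
- now apply continuity_2d_pt_opp.
- apply continuity_2d_pt_mult.
  + apply continuity_2d_pt_mult; [apply continuity_2d_pt_const|].
    apply continuity_2d_pt_minus; [apply continuity_2d_pt_const|auto].
  + apply continuity_2d_pt_plus; [apply continuity_2d_pt_const|auto].
- apply continuity_2d_pt_mult; auto. now apply continuity_2d_pt_mult.
Qed.

Lemma Phi_derive e : 1 < e -> is_derive Phi e (RInt (Phi1 e) 0 (PI / 2)).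
Proof.
intros He; unfold Phi.
rewrite <- (RInt_ext (fun t => Derive (fun e => (1 - (1 + e) * sin t ^ 2) * / sqrt (Wt e t)) e)).
2:{ intros t _; apply is_derive_unique, Phi_pt, Wt_pos; auto. }
apply (is_derive_RInt_param (fun e t => (1 - (1 + e) * sin t ^ 2) * / sqrt (Wt e t)) 0 (PI / 2) e).
- apply (filter_imp (fun z => 1 < z)); [|now apply locally_gt].
  intros z Hz t Ht. eexists; apply Phi_pt, Wt_pos; auto.
- intros t Ht. apply continuity_2d_pt_ext_loc with Phi1; [|now apply Phi1_2d].
  exists (mkposreal (e - 1) ltac:(lra)); intros u v Hu Hv; symmetry; apply is_derive_unique, Phi_pt, Wt_pos.
  simpl in Hu; apply Rabs_def2 in Hu; lra.
- apply (filter_imp (fun z => 1 < z)); [|now apply locally_gt].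
  intros z Hz; apply ex_RInt_cont; intros t; now apply Phi_cont.
Qed.

Lemma Phi1_cont e t : 1 < e -> continuous (Phi1 e) t.
Proof.
intros He; assert (C := isqrtW_cont e t He). unfold Phi1.
apply (continuous_plus (fun t => - sin t ^ 2 * / sqrt (Wt e t)) (fun t => - (1 - (1 + e) * sin t ^ 2) * (1 + sin t ^ 2) / 2 * (/ sqrt (Wt e t)) ^ 3)).
- apply (continuous_mult (fun t => - sin t ^ 2) (fun t => / sqrt (Wt e t))); auto.
  apply (ex_derive_continuous (fun t => - sin t ^ 2)); auto_derive; auto.
- apply (continuous_mult (fun t => - (1 - (1 + e) * sin t ^ 2) * (1 + sin t ^ 2) / 2) (fun t => (/ sqrt (Wt e t)) ^ 3)).
  + apply (ex_derive_continuous (fun t => - (1 - (1 + e) * sin t ^ 2) * (1 + sin t ^ 2) / 2)); auto_derive; auto.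
  + apply (continuous_comp (fun t => / sqrt (Wt e t)) (fun z => z ^ 3)); auto.
    apply (ex_derive_continuous (fun z => z ^ 3)); auto_derive; auto.
Qed.

Lemma sc_derive t : is_derive (fun t => sin t * cos t) t (1 - 2 * sin t ^ 2).
Proof.
auto_derive; auto. pose proof (sin2_cos2 t) as S; unfold Rsqr in S.
replace 1 with (sin t * sin t + cos t * cos t) at 3 by exact S. ring.
Qed.

Lemma Wt_derive e t : is_derive (Wt e) t (2 * (1 + e) * sin t * cos t).
Proof. unfold Wt; auto_derive; auto; simpl; ring. Qed.

Lemma cos2_sin2 t : cos t ^ 2 = 1 - sin t ^ 2.
Proof. pose proof (sin2_cos2 t) as S; unfold Rsqr in S. lra. Qed.

(** The W^(-3/2) terms are removed by the derivative of sin t cos t / sqrt W, whose primitive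
    vanishes at both ends. After multiplication by W^(3/2) the relation is a polynomial identity
    modulo the definition of W. Where Phi e = 0 only tau remains. *)
Lemma Phi1_value e : 1 < e -> RInt (Phi1 e) 0 (PI / 2) = e / (2 * (e ^ 2 - 1)) * Phi e - e / (2 * (e ^ 2 - 1)) * tau e.
Proof.
intros He.
rewrite (RInt_relation (Phi1 e) (fun t => (1 - (1 + e) * sin t ^ 2) * / sqrt (Wt e t)) (fun t => / sqrt (Wt e t))
  (fun t => - / (2 * (e - 1)) * (sin t * cos t * / sqrt (Wt e t)))
  (fun t => - / (2 * (e - 1)) * ((1 - 2 * sin t ^ 2) * / sqrt (Wt e t) + sin t * cos t * (2 * (1 + e) * sin t * cos t * (- / 2 * (/ sqrt (Wt e t)) ^ 3))))
  0 (PI / 2) (e / (2 * (e ^ 2 - 1))) (- (e / (2 * (e ^ 2 - 1))))).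
- rewrite sin_0, cos_PI2. unfold Phi, tau; simpl; ring.
- intros; now apply Phi1_cont.
- intros; now apply Phi_cont.
- intros; now apply isqrtW_cont.
- intros t; apply is_derive_scal.
  apply (is_derive_mult (fun t => sin t * cos t) (fun t => / sqrt (Wt e t))); [apply sc_derive| |intros; apply Rmult_comm].
  apply (is_derive_comp (fun z => / sqrt z) (Wt e)); [apply isq_derive, Wt_pos; auto|apply Wt_derive].
- intros t; unfold Phi1. destruct (sW e t He) as [w0 w2].
  set (w := sqrt (Wt e t)) in *. 
  replace (sin t * cos t * (2 * (1 + e) * sin t * cos t * (- / 2 * (/ w) ^ 3))) with (- (1 + e) * sin t ^ 2 * cos t ^ 2 * (/ w) ^ 3) by (field; lra).
  rewrite cos2_sin2. set (x := sin t ^ 2) in *.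
  assert (E : w ^ 2 = (e - 1) + (1 + e) * x) by (rewrite w2; reflexivity).
  assert (e2 : 0 < e ^ 2 - 1) by nra.
  apply Rmult_eq_reg_r with (w ^ 3); [|apply pow_nonzero; lra].
  apply Rminus_diag_uniq.
  match goal with |- ?L = 0 => transitivity ((w ^ 2 - ((e - 1) + (1 + e) * x)) * (- x - e / (2 * (e ^ 2 - 1)) * (1 - (1 + e) * x) + e / (2 * (e ^ 2 - 1)) + / (2 * (e - 1)) * (1 - 2 * x))) end.
  + field; lra.
  + rewrite E; ring.
Qed.

(** Same reduction, with sin t cos t sqrt W as the exact term; the left side is, up to sqrt 2, the
    numerator of [G]. *)
Lemma sqrt_value e : 1 < e -> Phi e = 0 ->
  RInt (fun t => (1 + e) * cos t ^ 2 * sqrt (Wt e t)) 0 (PI / 2) = 2 / 3 * e ^ 2 * tau e.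
Proof.
intros He H0.
rewrite (RInt_relation (fun t => (1 + e) * cos t ^ 2 * sqrt (Wt e t)) (fun t => / sqrt (Wt e t)) (fun t => (1 - (1 + e) * sin t ^ 2) * / sqrt (Wt e t))
  (fun t => (1 + e) / 3 * (sin t * cos t * sqrt (Wt e t)))
  (fun t => (1 + e) / 3 * ((1 - 2 * sin t ^ 2) * sqrt (Wt e t) + sin t * cos t * (2 * (1 + e) * sin t * cos t * (/ 2 * / sqrt (Wt e t)))))
  0 (PI / 2) (2 / 3 * e ^ 2) (- 2 / 3)).
- fold (tau e); fold (Phi e). rewrite H0, sin_0, cos_PI2. simpl; ring.
- intros t; apply (continuous_mult (fun t => (1 + e) * cos t ^ 2) (fun t => sqrt (Wt e t))); [|apply sqrtW_cont].
  apply (ex_derive_continuous (fun t => (1 + e) * cos t ^ 2)); auto_derive; auto.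
- intros; now apply isqrtW_cont.
- intros; now apply Phi_cont.
- intros t; apply is_derive_scal.
  apply (is_derive_mult (fun t => sin t * cos t) (fun t => sqrt (Wt e t))); [apply sc_derive| |intros; apply Rmult_comm].
  apply (is_derive_comp sqrt (Wt e)); [|apply Wt_derive].
  pose proof (Wt_pos e t He). auto_derive; auto; ring_simplify; field. apply Rgt_not_eq, sqrt_lt_R0; auto.
- intros t. destruct (sW e t He) as [w0 w2].
  set (w := sqrt (Wt e t)) in *.
  replace (sin t * cos t * (2 * (1 + e) * sin t * cos t * (/ 2 * / w))) with ((1 + e) * sin t ^ 2 * cos t ^ 2 * / w) by (field; lra).
  rewrite cos2_sin2. set (x := sin t ^ 2) in *.
  assert (E : w ^ 2 = (e - 1) + (1 + e) * x) by (rewrite w2; reflexivity).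
  apply Rmult_eq_reg_r with w; [|lra].
  apply Rminus_diag_uniq.
  match goal with |- ?L = 0 => transitivity ((w ^ 2 - ((e - 1) + (1 + e) * x)) * ((1 + e) * (1 - x) - (1 + e) / 3 * (1 - 2 * x))) end.
  + field; lra.
  + rewrite E; ring.
Qed.

Lemma tau_pos e : 1 < e -> 0 < tau e.
Proof.
intros He; pose proof PI2_1; apply RInt_gt_0; [lra| |].
- intros t _; apply Rinv_0_lt_compat, (sW e t He).
- intros t _; now apply isqrtW_cont.
Qed.

Section Turning.
Variable E : R.
Hypothesis E1 : 1 < E.
Let e := sqrt E.
Let X := xplus E.

Lemma e_gt1 : 1 < e.
Proof. unfold e; rewrite <- sqrt_1; apply sqrt_lt_1; lra. Qed.

Lemma e_sq : e ^ 2 = E.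
Proof. unfold e; apply pow2_sqrt; lra. Qed.

Lemma xplus_eq : X = sqrt 2 * sqrt (1 + e).
Proof. pose proof e_gt1; unfold X, xplus; rewrite <- sqrt_mult by lra; f_equal; fold e; ring. Qed.

Lemma xplus_pos : 0 < X.
Proof. pose proof e_gt1; rewrite xplus_eq; apply Rmult_lt_0_compat; apply sqrt_lt_R0; lra. Qed.

Lemma sqrt_EV t : 0 <= cos t -> sqrt (E - Vw (X * sin t)) = sqrt (1 + e) * cos t * sqrt (Wt e t).
Proof.
intros Ht; pose proof e_gt1. pose proof (Wt_pos e t e_gt1).
assert (0 <= sqrt (1 + e) * cos t) by (apply Rmult_le_pos; [apply sqrt_pos|auto]).
rewrite <- (sqrt_pow2 (sqrt (1 + e) * cos t)) at 1 by auto.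
rewrite <- sqrt_mult by (try apply pow2_ge_0; lra). f_equal.
unfold Vw. rewrite xplus_eq, !Rpow_mult_distr, !pow2_sqrt, cos2_sin2, <- e_sq by lra. unfold Wt. field.
Qed.

Lemma EV_pos x : 0 <= x < X -> 0 < E - Vw x.
Proof.
intros Hx; pose proof e_gt1. assert (X2 : X ^ 2 = 2 + 2 * e) by (unfold X, xplus; rewrite pow2_sqrt by (fold e; lra); auto).
assert (0 <= x ^ 2 < X ^ 2) by (split; [apply pow2_ge_0|nra]).
unfold Vw. rewrite <- e_sq. nra.
Qed.

Lemma EV_cont x : continuous (fun x => E - Vw x) x.
Proof. apply (ex_derive_continuous (fun x => E - Vw x)); unfold Vw; auto_derive; auto. Qed.

Lemma turning_gen (f : R -> R) : (forall x, continuous f x) ->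
  RInt_gen (fun x => f x / sqrt (E - Vw x)) (at_point 0) (at_left X) =
  RInt (fun t => sqrt 2 * (f (X * sin t) * / sqrt (Wt e t))) 0 (PI / 2).
Proof.
intros Cf; pose proof e_gt1 as e1. apply sin_subst_gen.
- apply xplus_pos.
- intros x Hx. apply (continuous_mult f (fun x => / sqrt (E - Vw x))); auto.
  apply (continuous_Rinv_comp (fun x => sqrt (E - Vw x))).
  + apply (continuous_comp (fun x => E - Vw x) sqrt); [apply EV_cont|apply continuous_sqrt].
  + apply Rgt_not_eq, sqrt_lt_R0, EV_pos; auto.
- intros t; apply (continuous_scal_r (sqrt 2) (fun t => f (X * sin t) * / sqrt (Wt e t))).
  apply (continuous_mult (fun t => f (X * sin t)) (fun t => / sqrt (Wt e t))); [|now apply isqrtW_cont].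
  apply (continuous_comp (fun t => X * sin t) f); auto.
  apply (ex_derive_continuous (fun t => X * sin t)); auto_derive; auto.
- intros t Ht. assert (c0 : 0 < cos t) by (apply cos_gt_0; lra).
  rewrite sqrt_EV by lra. destruct (sW e t e1). rewrite xplus_eq at 1.
  assert (0 < sqrt (1 + e)) by (apply sqrt_lt_R0; lra). field; lra.
Qed.

Lemma F_Phi : F E = 2 * sqrt 2 * Phi e.
Proof.
unfold F. fold X. rewrite (turning_gen (fun x => 2 - x ^ 2)).
- pose proof PI2_1. apply RInt_scal_ext; [lra|intros; apply Phi_cont, e_gt1|].
  intros t _. pose proof e_gt1. destruct (sW e t e_gt1).
  replace ((X * sin t) ^ 2) with (2 * (1 + e) * sin t ^ 2); [ring|].
  rewrite xplus_eq, !Rpow_mult_distr, !pow2_sqrt by lra; ring.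
- intros x; apply (ex_derive_continuous (fun x => 2 - x ^ 2)); auto_derive; auto.
Qed.

Lemma T_tau : RInt_gen (fun x => / sqrt (E - Vw x)) (at_point 0) (at_left X) = sqrt 2 * tau e.
Proof.
transitivity (RInt_gen (fun x => 1 / sqrt (E - Vw x)) (at_point 0) (at_left X)).
- f_equal. apply FunctionalExtensionality.functional_extensionality; intros; unfold Rdiv; ring.
- rewrite (turning_gen (fun _ => 1)); [|intros; apply continuous_const].
  pose proof PI2_1; apply RInt_scal_ext; [lra|intros; apply isqrtW_cont, e_gt1|intros; ring].
Qed.

Lemma action_tau : Phi e = 0 -> RInt (fun x => sqrt (E - Vw x)) 0 X = sqrt 2 * (2 / 3 * e ^ 2 * tau e).
Proof.
intros H0; pose proof e_gt1. pose proof PI2_1. rewrite <- sqrt_value by auto.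
assert (C : forall x, continuous (fun x => sqrt (E - Vw x)) x).
{ intros x; apply (continuous_comp (fun x => E - Vw x) sqrt); [apply EV_cont|apply continuous_sqrt]. }
transitivity (RInt (fun x => sqrt (E - Vw x)) (X * sin 0) (X * sin (PI / 2))).
{ rewrite sin_0, sin_PI2, Rmult_0_r, Rmult_1_r; auto. }
rewrite <- (RInt_comp (fun x => sqrt (E - Vw x)) (fun t => X * sin t) (fun t => X * cos t)).
- apply RInt_scal_ext; [lra| |].
  + intros t. apply (continuous_mult (fun t => (1 + e) * cos t ^ 2) (fun t => sqrt (Wt e t))); [|apply sqrtW_cont].
    apply (ex_derive_continuous (fun t => (1 + e) * cos t ^ 2)); auto_derive; auto.
  + intros t Ht. assert (c0 : 0 < cos t) by (apply cos_gt_0; lra).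
    unfold scal; simpl; unfold mult; simpl. rewrite sqrt_EV by lra. rewrite xplus_eq.
    assert (S : sqrt (1 + e) * sqrt (1 + e) = 1 + e) by (apply sqrt_sqrt; lra).
    rewrite <- S at 3. ring.
- intros; apply C.
- intros t _; split.
  + apply is_derive_scal. apply is_derive_Reals, derivable_pt_lim_sin.
  + apply (ex_derive_continuous (fun t => X * cos t)); auto_derive; auto.
Qed.
End Turning.

Lemma F_derive_at_zero E : 1 < E -> F E = 0 -> is_derive F E (- sqrt 2 * tau (sqrt E) / (2 * (E - 1))).
Proof.
intros HE H0. pose proof (e_gt1 E HE) as e1. pose proof (e_sq E HE) as e2.
assert (s2 : 0 < sqrt 2) by (apply sqrt_lt_R0; lra).
assert (P0 : Phi (sqrt E) = 0).
{ rewrite F_Phi in H0 by auto. apply Rmult_integral in H0; destruct H0; auto; lra. }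
apply (is_derive_ext_loc (fun E => 2 * sqrt 2 * Phi (sqrt E))).
- apply (filter_imp (fun z => 1 < z)); [|now apply locally_gt]. intros z Hz; now rewrite F_Phi.
- replace (- sqrt 2 * tau (sqrt E) / (2 * (E - 1))) with (2 * sqrt 2 * (/ (2 * sqrt E) * RInt (Phi1 (sqrt E)) 0 (PI / 2))).
  + apply is_derive_scal. apply (is_derive_comp Phi sqrt); [now apply Phi_derive|].
    auto_derive; [lra|]. field; lra.
  + rewrite Phi1_value, P0, e2 by auto. field. lra.
Qed.

(* Both integrals in -3 F'(E) G(E) reduce to T = int 1/p at a zero of F, and T cancels. *)
Lemma FG_value E : 1 < E -> F E = 0 -> Derive F E < 0 /\ -3 * Derive F E * G E = E / (E - 1).
Proof.
intros HE H0. pose proof (e_gt1 E HE) as e1. pose proof (e_sq E HE) as e2. pose proof (tau_pos _ e1) as t0.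
assert (s2 : 0 < sqrt 2) by (apply sqrt_lt_R0; lra).
assert (s22 : sqrt 2 * sqrt 2 = 2) by (apply sqrt_sqrt; lra).
assert (P0 : Phi (sqrt E) = 0).
{ rewrite F_Phi in H0 by auto. apply Rmult_integral in H0; destruct H0; auto; lra. }
rewrite (is_derive_unique _ _ _ (F_derive_at_zero E HE H0)). split.
- replace (- sqrt 2 * tau (sqrt E) / (2 * (E - 1))) with (- (sqrt 2 * tau (sqrt E) / (2 * (E - 1)))) by (field; lra).
  assert (0 < sqrt 2 * tau (sqrt E) / (2 * (E - 1))) by (apply Rdiv_lt_0_compat; [apply Rmult_lt_0_compat|]; lra). lra.
- unfold G. rewrite T_tau, action_tau, e2 by auto. field. lra.
Qed.

(** For be = 1/e the two problems differ by the dilation of ratio sqrt e, so the sine substitution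
    turns the integrand of [Acl] into a constant multiple of that of Phi e, whose integral over the
    quarter period is 0. *)
Lemma Zcond_of_F E : 1 < E -> F E = 0 -> Zcond (/ sqrt E).
Proof.
intros HE H0. pose proof (e_gt1 E HE) as e1. 
assert (s2 : 0 < sqrt 2) by (apply sqrt_lt_R0; lra).
assert (P0 : Phi (sqrt E) = 0).
{ rewrite F_Phi in H0 by auto. apply Rmult_integral in H0; destruct H0; auto; lra. }
set (e := sqrt E) in *. set (be := / e).
assert (be0 : 0 < be) by (apply Rinv_0_lt_compat; lra).
assert (be1 : be < 1) by (unfold be; rewrite <- Rinv_1; apply Rinv_lt_contravar; lra).
set (k := fun t => - sqrt (2 / e) * ((1 - (1 + e) * sin t ^ 2) * / sqrt (Wt e t))).
assert (K0 : RInt k 0 (PI / 2) = 0).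
{ unfold k. transitivity (- sqrt (2 / e) * Phi e); [|rewrite P0; simpl; ring].
  pose proof PI2_1; apply RInt_scal_ext; [lra|intros; now apply Phi_cont|auto]. }
assert (Xp : 0 < xp be) by (apply xp_pos; auto).
assert (X2 : xp be ^ 2 = 2 * (1 + be)) by (apply xp_sq; auto).
intros eps He.
destruct (sin_subst (xp be) (fun s => yy be s / sqrt (p2 be s)) k Xp) with (eps := eps) as [d [d0 Hd]]; auto.
- intros x Hx. 
  assert (0 < p2 be x) by (apply p2_pos; lra).
  apply (continuous_mult (yy be) (fun s => / sqrt (p2 be s))); [eapply is_derive_cont, yy_derive|].
  apply (continuous_Rinv_comp (fun s => sqrt (p2 be s))).
  + apply (continuous_comp (p2 be) sqrt); [eapply is_derive_cont, p2_derive|apply continuous_sqrt].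
  + apply Rgt_not_eq, sqrt_lt_R0; auto.
- intros t; apply (continuous_scal_r (- sqrt (2 / e)) (fun t => (1 - (1 + e) * sin t ^ 2) * / sqrt (Wt e t))). now apply Phi_cont.
- intros t Ht. assert (c0 : 0 < cos t) by (apply cos_gt_0; lra). pose proof (Wt_pos e t e1) as W0.
  destruct (sW e t e1) as [w0 w2].
  assert (Y : yy be (xp be * sin t) = - (1 - (1 + e) * sin t ^ 2) / e).
  { unfold yy. rewrite Rpow_mult_distr, X2. unfold be; field; lra. }
  assert (Q : sqrt (p2 be (xp be * sin t)) = xp be * cos t * (sqrt (Wt e t) * / sqrt (2 * e))).
  { assert (s2e : 0 < sqrt (2 * e)) by (apply sqrt_lt_R0; lra).
    assert (0 <= xp be * cos t * (sqrt (Wt e t) * / sqrt (2 * e))).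
    { apply Rmult_le_pos; apply Rmult_le_pos; try lra. left; apply Rinv_0_lt_compat; auto. }
    rewrite <- (sqrt_pow2 (xp be * cos t * (sqrt (Wt e t) * / sqrt (2 * e)))) by auto. f_equal.
    rewrite !Rpow_mult_distr, pow_inv, !pow2_sqrt, cos2_sin2, X2 by lra.
    unfold p2; rewrite Y; unfold Wt, be; field; lra. }
  rewrite Y, Q. unfold k.
  assert (s2e : 0 < sqrt (2 * e)) by (apply sqrt_lt_R0; lra).
  replace (sqrt (2 / e)) with (sqrt (2 * e) / e).
  + field. lra.
  + apply Rsqr_inj; [apply Rdiv_le_0_compat; lra|apply sqrt_pos|].
    rewrite Rsqr_div', !Rsqr_sqrt by (try lra; apply Rdiv_le_0_compat; lra). unfold Rsqr; field; lra.
- exists d; split; auto. intros x Hx Hx2; destruct (Hd x ltac:(lra) Hx2) as [l [L1 L2]].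
  rewrite K0, Rminus_0_r in L2. unfold Acl. assert (U := is_RInt_unique _ _ _ _ L1). simpl in U. rewrite U; auto.
Qed.

(** * Critical points of the eigenvalues *)

Lemma II_dilate f l : 1 <= l -> fast f -> II (fun x => f (l * x)) = / l * II f.
Proof.
intros Hl Hf. assert (Fd := fast_dilate f l ltac:(lra) Hf).
assert (L1 := II_lim _ Fd). assert (L2 := II_lim _ Hf).
apply Rmult_eq_reg_l with l; [|lra]. replace (l * (/ l * II f)) with (II f) by (field; lra).
destruct (fast_RInt_small f Hf) as [C [HC Hs]].
assert (E : forall n, l * RInt (fun x => f (l * x)) 0 (INR n) = RInt f 0 (l * INR n)).
{ intros n; pose proof (pos_INR n).
  assert (X := RInt_comp_lin f l 0 0 (INR n)).
  rewrite Rmult_0_r, !Rplus_0_r in X. rewrite <- X.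
  - symmetry; rewrite (RInt_ext _ (fun x => scal l (f (l * x)))).
    + apply (RInt_scal (fun x => f (l * x))). apply fast_ex_RInt; auto; lra.
    + intros; rewrite Rplus_0_r; auto.
  - apply fast_ex_RInt; auto; [lra|apply Rmult_le_pos; lra]. }
assert (L3 := is_lim_seq_scal_l _ l _ L1). simpl in L3.
assert (L4 : is_lim_seq (fun n => l * RInt (fun x => f (l * x)) 0 (INR n)) (II f)).
{ apply is_lim_seq_ext with (fun n => RInt f 0 (INR n) + RInt f (INR n) (l * INR n)).
  - intros n; rewrite E. pose proof (pos_INR n). assert (INR n <= l * INR n) by nra.
    rewrite <- (RInt_minus_Chasles f (INR n)) by (auto; lra). simpl; ring.
  - apply is_lim_seq_spec; intros eps. apply is_lim_seq_spec in L2.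
    destruct (L2 (mkposreal (eps / 2) ltac:(pose proof (cond_pos eps); lra))) as [N1 H1].
    destruct (exp_INR_small C (eps / 2) ltac:(pose proof (cond_pos eps); lra)) as [N2 H2].
    exists (max N1 N2); intros n Hn; specialize (H1 n ltac:(lia)); specialize (H2 n ltac:(lia)). simpl in H1.
    pose proof (pos_INR n). assert (INR n <= l * INR n) by nra.
    specialize (Hs (INR n) (l * INR n) ltac:(lra)).
    replace (RInt f 0 (INR n) + RInt f (INR n) (l * INR n) - II f) with ((RInt f 0 (INR n) - II f) + RInt f (INR n) (l * INR n)) by (simpl; ring).
    eapply Rle_lt_trans; [apply Rabs_triang|]. simpl in *; lra. }
assert (X := is_lim_seq_unique _ _ L3). assert (Y := is_lim_seq_unique _ _ L4). rewrite X in Y. now injection Y.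
Qed.

Lemma derive_approx f x l : is_derive f x l -> forall eps, 0 < eps -> exists d, 0 < d /\
  forall z, Rabs (z - x) < d -> Rabs (f z - f x - l * (z - x)) <= eps * Rabs (z - x).
Proof.
intros H eps He. apply is_derive_Reals in H. destruct (H eps He) as [d Hd]. exists d; split; [apply cond_pos|].
intros z Hz; destruct (Req_dec z x) as [->|Hn]; [replace (f x - f x - l * (x - x)) with 0 by ring; rewrite Rminus_diag, Rabs_R0; lra|].
specialize (Hd (z - x) ltac:(lra) Hz). replace (x + (z - x)) with z in Hd by ring.
replace (f z - f x - l * (z - x)) with (((f z - f x) / (z - x) - l) * (z - x)) by (field; lra).
rewrite Rabs_mult. apply Rmult_le_compat_r; [apply Rabs_pos|lra].
Qed.

Lemma derive_neg f x l : is_derive f x l -> l < 0 -> exists d, 0 < d /\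
  (forall z, x < z < x + d -> f z < f x) /\ (forall z, x - d < z < x -> f x < f z).
Proof.
intros H Hl; destruct (derive_approx f x l H (- l / 2) ltac:(lra)) as [d [d0 Hd]]; exists d; split; auto.
split; intros z Hz.
- specialize (Hd z). rewrite Rabs_right in Hd by lra. specialize (Hd ltac:(lra)). apply Rabs_le_between in Hd. nra.
- specialize (Hd z). rewrite (Rabs_left (z - x)) in Hd by lra. specialize (Hd ltac:(lra)). apply Rabs_le_between in Hd. nra.
Qed.

Lemma derive_pos f x l : is_derive f x l -> 0 < l -> exists d, 0 < d /\
  (forall z, x < z < x + d -> f x < f z) /\ (forall z, x - d < z < x -> f z < f x).
Proof.
intros H Hl. destruct (derive_neg (fun x => - f x) x (- l)) as [d [d0 [H1 H2]]]; [apply (is_derive_opp f); auto|lra|].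
exists d; split; auto; split; intros z Hz; [specialize (H1 z Hz)|specialize (H2 z Hz)]; lra.
Qed.

Lemma interior_min f a b m l : is_derive f m l -> a < m < b -> (forall z, a <= z <= b -> f m <= f z) -> l = 0.
Proof.
intros H Hm Hz. destruct (Rtotal_order l 0) as [L|[L|L]]; auto; exfalso.
- destruct (derive_neg f m l H L) as [d [d0 [H1 _]]]. pose proof (Rmin_l d (b - m)); pose proof (Rmin_r d (b - m)).
  assert (0 < Rmin d (b - m)) by (apply Rmin_pos; lra).
  specialize (H1 (m + Rmin d (b - m) / 2) ltac:(lra)). specialize (Hz (m + Rmin d (b - m) / 2) ltac:(lra)). lra.
- destruct (derive_pos f m l H L) as [d [d0 [_ H1]]]. pose proof (Rmin_l d (m - a)); pose proof (Rmin_r d (m - a)).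
  assert (0 < Rmin d (m - a)) by (apply Rmin_pos; lra).
  specialize (H1 (m - Rmin d (m - a) / 2) ltac:(lra)). specialize (Hz (m - Rmin d (m - a) / 2) ltac:(lra)). lra.
Qed.

(* [Derive] is a limit along a fixed sequence, so no differentiability is needed here. *)
Lemma Derive_bounds f x A B : f x = 0 -> (exists d, 0 < d /\ forall z, 0 < Rabs (z - x) < d -> A <= f z / (z - x) <= B) ->
  A <= Derive f x <= B.
Proof.
intros H0 [d [d0 Hd]]. unfold Derive, Lim, Rbar_loc_seq.
set (u := fun n : nat => (f (x + (0 + / (INR n + 1))) - f x) / (0 + / (INR n + 1))).
assert (Hu : eventually (fun n => A <= u n <= B)).
{ destruct (INR_unbounded (/ d)) as [N HN]; exists N; intros n Hn. apply le_INR in Hn.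
  assert (id : 0 < / d) by (apply Rinv_0_lt_compat; auto).
  assert (i0 : 0 < / (INR n + 1)) by (apply Rinv_0_lt_compat; lra).
  assert (i1 : / (INR n + 1) < d) by (rewrite <- (Rinv_inv d); apply Rinv_lt_contravar; [apply Rmult_lt_0_compat; lra|lra]).
  specialize (Hd (x + / (INR n + 1))). replace (x + / (INR n + 1) - x) with (/ (INR n + 1)) in Hd by ring.
  rewrite Rabs_right in Hd by lra. unfold u. rewrite Rplus_0_l, H0, Rminus_0_r. auto. }
assert (L1 : Rbar_le A (Lim_seq u)).
{ rewrite <- (Lim_seq_const A). apply Lim_seq_le_loc. revert Hu; apply filter_imp; intros; lra. }
assert (L2 : Rbar_le (Lim_seq u) B).
{ rewrite <- (Lim_seq_const B). apply Lim_seq_le_loc. revert Hu; apply filter_imp; intros; lra. }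
destruct (Lim_seq u); simpl in *; tauto.
Qed.

Lemma local_min_of_quotient (f g : R -> R) x c d : 0 < c -> (forall z, is_derive f z (g z)) ->
  (forall z, 0 < Rabs (z - x) < d -> c <= g z / (z - x)) -> forall z, 0 < Rabs (z - x) < d -> f x < f z.
Proof.
intros Hc Hf Hg z Hz.
assert (S : forall y, 0 < Rabs (y - x) < d -> c * Rabs (y - x) ^ 2 <= g y * (y - x)).
{ intros y Hy; specialize (Hg y Hy). rewrite pow2_abs. assert (y - x <> 0) by (intros K; rewrite K, Rabs_R0 in Hy; lra).
  replace (g y * (y - x)) with (g y / (y - x) * (y - x) ^ 2) by (field; auto).
  apply Rmult_le_compat_r; auto using pow2_ge_0. }
assert (D : forall y, derivable_pt_lim f y (g y)) by (intros; apply is_derive_Reals; auto).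
destruct (Rtotal_order z x) as [K|[K|K]].
- destruct (MVT_cor2 f g z x K (fun y _ => D y)) as [y [E Hy]].
  rewrite Rabs_left in Hz by lra. specialize (S y). rewrite Rabs_left in S by lra. specialize (S ltac:(lra)).
  assert (0 < c * (- (y - x)) ^ 2) by (apply Rmult_lt_0_compat; [lra|apply pow_lt; lra]).
  assert (g y < 0) by (apply Ropp_lt_cancel; apply Rmult_lt_reg_r with (x - y); lra). nra.
- subst; rewrite Rminus_diag, Rabs_R0 in Hz; lra.
- destruct (MVT_cor2 f g x z K (fun y _ => D y)) as [y [E Hy]].
  rewrite Rabs_right in Hz by lra. specialize (S y). rewrite Rabs_right in S by lra. specialize (S ltac:(lra)).
  assert (0 < c * (y - x) ^ 2) by (apply Rmult_lt_0_compat; [lra|apply pow_lt; lra]).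
  assert (0 < g y) by (apply Rmult_lt_reg_r with (y - x); lra). nra.
Qed.

Section Eigenvalue.
Variable j : nat.
Hypothesis Hj : (1 <= j)%nat.

Lemma ev_is_derive al : is_derive (ev j) al (Derive (ev j) al).
Proof.
destruct (eigenfunction j al Hj) as [u [u1 H]]. apply Derive_correct. eexists; exact (ev_derive j al u u1 Hj H).
Qed.

Lemma ev_cpt al : continuity_pt (ev j) al.
Proof. apply continuity_pt_filterlim. eapply is_derive_cont, ev_is_derive. Qed.

Lemma ev_Derive al u u1 : eigf j al u u1 -> 0 < II (fun t => u t ^ 2) /\
  Derive (ev j) al = - 2 * II (fun t => (t ^ 2 / 2 - al) * u t ^ 2) / II (fun t => u t ^ 2).
Proof.
intros H; split; [|now apply is_derive_unique, (ev_derive j al u u1)].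
destruct H as [U [Fu [Fu1 [u0 u10]]]]. apply (sol_norm_pos al (ev j al) u u1); auto. rewrite u0, u10; apply data_nz.
Qed.

Lemma ev_Derive_nonpos al : al <= 0 -> Derive (ev j) al < 0.
Proof.
intros Hal. destruct (eigenfunction j al Hj) as [u [u1 H]]. destruct (ev_Derive al u u1 H) as [Np ->].
destruct H as [U [Fu [Fu1 [u0 u10]]]].
assert (0 < II (fun t => (t ^ 2 / 2 - al) * u t ^ 2)) by (apply (nonpos_al_moment al (ev j al) u u1); auto; rewrite u0, u10; apply data_nz).
assert (0 < II (fun t => (t ^ 2 / 2 - al) * u t ^ 2) / II (fun t => u t ^ 2)) by (apply Rdiv_lt_0_compat; auto).
unfold Rdiv in *; lra.
Qed.

Lemma ev_Derive_deep al : 16 <= al -> ev j al <= 4 / 9 * al ^ 2 -> 0 < Derive (ev j) al.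
Proof.
intros Hal Hl. destruct (eigenfunction j al Hj) as [u [u1 H]]. destruct (ev_Derive al u u1 H) as [Np ->].
destruct H as [U [Fu [Fu1 [u0 u10]]]].
assert (II (fun t => (t ^ 2 / 2 - al) * u t ^ 2) < 0).
{ apply (deep_well al (ev j al) u u1); auto; [now apply ev_pos|rewrite u0, u10; apply data_prod|rewrite u0, u10; apply data_nz]. }
assert (0 < - II (fun t => (t ^ 2 / 2 - al) * u t ^ 2) / II (fun t => u t ^ 2)) by (apply Rdiv_lt_0_compat; lra).
unfold Rdiv in *; lra.
Qed.

(** Minimize over [0, A]. At 0 the derivative is negative. If the minimum were at A, then ev j A <=
    ev j 0 <= 4/9 A^2: minimality itself supplies the deep well condition, which makes the
    derivative at A positive, a contradiction. *)
Lemma ev_critical_exists : exists al, Derive (ev j) al = 0.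
Proof.
set (A := 16 + ev j 0). pose proof (ev_pos j 0 Hj) as p0.
destruct (continuity_ab_min (ev j) 0 A ltac:(unfold A; lra)) as [m [Hm [m0 mA]]]; [intros; apply ev_cpt|].
exists m. destruct (Req_dec m 0) as [E|E0].
{ exfalso; subst m. destruct (derive_neg _ _ _ (ev_is_derive 0) (ev_Derive_nonpos 0 (Rle_refl 0))) as [d [d0 [H1 _]]].
  assert (0 < Rmin d A) by (apply Rmin_pos; unfold A; lra). pose proof (Rmin_l d A). pose proof (Rmin_r d A).
  specialize (H1 (Rmin d A / 2) ltac:(lra)). specialize (Hm (Rmin d A / 2) ltac:(lra)). lra. }
destruct (Req_dec m A) as [E|EA].
{ exfalso; subst m. assert (K := Hm 0 ltac:(lra)).
  destruct (derive_pos _ _ _ (ev_is_derive A)) as [d [d0 [_ H1]]].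
  { apply ev_Derive_deep; unfold A in *; [lra|nra]. }
  assert (0 < Rmin d A) by (apply Rmin_pos; unfold A; lra). pose proof (Rmin_l d A). pose proof (Rmin_r d A).
  specialize (H1 (A - Rmin d A / 2) ltac:(lra)). specialize (Hm (A - Rmin d A / 2) ltac:(lra)). lra. }
apply (interior_min (ev j) 0 A m); [apply ev_is_derive|lra|auto].
Qed.

(** Between two critical points, both strict local minima by hypothesis, the maximum is interior,
    hence a critical point that is not a strict local minimum. *)
Lemma critical_unique : (forall a0, Derive (ev j) a0 = 0 -> exists d, 0 < d /\ forall z, 0 < Rabs (z - a0) < d -> ev j a0 < ev j z) ->
  forall a b, Derive (ev j) a = 0 -> Derive (ev j) b = 0 -> a = b.
Proof.
intros Hloc.
assert (W : forall a b, Derive (ev j) a = 0 -> Derive (ev j) b = 0 -> a < b -> False).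
{ intros a b Ha Hb ab.
  destruct (continuity_ab_maj (ev j) a b ltac:(lra)) as [m [Hm [ma mb]]]; [intros; apply ev_cpt|].
  assert (R0 : forall x, Derive (ev j) x = 0 -> a <= x < b -> x <> m).
  { intros x Hx Hxb E; subst x. destruct (Hloc m Hx) as [d [d0 Hd]].
    assert (0 < Rmin d (b - m)) by (apply Rmin_pos; lra). pose proof (Rmin_l d (b - m)). pose proof (Rmin_r d (b - m)).
    specialize (Hd (m + Rmin d (b - m) / 2)). rewrite Rabs_right in Hd by lra.
    specialize (Hd ltac:(lra)). specialize (Hm (m + Rmin d (b - m) / 2) ltac:(lra)). lra. }
  assert (m <> a) by (intros E; apply (R0 a Ha); [lra|auto]).
  assert (m <> b).
  { intros E; subst m. destruct (Hloc b Hb) as [d [d0 Hd]].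
    assert (0 < Rmin d (b - a)) by (apply Rmin_pos; lra). pose proof (Rmin_l d (b - a)). pose proof (Rmin_r d (b - a)).
    specialize (Hd (b - Rmin d (b - a) / 2)). rewrite Rabs_left in Hd by lra.
    specialize (Hd ltac:(lra)). specialize (Hm (b - Rmin d (b - a) / 2) ltac:(lra)). lra. }
  apply (R0 m); [|lra|auto].
  assert (- Derive (ev j) m = 0); [|lra].
  apply (interior_min (fun x => - ev j x) a b m); [apply (is_derive_opp (ev j)), ev_is_derive|lra|].
  intros z Hz; specialize (Hm z Hz); lra. }
intros a b Ha Hb; destruct (Rtotal_order a b) as [K|[K|K]]; auto; exfalso; eauto.
Qed.
End Eigenvalue.

(** At a critical point al is positive and not in the deep well regime, so a bound on the eigenvalue
    bounds al. Theta is then bounded by compactness, whereas it equals j pi/2 at the j-th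
    eigenvalue. *)
Lemma critical_far Lam : exists J, (1 <= J)%nat /\ forall j al, (J <= j)%nat -> Derive (ev j) al = 0 ->
  Lam < ev j al /\ 0 < al /\ al ^ 2 < 9 / 4 * ev j al.
Proof.
(* 1000 lets the case al < 16 satisfy al^2 < 9/4 ev and al <= 2 L as well. *)
set (L := Rmax Lam 1000). assert (L1 : Lam <= L) by apply Rmax_l. assert (L2 : 1000 <= L) by apply Rmax_r.
destruct (continuity_ab_maj (fun al => Theta al L) 0 (2 * L) ltac:(lra)) as [m [Hm _]]; [intros; apply Theta_cont_al|].
destruct (INR_unbounded (Theta m L)) as [J HJ]. exists (S J); split; [lia|].
intros j al Hj H0. assert (j1 : (1 <= j)%nat) by lia. assert (jJ : INR J <= INR j) by (apply le_INR; lia).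
assert (al0 : 0 < al).
{ destruct (Rlt_dec 0 al); auto. pose proof (ev_Derive_nonpos j j1 al ltac:(lra)); lra. }
assert (K : al < 16 \/ al ^ 2 < 9 / 4 * ev j al).
{ destruct (Rlt_dec al 16); auto. right. destruct (Rle_dec (ev j al) (4 / 9 * al ^ 2)); [|lra].
  pose proof (ev_Derive_deep j j1 al ltac:(lra) ltac:(lra)); lra. }
assert (B : L < ev j al).
{ destruct (Rlt_dec L (ev j al)) as [|Hn]; auto; exfalso.
  assert (al <= 2 * L) by (destruct K; [lra|nra]).
  specialize (Hm al ltac:(lra)); cbv beta in Hm.
  assert (X := Theta_mono_le al (ev j al) L ltac:(lra)). rewrite ev_spec in X by auto. pose proof PI2_1.
  pose proof (pos_INR j). nra. }
split; [lra|split; auto]. destruct K; auto. nra.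
Qed.

Lemma moment_scaled al l u : 1 <= l -> fast u ->
  II (fun x => u (l * x) ^ 2) = / l * II (fun t => u t ^ 2) /\
  II (fun x => Ys (al / l ^ 2) x * u (l * x) ^ 2) = / l ^ 3 * II (fun t => (t ^ 2 / 2 - al) * u t ^ 2).
Proof.
intros Hl Fu. assert (Fd := fast_dilate u l ltac:(lra) Fu). assert (SY := slow_Ys (al / l ^ 2)). split.
- apply (II_dilate (fun t => u t ^ 2) l); [auto|sf].
- transitivity (II (fun x => / l ^ 2 * (fun t => (t ^ 2 / 2 - al) * u t ^ 2) (l * x))).
  + apply II_ext; [sf| |].
    * apply (fast_dilate (fun t => / l ^ 2 * ((t ^ 2 / 2 - al) * u t ^ 2)) l); [lra|sf].
    * intros; unfold Ys; field; lra.
  + rewrite II_scal by (apply (fast_dilate (fun t => (t ^ 2 / 2 - al) * u t ^ 2) l); [lra|sf]).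
    rewrite (II_dilate (fun t => (t ^ 2 / 2 - al) * u t ^ 2)) by (auto; sf). field; lra.
Qed.

Section Limit.
Variable be : R.
Hypothesis be0 : 0 < be.
Hypothesis be1 : be < 1.
Hypothesis HZ : Zcond be.

(** J depends on eps only, through the size of hh, whereas d may depend on j and a0; so al - a0 can
    be taken small relative to an hh that is already fixed. *)
Lemma critical_quotient eps : 0 < eps -> exists J, (1 <= J)%nat /\ forall j a0, (J <= j)%nat -> Derive (ev j) a0 = 0 ->
  exists d, 0 < d /\ forall al, 0 < Rabs (al - a0) < d -> Rabs (Derive (ev j) al / (al - a0) - 2 * r0 be) <= eps.
Proof.
intros He. destruct (second_variation be be0 be1 HZ) as [C [h1 [C1 [Hh1 HS]]]].
(* sqrt hh, |de| and eta will each be at most q, for a total error 2 C (3 q) = 3/4 eps. *)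
set (q := eps / (8 * C)). assert (q0 : 0 < q) by (apply Rdiv_lt_0_compat; lra).
set (Lam := 1 + / h1 + / q ^ 2).
assert (ih : 0 < / h1) by (apply Rinv_0_lt_compat; lra).
assert (iq : 0 < / q ^ 2) by (apply Rinv_0_lt_compat, pow_lt; auto).
destruct (critical_far Lam) as [J [J1 HJ]]. exists J; split; auto. intros j a0 Hj H0.
assert (j1 : (1 <= j)%nat) by lia.
destruct (HJ j a0 Hj H0) as [Hl [Ha Hal]]. set (lam := ev j a0) in *.
set (l := sqrt (sqrt lam)). assert (L2 : l ^ 2 = sqrt lam) by (apply pow2_sqrt, sqrt_pos).
assert (L4 : l ^ 4 = lam). { replace (l ^ 4) with ((l ^ 2) ^ 2) by ring. rewrite L2; apply pow2_sqrt; unfold Lam in Hl; lra. }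
assert (lam1 : 1 < lam) by (unfold Lam in Hl; lra).
assert (s1 : 1 < sqrt lam) by (rewrite <- sqrt_1; apply sqrt_lt_1; lra).
assert (l1 : 1 < l) by (unfold l; rewrite <- sqrt_1; apply sqrt_lt_1; lra).
set (hh := / l ^ 6).
assert (l6 : lam <= l ^ 6). { replace (l ^ 6) with (l ^ 4 * l ^ 2) by ring. rewrite L4, L2. nra. }
assert (hh0 : 0 < hh) by (apply Rinv_0_lt_compat; lra).
assert (hh1 : hh <= h1).
{ unfold hh; rewrite <- (Rinv_inv h1). apply Rinv_le_contravar; auto. unfold Lam in Hl; lra. }
assert (hhq : sqrt hh <= q).
{ rewrite <- (sqrt_pow2 q) by lra. apply sqrt_le_1_alt. rewrite <- (Rinv_inv (q ^ 2)). unfold hh.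
  apply Rinv_le_contravar; auto. unfold Lam in Hl; lra. }
set (s := sqrt hh) in *. assert (s0 : 0 < s) by (apply sqrt_lt_R0; auto).
set (eta := Rmin 1 q). assert (eta0 : 0 < eta) by (apply Rmin_pos; lra).
assert (eta1 : eta <= 1) by apply Rmin_l. assert (eta2 : eta <= q) by apply Rmin_r.
assert (l2p : 0 < l ^ 2) by lra.
(* The derivative is zero at a0, so the eigenvalue moves by at most eta l^2 |al - a0|; after
   division by l^4 this reads |1 - et| <= eta |de|. *)
destruct (derive_approx (ev j) a0 0) with (eps := eta * l ^ 2) as [dm [dm0 Hdm]].
{ rewrite <- H0; apply ev_is_derive; auto. }
{ apply Rmult_lt_0_compat; auto. }
(* 1/2 and s/C are the smallness conditions of [second_variation]; q is the share of |de| in the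
   error. *)
set (dd := Rmin (1 / 2) (Rmin (s / C) q)).
assert (dd0 : 0 < dd) by (repeat apply Rmin_pos; try lra; apply Rdiv_lt_0_compat; lra).
assert (dd1 : dd <= 1 / 2) by apply Rmin_l.
assert (dd2 : dd <= s / C) by (unfold dd; eapply Rle_trans; [apply Rmin_r|apply Rmin_l]).
assert (dd3 : dd <= q) by (unfold dd; eapply Rle_trans; [apply Rmin_r|apply Rmin_r]).
destruct (eigenfunction j a0 j1) as [u [u1 HU]]. destruct (ev_Derive j j1 a0 u u1 HU) as [Nu Du].
exists (Rmin dm (l ^ 2 * dd)); split; [apply Rmin_pos; auto; apply Rmult_lt_0_compat; auto|].
intros al [Hp Hd]. pose proof (Rmin_l dm (l ^ 2 * dd)). pose proof (Rmin_r dm (l ^ 2 * dd)).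
set (D := al - a0) in *. assert (D0 : D <> 0) by (intros K; rewrite K, Rabs_R0 in Hp; lra).
destruct (eigenfunction j al j1) as [v [v1 HV]]. destruct (ev_Derive j j1 al v v1 HV) as [Nv Dv].
destruct HU as [U [Fu [Fu1 [Eu0 Eu1]]]]. destruct HV as [V [Fv [Fv1 [Ev0 Ev1]]]].
set (de := D / l ^ 2). set (et := ev j al / l ^ 4). set (b := a0 / l ^ 2).
assert (de1 : Rabs de = Rabs D / l ^ 2) by (unfold de, Rdiv; rewrite Rabs_mult, (Rabs_right (/ l ^ 2)); auto; left; apply Rinv_0_lt_compat; auto).
assert (de2 : Rabs de < dd).
{ rewrite de1; apply Rmult_lt_reg_r with (l ^ 2); auto. unfold Rdiv; rewrite Rmult_assoc, Rinv_l by lra. lra. }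
assert (de0 : 0 < Rabs de) by (rewrite de1; apply Rdiv_lt_0_compat; auto).
assert (den : de <> 0) by (intros K; rewrite K, Rabs_R0 in de0; lra).
destruct (moment_scaled a0 l u ltac:(lra) Fu) as [Mu0 Mu1]. destruct (moment_scaled al l v ltac:(lra) Fv) as [Mv0 Mv1].
assert (Eb : al / l ^ 2 = b + de) by (unfold b, de, D; field; lra).
assert (SU := ssol_of_sol a0 (ev j a0) l u u1 ltac:(lra) U Fu Fu1 ltac:(rewrite Eu0, Eu1; apply data_prod)).
assert (SV := ssol_of_sol al (ev j al) l v v1 ltac:(lra) V Fv Fv1 ltac:(rewrite Ev0, Ev1; apply data_prod)).
fold lam in SU. fold hh b in SU. fold hh et in SV. rewrite Eb in SV. replace (lam / l ^ 4) with 1 in SU by (rewrite L4; field; lra).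
assert (il : 0 < / l) by (apply Rinv_0_lt_compat; lra).
assert (bd : Rabs (be - b) <= 3 / 2).
{ assert (0 < b < 3 / 2).
  { unfold b; split; [apply Rdiv_lt_0_compat; auto|]. apply Rmult_lt_reg_r with (l ^ 2); auto.
    unfold Rdiv; rewrite Rmult_assoc, Rinv_l by lra. assert (lam = (l ^ 2) ^ 2) by (rewrite <- L4; ring). nra. }
  apply Rabs_le; lra. }
assert (Y0 : II (fun t => (t ^ 2 / 2 - a0) * u t ^ 2) = 0).
{ rewrite H0 in Du. symmetry in Du. unfold Rdiv at 1 in Du. apply Rmult_integral in Du; destruct Du as [Du|Du]; [lra|].
  exfalso; revert Du; apply Rinv_neq_0_compat; lra. }
assert (etb : Rabs (1 - et) <= eta * Rabs de).
{ assert (X := Hdm al ltac:(fold D; lra)). fold lam D in X. rewrite Rmult_0_l, Rminus_0_r in X.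
  replace (1 - et) with (- ((ev j al - lam) * / l ^ 4)) by (unfold et; rewrite L4; field; lra).
  rewrite Rabs_Ropp, Rabs_mult, (Rabs_right (/ l ^ 4)) by (left; apply Rinv_0_lt_compat; lra).
  apply Rle_trans with (eta * l ^ 2 * Rabs D * / l ^ 4); [apply Rmult_le_compat_r; auto; left; apply Rinv_0_lt_compat; lra|].
  rewrite de1. replace (eta * l ^ 2 * Rabs D * / l ^ 4) with (eta * (Rabs D / l ^ 2)) by (field; lra). lra. }
assert (HC2 : C * Rabs de <= s).
{ replace s with (C * (s / C)) by (field; lra). apply Rmult_le_compat_l; lra. }
assert (K := HS hh b _ _ (conj hh0 hh1) bd SU). cbv beta in K. rewrite Mu0 in K. fold b in Mu1; rewrite Mu1 in K.
specialize (K ltac:(apply Rmult_lt_0_compat; auto) ltac:(rewrite Y0; ring) de et eta _ _ ltac:(lra) HC2 ltac:(lra) etb SV).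
specialize (K ltac:(cbv beta; rewrite Rmult_0_r; lra) ltac:(cbv beta; rewrite Rmult_0_r; congruence)).
cbv beta in K. rewrite <- Eb, Mv0, Mv1 in K. fold s in K.
set (N := II (fun t => v t ^ 2)) in *. set (Y := II (fun t => (t ^ 2 / 2 - al) * v t ^ 2)) in *.
rewrite Dv.
replace (- 2 * Y / N / D - 2 * r0 be) with (- (/ l ^ 3 * Y + de * r0 be * (/ l * N)) * (2 * (/ (de * (/ l * N))))).
2:{ unfold de. field. repeat split; lra. }
rewrite Rabs_mult, Rabs_Ropp.
assert (Z : 0 < Rabs de * (/ l * N)) by (repeat apply Rmult_lt_0_compat; auto).
assert (Z2 : Rabs (2 * / (de * (/ l * N))) = 2 * / (Rabs de * (/ l * N))).
{ rewrite Rabs_mult, (Rabs_right 2), Rabs_inv, Rabs_mult, (Rabs_right (/ l * N)); try lra.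
  left; apply Rmult_lt_0_compat; auto. }
rewrite Z2.
apply Rle_trans with (C * (s + Rabs de + eta) * Rabs de * (/ l * N) * (2 * / (Rabs de * (/ l * N)))).
{ apply Rmult_le_compat_r; auto. assert (0 < / (Rabs de * (/ l * N))) by (apply Rinv_0_lt_compat; auto). lra. }
replace (C * (s + Rabs de + eta) * Rabs de * (/ l * N) * (2 * / (Rabs de * (/ l * N)))) with (2 * C * (s + Rabs de + eta)) by (field; lra).
assert (2 * C * (s + Rabs de + eta) <= 2 * C * (3 * q)) by (apply Rmult_le_compat_l; lra).
replace (2 * C * (3 * q)) with (3 / 4 * eps) in * by (unfold q; field; lra). lra.
Qed.
End Limit.

Lemma Derive_lambda j al : (1 <= j)%nat -> Derive (lambda j) al = Derive (ev j) al.
Proof. intros Hj; apply Derive_ext; intros; now apply lambda_ev. Qed.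

Lemma Derive2_lambda j al : (1 <= j)%nat -> Derive_n (lambda j) 2 al = Derive (Derive (ev j)) al.
Proof. intros Hj; simpl. apply Derive_ext; intros; now apply Derive_lambda. Qed.

Theorem theorem1p5 (Ec : R) (HEc1 : 1 < Ec) (HFEc : F Ec = 0) :
  Derive F Ec < 0 /\
  0 < -3 * Derive F Ec * G Ec /\
  exists j0 : nat, (1 <= j0)%nat /\
  exists alpha_c : nat -> R,
    (forall j : nat, (j0 <= j)%nat ->
       Derive (lambda j) (alpha_c j) = 0 /\
       (forall a : R, Derive (lambda j) a = 0 -> a = alpha_c j) /\
       0 < Derive_n (lambda j) 2 (alpha_c j) /\
       (exists eps : R, 0 < eps /\
          forall a : R, Rabs (a - alpha_c j) < eps ->
            lambda j (alpha_c j) <= lambda j a)) /\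
    is_lim_seq (fun j => Derive_n (lambda j) 2 (alpha_c j))
               (-3 * Derive F Ec * G Ec).
Proof.
destruct (FG_value Ec HEc1 HFEc) as [HF ->].
assert (L0 : 0 < Ec / (Ec - 1)) by (apply Rdiv_lt_0_compat; lra).
split; [auto|split; [auto|]].
set (be := / sqrt Ec). pose proof (e_gt1 Ec HEc1) as e1. pose proof (e_sq Ec HEc1) as e2.
assert (be0 : 0 < be) by (apply Rinv_0_lt_compat; lra).
assert (be1 : be < 1) by (unfold be; rewrite <- Rinv_1; apply Rinv_lt_contravar; lra).
assert (HZ : Zcond be) by (apply Zcond_of_F; auto).
assert (HL : 2 * r0 be = Ec / (Ec - 1)).
{ unfold r0, be. rewrite <- e2 at 2 3. field. repeat split; nra. }
set (L := Ec / (Ec - 1)) in *.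
(* The derivative vanishes at a0, so its difference quotient there is Derive (ev j) z / (z - a0),
   which [critical_quotient] encloses; J does not depend on the critical point. *)
assert (D2 : forall eps, 0 < eps -> exists J, (1 <= J)%nat /\ forall j a0, (J <= j)%nat -> Derive (ev j) a0 = 0 ->
  L - eps <= Derive (Derive (ev j)) a0 <= L + eps).
{ intros eps He. destruct (critical_quotient be be0 be1 HZ eps He) as [J [J1 HJ]]; exists J; split; auto.
  intros j a0 Hj H0. apply Derive_bounds; auto. destruct (HJ j a0 Hj H0) as [d [d0 Hd]].
  exists d; split; auto. intros z Hz; specialize (Hd z Hz). rewrite HL in Hd. apply Rabs_le_between in Hd. lra. }
destruct (critical_quotient be be0 be1 HZ (L / 2) ltac:(lra)) as [Ja [Ja1 HJa]].
destruct (D2 (L / 2) ltac:(lra)) as [Jb [Jb1 HJb]].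
assert (Hloc : forall j a0, (Ja <= j)%nat -> Derive (ev j) a0 = 0 -> exists d, 0 < d /\ forall z, 0 < Rabs (z - a0) < d -> ev j a0 < ev j z).
{ intros j a0 Hj H0; destruct (HJa j a0 Hj H0) as [d [d0 Hd]]; exists d; split; auto.
  apply (local_min_of_quotient (ev j) (Derive (ev j)) a0 (L / 2) d); [lra|intros; apply ev_is_derive; lia|].
  intros z Hz; specialize (Hd z Hz). rewrite HL in Hd. apply Rabs_le_between in Hd. lra. }
(* A critical point exists for every j >= 1; from j0 on it is the only one, so the choice is
   immaterial. *)
set (ac := fun j => epsilon (inhabits 0) (fun a => Derive (ev j) a = 0)).
assert (Hac : forall j, (1 <= j)%nat -> Derive (ev j) (ac j) = 0).
{ intros j Hj; apply (epsilon_spec (inhabits 0) (fun a => Derive (ev j) a = 0)), ev_critical_exists, Hj. }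
exists (max Ja Jb); split; [lia|]. exists ac; split.
- intros j Hj. assert (j1 : (1 <= j)%nat) by lia. rewrite Derive_lambda, Derive2_lambda by auto.
  split; [auto|split; [|split]].
  + intros a Ha; rewrite Derive_lambda in Ha by auto. apply (critical_unique j j1); auto. intros; apply Hloc; auto; lia.
  + specialize (HJb j (ac j) ltac:(lia) (Hac j j1)). lra.
  + destruct (Hloc j (ac j) ltac:(lia) (Hac j j1)) as [d [d0 Hd]]; exists d; split; auto. intros a Ha.
    rewrite !lambda_ev by auto. destruct (Req_dec a (ac j)) as [->|Hn]; [lra|].
    left; apply Hd; split; auto. apply Rabs_pos_lt; lra.
- apply is_lim_seq_spec; intros eps. pose proof (cond_pos eps).
  destruct (D2 (eps / 2) ltac:(lra)) as [J [J1 HJ]]. exists J; intros j Hj.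
  rewrite Derive2_lambda by lia. specialize (HJ j (ac j) Hj (Hac j ltac:(lia))). apply Rabs_def1; lra.
Qed.
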